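(* Let $\varphi:\mathbb P^1\to\mathbb P^1$ be a branched Galois covering of degree $12$ with Galois group $A_4$; up to Möbius transformations, $\varphi$ is $[x,y]\mapsto\Phi^3/\Psi^3$, where $\Phi=x^4-2\sqrt3\,i\,x^2y^2+y^4$, $\Psi=x^4+2\sqrt3\,i\,x^2y^2+y^4$, and put $\Omega=xy(x^4-y^4)$. Let $g([x,y]):\mathbb P^1\to\mathbb P^3$ be a holomorphic curve which is a Galois lift, with covering $\varphi$, of a sextic curve $F$ in $\mathcal V_5$, so $f_1\circ g=F\circ\varphi$. Then, up to Möbius transformations on $\mathbb P^1$ and $PSL_2$-equivalence, $\deg g=13$ or $15$, and the following classification holds. (1) If $\deg g=13$, then $$g=\begin{pmatrix} a_1 & a_2 & a_3 \\ b_1 & b_2 & b_3 \end{pmatrix}\begin{pmatrix} x\Omega^2 & x\Phi^3 & -\Omega\Phi\frac{\partial\Psi}{\partial y} \\ y\Omega^2 & y\Phi^3 & \Omega\Phi\frac{\partial\Psi}{\partial x} \end{pmatrix}^T.$$ This class depends on two free parameters and belongs to the generally ramified family. (2) If $\deg g=15$, then $$g=\begin{pmatrix} a_1 & a_2 & a_3 \\ b_1 & b_2 & b_3 \end{pmatrix}\begin{pmatrix} x\Omega\Phi^2 & -\Omega^2\frac{\partial\Psi}{\partial y} & -\Phi^3\frac{\partial\Psi}{\partial y} \\ y\Omega\Phi^2 & \Omega^2\frac{\partial\Psi}{\partial x} & \Phi^3\frac{\partial\Psi}{\partial x} \end{pmatrix}^T,$$ where $\begin{pmatrix} a_1 & a_2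 & a_3 \\ b_1 & b_2 & b_3 \end{pmatrix}\in G(2,3)$ is the unique plane which is perpendicular to $$\big((t^4-1)(2\sqrt{-3}t^2-t^4-1)^2,\ 4t^2(t^4-1)^2(\sqrt{-3}+t^2),\ -4(2\sqrt{-3}t^2-t^4-1)^3(\sqrt{-3}+t^2)\big)$$ under the bilinear inner product. This class depends on one free parameter $t$ and belongs to the generally ramified family.
   Context: The ground field is $\mathbb C$; $\sqrt{-3}=\sqrt3\,i$. $V_n$ is the space of binary forms of degree $n$ in $u,v$, with $SL_2=SL_2(\mathbb C)$ acting by $(A\cdot f)(u,v)=f(A^{-1}(u,v)^T)$. $\mathcal V_5\subset\mathbb P(V_6)=\mathbb P^6$ is the closure of $PSL_2\cdot[uv(u^4-v^4)]$; it is the disjoint union of this open orbit, the $2$-dimensional orbit $PSL_2\cdot[u^5v]$ and the $1$-dimensional orbit $PSL_2\cdot[u^6]$. A sextic curve is a holomorphic curve $F:\mathbb P^1\to\mathcal V_5\subset\mathbb P^6$ of degree $6$, linearly full in $\mathbb P^6$, not contained in $\overline{PSL_2\cdot[u^5v]}$. It is in the generally ramified family if it is tangent to the $1$-dimensional orbit at some point where it meets that orbit; otherwise it is in the exceptional transversal family. A class of curves $g$ is said to belong to one of these families if the corresponding curves $F$ do. Points of $\mathbb P^3$ are nonzero $2\times2$ matrices $\begin{pmatrix} a & b \\ c & d \end{pmatrix}$ up to scale, and $f_1:\mathbb P^3\dashrightarrow\mathbb P(V_6)$ sends this matrix to $[(du-bv)(av-cu)((du-bv)^4-(av-cu)^4)]$;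 on $PSL_2$ it is the orbit map of $[uv(u^4-v^4)]$. $S_4^*\subset SU(2)$ is the binary octahedral group (order $48$) generated by $\mathrm{diag}(e^{\pi i/4},e^{-\pi i/4})$ and $\frac1{\sqrt2}\begin{pmatrix} 1 & -1 \\ 1 & 1 \end{pmatrix}$; its image in $PSL_2$ is the stabilizer of $[uv(u^4-v^4)]$. A branched covering $\varphi$ is Galois if its group $G=\{\sigma:\varphi\circ\sigma=\varphi\}$ has order $\deg\varphi$. A map $g:\mathbb P^1\to\mathbb P^3$ of degree $n$ is a $2\times2$ matrix of degree-$n$ forms in $x,y$ without common factor. It is a Galois lift of $F$ with covering $\varphi$ if $f_1\circ g=F\circ\varphi$ and the homomorphism $\sigma\mapsto g(\sigma(q))^{-1}g(q)$ (independent of generic $q$) from $G$ to the stabilizer of $[uv(u^4-v^4)]$ is injective. Two curves $g,\tilde g:\mathbb P^1\to\mathbb P^3$ are $PSL_2$-equivalent if $AgB^T=\tilde g$ for some $A\in SL_2$, $B\in S_4^*$. Möbius transformations may be applied to both copies of $\mathbb P^1$ (source and target of $\varphi$). $G(2,k)$ is the Grassmannian of $2$-planes in $\mathbb C^k$; a $2\times k$ matrix of rank $2$ denotes its row space (in (1) the coefficient matrix also has rank $2$). The bilinear inner product is $\sum_i p_iq_i$ (no conjugation). *)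

(* Defs.v *)
From mathcomp Require Import all_boot all_order all_fingroup all_algebra all_solvable.
From mathcomp Require Import reals complex mpoly.

Set Implicit Arguments.
Unset Strict Implicit.
Unset Printing Implicit Defensive.

Import GRing.Theory Num.Theory.
Local Open Scope ring_scope.

(* Polynomials in two variables; binary forms of degree d are the p : binform C
   with p \is d.-homog. *)
Notation binform C := {mpoly C[2]}.

Section Definitions.

Variable C : numClosedFieldType.

Definition X0 : binform C := 'X_(ord0 : 'I_2).
Definition X1 : binform C := 'X_(ord_max : 'I_2).
Definition d0 (p : binform C) : binform C := p^`M(ord0 : 'I_2).
Definition d1 (p : binform C) : binform C := p^`M(ord_max : 'I_2).

Definition mx_of_rows (K : nmodType) m n (s : seq (seq K)) : 'M[K]_(m, n) :=
  \matrix_(i, j) (nth [::] s i)`_j.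

(* Points of a projective space are nonzero matrices up to scale. *)
Definition same_point m n (A B : 'M[C]_(m, n)) : Prop :=
  exists c : C, c != 0 /\ A = c *: B.

(* Degree-d maps from P^1 to the projective space of m x n matrices. *)
Definition is_curve d m n (g : 'M[binform C]_(m, n)) : Prop :=
  (forall i j, g i j \is d.-homog) /\
  (forall (p : binform C) (h : 'M[binform C]_(m, n)),
     (forall i j, g i j = h i j * p) -> exists c : C, p = c%:MP).

Definition at_pt m n (g : 'M[binform C]_(m, n)) (q : 'cV[C]_2) : 'M[C]_(m, n) :=
  map_mx (meval (fun i => q i 0)) g.

(* The action of SL_2 on binary forms: (A . f)(u, v) = f(A^-1 (u, v)^T). *)
Definition sl2_act (A : 'M[C]_2) (f : binform C) : binform C :=
  f \mPo [tuple \sum_(j < 2) invmx A i j *: 'X_j | i < 2].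

(* V_6 is identified with C^7: the k-th coordinate of a binary sextic is the
   coefficient of u^(6-k) v^k. *)
Definition coords (f : binform C) : 'cV[C]_7 :=
  \col_(k < 7) f@_[multinom (if i == ord0 then 6 - k else k)%N | i < 2].

Definition orbit6 (f : binform C) (p : 'cV[C]_7) : Prop :=
  exists A : 'M[C]_2, \det A = 1 /\ same_point p (coords (sl2_act A f)).

(* Zariski closure in P^6; for an orbit of an algebraic group this is also the
   closure in the classical topology. *)
Definition closure6 (S : 'cV[C]_7 -> Prop) (p : 'cV[C]_7) : Prop :=
  forall d (P : {mpoly C[7]}), P \is d.-homog ->
    (forall s, S s -> P.@[fun i => s i 0] = 0) -> P.@[fun i => p i 0] = 0.

Definition f_oct : binform C := X0 * X1 * (X0 ^+ 4 - X1 ^+ 4).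

Definition V5 : 'cV[C]_7 -> Prop := closure6 (orbit6 f_oct).

Definition sextic_curve (F : 'M[binform C]_(7, 1)) : Prop :=
  [/\ is_curve 6 F,
      forall q, q != 0 -> V5 (at_pt F q),
      forall w : 'rV[C]_7, (forall q, w *m at_pt F q = 0) -> w = 0
    & ~ (forall q, q != 0 ->
           closure6 (orbit6 (X0 ^+ 5 * X1)) (at_pt F q))].

(* Up to sign, the derivative of exp(s X) . f at s = 0.  Letting X range over
   gl_2, which includes the scalars, these are all the tangent vectors at f to
   the cone over the orbit of [f]. *)
Definition inf_act (X : 'M[C]_2) (f : binform C) : binform C :=
  \sum_(i < 2) \sum_(j < 2) X i j *: ('X_j * f^`M(i)).

(* The columns of the Jacobian matrix span the cone over the tangent line. *)
Definition jacobian (F : 'M[binform C]_(7, 1)) (q : 'cV[C]_2) : 'M[C]_(7, 2) :=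
  \matrix_(k, i) ((F k 0)^`M(i)).@[fun l => q l 0].

(* At some point of the orbit of [u^6], the curve and the orbit have the same
   tangent line. *)
Definition generally_ramified (F : 'M[binform C]_(7, 1)) : Prop :=
  exists (q : 'cV[C]_2) (A : 'M[C]_2),
    let f := sl2_act A (X0 ^+ 6) in
    [/\ q != 0, \det A = 1, same_point (at_pt F q) (coords f)
      & forall w : 'cV[C]_7, (exists a, w = jacobian F q *m a) <->
                             (exists X, w = coords (inf_act X f))].

Definition f1 (M : 'M[C]_2) : 'cV[C]_7 :=
  let a := M ord0 ord0 in let b := M ord0 ord_max in
  let c := M ord_max ord0 in let d := M ord_max ord_max in
  let p : binform C := d *: X0 - b *: X1 in
  let q : binform C := a *: X1 - c *: X0 in
  coords (p * q * (p ^+ 4 - q ^+ 4)).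

(* Elements of PGL_2 = PSL_2 are represented by invertible matrices up to
   scale. *)
Definition deck (phi : 'M[binform C]_(2, 1)) (S : 'M[C]_2) : Prop :=
  S \in unitmx /\
  forall q, q != 0 -> same_point (at_pt phi (S *m q)) (at_pt phi q).

(* phi is Galois of degree d, and theta induces an isomorphism from K onto its
   Galois group. *)
Definition galois_covering (gT : finGroupType) (K : {group gT}) d
    (phi : 'M[binform C]_(2, 1)) : Prop :=
  [/\ is_curve d phi, #|K| = d &
   exists theta : gT -> 'M[C]_2,
   [/\ forall s, s \in K -> deck phi (theta s),
       forall s t, s \in K -> t \in K ->
         same_point (theta (s * t)%g) (theta s *m theta t),
       forall s t, s \in K -> t \in K ->
         same_point (theta s) (theta t) -> s = t
     & forall S, deck phi S ->
         exists s, s \in K /\ same_point S (theta s)]].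

Definition stab_oct (H : 'M[C]_2) : Prop :=
  H \in unitmx /\ same_point (coords (sl2_act H f_oct)) (coords f_oct).

(* g(sigma(q))^-1 g(q) is the class of H for every q where it is defined. *)
Definition lift_value (g : 'M[binform C]_(2, 2)) (S H : 'M[C]_2) : Prop :=
  forall q, at_pt g q \in unitmx -> at_pt g (S *m q) \in unitmx ->
    same_point (invmx (at_pt g (S *m q)) *m at_pt g q) H.

Definition galois_lift (phi : 'M[binform C]_(2, 1)) (F : 'M[binform C]_(7, 1))
    (g : 'M[binform C]_(2, 2)) : Prop :=
  [/\ exists q, f1 (at_pt g q) != 0,
      (* f_1 o g = F o phi as rational maps *)
      forall q, f1 (at_pt g q) != 0 ->
        same_point (f1 (at_pt g q)) (at_pt F (at_pt phi q)),
      forall S, deck phi S -> exists H, stab_oct H /\ lift_value g S H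
    & forall S T H, deck phi S -> deck phi T ->
        lift_value g S H -> lift_value g T H -> same_point S T].

(* The binary octahedral group S_4^*; the first generator is
   diag(e^(i pi/4), e^(-i pi/4)), with e^(i pi/4) = (1 + i)/sqrt 2. *)
Inductive bin_oct : 'M[C]_2 -> Prop :=
| bin_oct_one : bin_oct 1%:M
| bin_oct_diag : bin_oct (mx_of_rows 2 2
    [:: [:: (1 + 'i) / sqrtC 2; 0]; [:: 0; (1 - 'i) / sqrtC 2]])
| bin_oct_rot : bin_oct ((sqrtC 2)^-1 *: mx_of_rows 2 2
    [:: [:: 1; -1]; [:: 1; 1]])
| bin_oct_mul A B : bin_oct A -> bin_oct B -> bin_oct (A *m B)
| bin_oct_inv A : bin_oct A -> bin_oct (invmx A).

(* A (g o alpha) B^T = h as maps to P^3. *)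
Definition carries (alpha A B : 'M[C]_2) (g h : 'M[binform C]_(2, 2)) : Prop :=
  [/\ alpha \in unitmx, \det A = 1, bin_oct B
    & forall q, q != 0 ->
        same_point (A *m at_pt g (alpha *m q) *m B^T) (at_pt h q)].

Definition equivalent (g h : 'M[binform C]_(2, 2)) : Prop :=
  exists alpha A B, carries alpha A B g h.

Definition sqrtm3 : C := sqrtC 3 * 'i.

Definition Phi : binform C :=
  X0 ^+ 4 - (2 * sqrtm3) *: (X0 ^+ 2 * X1 ^+ 2) + X1 ^+ 4.
Definition Psi : binform C :=
  X0 ^+ 4 + (2 * sqrtm3) *: (X0 ^+ 2 * X1 ^+ 2) + X1 ^+ 4.
Definition Omega : binform C := X0 * X1 * (X0 ^+ 4 - X1 ^+ 4).

Definition phi_A4 : 'M[binform C]_(2, 1) :=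
  mx_of_rows 2 1 [:: [:: Phi ^+ 3]; [:: Psi ^+ 3]].

Definition N13 : 'M[binform C]_(2, 3) := mx_of_rows 2 3
  [:: [:: X0 * Omega ^+ 2; X0 * Phi ^+ 3; - (Omega * Phi * d1 Psi)];
      [:: X1 * Omega ^+ 2; X1 * Phi ^+ 3; Omega * Phi * d0 Psi]].

Definition N15 : 'M[binform C]_(2, 3) := mx_of_rows 2 3
  [:: [:: X0 * Omega * Phi ^+ 2; - (Omega ^+ 2 * d1 Psi);
          - (Phi ^+ 3 * d1 Psi)];
      [:: X1 * Omega * Phi ^+ 2; Omega ^+ 2 * d0 Psi; Phi ^+ 3 * d0 Psi]].

Definition curve_of_plane (N : 'M[binform C]_(2, 3)) (M : 'M[C]_(2, 3)) :
  'M[binform C]_(2, 2) := map_mx (fun c => c%:MP) M *m N^T.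

Definition normal15 (t : C) : 'cV[C]_3 :=
  let P := 2 * sqrtm3 * t ^+ 2 - t ^+ 4 - 1 in
  mx_of_rows 3 1
    [:: [:: (t ^+ 4 - 1) * P ^+ 2];
        [:: 4 * t ^+ 2 * (t ^+ 4 - 1) ^+ 2 * (sqrtm3 + t ^+ 2)];
        [:: - 4 * P ^+ 3 * (sqrtm3 + t ^+ 2)]].

(* M represents the plane of G(2,3) perpendicular to normal15 t. *)
Definition plane15 (t : C) (M : 'M[C]_(2, 3)) : Prop :=
  \rank M = 2%N /\ M *m normal15 t = 0.

(* Pluecker coordinates, up to signs. *)
Definition minors (M : 'M[C]_(2, 3)) (k : 'I_3) : C := \det (col' k M).

Definition lifts_sextic n (g : 'M[binform C]_(2, 2)) : Prop :=
  is_curve n g /\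
  exists F, sextic_curve F /\ galois_lift phi_A4 F g.

(* The class of degree-13 curves depends on two free parameters: the members of
   a nonempty Zariski-open subset of the surface G(2,3) occur, and each
   equivalence class contains only finitely many of them. *)
Definition two_free_parameters : Prop :=
  (exists d (P : {mpoly C[3]}),
     [/\ P \is d.-homog, P != 0 &
      forall M : 'M[C]_(2, 3), \rank M = 2%N -> P.@[minors M] != 0 ->
        lifts_sextic 13 (curve_of_plane N13 M)]) /\
  (forall M : 'M[C]_(2, 3), \rank M = 2%N ->
     lifts_sextic 13 (curve_of_plane N13 M) ->
     exists s : seq 'M[C]_(2, 3), forall M' : 'M[C]_(2, 3), \rank M' = 2%N ->
       equivalent (curve_of_plane N13 M) (curve_of_plane N13 M') ->
       exists2 M0, M0 \in s & (M' == M0)%MS).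

(* Likewise for degree 15: all but finitely many t occur, and each equivalence
   class contains the curves of only finitely many t. *)
Definition one_free_parameter : Prop :=
  (exists s : seq C, forall t M, t \notin s -> plane15 t M ->
     lifts_sextic 15 (curve_of_plane N15 M)) /\
  (forall t M, plane15 t M -> lifts_sextic 15 (curve_of_plane N15 M) ->
     exists s : seq C, forall t' M', plane15 t' M' ->
       equivalent (curve_of_plane N15 M) (curve_of_plane N15 M') -> t' \in s).

End Definitions.

(* Main.v *)
Require Import Defs.
From mathcomp Require Import all_boot all_order all_fingroup all_algebra all_solvable.
From mathcomp Require Import reals complex mpoly.
From mathcomp Require Import boolp separable ring zify.

(**
   After Moebius transformations the Galois lift becomes a matrix of binary forms
   that is equivariant under the binary tetrahedral group, and such matrices can
   be listed by invariant theory.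

   Normalization. Subgroups of PGL_2 isomorphic to the alternating group on four
   letters are conjugate, with their generators (A4_conj). This brings the deck
   group to the standard tetrahedral group; the components of the covering are
   then invariants of the quaternion group, that is, cubics in Phi and Psi, and
   the generator of order 3 leaves only Phi ^ 3 and Psi ^ 3. The images of the
   deck transformations under the lift form a second tetrahedral group, which is
   moved to the first one by an octahedral matrix because Omega is its only
   semi-invariant sextic (conjugator_octa). Hence g (S q) = chi (S) g (q) S^T for
   S in the binary tetrahedral group, with a character chi (normalize).

   Degrees. The sextic f_1 (g) is the value of Omega at a combination of the rows
   of g, and equals E times F over the covering, for a form E of degree
   6 deg g - 72. On a general line E divides the product of the contents of six
   combinations of the rows, the zeros of Omega giving the combinations. The
   contents are pairwise coprime divisors of the determinant of g, which is also
   divisible by Phi Psi, because g is degenerate at the fixed points of the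
   elements of order 3; at these points the contents do not vanish. Therefore
   0 <= 6 deg g - 72 and 6 deg g - 72 + 8 <= 2 deg g, so that deg g lies between
   12 and 16 (degree_bound); being odd, it is 13 or 15.

   Classification. A row equivariant like (x, y) has a determinant against (x, y)
   that is a semi-invariant, produced by multiples of the turned gradient of Psi;
   the rest is a semi-invariant times (x, y). In degrees 13 and 15 this leaves the
   spans of the columns of the two frames (row_classify13, row_classify15), up to
   an octahedral matrix that exchanges the two characters in degree 15.

   The explicit value of Omega at a row of either frame (Omf_expand) is Omega
   times a polynomial S13 or S15 in X = Phi ^ 3 and Z = Omega ^ 2, which are
   coordinates of the target. It is F in degree 13 and a linear form e times F in
   degree 15 (descend). The expansion shows to first order that F is tangent to
   the orbit of the sixth powers (ramified13, ramified15). In degree 15 it also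
   factors over the source into six forms attached to the normal vectors
   normal15, and the zero of e gives a vector perpendicular to the plane
   (H15_dn, plane15_exists).

   Families. Conversely, F is defined by dividing the factor e out of the
   expansion. What has to be proved is that its seven coordinates are
   independent. In degree 13 the coefficients with respect to suitable linear
   forms in u and v vanish to different orders at one point, under an open
   condition on the minors of the plane (lifts_sextic13). In degree 15
   independence is the nonvanishing of a determinant that is polynomial in t and
   that is computed at t = 0 (K15_0). The curve F lies in V5 because it does so
   over the points where g is invertible, and it is not contained in the boundary
   because the quadratic invariant of sextics does not vanish at these points.
   Finally an equivalence between two planes is determined, up to finitely many
   possibilities, by the images of three zeros of Omega, at which all these
   curves are degenerate (finite_planes).
*)

Set Implicit Arguments.
Unset Strict Implicit.
Unset Printing Implicit Defensive.

Import GRing.Theory Num.Theory.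
Local Open Scope ring_scope.

(** * Binary forms as functions of two variables *)

Section Forms.
Variable C : numClosedFieldType.
Implicit Types (p : binform C) (x y z : C).

Definition pt x y : 'cV[C]_2 := \col_i (if i == ord0 then x else y).

Lemma colE (q : 'cV[C]_2) : q = pt (q ord0 0) (q ord_max 0).
Proof.
apply/colP=> i; rewrite !mxE; case: eqP => [-> //|/eqP].
by case: i => [[|[|//]] //] lt_i _; congr (q _ 0); apply: val_inj.
Qed.

Lemma pt_eq0 x y : (pt x y == 0) = (x == 0) && (y == 0).
Proof.
apply/eqP/andP=> [/colP p0|[/eqP-> /eqP->]].
  by have := (p0 ord0, p0 ord_max); rewrite !mxE /= => -[-> ->].
by apply/colP=> i; rewrite !mxE if_same.
Qed.

Definition ev p x y := p.@[fun i => pt x y i 0].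

Lemma evD p q x y : ev (p + q) x y = ev p x y + ev q x y. Proof. exact: mevalD. Qed.
Lemma evN p x y : ev (- p) x y = - ev p x y. Proof. exact: mevalN. Qed.
Lemma evB p q x y : ev (p - q) x y = ev p x y - ev q x y. Proof. exact: mevalB. Qed.
Lemma evM p q x y : ev (p * q) x y = ev p x y * ev q x y. Proof. exact: mevalM. Qed.
Lemma evX p k x y : ev (p ^+ k) x y = ev p x y ^+ k. Proof. exact: rmorphXn. Qed.
Lemma evZ c p x y : ev (c *: p) x y = c * ev p x y. Proof. exact: mevalZ. Qed.
Lemma evC c x y : ev c%:MP x y = c. Proof. exact: mevalC. Qed.
Lemma ev0 x y : ev 0 x y = 0. Proof. exact: meval0. Qed.
Lemma ev1 x y : ev 1 x y = 1. Proof. exact: meval1. Qed.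
Lemma evX0 x y : ev (X0 C) x y = x. Proof. by rewrite /ev mevalXU mxE. Qed.
Lemma evX1 x y : ev (X1 C) x y = y. Proof. by rewrite /ev mevalXU mxE. Qed.
Lemma ev_sum (I : Type) (r : seq I) (P : pred I) (F : I -> binform C) x y :
  ev (\sum_(i <- r | P i) F i) x y = \sum_(i <- r | P i) ev (F i) x y.
Proof. exact: raddf_sum. Qed.
Definition evE := (evD, evN, evB, evM, evX, evZ, evC, ev0, ev1, evX0, evX1).

Definition bimon d k : 'X_{1..2} :=
  [multinom (if i == ord0 then d - k else k)%N | i < 2].

Lemma homog_sum d p : p \is d.-homog ->
  p = \sum_(k < d.+1) p@_(bimon d k) *: (X0 C ^+ (d - k) * X1 C ^+ k).
Proof.
move=> hp.
have monE k : (k <= d)%N -> X0 C ^+ (d - k) * X1 C ^+ k = 'X_[bimon d k].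
  move=> lek; rewrite mpolyXE_id big_ord_recl big_ord1 !mnmE /=.
  by congr (_ * _ ^+ _); congr 'X_ _; apply: val_inj.
have supp m : m \in msupp p -> exists2 k, (k <= d)%N & m = bimon d k.
  move/(dhomog_mf hp); rewrite /= mdegE big_ord_recl big_ord1 => <-.
  exists (m (lift ord0 ord0)); first by rewrite leq_addl.
  apply/mnmP=> i; rewrite !mnmE addnK; case: eqP => [-> //|/eqP].
  by case: i => [[|[|//]] //] lt_i _; congr (m _); apply: val_inj.
apply/mpolyP=> m; rewrite raddf_sum /=.
have bimon_inj k1 k2 : bimon d k1 = bimon d k2 -> k1 = k2.
  by move/mnmP/(_ ord_max); rewrite !mnmE.
have rhsE k : (k < d.+1)%N ->
    (p@_(bimon d k) *: (X0 C ^+ (d - k) * X1 C ^+ k))@_m = p@_m *+ (bimon d k == m).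
  move=> ltk; rewrite mcoeffZ (monE k ltk) mcoeffX.
  by case: eqP => [->|_]; rewrite ?mulr1 ?mulr0.
rewrite (eq_bigr _ (fun k _ => rhsE _ (ltn_ord k))).
have [|mNp] := boolP (m \in msupp p).
  case/supp=> k lek ->; rewrite (bigD1 (Ordinal (lek : (k < d.+1)%N))) //= eqxx.
  rewrite big1 ?addr0 // => i /eqP neq_i; case: eqP => [/bimon_inj eq_i|_ //].
  by case: neq_i; apply: val_inj.
by have := mNp; rewrite -mcoeff_eq0 => /eqP->; rewrite big1 // => i _; rewrite mul0rn.
Qed.

(** The field being infinite, a form is determined by its values; with functions
    instead of polynomials, substitutions are compositions and identities are
    proved pointwise. *)
Definition form d (f : C -> C -> C) :=
  exists2 p, p \is d.-homog & forall x y, f x y = ev p x y.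

Lemma form_ev d p : p \is d.-homog -> form d (ev p).
Proof. by exists p. Qed.

Lemma form_ext d f g : (forall x y, f x y = g x y) -> form d f -> form d g.
Proof. by move=> fg [p hp fE]; exists p => // x y; rewrite -fg. Qed.

Lemma formC c : form 0 (fun _ _ => c).
Proof.
exists c%:MP => [|x y]; last by rewrite evC.
by rewrite -[c%:MP]mulr1 mul_mpolyC dhomogZ ?dhomog1.
Qed.

Lemma form0 d : form d (fun _ _ => 0).
Proof. by exists 0 => [|x y]; rewrite ?dhomog0 ?ev0. Qed.

Lemma formx : form 1 (fun x _ => x).
Proof. by exists (X0 C) => [|x y]; rewrite ?evX0 // dhomogX /= mdeg1. Qed.

Lemma formy : form 1 (fun _ y => y).
Proof. by exists (X1 C) => [|x y]; rewrite ?evX1 // dhomogX /= mdeg1. Qed.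

Lemma formD d f g : form d f -> form d g -> form d (fun x y => f x y + g x y).
Proof.
move=> [p hp fE] [q hq gE]; exists (p + q); first exact: dhomogD.
by move=> x y; rewrite evD fE gE.
Qed.

Lemma formZ d c f : form d f -> form d (fun x y => c * f x y).
Proof.
move=> [p hp fE]; exists (c *: p); first exact: dhomogZ.
by move=> x y; rewrite evZ fE.
Qed.

Lemma formN d f : form d f -> form d (fun x y => - f x y).
Proof. by move/(formZ (-1)); apply: form_ext => x y; rewrite mulN1r. Qed.

Lemma formB d f g : form d f -> form d g -> form d (fun x y => f x y - g x y).
Proof. by move=> ff /formN; apply: formD. Qed.

Lemma formM d e f g : form d f -> form e g -> form (d + e) (fun x y => f x y * g x y).
Proof.
move=> [p hp fE] [q hq gE]; exists (p * q); first exact: dhomogM.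
by move=> x y; rewrite evM fE gE.
Qed.

Lemma form_exp d k f : form d f -> form (d * k) (fun x y => f x y ^+ k).
Proof.
move=> [p hp fE]; exists (p ^+ k); first exact: dhomogMn.
by move=> x y; rewrite evX fE.
Qed.

Lemma form_sum d (I : Type) (r : seq I) (F : I -> C -> C -> C) :
  (forall i, form d (F i)) -> form d (fun x y => \sum_(i <- r) F i x y).
Proof.
move=> fF; elim: r => [|i r IHr].
  by apply: form_ext (form0 d) => x y; rewrite big_nil.
by apply: form_ext (formD (fF i) IHr) => x y; rewrite big_cons.
Qed.

Lemma form_lin a b : form 1 (fun x y => a * x + b * y).
Proof. exact: formD (formZ a formx) (formZ b formy). Qed.

Lemma form_coef d f : form d f ->
  exists a : nat -> C, forall x y, f x y = \sum_(k < d.+1) a k * (x ^+ (d - k) * y ^+ k).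
Proof.
move=> [p /homog_sum hp fE]; exists (fun k => p@_(bimon d k)) => x y.
by rewrite fE {1}hp ev_sum; apply: eq_bigr => k _; rewrite !evE.
Qed.

Lemma coef_form d (a : nat -> C) : form d (fun x y => \sum_(k < d.+1) a k * (x ^+ (d - k) * y ^+ k)).
Proof.
apply: form_sum => k; apply: formZ.
have {1}<- : ((d - k) + k)%N = d by rewrite subnK // -ltnS.
by have := formM (form_exp (d - k) formx) (form_exp k formy); rewrite !mul1n.
Qed.

Lemma form_subst d f g h : form d f -> form 1 g -> form 1 h ->
  form d (fun x y => f (g x y) (h x y)).
Proof.
move=> /form_coef[a fE] fg fh.
suff: form d (fun x y => \sum_(k < d.+1) a k * (g x y ^+ (d - k) * h x y ^+ k)).
  by apply: form_ext => x y; rewrite fE.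
apply: form_sum => k; apply: formZ.
have {1}<- : ((d - k) + k)%N = d by rewrite subnK // -ltnS.
by have := formM (form_exp (d - k) fg) (form_exp k fh); rewrite !mul1n.
Qed.

Lemma form_scale d f t x y : form d f -> f (t * x) (t * y) = t ^+ d * f x y.
Proof.
move/form_coef=> [a fE]; rewrite !fE mulr_sumr; apply: eq_bigr => k _.
have -> : t ^+ d = t ^+ (d - k) * t ^+ k by rewrite -exprD subnK // -ltnS.
rewrite !exprMn; ring.
Qed.

Let addBK (a b : C) : a + (b - a) = b. Proof. by rewrite addrC subrK. Qed.

Lemma poly_inf0 (P : {poly C}) : (forall z, P.[z] = 0) -> P = 0.
Proof.
move=> P0; apply/eqP; apply/negP=> /negP /closed_nonrootP [z].
by rewrite /root P0 eqxx.
Qed.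

(** Restriction to a line, with which vanishing and divisibility of forms are
    reduced to polynomials in one variable. *)
Lemma form_line d f x0 y0 x1 y1 : form d f -> exists P : {poly C},
  [/\ forall z, P.[z] = f (x0 + z * x1) (y0 + z * y1), (size P <= d.+1)%N
    & P`_d = f x1 y1].
Proof.
move=> ff.
have fs : form d (fun x y => f (x1 * x + x0 * y) (y1 * x + y0 * y)).
  by apply: form_subst => //; apply: form_lin.
have [a aE] := form_coef fs; exists (\poly_(k < d.+1) a (d - k)%N); split.
- move=> z; rewrite horner_poly.
  have := aE z 1; rewrite !mulr1 ![_ * z]mulrC ![z * _ + _]addrC => ->.
  rewrite (reindex_inj rev_ord_inj) /=; apply: eq_bigr => k _.
  by rewrite expr1n mulr1 subSS subKn // -ltnS.
- exact: size_poly.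
- rewrite coef_poly ltnSn subnn.
  have := aE 1 0; rewrite !mulr0 !mulr1 !addr0 => ->.
  rewrite big_ord_recl /= expr1n expr0 !mulr1 big1 ?addr0 // => k _.
  by rewrite expr0n /= !mulr0.
Qed.

Lemma form_inf0 d f : form d f -> (forall z, f 1 z = 0) -> forall x y, f x y = 0.
Proof.
move=> ff f0 x y; have [a aE] := form_coef ff.
suff a0 k : (k < d.+1)%N -> a k = 0.
  by rewrite aE big1 // => k _; rewrite a0 ?mul0r.
have: \poly_(k < d.+1) a k = 0.
  apply: poly_inf0 => z; rewrite horner_poly -[RHS](f0 z) aE; apply: eq_bigr => j _.
  by rewrite expr1n mul1r.
by move/polyP/(_ k); rewrite coef_poly coef0 => ak ltk; move: ak; rewrite ltk.
Qed.

Lemma form_line0 d f x0 y0 x1 y1 : form d f ->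
  f x0 y0 != 0 -> exists P : {poly C}, P != 0 /\
  forall z, P.[z] = f (x0 + z * x1) (y0 + z * y1).
Proof.
move=> ff f0; have [P [PE _ _]] := form_line x0 y0 x1 y1 ff; exists P; split=> //.
by apply: contraNneq f0 => P0; have := PE 0; rewrite P0 horner0 !mul0r !addr0 => <-.
Qed.

Lemma form_mul0 d e f g : form d f -> form e g ->
  (forall x y, f x y * g x y = 0) -> (exists x y, f x y != 0) ->
  forall x y, g x y = 0.
Proof.
move=> ff fg fg0 [x0 [y0 nz]] x y.
have [//|gnz] := eqVneq (g x y) 0.
have [P [Pnz PE]] := form_line0 (x - x0) (y - y0) ff nz.
have [Q [QE _ _]] := form_line x0 y0 (x - x0) (y - y0) fg.
have: P * Q = 0 by apply: poly_inf0 => z; rewrite hornerM PE QE fg0.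
move/eqP; rewrite mulf_eq0 (negbTE Pnz) => /eqP Q0.
by have := QE 1; rewrite Q0 horner0 !mul1r !addBK => <-.
Qed.

Lemma form_neqM d e f g : form d f -> form e g ->
  (exists x y, f x y != 0) -> (exists x y, g x y != 0) ->
  exists x y, f x y * g x y != 0.
Proof.
move=> [p hp fE] [q hq gE] [x0 [y0 f0]] [x1 [y1 g1]].
have ff : form d f by exists p.
have fg : form e g by exists q.
have [P [Pnz PE]] := form_line0 (x1 - x0) (y1 - y0) ff f0.
have [Q [QE _ _]] := form_line x0 y0 (x1 - x0) (y1 - y0) fg.
have Qnz : Q != 0.
  apply: contraNneq g1 => Q0; have := QE 1.
  by rewrite Q0 horner0 !mul1r !addBK => <-.
have /closed_nonrootP[z] : P * Q != 0 by rewrite mulf_neq0.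
by rewrite /root hornerM PE QE => nz; eexists _, _; apply: nz.
Qed.

(** The factor theorem in one variable, made homogeneous. *)
Lemma form_div d f x0 y0 : form d.+1 f -> (x0, y0) != (0, 0) -> f x0 y0 = 0 ->
  exists2 g, form d g & forall x y, f x y = (y0 * x - x0 * y) * g x y.
Proof.
have main e h u v : form e.+1 h -> u != 0 -> h u v = 0 ->
    exists2 g, form e g & forall x y, h x y = (v * x - u * y) * g x y.
  move=> fh nzu h0; have [a aE] := form_coef fh.
  pose P := \poly_(k < e.+2) a k.
  have PE z : P.[z] = h 1 z.
    by rewrite horner_poly aE; apply: eq_bigr => k _; rewrite expr1n mul1r.
  have: root P (v / u).
    rewrite /root PE; have := form_scale u 1 (v / u) fh.
    rewrite mulr1 mulrC divfK // h0 => /esym/eqP; rewrite mulf_eq0 expf_eq0.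
    by rewrite (negbTE nzu) andbF.
  rewrite root_factor_theorem => /dvdpP[Q PQ].
  have szQ : (size Q <= e.+1)%N.
    have [->|Qnz] := eqVneq Q 0; first by rewrite size_poly0.
    have := size_poly e.+2 a; rewrite -/P PQ size_Mmonic ?monicXsubC //.
    by rewrite size_XsubC addn2.
  pose g x y := - u^-1 * \sum_(k < e.+1) Q`_k * (x ^+ (e - k) * y ^+ k).
  have fg : form e g by apply: formZ; apply: coef_form.
  exists g => // x y; apply/eqP; rewrite -subr_eq0; apply/eqP.
  apply: (@form_inf0 e.+1 (fun x y => h x y - (v * x - u * y) * g x y)).
    apply: formB => //; rewrite -add1n; apply: formM fg; apply: form_ext (form_lin v (- u)) => ? ?.
    by rewrite mulNr.
  move=> z; rewrite -PE PQ /g hornerM hornerXsubC (horner_coef_wide _ szQ).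
  have -> : \sum_(k < e.+1) Q`_k * (1 ^+ (e - k) * z ^+ k) = \sum_(i < e.+1) Q`_i * z ^+ i.
    by apply: eq_bigr => k _; rewrite expr1n mul1r.
  by set S := \sum_(_ < _) _; field.
move=> ff nz0 f0; have [y00|nzy] := eqVneq x0 0; last exact: main.
have nzy : y0 != 0 by apply: contraNneq nz0 => ->; rewrite y00.
have fs : form d.+1 (fun x y => f y x) by apply: form_subst => //; [apply: formy|apply: formx].
have [||g fg gE] := main _ _ y0 x0 fs => //.
exists (fun x y => - g y x) => [|x y]; last by rewrite gE; ring.
by apply: formN; apply: form_subst => //; [apply: formy|apply: formx].
Qed.

Lemma form_root d f : form d.+1 f -> exists x y, (x, y) != (0, 0) /\ f x y = 0.
Proof.
move=> ff; have [P [PE szP lcP]] := form_line 0 1 1 0 ff.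
have [f0|nz] := eqVneq (f 1 0) 0.
  by exists 1, 0; split=> //; rewrite xpair_eqE oner_eq0.
have: size P != 1%N.
  apply: contraNneq nz => sP; rewrite -lcP nth_default ?sP //.
case/closed_rootP=> z; rewrite /root PE !add0r mulr1 mulr0 addr0 => /eqP fz.
by exists z, 1; split=> //; rewrite xpair_eqE oner_eq0 andbF.
Qed.

End Forms.

(** * Divisibility of forms and curves without common zeros *)

Section Divisibility.
Variable C : numClosedFieldType.
Implicit Types (f g h : C -> C -> C).

Definition nonzero f := exists x y, f x y != 0.

Lemma split_neq0 (a b : C) : a * b != 0 -> a != 0 /\ b != 0.
Proof. by rewrite mulf_eq0 => /norP. Qed.

Lemma base_neq0 (a : C) k : a ^+ k.+1 != 0 -> a != 0.
Proof. by apply: contraNneq => ->; rewrite expr0n. Qed.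

Lemma form_cancel d e b f g : form e b -> nonzero b -> form d f -> form d g ->
  (forall x y, b x y * f x y = b x y * g x y) -> forall x y, f x y = g x y.
Proof.
move=> fb nzb ff fg eq_fg x y; apply/eqP; rewrite -subr_eq0; apply/eqP.
apply: (form_mul0 fb (formB ff fg) _ nzb) => {}x {}y.
by rewrite mulrBr eq_fg subrr.
Qed.

Lemma form_ell (u v : C) : form 1 (fun x y => v * x - u * y).
Proof. by apply: form_ext (form_lin v (- u)) => x y; rewrite mulNr. Qed.

Lemma ell_nonzero (u v : C) : (u, v) != (0, 0) -> nonzero (fun x y => v * x - u * y).
Proof.
rewrite xpair_eqE negb_and => /orP[nz|nz]; [exists 0, (-1)|exists 1, 0].
  by rewrite mulr0 mulrN1 sub0r opprK.
by rewrite mulr0 mulr1 subr0.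
Qed.

(** Unique factorization enters only here: the linear factors of b are cancelled
    one at a time, each against a c l that does not vanish at its zero. *)
Lemma form_gauss (T : Type) n e d a b (c : T -> C -> C -> C) :
  form d a -> form e b -> nonzero a -> nonzero b -> (forall l, form n (c l)) ->
  (forall x y, (x, y) != (0, 0) -> exists l, c l x y != 0) ->
  (forall l, exists m, exists2 h, form m h &
     (m + e = d + n)%N /\ forall x y, a x y * c l x y = b x y * h x y) ->
  (e <= d)%N /\ exists2 E, form (d - e) E & forall x y, a x y = E x y * b x y.
Proof.
move=> fa fb nza nzb fc c_prim; elim: e d a b fa fb nza nzb => [|e IHe] d a b fa fb nza nzb ach.
  have [k kE] := form_coef fb.
  have {}kE x y : b x y = k 0%N by rewrite kE big_ord1 !mulr1.
  have nzk : k 0%N != 0 by have [x [y]] := nzb; rewrite kE.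
  split=> //; rewrite subn0; exists (fun x y => (k 0%N)^-1 * a x y); first exact: formZ.
  by move=> x y; rewrite kE mulrC mulVKf.
have [u [v [nzq b0]]] := form_root fb.
have [b' fb' bE] := form_div fb nzq b0.
have [l nzl] := c_prim _ _ nzq.
have a0 : a u v = 0.
  have [m [h _ [_ /(_ u v)]]] := ach l.
  by rewrite b0 mul0r => /eqP; rewrite mulf_eq0 (negbTE nzl) orbF => /eqP.
case: d fa ach => [|d] fa ach.
  have [k kE] := form_coef fa; have [x [y]] := nza.
  by have := a0; rewrite !kE !big_ord1 !mulr1 => ->; rewrite eqxx.
have [a' fa' aE] := form_div fa nzq a0.
have fl := form_ell u v; have nzl' := ell_nonzero nzq.
have [||l'|le_ed [E fE aE']] := IHe d a' b' fa' fb'.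
- by have [x [y]] := nza; rewrite aE mulf_eq0 => /norP[_]; exists x, y.
- by have [x [y]] := nzb; rewrite bE mulf_eq0 => /norP[_]; exists x, y.
- have [m [h fh [mE hE]]] := ach l'; exists m, h => //; split; first by lia.
  have fr : form (d + n) (fun x y => b' x y * h x y).
    by have -> : (d + n = e + m)%N by [lia]; apply: formM.
  apply: (form_cancel fl nzl' (formM fa' (fc l')) fr) => x y.
  by rewrite !mulrA -aE -bE hE.
split; first exact: le_ed.
by exists E; rewrite ?subSS // => x y; rewrite aE aE' bE mulrCA.
Qed.

Definition proportional (T : Type) (A B : T -> C -> C -> C) :=
  forall k l x y, A k x y * B l x y = A l x y * B k x y.

Definition primitive (T : Type) (B : T -> C -> C -> C) :=
  forall x y, (x, y) != (0, 0) -> exists l, B l x y != 0.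

(** By proportionality B k divides A k * B l for all l, and the B l have no
    common zero, so form_gauss applies; the quotients for different k agree. *)
Lemma proportional_primitive (T : Type) d e (A B : T -> C -> C -> C) :
  (forall k, form d (A k)) -> (forall k, form e (B k)) ->
  (exists k, nonzero (A k)) -> proportional A B -> primitive B ->
  (e <= d)%N /\ exists2 E, form (d - e) E & forall k x y, A k x y = E x y * B k x y.
Proof.
move=> fA fB [k0 nzA] AB primB.
have nzB : nonzero (B k0).
  have [l nzl] : exists l, nonzero (B l).
    have [|l nz] := primB 1 0; first by rewrite xpair_eqE oner_eq0.
    by exists l, 1, 0.
  have [x [y]] := form_neqM (fA k0) (fB l) nzA nzl.
  by rewrite AB mulf_eq0 => /norP[_]; exists x, y.
have [|le_ed [E fE EA]] := form_gauss (fA k0) (fB k0) nzA nzB fB primB.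
  move=> l; exists d, (A l) => //; split=> // x y.
  by rewrite AB mulrC.
split=> //; exists E => // k.
have fEB : form d (fun x y => E x y * B k x y) by rewrite -(subnK le_ed); apply: formM.
apply: (form_cancel (fB k0) nzB (fA k) fEB) => x y.
by rewrite mulrC AB EA; ring.
Qed.

Lemma form_degree0 f : form 0 f -> exists c, forall x y, f x y = c.
Proof.
move/form_coef=> [a aE]; exists (a 0%N) => x y.
by rewrite aE big_ord1 !mulr1.
Qed.

Lemma proportional_const (T : Type) d (A B : T -> C -> C -> C) :
  (forall k, form d (A k)) -> (forall k, form d (B k)) ->
  (exists k, nonzero (A k)) -> proportional A B -> primitive B ->
  exists2 c, c != 0 & forall k x y, A k x y = c * B k x y.
Proof.
move=> fA fB nzA AB pB; have [_ [E fE EA]] := proportional_primitive fA fB nzA AB pB.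
rewrite subnn in fE; have [c cE] := form_degree0 fE.
exists c => [|k x y]; last by rewrite EA cE.
have [k [x [y]]] := nzA; apply: contraNneq => c0.
by rewrite EA cE c0 mul0r.
Qed.

End Divisibility.

Section Curves.
Variable C : numClosedFieldType.

Lemma ev_inj0 (p : binform C) : (forall x y, ev p x y = 0) -> p = 0.
Proof.
move=> p0; rewrite (pihomog_partitionE (leqnn (mmeasure mdeg p))) big1 // => i _.
set q := pihomog _ _ _.
have hq : q \is (i : nat).-homog by apply: pihomogP.
suff q0 x y : ev q x y = 0.
  rewrite (homog_sum hq) big1 // => k _.
  suff -> : q@_(bimon i k) = 0 by rewrite scale0r.
  have: \poly_(k < i.+1) q@_(bimon i k) = 0.
    apply: poly_inf0 => z; rewrite -[RHS](q0 1 z) horner_poly {2}(homog_sum hq) ev_sum.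
    by apply: eq_bigr => j _; rewrite !evE expr1n mul1r.
  by move/polyP/(_ k); rewrite coef_poly coef0 ltn_ord.
have: \poly_(j < mmeasure mdeg p) ev (pihomog mdeg j p) x y = 0.
  apply: poly_inf0 => z; rewrite horner_poly -[RHS](p0 (z * x) (z * y)).
  rewrite [in RHS](pihomog_partitionE (leqnn (mmeasure mdeg p))) ev_sum.
  apply: eq_bigr => j _; have hj : pihomog mdeg j p \is j.-homog by apply: pihomogP.
  by rewrite (form_scale _ _ _ (form_ev hj)) mulrC.
by move/polyP/(_ i); rewrite coef_poly coef0 ltn_ord.
Qed.

Lemma ev_inj (p q : binform C) : (forall x y, ev p x y = ev q x y) -> p = q.
Proof.
move=> pq; apply/eqP; rewrite -subr_eq0; apply/eqP/ev_inj0 => x y.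
by rewrite evB pq subrr.
Qed.

Lemma ev_at m n (g : 'M[binform C]_(m, n)) x y i j : at_pt g (pt x y) i j = ev (g i j) x y.
Proof. by rewrite mxE. Qed.

(** A common zero of the entries would split off a common linear factor. *)
Lemma curve_primitive d m n (g : 'M[binform C]_(m, n)) : is_curve d g ->
  primitive (fun k : 'I_m * 'I_n => ev (g k.1 k.2)).
Proof.
move=> [hg prim] u v nzq.
case: (pickP [pred k : 'I_m * 'I_n | ev (g k.1 k.2) u v != 0]) => [k nz|g0].
  by exists k.
pose l : binform C := v *: X0 C - u *: X1 C.
have evl x y : ev l x y = v * x - u * y by rewrite !evE.
suff /fin_all_exists2[h _ hE] (k : 'I_m * 'I_n) : exists2 h, True & g k.1 k.2 = h * l.
  have [|c lc] := prim l (\matrix_(i, j) h (i, j)).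
    by move=> i j; rewrite mxE -hE.
  have {}evl x y : c = v * x - u * y by rewrite -evl lc evC.
  case/eqP: nzq; have := evl 0 0; rewrite !mulr0 subr0 => c0.
  have := evl 1 0; have := evl 0 1; rewrite c0 !mulr0 !mulr1 subr0 sub0r.
  by move=> /esym/eqP; rewrite oppr_eq0 => /eqP-> <-.
have g0' : ev (g k.1 k.2) u v = 0 by apply/eqP/negbNE; rewrite [_ != _]g0.
case: d hg prim => [|d] hg _; last first.
  have [f [p hp fE] gE] := form_div (form_ev (hg k.1 k.2)) nzq g0'.
  by exists p => //; apply: ev_inj => x y; rewrite evM gE fE evl mulrC.
exists 0 => //; rewrite mul0r; apply: ev_inj0 => x y.
have [c cE] := form_degree0 (form_ev (hg k.1 k.2)).
by rewrite cE -(cE u v).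
Qed.

(** A common factor of positive degree has a zero, the field being algebraically
    closed. *)
Lemma primitive_curve d m n (g : 'M[binform C]_(m, n)) :
  (forall i j, g i j \is d.-homog) ->
  primitive (fun k : 'I_m * 'I_n => ev (g k.1 k.2)) -> is_curve d g.
Proof.
move=> hg prim; split=> // p h gE.
have nzp x y : (x, y) != (0, 0) -> ev p x y != 0.
  move=> nzq; have [k] := prim x y nzq; apply: contraNneq => p0.
  by rewrite gE evM p0 mulr0.
pose Px y := mmap (@polyC C) (fun i : 'I_2 => if i == ord0 then 'X else y%:P) p.
pose Py x := mmap (@polyC C) (fun i : 'I_2 => if i == ord0 then x%:P else 'X) p.
have PxE x y : (Px y).[x] = ev p x y.
  rewrite /Px /mmap /ev mevalE horner_sum; apply: eq_bigr => m' _.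
  rewrite hornerM hornerC; congr (_ * _); rewrite horner_prod; apply: eq_bigr => i _.
  by rewrite horner_exp mxE; case: ifP => _; rewrite ?hornerX ?hornerC.
have PyE x y : (Py x).[y] = ev p x y.
  rewrite /Py /mmap /ev mevalE horner_sum; apply: eq_bigr => m' _.
  rewrite hornerM hornerC; congr (_ * _); rewrite horner_prod; apply: eq_bigr => i _.
  by rewrite horner_exp mxE; case: ifP => _; rewrite ?hornerX ?hornerC.
have const (P : {poly C}) : (forall z, P.[z] != 0) -> forall z1 z2, P.[z1] = P.[z2].
  move=> nzP; have [/eqP|/closed_rootP[z]] := eqVneq (size P) 1%N.
    by case/size_poly1P=> c _ -> z1 z2; rewrite !hornerC.
  by rewrite /root (negbTE (nzP z)).
have pE x y : y != 0 -> ev p x y = ev p 1 1.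
  move=> nzy; rewrite -PxE (const _ _ x 1) => [|z]; last first.
    by rewrite PxE nzp // xpair_eqE negb_and nzy orbT.
  rewrite PxE -PyE (const _ _ y 1) ?PyE // => z.
  by rewrite PyE nzp // xpair_eqE negb_and oner_eq0.
exists (ev p 1 1); apply/eqP; rewrite -subr_eq0.
have: X1 C * (p - (ev p 1 1)%:MP) = 0.
  apply: ev_inj0 => x y; rewrite !evE; have [->|nzy] := eqVneq y 0; first by rewrite mul0r.
  by rewrite pE // subrr mulr0.
move/eqP; rewrite mulf_eq0 => /orP[/eqP X10|//].
by have /eqP := evX1 0 (1 : C); rewrite X10 ev0 eq_sym oner_eq0.
Qed.

End Curves.

(** * Two by two matrices up to scalars *)

Section Matrices.
Variable C : numClosedFieldType.
Implicit Types (a b c d x y u v : C).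

Definition mx2 a b c d : 'M[C]_2 :=
  \matrix_(i, j) (if i == ord0 then if j == ord0 then a else b
                  else if j == ord0 then c else d).

Lemma ord2P (i : 'I_2) : i = ord0 \/ i = ord_max.
Proof. by case: i => [[|[|//]] lti]; [left|right]; apply: val_inj. Qed.

Lemma mx2P (A : 'M[C]_2) :
  A = mx2 (A ord0 ord0) (A ord0 ord_max) (A ord_max ord0) (A ord_max ord_max).
Proof.
by apply/matrixP=> i j; rewrite mxE; case: (ord2P i) (ord2P j) => [] -> [] ->.
Qed.

Lemma mx2_ex (A : 'M[C]_2) : exists a b c d, A = mx2 a b c d.
Proof. by do 4!eexists; apply: mx2P. Qed.

Lemma big_ord2 (R : nmodType) (F : 'I_2 -> R) : \sum_i F i = F ord0 + F ord_max.
Proof. by rewrite big_ord_recl big_ord1; congr (_ + F _); apply: val_inj. Qed.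

Lemma mx2_inj a b c d a' b' c' d' : mx2 a b c d = mx2 a' b' c' d' ->
  [/\ a = a', b = b', c = c' & d = d'].
Proof.
move/matrixP=> E.
by have := (E ord0 ord0, E ord0 ord_max, E ord_max ord0, E ord_max ord_max);
   rewrite !mxE /= => -[[[-> ->] ->] ->].
Qed.

Lemma mul_mx2 a b c d a' b' c' d' :
  mx2 a b c d *m mx2 a' b' c' d' =
  mx2 (a * a' + b * c') (a * b' + b * d') (c * a' + d * c') (c * b' + d * d').
Proof.
by apply/matrixP=> i j; rewrite !mxE big_ord2 !mxE /=;
   case: (ord2P i) (ord2P j) => [] -> [] ->.
Qed.

Lemma mul_mx2_pt a b c d x y :
  mx2 a b c d *m pt x y = pt (a * x + b * y) (c * x + d * y).
Proof.
by apply/colP=> i; rewrite !mxE big_ord2 !mxE /=; case: (ord2P i) => ->.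
Qed.

Lemma scale_mx2 k a b c d : k *: mx2 a b c d = mx2 (k * a) (k * b) (k * c) (k * d).
Proof.
by apply/matrixP=> i j; rewrite !mxE; case: (ord2P i) (ord2P j) => [] -> [] ->.
Qed.

Lemma scale_pt k x y : k *: pt x y = pt (k * x) (k * y).
Proof. by apply/colP=> i; rewrite !mxE; case: (ord2P i) => ->. Qed.

Lemma pt_inj x y x' y' : pt x y = pt x' y' -> x = x' /\ y = y'.
Proof.
by move/colP=> E; have := (E ord0, E ord_max); rewrite !mxE /= => -[-> ->].
Qed.

Lemma tr_mx2 a b c d : (mx2 a b c d)^T = mx2 a c b d.
Proof.
by apply/matrixP=> i j; rewrite !mxE; case: (ord2P i) (ord2P j) => [] -> [] ->.
Qed.

Lemma det_mx2 a b c d : \det (mx2 a b c d) = a * d - b * c.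
Proof.
rewrite (expand_det_row _ ord0) big_ord2 /cofactor !det_mx11 !mxE /=.
by rewrite expr0 expr1 mul1r mulN1r mulrN.
Qed.

Lemma unit_mx2 a b c d : (mx2 a b c d \in unitmx) = (a * d - b * c != 0).
Proof. by rewrite unitmxE unitfE det_mx2. Qed.

Lemma mx2_1 : 1%:M = mx2 1 0 0 1.
Proof.
by apply/matrixP=> i j; rewrite !mxE; case: (ord2P i) (ord2P j) => [] -> [] ->.
Qed.

Lemma inv_mx2 a b c d : a * d - b * c != 0 ->
  invmx (mx2 a b c d) = (a * d - b * c)^-1 *: mx2 d (- b) (- c) a.
Proof.
move=> nz; have u : mx2 a b c d \in unitmx by rewrite unit_mx2.
rewrite -[LHS]mulmx1 -[RHS](mulKmx u); congr (_ *m _).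
rewrite -scalemxAr mul_mx2 scale_mx2 mx2_1.
by congr mx2; field.
Qed.

Section SamePoint.
Variables m n : nat.
Implicit Types A B D : 'M[C]_(m, n).

Lemma same_refl A : same_point A A.
Proof. by exists 1; rewrite scale1r oner_eq0. Qed.

Lemma same_sym A B : same_point A B -> same_point B A.
Proof.
move=> [c [nzc ->]]; exists c^-1; split; first by rewrite invr_eq0.
by rewrite scalerK.
Qed.

Lemma same_trans A B D : same_point A B -> same_point B D -> same_point A D.
Proof.
move=> [c [nzc ->]] [e [nze ->]]; exists (c * e); split; first by rewrite mulf_neq0.
by rewrite scalerA.
Qed.

End SamePoint.

Lemma same_mul m n p (A A' : 'M[C]_(m, n)) (B B' : 'M[C]_(n, p)) :
  same_point A A' -> same_point B B' -> same_point (A *m B) (A' *m B').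
Proof.
move=> [c [nzc ->]] [e [nze ->]]; exists (c * e); split; first by rewrite mulf_neq0.
by rewrite -scalemxAl -scalemxAr scalerA.
Qed.

Lemma same_tr m n (A B : 'M[C]_(m, n)) : same_point A B -> same_point A^T B^T.
Proof. by move=> [c [nzc ->]]; exists c; rewrite linearZ. Qed.

Lemma same_unit n (A B : 'M[C]_n) : same_point A B -> B \in unitmx -> A \in unitmx.
Proof. by move=> [c [nzc ->]] uB; rewrite unitmxZ ?unitfE. Qed.

Lemma same_mull n m (A B : 'M[C]_(n, m)) (U : 'M[C]_n) : U \in unitmx ->
  same_point (U *m A) (U *m B) -> same_point A B.
Proof.
move=> uU [c [nzc E]]; exists c; split=> //.
by rewrite -(mulKmx uU A) E -scalemxAr mulKmx.
Qed.

End Matrices.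

(** * Binary sextics and the forms Phi, Psi and Omega *)

Section Sextics.
Variable C : numClosedFieldType.
Implicit Types (a b c d x y u v : C).

Lemma homog_of_form (d : nat) (p : binform C) : form d (ev p) -> p \is d.-homog.
Proof. by move=> [q hq pq]; rewrite (ev_inj pq). Qed.

Definition val6 (w : 'cV[C]_7) u v := \sum_(k < 7) w k 0 * (u ^+ (6 - k) * v ^+ k).

Lemma val6_coords f u v : f \is 6.-homog -> val6 (coords f) u v = ev f u v.
Proof.
move=> hf; rewrite (homog_sum hf) ev_sum; apply: eq_bigr => k _.
by rewrite mxE -(homog_sum hf) !evE.
Qed.

Lemma val6Z c w u v : val6 (c *: w) u v = c * val6 w u v.
Proof. by rewrite /val6 mulr_sumr; apply: eq_bigr => k _; rewrite mxE -mulrA. Qed.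

Lemma val6D w w' u v : val6 (w + w') u v = val6 w u v + val6 w' u v.
Proof. by rewrite /val6 -big_split /=; apply: eq_bigr => k _; rewrite mxE mulrDl. Qed.

Lemma val6_0 u v : val6 0 u v = 0.
Proof. by rewrite /val6 big1 // => k _; rewrite mxE mul0r. Qed.

Lemma val6_eq0 w : (forall u v, val6 w u v = 0) -> w = 0.
Proof.
move=> w0; have: \poly_(k < 7) w (inord k) 0 = 0.
  apply: poly_inf0 => z; rewrite horner_poly -[RHS](w0 1 z).
  by apply: eq_bigr => k _; rewrite inord_val expr1n mul1r.
move/polyP=> E; apply/colP=> k; have := E k.
by rewrite coef_poly ltn_ord coef0 inord_val mxE.
Qed.

Lemma val6_inj w w' : (forall u v, val6 w u v = val6 w' u v) -> w = w'.
Proof.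
move=> ww'; apply/eqP; rewrite -subr_eq0; apply/eqP/val6_eq0 => u v.
by rewrite val6D -scaleN1r val6Z ww' mulN1r subrr.
Qed.

Lemma same_val6 w w' :
  same_point w w' <-> exists c, c != 0 /\ forall u v, val6 w u v = c * val6 w' u v.
Proof.
split=> [[c [nzc ->]]|[c [nzc E]]]; exists c; split=> //.
  by move=> u v; rewrite val6Z.
by apply: val6_inj => u v; rewrite val6Z.
Qed.

Definition Omf x y := x * y * (x ^+ 4 - y ^+ 4).
Definition Phif x y := x ^+ 4 - (2 * sqrtm3 C) * (x ^+ 2 * y ^+ 2) + y ^+ 4.
Definition Psif x y := x ^+ 4 + (2 * sqrtm3 C) * (x ^+ 2 * y ^+ 2) + y ^+ 4.
(** The gradient of Psif is 4 times (dPx, dPy). *)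
Definition dPx x y := x ^+ 3 + sqrtm3 C * (x * y ^+ 2).
Definition dPy x y := y ^+ 3 + sqrtm3 C * (x ^+ 2 * y).

Lemma ii : 'i * 'i = -1 :> C. Proof. by rewrite -expr2 sqrCi. Qed.

Lemma ss : sqrtm3 C * sqrtm3 C = - 3.
Proof. by rewrite /sqrtm3 -expr2 exprMn sqrtCK sqrCi mulrN1. Qed.

Lemma ev_Phi x y : ev (Phi C) x y = Phif x y. Proof. by rewrite /Phi !evE. Qed.
Lemma ev_Psi x y : ev (Psi C) x y = Psif x y. Proof. by rewrite /Psi !evE. Qed.
Lemma ev_Omega x y : ev (Omega C) x y = Omf x y. Proof. by rewrite /Omega !evE. Qed.
Lemma ev_f_oct x y : ev (f_oct C) x y = Omf x y. Proof. by rewrite /f_oct !evE. Qed.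

Lemma mderivXU (i j : 'I_2) : ('X_j : binform C)^`M(i) = (i == j)%:R%:MP.
Proof.
have [->|neq_ij] := eqVneq i j; last first.
  by rewrite mderivX mnm1E eq_sym (negbTE neq_ij) scale0r mpolyC0.
by rewrite mderivX mnm1E eqxx scale1r -[X in (X - _)%MM]add0m addmK mpolyX0 mpolyC1.
Qed.

Lemma ev_d0Psi x y : ev (d0 (Psi C)) x y = 4 * dPx x y.
Proof.
rewrite /d0 /Psi /X0 /X1 !(exprS _ _) !expr0 !mulr1.
rewrite !(mderivD, mderivZ, mderivM, mderivXU) /= -/(X0 C) -/(X1 C) !evE /dPx; ring.
Qed.

Lemma ev_d1Psi x y : ev (d1 (Psi C)) x y = 4 * dPy x y.
Proof.
rewrite /d1 /Psi /X0 /X1 !(exprS _ _) !expr0 !mulr1.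
rewrite !(mderivD, mderivZ, mderivM, mderivXU) /= -/(X0 C) -/(X1 C) !evE /dPy; ring.
Qed.

End Sextics.

Section Degrees.
Variable C : numClosedFieldType.
Implicit Types (d e : nat) (f g : C -> C -> C).
Lemma form_deg d e f : form d f -> d = e -> form e f.
Proof. by move=> ? <-. Qed.
Lemma form_add d e f g : form d f -> form e g -> d = e ->
  form d (fun x y => f x y + g x y).
Proof. by move=> ff fg de; rewrite -de in fg; apply: formD. Qed.
Lemma form_sub d e f g : form d f -> form e g -> d = e ->
  form d (fun x y => f x y - g x y).
Proof. by move=> ff fg de; rewrite -de in fg; apply: formB. Qed.
End Degrees.

(* Computes the degree of an explicit form. *)
Ltac form_rec :=
  match goal with
  | H : form _ ?f |- form _ ?f => exact H
  | |- form _ (fun x y => x) => eapply formx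
  | |- form _ (fun x y => y) => eapply formy
  | |- form _ (fun x y => ?c) => eapply formC
  | |- form _ (fun x y => @?f x y - @?g x y) =>
    eapply (@form_sub _ _ _ f g); [form_rec | form_rec | first [reflexivity | lia]]
  | |- form _ (fun x y => @?f x y + @?g x y) =>
    eapply (@form_add _ _ _ f g); [form_rec | form_rec | first [reflexivity | lia]]
  | |- form _ (fun x y => - @?f x y) => eapply (@formN _ _ f); form_rec
  | |- form _ (fun x y => ?c * @?f x y) => eapply (@formZ _ _ c f); form_rec
  | |- form _ (fun x y => @?f x y * @?g x y) =>
    eapply (@formM _ _ _ f g); [form_rec | form_rec]
  | |- form _ (fun x y => @?f x y ^+ _) => eapply (@form_exp _ _ _ f); form_rec
  end.
Ltac form_tac := eapply form_deg; [form_rec | first [reflexivity | lia]].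

Section DegreesOfForms.
Variable C : numClosedFieldType.
Implicit Types (a b c d x y u v : C).

Lemma form_Om : form 6 (@Omf C). Proof. rewrite /Omf; form_tac. Qed.
Lemma form_Phi : form 4 (@Phif C). Proof. rewrite /Phif; form_tac. Qed.
Lemma form_Psi : form 4 (@Psif C). Proof. rewrite /Psif; form_tac. Qed.
Lemma form_dPx : form 3 (@dPx C). Proof. rewrite /dPx; form_tac. Qed.
Lemma form_dPy : form 3 (@dPy C). Proof. rewrite /dPy; form_tac. Qed.

Lemma Om12_neq0 : Omf 1 2 != 0 :> C.
Proof.
have -> : Omf 1 2 = - (30%:R) :> C by rewrite /Omf; ring.
by rewrite oppr_eq0 pnatr_eq0.
Qed.

Lemma nonzero_Om : nonzero (@Omf C).
Proof. by exists 1, 2; apply: Om12_neq0. Qed.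

Lemma s_neq0 : sqrtm3 C != 0.
Proof. by apply/eqP => s0; have /eqP := ss C; rewrite s0 mul0r eq_sym oppr_eq0 pnatr_eq0. Qed.

Lemma f_oct_homog : f_oct C \is 6.-homog.
Proof. by apply: homog_of_form; apply: form_ext form_Om => x y; rewrite ev_f_oct. Qed.

Lemma val6_f1 a b c d u v :
  val6 (f1 (mx2 a b c d)) u v = Omf (d * u - b * v) (a * v - c * u).
Proof.
rewrite val6_coords ?mxE /= ?evE //.
apply: homog_of_form; set p := d *: _ - _; set q := a *: _ - _.
apply: (form_ext (f := fun u v => Omf (d * u - b * v) (a * v - c * u))).
  by move=> x y; rewrite !evE.
by apply: (form_subst form_Om); form_tac.
Qed.

Lemma ev_act (A : 'M[C]_2) (f : binform C) u v :
  ev (sl2_act A f) u v = ev f (invmx A ord0 ord0 * u + invmx A ord0 ord_max * v)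
                              (invmx A ord_max ord0 * u + invmx A ord_max ord_max * v).
Proof.
rewrite /ev /sl2_act comp_mpoly_meval; apply: meval_eq => i.
rewrite tnth_mktuple big_ord2 mevalD !mevalZ !mevalXU !mxE /=.
by case: (ord2P i) => ->.
Qed.

Lemma act_homog A (d : nat) (f : binform C) : f \is d.-homog -> sl2_act A f \is d.-homog.
Proof.
move=> hf; apply: homog_of_form.
by apply: (form_ext (fun u v => esym (ev_act A f u v))); apply: (form_subst (form_ev hf)); form_tac.
Qed.

Lemma dP_eq0 x y : dPx x y = 0 -> dPy x y = 0 -> x = 0 /\ y = 0.
Proof.
have s3 := ss C; move: s3; rewrite /dPx /dPy; set s := sqrtm3 C => s3 ex ey.
have nz (n : nat) : (n.+1%:R : C) != 0 by rewrite pnatr_eq0.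
have e1 : x * (x ^+ 2 + s * y ^+ 2) = 0 by rewrite -ex; ring.
have e2 : y * (y ^+ 2 + s * x ^+ 2) = 0 by rewrite -ey; ring.
move/eqP: e1; rewrite mulf_eq0 => /orP[/eqP x0|/eqP e1].
  split=> //; move: e2; rewrite x0 expr0n /= mulr0 addr0 -exprS => /eqP.
  by rewrite expf_eq0 => /eqP.
have /eqP : 4 * y ^+ 3 = 0.
  by rewrite -e2 -[RHS]subr0 -[X in _ - X](mulr0 (s * y)) -e1; ring: s3.
rewrite mulf_eq0 expf_eq0 (negbTE (nz 3)) /= => /eqP y0; split=> //.
by move/eqP: e1; rewrite y0 expr0n /= mulr0 addr0 expf_eq0 => /eqP.
Qed.

End DegreesOfForms.

(** * The alternating group on four letters inside PGL_2 *)

Section Alternating4.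

Let o k (lt_k4 : (k < 4)%N) : 'I_4 := Ordinal lt_k4.
Let o0 := @o 0 isT. Let o1 := @o 1 isT. Let o2 := @o 2 isT. Let o3 := @o 3 isT.
Definition a4s : 'S_4 := (tperm o0 o1 * tperm o2 o3)%g.
Definition a4t : 'S_4 := (tperm o0 o2 * tperm o1 o3)%g.
Definition a4k : 'S_4 := (tperm o0 o1 * tperm o0 o2)%g.

Let ord4 (P : 'I_4 -> Prop) : P o0 -> P o1 -> P o2 -> P o3 -> forall x, P x.
Proof.
move=> p0 p1 p2 p3 [[|[|[|[|//]]]] lt_x].
- by have -> : Ordinal lt_x = o0 by apply: val_inj.
- by have -> : Ordinal lt_x = o1 by apply: val_inj.
- by have -> : Ordinal lt_x = o2 by apply: val_inj.
- by have -> : Ordinal lt_x = o3 by apply: val_inj.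
Qed.

Lemma a4_in : [/\ a4s \in ('Alt_('I_4))%G, a4t \in ('Alt_('I_4))%G & a4k \in ('Alt_('I_4))%G].
Proof. by split; rewrite Alt_even odd_permM !odd_tperm. Qed.

(** These relations are what passes to matrices up to scalars: two commuting
    involutions, which a third element permutes cyclically together with their
    product. *)
Lemma a4_rel : [/\ (a4s * a4s = 1)%g, (a4t * a4t = 1)%g, (a4s * a4t = a4t * a4s)%g,
  (a4k * a4s = a4t * a4k)%g & (a4k * a4t = a4s * a4t * a4k)%g].
Proof. by split; apply/permP; apply: ord4;
   by rewrite /a4s /a4t /a4k ?permM ?perm1; do !rewrite permE /=. Qed.

Lemma a4_neq : [/\ a4s != 1%g, a4t != 1%g & a4s != a4t].
Proof.
by split; apply/eqP=> /permP/(_ o0); rewrite /a4s /a4t ?permM ?perm1; do !rewrite permE /=.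
Qed.

End Alternating4.

Section Tetrahedral.
Variable C : numClosedFieldType.
Implicit Types (a b c d x y u v : C).

Let ii := ii C.
Let nz2 : (2 : C) != 0. Proof. by rewrite pnatr_eq0. Qed.

Lemma Ci_neq0 : 'i != 0 :> C. Proof. exact: neq0Ci. Qed.

(** Generators of the binary tetrahedral group, as matrices of determinant 1:
    the first two generate the quaternion group. *)
Definition Im : 'M[C]_2 := mx2 'i 0 0 (- 'i).
Definition Jm : 'M[C]_2 := mx2 0 (- 1) 1 0.
Definition Cm : 'M[C]_2 :=
  mx2 (2^-1 * (1 + 'i)) (2^-1 * (1 + 'i)) (- (2^-1 * (1 - 'i))) (2^-1 * (1 - 'i)).

Lemma unit_Im : Im \in unitmx.
Proof. by rewrite unit_mx2 mulrN ii opprK mulr0 subr0 oner_eq0. Qed.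
Lemma unit_Jm : Jm \in unitmx.
Proof. by rewrite unit_mx2 mulr0 mulr1 sub0r opprK oner_eq0. Qed.
Lemma unit_Cm : Cm \in unitmx.
Proof.
rewrite unit_mx2; set e := (_ - _); suff -> : e = 1 by rewrite oner_eq0.
by rewrite /e; field: ii.
Qed.

Lemma same_mx2 k a b c d a' b' c' d' : k != 0 ->
  a = k * a' -> b = k * b' -> c = k * c' -> d = k * d' ->
  same_point (mx2 a b c d) (mx2 a' b' c' d').
Proof. by move=> nzk -> -> -> ->; exists k; split; rewrite ?scale_mx2. Qed.

(** By the theorem of Cayley and Hamilton a matrix with a scalar square is
    scalar or has trace zero. *)
Lemma involution (S : 'M[C]_2) : S \in unitmx -> same_point (S *m S) 1%:M ->
  ~ same_point S 1%:M -> exists k a b c,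
  [/\ k != 0, S = k *: mx2 a b c (- a) & a * a + b * c = -1].
Proof.
move=> uS [l [nzl E]] nS1; have [a [b [c [d SE]]]] := mx2_ex S.
have tr0 : d = - a.
  move: E; rewrite SE mul_mx2 mx2_1 scale_mx2 => /mx2_inj[].
  rewrite mulr1 mulr0 => e1 e2 e3 e4.
  apply/eqP; rewrite -subr_eq0 opprK; apply/negbNE/negP => nz_tr.
  have b0 : b = 0.
    apply/eqP; have /eqP : (d + a) * b = 0 by rewrite -e2; ring.
    by rewrite mulf_eq0 (negbTE nz_tr).
  have c0 : c = 0.
    apply/eqP; have /eqP : (d + a) * c = 0 by rewrite -e3; ring.
    by rewrite mulf_eq0 (negbTE nz_tr).
  have ad : d - a = 0.
    apply/eqP; have /eqP : (d + a) * (d - a) = 0.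
      have -> : (d + a) * (d - a) = (c * b + d * d) - (a * a + b * c) by ring.
      by rewrite e1 e4 subrr.
    by rewrite mulf_eq0 (negbTE nz_tr).
  case: nS1; exists a; rewrite SE b0 c0 mx2_1 scale_mx2 mulr1 mulr0.
  split; last by congr mx2; apply/eqP; rewrite -subr_eq0 ad.
  move: uS; rewrite SE unit_mx2 b0 mul0r subr0 mulf_eq0 negb_or.
  by case/andP.
pose k := sqrtC (- l); have kk : k * k = - l by rewrite -expr2 sqrtCK.
have nzk : k != 0.
  by apply: contraNneq nzl => k0; move/eqP: kk; rewrite k0 mul0r eq_sym oppr_eq0.
exists k, (a / k), (b / k), (c / k); split=> //.
  by rewrite SE tr0 scale_mx2; congr mx2; field.
move: E; rewrite SE mul_mx2 mx2_1 scale_mx2 => /mx2_inj[e1 _ _ _].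
rewrite mulr1 in e1.
have -> : a / k * (a / k) + b / k * (c / k) = (a * a + b * c) / (k * k) by field.
by rewrite e1 kk invrN mulrN divff.
Qed.

(** Up to conjugation PGL_2 has a single copy of the alternating group on four
    letters, even with marked generators: two commuting involutions are
    anticommuting matrices, which have a common normal form, and the remaining
    generator is then determined up to an element of the four-group, which a
    conjugation by the four-group absorbs. *)
Lemma A4_conj (S T K : 'M[C]_2) :
  S \in unitmx -> T \in unitmx -> K \in unitmx ->
  same_point (S *m S) 1%:M -> ~ same_point S 1%:M ->
  same_point (T *m T) 1%:M -> ~ same_point T 1%:M -> ~ same_point S T ->
  same_point (S *m T) (T *m S) -> same_point (K *m S) (T *m K) ->
  same_point (K *m T) (S *m T *m K) ->
  exists Q, [/\ Q \in unitmx, same_point (S *m Q) (Q *m Im),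
    same_point (T *m Q) (Q *m Jm) & same_point (K *m Q) (Q *m Cm)].
Proof.
move=> uS uT uK SS S1 TT T1 neST ST KS KT.
have [k [a [b [c [nzk SE abc]]]]] := involution uS SS S1.
have [l [d [e [f [nzl TE def]]]]] := involution uT TT T1.
pose S0 := mx2 a b c (- a); pose T0 := mx2 d e f (- d).
have S0S0 : S0 *m S0 = - 1%:M.
  rewrite mul_mx2 mx2_1 -scaleN1r scale_mx2 !mulN1r; congr mx2; rewrite -?abc; ring.
have T0T0 : T0 *m T0 = - 1%:M.
  rewrite mul_mx2 mx2_1 -scaleN1r scale_mx2 !mulN1r; congr mx2; rewrite -?def; ring.
have addM (x y z t x' y' z' t' : C) :
    mx2 x y z t + mx2 x' y' z' t' = mx2 (x + x') (y + y') (z + z') (t + t').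
  by apply/matrixP=> i j; rewrite !mxE; case: (ord2P i) (ord2P j) => [] -> [] ->.
pose r := 2 * (a * d) + b * f + c * e.
have polar : S0 *m T0 + T0 *m S0 = r *: 1%:M.
  rewrite !mul_mx2 addM mx2_1 scale_mx2; congr mx2; rewrite /r; ring.
have anti : S0 *m T0 = - (T0 *m S0).
  apply/eqP; rewrite -addr_eq0 polar; apply/negbNE/negP => nz.
  have nzr : r != 0 by apply: contraNneq nz => ->; rewrite scale0r.
  have nzkl : k * l != 0 by rewrite mulf_neq0.
  case: ST => m [nzm]; rewrite SE TE.
  have -> : k *: S0 *m (l *: T0) = (k * l) *: (S0 *m T0).
    by rewrite -scalemxAl -scalemxAr scalerA.
  have -> : l *: T0 *m (k *: S0) = (k * l) *: (T0 *m S0).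
    by rewrite -scalemxAl -scalemxAr scalerA mulrC.
  have -> : m *: ((k * l) *: (T0 *m S0)) = (k * l) *: (m *: (T0 *m S0)).
    by rewrite !scalerA mulrC.
  move=> H; have {H}E := scalerI nzkl H.
  move: polar; rewrite E -[X in _ + X]scale1r -scalerDl => polar'.
  have nzm1 : m + 1 != 0.
    apply: contraNneq nz => m1; rewrite -polar' m1 scale0r eqxx //.
  have TS : T0 *m S0 = (r / (m + 1)) *: 1%:M.
    apply: (scalerI nzm1); rewrite polar' scalerA; congr (_ *: _); field.
    exact: nzm1.
  have {}TS : T0 = (- (r / (m + 1))) *: S0.
    have := congr1 (mulmx^~ S0) TS; rewrite -mulmxA S0S0 mulmxN mulmx1 -scalemxAl mul1mx.
    by move=> /eqP; rewrite eqr_oppLR => /eqP ->; rewrite scaleNr.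
  case: neST; rewrite SE TE -/S0 -/T0 TS scalerA.
  exists (k / (l * - (r / (m + 1)))); split.
    by rewrite mulf_neq0 ?invr_eq0 ?mulf_neq0 ?oppr_eq0 ?mulf_neq0 ?invr_eq0.
  rewrite scalerA; congr (_ *: _); field; rewrite nzl nzr nzm1 //.
(* an eigenvector of S0 for the eigenvalue i, and its image by T0 *)
have [x [y [nze Sx]]] : exists x y, pt x y != 0 /\ S0 *m pt x y = 'i *: pt x y.
  have [nz|/negbNE/eqP a0] := boolP (a + 'i != 0).
    exists (a + 'i), c; rewrite pt_eq0 (negbTE nz); split=> //.
    rewrite mul_mx2_pt scale_pt; congr pt; last by ring.
    by have -> : b * c = -1 - a * a by [rewrite -abc; ring]; ring: ii.
  have {}a0 : a = - 'i by apply/eqP; rewrite -addr_eq0 a0.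
  have [b0|nzb] := eqVneq b 0.
    exists 0, 1; rewrite pt_eq0 oner_eq0 andbF; split=> //.
    by rewrite mul_mx2_pt scale_pt a0 b0; congr pt; ring.
  exists b, (2 * 'i); rewrite pt_eq0 (negbTE nzb); split=> //.
  rewrite mul_mx2_pt scale_pt a0; congr pt; first by ring.
  have -> : c * b = 0 by rewrite mulrC -[LHS](addKr (a * a)) abc a0; ring: ii.
  by ring.
pose z := d * x + e * y; pose t := f * x - d * y.
have Tx : T0 *m pt x y = pt z t by rewrite mul_mx2_pt mulNr.
have Tz : T0 *m pt z t = - pt x y by rewrite -Tx mulmxA T0T0 mulNmx mul1mx.
have Sz : S0 *m pt z t = (- 'i) *: pt z t.
  by rewrite -Tx mulmxA anti mulNmx -mulmxA Sx -scalemxAr scaleNr.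
pose Q0 := mx2 x z y t.
have col_mx2 (p q p' q' : C) : forall i, mx2 p q p' q' i ord0 = pt p p' i 0 /\
    mx2 p q p' q' i ord_max = pt q q' i 0.
  by move=> i; rewrite !mxE.
have mx2_ext (U V : 'M[C]_2) : U *m pt 1 0 = V *m pt 1 0 -> U *m pt 0 1 = V *m pt 0 1 -> U = V.
  rewrite (mx2P U) (mx2P V) !mul_mx2_pt !mulr0 !mulr1 !addr0 !add0r.
  by move=> /pt_inj[-> ->] /pt_inj[-> ->].
have Q10 : Q0 *m pt 1 0 = pt x y by rewrite mul_mx2_pt !mulr0 !mulr1 !addr0.
have Q01 : Q0 *m pt 0 1 = pt z t by rewrite mul_mx2_pt !mulr0 !mulr1 !add0r.
have ptN (p q : C) : - pt p q = pt (- p) (- q) by rewrite -scaleN1r scale_pt !mulN1r.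
have I10 : Im *m pt 1 0 = 'i *: pt 1 0 by rewrite mul_mx2_pt scale_pt; congr pt; ring.
have I01 : Im *m pt 0 1 = - 'i *: pt 0 1 by rewrite mul_mx2_pt scale_pt; congr pt; ring.
have J10 : Jm *m pt 1 0 = pt 0 1 by rewrite mul_mx2_pt; congr pt; ring.
have J01 : Jm *m pt 0 1 = - pt 1 0 by rewrite mul_mx2_pt ptN; congr pt; ring.
have SQ : S0 *m Q0 = Q0 *m Im.
  apply: mx2_ext; rewrite -!mulmxA ?I10 ?I01 -?scalemxAr ?Q10 ?Q01 //.
have TQ : T0 *m Q0 = Q0 *m Jm.
  apply: mx2_ext; rewrite -!mulmxA ?J10 ?J01 ?mulmxN ?Q10 ?Q01 //.
have uQ : Q0 \in unitmx.
  rewrite unit_mx2; apply/negP => /eqP det0.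
  (* otherwise both eigenspaces of S0 would contain the same line *)
  have Tu : T0 \in unitmx.
    rewrite unit_mx2 (_ : _ - _ = 1) ?oner_eq0 //; rewrite -[RHS]opprK -def; ring.
  have : 'i *: pt x y = 0.
    have E1 : x *: pt z t = z *: pt x y.
      rewrite !scale_pt; congr pt; first by ring.
      by apply/eqP; rewrite -subr_eq0 -det0; apply/eqP; ring.
    have E2 : y *: pt z t = t *: pt x y.
      rewrite !scale_pt; congr pt; last by ring.
      by apply/eqP; rewrite eq_sym -subr_eq0 -det0; apply/eqP; ring.
    have zero (w p : C) : w *: pt z t = p *: pt x y -> w = 0 \/ pt z t = 0.
      move=> E; have E' := congr1 (mulmx S0) E; rewrite -!scalemxAr Sx Sz in E'.
      have : (2 * 'i) *: (w *: pt z t) = 0.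
        have -> : (2 * 'i) *: (w *: pt z t) = 'i *: (w *: pt z t) - w *: (- 'i *: pt z t).
          by rewrite !scalerA -scalerBl; congr (_ *: _); ring.
        by rewrite E' E !scalerA mulrC subrr.
      move/eqP; rewrite !scaler_eq0 mulf_eq0 (negbTE nz2) (negbTE Ci_neq0) /=.
      by case/orP=> /eqP ->; [left|right].
    have [x0|/eqP] := zero _ _ E1; last first.
      by rewrite -Tx => /eqP /(congr1 (mulmx (invmx T0))); rewrite mulKmx // mulmx0 => xy0; rewrite xy0 eqxx in nze.
    have [y0|/eqP] := zero _ _ E2; last first.
      by rewrite -Tx => /eqP /(congr1 (mulmx (invmx T0))); rewrite mulKmx // mulmx0 => xy0; rewrite xy0 eqxx in nze.
    by move: nze; rewrite x0 y0 pt_eq0 eqxx.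
  by move/eqP; rewrite scaler_eq0 (negbTE nze) (negbTE Ci_neq0).
have uI := unit_Im; have uJ := unit_Jm.
have SQ' : same_point (S *m Q0) (Q0 *m Im).
  by exists k; rewrite SE -scalemxAl SQ.
have TQ' : same_point (T *m Q0) (Q0 *m Jm).
  by exists l; rewrite TE -scalemxAl TQ.
(* K in the basis of Q0 *)
pose K0 := invmx Q0 *m K *m Q0.
have KQ : K *m Q0 = Q0 *m K0 by rewrite /K0 !mulmxA mulmxV // mul1mx.
have uK0 : K0 \in unitmx by rewrite !unitmx_mul unitmx_inv uQ uK.
clearbody K0.
have K0I : same_point (K0 *m Im) (Jm *m K0).
  apply: (same_mull uQ); rewrite !mulmxA -?KQ.
  apply: same_trans (_ : same_point _ (K *m S *m Q0)) _.
    by rewrite -!mulmxA; apply: same_mul (same_refl _) (same_sym SQ').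
  apply: same_trans (same_mul KS (same_refl Q0)) _.
  rewrite -mulmxA KQ mulmxA; exact: same_mul TQ' (same_refl _).
have K0J : same_point (K0 *m Jm) (Im *m Jm *m K0).
  apply: (same_mull uQ); rewrite !mulmxA -?KQ.
  apply: same_trans (_ : same_point _ (K *m T *m Q0)) _.
    by rewrite -!mulmxA; apply: same_mul (same_refl _) (same_sym TQ').
  apply: same_trans (same_mul KT (same_refl Q0)) _.
  rewrite -[S *m T *m K *m Q0]mulmxA KQ mulmxA; apply: same_mul (same_refl _).
  rewrite -mulmxA; apply: same_trans (same_mul (same_refl S) TQ') _.
  by rewrite !mulmxA; apply: same_mul SQ' (same_refl _).
have [p [q [p' [q' K0E]]]] := mx2_ex K0.
have [la [nzla eI]] := K0I; have [mu [nzmu eJ]] := K0J.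
move: eI eJ; rewrite K0E !mul_mx2 !scale_mx2 => /mx2_inj[i1 i2 i3 i4] /mx2_inj[j1 j2 j3 j4].
have p'E : p' = - 'i * la * p.
  have -> : - 'i * la * p = - 'i * (la * (1 * p + 0 * p')) by ring.
  by rewrite -i3; ring: ii.
have q'E : q' = 'i * la * q.
  have -> : 'i * la * q = 'i * (la * (1 * q + 0 * q')) by ring.
  by rewrite -i4; ring: ii.
have pla : p = la * la * p.
  have -> : la * la * p = 'i * la * p' by rewrite p'E; ring: ii.
  have -> : 'i * la * p' = - 'i * (la * (0 * p + - 1 * p')) by ring.
  by rewrite -i1; ring: ii.
have qE : q = - (mu * la * p).
  have -> : - (mu * la * p) = mu * ((- 'i) * ('i * la * p)) *(-1) by ring: ii.
  have -> : 'i * la * p = - p' by rewrite p'E; ring.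
  have -> : mu * (- 'i * - p') * -1 = mu * (('i * 0 + 0 * 1) * p + ('i * -1 + 0 * 0) * p').
    by ring.
  by rewrite -j1; ring.
have nzp : p != 0.
  apply: contraTneq uK0 => p0.
  rewrite K0E unit_mx2 q'E p'E qE p0 negbK; apply/eqP; ring.
have la2 : la * la = 1 by apply: (mulIf nzp); rewrite -pla mul1r.
have {}q'E : q' = - 'i * mu * p.
  have -> : - 'i * mu * p = - 'i * mu * (la * la) * p by rewrite la2; ring.
  by rewrite q'E qE; ring.
have mu2 : mu * mu = 1.
  apply: (mulIf nzp); rewrite mul1r.
  have -> : mu * mu * p = - (mu * (('i * 0 + 0 * 1) * q + ('i * -1 + 0 * 0) * q')).
    by rewrite q'E; ring: ii.
  by rewrite -j2; ring.
have sign (h : C) : h * h = 1 -> h = 1 \/ h = -1.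
  move=> hh; have /eqP : (h - 1) * (h + 1) = 0 by ring: hh.
  by rewrite mulf_eq0 subr_eq0 addr_eq0 => /orP[/eqP|/eqP]; [left|right].
have nzi := Ci_neq0; have nz1i : 1 - 'i != 0 :> C.
  apply: contraNneq nz2 => E.
  have <- : (1 - 'i) * (1 + 'i) = 2 :> C by ring: ii.
  by rewrite E mul0r.
suff [w [uw Iw Jw Kw]] : exists w : 'M[C]_2, [/\ w \in unitmx, same_point (Im *m w) (w *m Im),
    same_point (Jm *m w) (w *m Jm) & same_point (K0 *m w) (w *m Cm)].
  have move_w (U U0 U1 : 'M[C]_2) : same_point (U *m Q0) (Q0 *m U0) -> same_point (U0 *m w) (w *m U1) ->
      same_point (U *m (Q0 *m w)) (Q0 *m w *m U1).
    move=> UU0 U01; rewrite mulmxA; apply: same_trans (same_mul UU0 (same_refl w)) _.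
    by rewrite -!mulmxA; apply: same_mul (same_refl _) U01.
  have KQ' : same_point (K *m Q0) (Q0 *m K0) by rewrite KQ; apply: same_refl.
  exists (Q0 *m w); split; first by rewrite unitmx_mul uQ.
  - exact: move_w SQ' Iw.
  - exact: move_w TQ' Jw.
  - exact: move_w KQ' Kw.
rewrite K0E p'E q'E qE /Im /Jm /Cm.
have [laE|laE] := sign _ la2; have [muE|muE] := sign _ mu2; rewrite laE muE.
- exists Im; split; rewrite ?unit_Im // !mul_mx2.
  + by apply: (same_mx2 (k := 1)); rewrite ?oner_eq0 //; ring.
  + by apply: (same_mx2 (k := -1)); rewrite ?oppr_eq0 ?oner_eq0 //; ring.
  + by apply: (same_mx2 (k := p * (1 - 'i))); rewrite ?mulf_neq0 //; field: ii.
- exists Jm; split; rewrite ?unit_Jm // !mul_mx2.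
  + by apply: (same_mx2 (k := -1)); rewrite ?oppr_eq0 ?oner_eq0 //; ring.
  + by apply: (same_mx2 (k := 1)); rewrite ?oner_eq0 //; ring.
  + by apply: (same_mx2 (k := 'i * p * (1 - 'i))); rewrite ?mulf_neq0 //; field: ii.
- exists 1%:M; split; rewrite ?unitmx1 // ?mulmx1 ?mul1mx; try exact: same_refl.
  by apply: (same_mx2 (k := p * (1 - 'i))); rewrite ?mulf_neq0 //; field: ii.
- exists (Im *m Jm); split; rewrite ?unitmx_mul ?unit_Im ?unit_Jm // !mul_mx2.
  + by apply: (same_mx2 (k := -1)); rewrite ?oppr_eq0 ?oner_eq0 //; ring.
  + by apply: (same_mx2 (k := -1)); rewrite ?oppr_eq0 ?oner_eq0 //; ring.
  + by apply: (same_mx2 (k := 'i * p * (1 - 'i))); rewrite ?mulf_neq0 //; field: ii.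
Qed.

End Tetrahedral.

(** * Invariants of the quaternion group *)

Section Invariants.
Variable C : numClosedFieldType.
Implicit Types (f g : C -> C -> C).

Let ii := ii C.
Let ss := ss C.
Local Notation s := (sqrtm3 C).

Definition cx (x y : C) := 2^-1 * (1 + 'i) * (x + y).
Definition cy (x y : C) := 2^-1 * (1 - 'i) * (y - x).

Lemma Im_pt (x y : C) : Im C *m pt x y = pt ('i * x) (- ('i * y)).
Proof. by rewrite mul_mx2_pt; congr pt; ring. Qed.
Lemma Jm_pt (x y : C) : Jm C *m pt x y = pt (- y) x.
Proof. by rewrite mul_mx2_pt; congr pt; ring. Qed.
Lemma Cm_pt (x y : C) : Cm C *m pt x y = pt (cx x y) (cy x y).
Proof. by rewrite mul_mx2_pt; congr pt; rewrite /cx /cy; ring. Qed.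

(** The value of Phi and Psi under the generator of order 3 is multiplied by
    the primitive cube roots of unity om2 and om1. *)
Definition om1 : C := 2^-1 * (-1 + s).
Definition om2 : C := 2^-1 * (-1 - s).

Let nz2 : (2 : C) != 0. Proof. by rewrite pnatr_eq0. Qed.

Lemma om12 : om1 * om2 = 1. Proof. by rewrite /om1 /om2; field: ss. Qed.
Lemma om11 : om1 * om1 = om2. Proof. by rewrite /om1 /om2; field: ss. Qed.
Lemma om22 : om2 * om2 = om1. Proof. by rewrite /om1 /om2; field: ss. Qed.
Lemma om1_neq1 : om1 - 1 != 0.
Proof.
have nz3 : (3 : C) != 0 by rewrite pnatr_eq0.
apply: contraNneq nz3 => E; have <- : (om1 - 1) * (om2 - 1) = 3 by rewrite /om1 /om2; field: ss.
by rewrite E mul0r.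
Qed.
Lemma om2_neq1 : om2 - 1 != 0.
Proof.
have nz3 : (3 : C) != 0 by rewrite pnatr_eq0.
apply: contraNneq nz3 => E; have <- : (om1 - 1) * (om2 - 1) = 3 by rewrite /om1 /om2; field: ss.
by rewrite E mulr0.
Qed.

Lemma Phi_c (x y : C) : Phif (cx x y) (cy x y) = om2 * Phif x y.
Proof. by rewrite /Phif /cx /cy /om2; field: ss ii. Qed.
Lemma Psi_c (x y : C) : Psif (cx x y) (cy x y) = om1 * Psif x y.
Proof. by rewrite /Psif /cx /cy /om1; field: ss ii. Qed.
Lemma Om_c (x y : C) : Omf (cx x y) (cy x y) = Omf x y.
Proof. by rewrite /Omf /cx /cy; field: ss ii. Qed.
Lemma XZ_rel (x y : C) : Psif x y ^+ 3 = Phif x y ^+ 3 + 12 * s * Omf x y ^+ 2.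
Proof. by rewrite /Omf /Phif /Psif; ring: ss. Qed.

Definition Q8_inv f :=
  (forall x y, f ('i * x) (- ('i * y)) = f x y) /\ (forall x y, f (- y) x = f x y).

Lemma coef_inj d (a b : nat -> C) :
  (forall x y, \sum_(k < d.+1) a k * (x ^+ (d - k) * y ^+ k) =
               \sum_(k < d.+1) b k * (x ^+ (d - k) * y ^+ k)) ->
  forall k, (k <= d)%N -> a k = b k.
Proof.
move=> ab; have: \poly_(k < d.+1) a k = \poly_(k < d.+1) b k.
  apply/eqP; rewrite -subr_eq0; apply/eqP/poly_inf0 => z.
  rewrite hornerD hornerN !horner_poly; apply/eqP; rewrite subr_eq0; apply/eqP.
  have := ab 1 z; under eq_bigr do rewrite expr1n mul1r.
  by move=> ->; apply: eq_bigr => k _; rewrite expr1n mul1r.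
by move=> /polyP E k lek; have := E k; rewrite !coef_poly ltnS lek.
Qed.

(** Invariance under Im determines the parity of the exponents of the monomials,
    and invariance under Jm relates the coefficients of x^(d-k) y^k and
    x^k y^(d-k). *)
Lemma Q8_coef d f : form d f -> Q8_inv f -> exists a : nat -> C,
  [/\ forall x y, f x y = \sum_(k < d.+1) a k * (x ^+ (d - k) * y ^+ k),
      forall k, (k <= d)%N -> a k * ('i ^+ d * (-1) ^+ k) = a k &
      forall k, (k <= d)%N -> a (d - k)%N * (-1) ^+ k = a k].
Proof.
move=> /form_coef[a aE] [fI fJ]; exists a; split=> // k lek.
  apply: (coef_inj (a := fun k => a k * ('i ^+ d * (-1) ^+ k)) _ lek) => x y.
  rewrite -aE -fI aE; apply: eq_bigr => j _.
  have -> : 'i ^+ d = 'i ^+ (d - j) * 'i ^+ j :> C by rewrite -exprD subnK // -ltnS.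
  by rewrite -mulNr !exprMn (exprNn 'i); ring.
apply: (coef_inj (a := fun k => a (d - k)%N * (-1) ^+ k) _ lek) => x y.
rewrite -aE -fJ aE (reindex_inj rev_ord_inj) /=; apply: eq_bigr => j _.
have lej : (j <= d)%N by rewrite -ltnS.
by rewrite subSS (subKn lej) (exprNn y); ring.
Qed.

Let neg_eq (z : C) : z = - z -> z = 0.
Proof.
move=> E; apply/eqP; have /eqP : 2 * z = 0 by rewrite mulr2n mulrDl mul1r {2}E subrr.
by rewrite mulf_eq0 (negbTE nz2).
Qed.

Let i2 : 'i ^+ 2 = -1 :> C. Proof. exact: sqrCi. Qed.

(** The ring of invariants of the quaternion group is generated by Phi, Psi and
    Omega, with the single relation XZ_rel; in the four degrees that occur this is
    checked on the coefficients. *)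
Lemma Q8_inv6 f : form 6 f -> Q8_inv f -> exists a, forall x y, f x y = a * Omf x y.
Proof.
move=> ff /(Q8_coef ff)[a [aE aI aJ]]; exists (a 1%N) => x y.
have i6 : 'i ^+ 6 = -1 :> C by rewrite (exprM _ 2 3) i2; ring.
have e0 : a 0%N = 0 by apply: neg_eq; rewrite -{1}(aI 0%N) // i6; ring.
have e2 : a 2%N = 0 by apply: neg_eq; rewrite -{1}(aI 2%N) // i6; ring.
have e4 : a 4%N = 0 by apply: neg_eq; rewrite -{1}(aI 4%N) // i6; ring.
have e6 : a 6%N = 0 by apply: neg_eq; rewrite -{1}(aI 6%N) // i6; ring.
have e3 : a 3%N = 0 by apply: neg_eq; rewrite -{1}(aJ 3%N) // /=; ring.
have e5 : a 5%N = - a 1%N by rewrite -(aJ 5%N) //=; ring.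
rewrite aE !big_ord_recl big_ord0 /bump /= e0 e2 e3 e4 e5 e6 /Omf; ring.
Qed.

Lemma Q8_inv12 f : form 12 f -> Q8_inv f -> exists a0 a1 a2 a3, forall x y,
  f x y = a0 * Phif x y ^+ 3 + a1 * (Phif x y ^+ 2 * Psif x y)
        + a2 * (Phif x y * Psif x y ^+ 2) + a3 * Psif x y ^+ 3.
Proof.
move=> ff /(Q8_coef ff)[a [aE aI aJ]].
have i12 : 'i ^+ 12 = 1 :> C by rewrite (exprM _ 2 6) i2; ring.
have odd0 k : (k <= 12)%N -> odd k -> a k = 0.
  move=> lek oddk; apply: neg_eq; rewrite -{1}(aI k) // i12 -signr_odd oddk; ring.
have sym k : (k <= 12)%N -> ~~ odd k -> a (12 - k)%N = a k.
  move=> lek evk; rewrite -[RHS](aJ k) // -signr_odd (negbTE evk); ring.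
exists 
    ((a 0%N) * ((1 / 8)) + (a 2%N) * ((1 / 48) * s) + (a 4%N - 3 * a 0%N) * ((-1 / 96)) + (a 6%N - 2 * a 2%N) * ((-1 / 576) * s)), 
    ((a 0%N) * ((3 / 8)) + (a 2%N) * ((1 / 48) * s) + (a 4%N - 3 * a 0%N) * ((1 / 96)) + (a 6%N - 2 * a 2%N) * ((1 / 192) * s)), 
    ((a 0%N) * ((3 / 8)) + (a 2%N) * ((-1 / 48) * s) + (a 4%N - 3 * a 0%N) * ((1 / 96)) + (a 6%N - 2 * a 2%N) * ((-1 / 192) * s)), 
    ((a 0%N) * ((1 / 8)) + (a 2%N) * ((-1 / 48) * s) + (a 4%N - 3 * a 0%N) * ((-1 / 96)) + (a 6%N - 2 * a 2%N) * ((1 / 576) * s)).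
move=> x y; rewrite aE !big_ord_recl big_ord0 /bump /=.
rewrite (odd0 1%N) // (odd0 3%N) // (odd0 5%N) // (odd0 7%N) // (odd0 9%N) // (odd0 11%N) //.
have := sym 0%N isT isT; have := sym 2%N isT isT; have := sym 4%N isT isT => /= -> -> ->.
rewrite /Phif /Psif.
field: ss.
all: by rewrite ?pnatr_eq0.
Qed.

Lemma Q8_inv14 f : form 14 f -> Q8_inv f -> exists a0 a1 a2, forall x y,
  f x y = Omf x y * (a0 * Phif x y ^+ 2 + a1 * (Phif x y * Psif x y) + a2 * Psif x y ^+ 2).
Proof.
move=> ff /(Q8_coef ff)[a [aE aI aJ]].
have i14 : 'i ^+ 14 = -1 :> C by rewrite (exprM _ 2 7) i2; ring.
have ev0 k : (k <= 14)%N -> ~~ odd k -> a k = 0.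
  move=> lek evk; apply: neg_eq; rewrite -{1}(aI k) // i14 -signr_odd (negbTE evk); ring.
have sym k : (k <= 14)%N -> odd k -> a (14 - k)%N = - a k.
  move=> lek oddk; rewrite -[a k](aJ k) // -signr_odd oddk; ring.
have a7 : a 7%N = 0 by apply: neg_eq; rewrite -(sym 7%N).
exists 
    ((a 1%N) * ((1 / 4)) + (a 3%N) * ((1 / 24) * s) + (a 5%N - a 1%N) * ((-1 / 48))), 
    ((a 1%N) * ((1 / 2)) + (a 5%N - a 1%N) * ((1 / 24))), 
    ((a 1%N) * ((1 / 4)) + (a 3%N) * ((-1 / 24) * s) + (a 5%N - a 1%N) * ((-1 / 48))).
move=> x y; rewrite aE !big_ord_recl big_ord0 /bump /=.
rewrite (ev0 0%N) // (ev0 2%N) // (ev0 4%N) // (ev0 6%N) // (ev0 8%N) // (ev0 10%N) // (ev0 12%N) // (ev0 14%N) //.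
have := sym 1%N isT isT; have := sym 3%N isT isT; have := sym 5%N isT isT => /= -> -> ->.
rewrite a7 /Phif /Psif /Omf.
field: ss.
all: by rewrite ?pnatr_eq0.
Qed.

Lemma Q8_inv16 f : form 16 f -> Q8_inv f -> exists a0 a1 a2 a3 a4, forall x y,
  f x y = a0 * Phif x y ^+ 4 + a1 * (Phif x y ^+ 3 * Psif x y)
        + a2 * (Phif x y ^+ 2 * Psif x y ^+ 2) + a3 * (Phif x y * Psif x y ^+ 3)
        + a4 * Psif x y ^+ 4.
Proof.
move=> ff /(Q8_coef ff)[a [aE aI aJ]].
have i16 : 'i ^+ 16 = 1 :> C by rewrite (exprM _ 2 8) i2; ring.
have odd0 k : (k <= 16)%N -> odd k -> a k = 0.
  move=> lek oddk; apply: neg_eq; rewrite -{1}(aI k) // i16 -signr_odd oddk; ring.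
have sym k : (k <= 16)%N -> ~~ odd k -> a (16 - k)%N = a k.
  move=> lek evk; rewrite -[RHS](aJ k) // -signr_odd (negbTE evk); ring.
exists 
    ((a 0%N) * ((1 / 16)) + (a 2%N) * ((1 / 96) * s) + (a 4%N - 4 * a 0%N) * ((-1 / 192)) + (a 6%N - 3 * a 2%N) * ((-1 / 1152) * s) + (a 8%N - 2 * (a 4%N - 4 * a 0%N) - 6 * a 0%N) * ((1 / 2304))), 
    ((a 0%N) * ((1 / 4)) + (a 2%N) * ((1 / 48) * s) + (a 6%N - 3 * a 2%N) * ((1 / 576) * s) + (a 8%N - 2 * (a 4%N - 4 * a 0%N) - 6 * a 0%N) * ((-1 / 576))), 
    ((a 0%N) * ((3 / 8)) + (a 4%N - 4 * a 0%N) * ((1 / 96)) + (a 8%N - 2 * (a 4%N - 4 * a 0%N) - 6 * a 0%N) * ((1 / 384))), 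
    ((a 0%N) * ((1 / 4)) + (a 2%N) * ((-1 / 48) * s) + (a 6%N - 3 * a 2%N) * ((-1 / 576) * s) + (a 8%N - 2 * (a 4%N - 4 * a 0%N) - 6 * a 0%N) * ((-1 / 576))), 
    ((a 0%N) * ((1 / 16)) + (a 2%N) * ((-1 / 96) * s) + (a 4%N - 4 * a 0%N) * ((-1 / 192)) + (a 6%N - 3 * a 2%N) * ((1 / 1152) * s) + (a 8%N - 2 * (a 4%N - 4 * a 0%N) - 6 * a 0%N) * ((1 / 2304))).
move=> x y; rewrite aE !big_ord_recl big_ord0 /bump /=.
rewrite (odd0 1%N) // (odd0 3%N) // (odd0 5%N) // (odd0 7%N) // (odd0 9%N) // (odd0 11%N) // (odd0 13%N) // (odd0 15%N) //.
have := sym 0%N isT isT; have := sym 2%N isT isT; have := sym 4%N isT isT; have := sym 6%N isT isT => /= -> -> -> ->.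
rewrite /Phif /Psif.
field: ss.
all: by rewrite ?pnatr_eq0.
Qed.

End Invariants.

(** * The octahedral group *)

Section Octahedral.
Variable C : numClosedFieldType.
Implicit Types (M N : 'M[C]_2) (q : 'cV[C]_2).

Let ii := ii C.
Let nz2 : (2 : C) != 0. Proof. by rewrite pnatr_eq0. Qed.

Definition Omv q := Omf (q ord0 0) (q ord_max 0).

Lemma Omv_pt x y : Omv (pt x y) = Omf x y :> C.
Proof. by rewrite /Omv !mxE. Qed.

Lemma OmvZ k q : Omv (k *: q) = k ^+ 6 * Omv q.
Proof. by rewrite /Omv !mxE /Omf; ring. Qed.

(** The scalar multiples of the elements of the binary octahedral group, in a
    form that is visibly stable under products, inverses and scalars. *)
Definition octa M := M \in unitmx /\ exists c, c != 0 /\ forall q, Omv (M *m q) = c * Omv q.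

Lemma octa1 : octa 1%:M.
Proof. by split; [exact: unitmx1|exists 1; rewrite oner_neq0; split=> // q; rewrite mul1mx mul1r]. Qed.

Lemma octaM M N : octa M -> octa N -> octa (M *m N).
Proof.
move=> [uM [c [nzc cE]]] [uN [d [nzd dE]]]; split; first by rewrite unitmx_mul uM.
exists (c * d); split=> [|q]; first by rewrite mulf_neq0.
by rewrite -mulmxA cE dE mulrA.
Qed.

Lemma octaV M : octa M -> octa (invmx M).
Proof.
move=> [uM [c [nzc cE]]]; split; first by rewrite unitmx_inv.
exists c^-1; split=> [|q]; first by rewrite invr_eq0.
by apply: (mulfI nzc); rewrite -cE mulKVmx // mulVKf.
Qed.

Lemma octaZ k M : k != 0 -> octa M -> octa (k *: M).
Proof.
move=> nzk [uM [c [nzc cE]]]; split; first by rewrite unitmxZ ?unitfE.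
exists (k ^+ 6 * c); split=> [|q]; first by rewrite mulf_neq0 ?expf_neq0.
by rewrite -scalemxAl OmvZ cE mulrA.
Qed.

Lemma octa_same M N : same_point M N -> octa N -> octa M.
Proof. by move=> [k [nzk ->]]; apply: octaZ. Qed.

Lemma octa_Jm : octa (Jm C).
Proof.
split; first exact: unit_Jm.
exists 1; split=> [|q]; first exact: oner_neq0.
by rewrite (colE q) Jm_pt !Omv_pt /Omf; ring.
Qed.

Lemma octa_Im : octa (Im C).
Proof.
split; first exact: unit_Im.
exists 1; split=> [|q]; first exact: oner_neq0.
by rewrite (colE q) Im_pt !Omv_pt /Omf; ring: ii.
Qed.

(** Up to a scalar, transposition is inversion followed by the conjugation by
    Jm. *)
Lemma octaT M : octa M -> octa M^T.
Proof.
move=> oM; have [uM _] := oM.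
suff -> : M^T = \det M *: (invmx (Jm C) *m invmx M *m Jm C).
  apply: octaZ; first by move: uM; rewrite unitmxE unitfE.
  exact: octaM (octaM (octaV octa_Jm) (octaV oM)) octa_Jm.
have [a [b [c [d ME]]]] := mx2_ex M; move: uM; rewrite ME unit_mx2 => nz.
have JV : invmx (Jm C) = mx2 0 1 (-1) 0.
  have d1 : 0 * 0 - -1 * 1 = 1 :> C by ring.
  by rewrite inv_mx2 d1 ?oner_neq0 // invr1 scale1r opprK.
rewrite inv_mx2 // JV -scalemxAr -scalemxAl scalerA det_mx2 divff // scale1r.
by rewrite tr_mx2 !mul_mx2; congr mx2; ring.
Qed.

Lemma stab_octP (H : 'M[C]_2) : stab_oct H <-> octa H.
Proof.
split=> [[uH /same_val6[c [nzc cE]]]|oH].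
  suff oV : octa (invmx H) by rewrite -[H]invmxK; apply: octaV.
  split; first by rewrite unitmx_inv.
  exists c; split=> // q; have := cE (q ord0 0) (q ord_max 0).
  rewrite !val6_coords ?act_homog ?f_oct_homog // ev_act !ev_f_oct => <-.
  have -> : invmx H *m q = pt (invmx H ord0 ord0 * q ord0 0 + invmx H ord0 ord_max * q ord_max 0)
      (invmx H ord_max ord0 * q ord0 0 + invmx H ord_max ord_max * q ord_max 0).
    by rewrite {1}(mx2P (invmx H)) {1}(colE q) mul_mx2_pt.
  by rewrite Omv_pt.
have [uH [c [nzc cE]]] := octaV oH; split; first by rewrite -unitmx_inv.
apply/same_val6; exists c; split=> // u v.
rewrite !val6_coords ?act_homog ?f_oct_homog // ev_act !ev_f_oct -!Omv_pt -cE.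
by rewrite -mul_mx2_pt -mx2P.
Qed.

Let sq2 : sqrtC 2 * sqrtC 2 = 2 :> C. Proof. by rewrite -expr2 sqrtCK. Qed.
Let nzs : sqrtC 2 != 0 :> C. Proof. by rewrite sqrtC_eq0. Qed.

Lemma mx_of_rows2 (a b c d : C) :
  mx_of_rows 2 2 [:: [:: a; b]; [:: c; d]] = mx2 a b c d.
Proof.
by apply/matrixP=> i j; rewrite !mxE; case: (ord2P i) (ord2P j) => [] -> [] ->.
Qed.

Definition z8 : C := (1 + 'i) / sqrtC 2.
Definition z8' : C := (1 - 'i) / sqrtC 2.

Lemma z8z8' : z8 * z8' = 1.
Proof.
have -> : z8 * z8' = (1 - 'i * 'i) / (sqrtC 2 * sqrtC 2) by rewrite /z8 /z8'; field.
by rewrite ii sq2 opprK divff.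
Qed.

Lemma z8z8 : z8 * z8 = 'i.
Proof.
have -> : z8 * z8 = (1 + 2 * 'i + 'i * 'i) / (sqrtC 2 * sqrtC 2) by rewrite /z8; field.
by rewrite ii sq2; field.
Qed.

Lemma z8'E : z8' = - 'i * z8.
Proof.
have E1 : z8' = - ('i * 'i) * z8' by rewrite ii opprK mul1r.
have E2 : - ('i * 'i) * z8' = - 'i * z8 * (z8 * z8') by rewrite -{2}z8z8; ring.
by rewrite E1 E2 z8z8' mulr1.
Qed.

Lemma oct_diag : bin_oct (mx2 z8 0 0 z8').
Proof. by rewrite -mx_of_rows2; apply: bin_oct_diag. Qed.

Lemma oct_rot : bin_oct ((sqrtC 2)^-1 *: mx2 1 (-1) 1 1 : 'M[C]_2).
Proof. by rewrite -mx_of_rows2; apply: bin_oct_rot. Qed.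

Lemma bin_oct_octa (B : 'M[C]_2) : bin_oct B -> octa B.
Proof.
elim=> {B} [|||A B _ + _|A _].
- exact: octa1.
- rewrite mx_of_rows2 -/z8 -/z8' z8'E; split.
    rewrite unit_mx2 -z8'E z8z8' mulr0 subr0; exact: oner_neq0.
  exists (-1); split=> [|q]; first by rewrite oppr_eq0 oner_neq0.
  have e2 := z8z8; rewrite (colE q) mul_mx2_pt !Omv_pt /Omf; move: (q _ _) (q _ _) => y x.
  rewrite !mul0r addr0 add0r.
  have -> : z8 * x * (- 'i * z8 * y) = - ('i * (z8 * z8)) * (x * y) by ring.
  have -> : (z8 * x) ^+ 4 - (- 'i * z8 * y) ^+ 4 =
      (z8 * z8) * (z8 * z8) * (x ^+ 4 - ('i * 'i) * ('i * 'i) * y ^+ 4) by ring.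
  by rewrite e2 !ii; ring.
- rewrite mx_of_rows2; apply: octaZ; first by rewrite invr_eq0.
  split; first by rewrite unit_mx2 !mulr1 opprK.
  exists (- 8); split=> [|q]; first by rewrite oppr_eq0 pnatr_eq0.
  by rewrite (colE q) mul_mx2_pt !Omv_pt /Omf; ring.
- by move=> oA; apply: octaM.
- exact: octaV.
Qed.

(** The group generated by the two matrices is transitive on the six zeros of
    Omf, and an element fixing the zero (1, 0) is a power of the diagonal
    generator. *)
Lemma octa_bin_oct M : octa M -> exists k, k != 0 /\ bin_oct (k *: M).
Proof.
have scal (A B : 'M[C]_2) : bin_oct B -> same_point A B -> exists k, k != 0 /\ bin_oct (k *: A).
  move=> bB [k [nzk ->]]; exists k^-1; rewrite invr_eq0; split=> //.
  by rewrite scalerK.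
have red N : bin_oct N -> (exists k, k != 0 /\ bin_oct (k *: (N *m M))) ->
    exists k, k != 0 /\ bin_oct (k *: M).
  move=> bN [k [nzk bkNM]]; exists k; split=> //.
  have [uN _] := bin_oct_octa bN.
  by have := bin_oct_mul (bin_oct_inv bN) bkNM; rewrite -scalemxAr mulKmx.
pose D := mx2 z8 0 0 z8'.
have bD n : bin_oct (iter n (mulmx D) 1%:M).
  elim: n => [|n IHn] /=; first exact: bin_oct_one.
  by apply: bin_oct_mul IHn; apply: oct_diag.
have sameD n : same_point (iter n (mulmx D) 1%:M) (mx2 ('i ^+ n) 0 0 1).
  elim: n => [|n IHn] /=; first by rewrite expr0 -mx2_1; apply: same_refl.
  apply: same_trans (same_mul (same_refl D) IHn) _.
  rewrite mul_mx2 exprS; have -> : 'i * 'i ^+ n = z8 * z8 * 'i ^+ n by rewrite z8z8.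
  apply: (same_mx2 (k := z8')); try by ring.
    by apply/negP=> /eqP z0; have /eqP := z8z8'; rewrite z0 mulr0 eq_sym oner_eq0.
  have -> : z8' * (z8 * z8 * 'i ^+ n) = (z8 * z8') * z8 * 'i ^+ n by ring.
  by rewrite z8z8'; ring.
have fixed N : octa N -> (exists a, N *m pt 1 0 = pt a 0) -> exists k, k != 0 /\ bin_oct (k *: N).
  have [a [b [c [d ->]]]] := mx2_ex N; move=> [uN [e [nze eE]]] [a' ].
  rewrite mul_mx2_pt !mulr0 !mulr1 !addr0 => /pt_inj[_ c0].
  move: uN; rewrite unit_mx2 c0 mulr0 subr0 mulf_eq0 => /norP[nza nzd].
  have E x y : Omf (a * x + b * y) (d * y) = e * Omf x y.
    by have := eE (pt x y); rewrite mul_mx2_pt !Omv_pt c0 mul0r add0r.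
  (* compare the coefficients of x^4 y^2 and of x y^5 *)
  have P0 : forall y, (d * y) * ((a + b * y) * ((a + b * y) ^+ 4 - (d * y) ^+ 4)) = e * (y * (1 - y ^+ 4)).
    by move=> y; have := E 1 y; rewrite /Omf !mulr1 !mul1r expr1n => <-; ring.
  pose P : {poly C} := (d *: 'X) * ((a%:P + b *: 'X) * ((a%:P + b *: 'X) ^+ 4 - (d *: 'X) ^+ 4))
     - e *: ('X * (1 - 'X ^+ 4)).
  have : P = 0.
    apply: poly_inf0 => y; rewrite /P.
    rewrite !(hornerD, hornerN, hornerM, hornerZ, hornerX, hornerC, horner_exp).
    by rewrite P0 subrr.
  have -> : P = (\poly_(k < 7) [:: 0; a ^+ 5 * d - e; 5 * a ^+ 4 * b * d; 10 * a ^+ 3 * b ^+ 2 * d;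
      10 * a ^+ 2 * b ^+ 3 * d; d * (5 * a * b ^+ 4 - a * d ^+ 4) + e; d * (b ^+ 5 - b * d ^+ 4)]`_k).
    rewrite poly_def !big_ord_recl big_ord0 /= /P -!mul_polyC.
    rewrite !(polyCM, polyCB, polyCD, polyC_exp) /bump /=; ring.
  move/polyP=> Pk; have := Pk 1%N; have := Pk 2%N; have := Pk 5%N.
  rewrite !coef_poly !coef0 /= => e5 e2 e1.
  have b0 : b = 0.
    have nz : 5 * a ^+ 4 * d != 0 by rewrite !mulf_neq0 ?expf_neq0 ?pnatr_eq0.
    by apply: (mulfI nz); rewrite mulr0 -[RHS]e2; ring.
  have ad : a ^+ 4 = d ^+ 4.
    have eE' : e = a ^+ 5 * d by apply/eqP; rewrite eq_sym -subr_eq0 e1.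
    apply: (mulfI nza); apply: (mulfI nzd); apply/eqP; rewrite -subr_eq0.
    by apply/eqP; rewrite -[RHS]e5 eE' b0; ring.
  have [n nE] : exists n, a = 'i ^+ n * d.
    have /eqP : (a - d) * (a + d) * ((a - 'i * d) * (a + 'i * d)) = 0.
      have -> : (a - d) * (a + d) * ((a - 'i * d) * (a + 'i * d)) = a ^+ 4 - d ^+ 4 by ring: ii.
      by rewrite ad subrr.
    rewrite !mulf_eq0 -!orbA => /or4P[]; rewrite ?subr_eq0 ?addr_eq0 => /eqP->.
    - by exists 0%N; rewrite expr0 mul1r.
    - by exists 2%N; rewrite sqrCi mulN1r.
    - by exists 1%N; rewrite expr1.
    - by exists 3%N; rewrite exprS sqrCi mulrN1 mulNr.
  apply: scal (bD n) _; apply: same_trans (same_sym (sameD n)).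
  by apply: (same_mx2 (k := d)); rewrite ?c0 ?b0 ?nE //; ring.
move=> oM; have [uM [c [nzc cE]]] := oM.
have : Omv (M *m pt 1 0) = 0 by rewrite cE Omv_pt /Omf !(mulr0, mul0r).
rewrite (colE (M *m _)); set x := (M *m _) ord0 0; set y := (M *m _) ord_max 0.
have ME : M *m pt 1 0 = pt x y by rewrite -colE.
rewrite Omv_pt /Omf => /eqP.
have -> : x ^+ 4 - y ^+ 4 = (x - y) * (x + y) * ((x - 'i * y) * (x + 'i * y)) by ring: ii.
have move_to N : bin_oct N -> (exists a, N *m pt x y = pt a 0) -> exists k, k != 0 /\ bin_oct (k *: M).
  move=> bN [a aE]; apply: (red N bN); apply: fixed.
    exact: octaM (bin_oct_octa bN) oM.
  by exists a; rewrite -mulmxA ME.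
have rotV : bin_oct (invmx ((sqrtC 2)^-1 *: mx2 1 (-1) 1 1 : 'M[C]_2)) by apply: bin_oct_inv oct_rot.
have rotVE : invmx ((sqrtC 2)^-1 *: mx2 1 (-1) 1 1 : 'M[C]_2) = (sqrtC 2)^-1 *: mx2 1 1 (-1) 1.
  have nn : (sqrtC 2)^-1 * (sqrtC 2)^-1 = 2^-1 :> C by rewrite -invfM sq2.
  pose h : C := (sqrtC 2)^-1.
  have nd : h * 1 * (h * 1) - h * -1 * (h * 1) = 1.
    have -> : h * 1 * (h * 1) - h * -1 * (h * 1) = 2 * (h * h) by ring.
    by rewrite nn divff.
  rewrite -/h !scale_mx2 inv_mx2 nd ?oner_neq0 // invr1 scale1r; congr mx2; ring.
have diag_move n : x = 'i ^+ n * y -> exists k, k != 0 /\ bin_oct (k *: M).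
  move=> xE; have [k [nzk kE]] := sameD (4 * n - n)%N.
  apply: (move_to _ (bin_oct_mul rotV (bD (4 * n - n)%N))).
  rewrite kE rotVE -mulmxA -!scalemxAl mul_mx2_pt -scalemxAr mul_mx2_pt.
  rewrite mul0r addr0 mul0r add0r mul1r.
  have -> : 'i ^+ (4 * n - n) * x = y.
    rewrite xE mulrA -exprD subnK ?leq_pmull // exprM.
    have -> : 'i ^+ 4 = 1 :> C by rewrite (exprM _ 2 2) sqrCi; ring.
    by rewrite expr1n mul1r.
  rewrite !scale_pt; eexists; congr pt; ring.
rewrite !mulf_eq0 -!orbA => /or4P[/eqP x0|/eqP y0|/eqP E|/or3P[]/eqP E].
- apply: (move_to _ (bin_oct_mul rotV rotV)); rewrite rotVE x0.
  rewrite -mulmxA -!scalemxAl mul_mx2_pt -scalemxAr mul_mx2_pt !scale_pt; eexists; congr pt; ring.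
- by apply: (move_to _ (bin_oct_one C)); rewrite mul1mx y0; exists x.
- by apply: (diag_move 0%N); rewrite expr0 mul1r; apply/eqP; rewrite -subr_eq0 E.
- by apply: (diag_move 2%N); rewrite sqrCi mulN1r; apply/eqP; rewrite -addr_eq0 E.
- by apply: (diag_move 1%N); rewrite expr1; apply/eqP; rewrite -subr_eq0 E.
- by apply: (diag_move 3%N); rewrite exprS sqrCi mulrN1 mulNr; apply/eqP; rewrite -addr_eq0 E.
Qed.

End Octahedral.

(** * Characters of the binary tetrahedral group *)

Section Lifts.
Variable C : numClosedFieldType.

Let ii := ii C.
Local Notation s := (sqrtm3 C).
Let nz2 : (2 : C) != 0. Proof. by rewrite pnatr_eq0. Qed.

Lemma form_comp d e (f g h : C -> C -> C) : form d f -> form e g -> form e h ->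
  form (d * e) (fun x y => f (g x y) (h x y)).
Proof.
move=> /form_coef[a fE] fg fh.
suff: form (d * e) (fun x y => \sum_(k < d.+1) a k * (g x y ^+ (d - k) * h x y ^+ k)).
  by apply: form_ext => x y; rewrite fE.
apply: form_sum => k; apply: formZ.
have lek : (k <= d)%N by rewrite -ltnS.
have -> : (d * e = e * (d - k) + e * k)%N by rewrite -mulnDr (subnK lek) mulnC.
exact: formM (form_exp _ fg) (form_exp _ fh).
Qed.

Lemma nth_root k (z : C) : exists x, x ^+ k.+1 = z.
Proof. by exists (k.+1.-root z); rewrite rootCK. Qed.

(** Phi and Psi determine x^4 + y^4 and x^2 y^2, hence x^4 and y^4 as roots of a
    quadratic equation; the sign of x^2 y^2 is adjusted by replacing y by 'i y. *)
Lemma PhiPsi_surj (X Y : C) : exists x y, Phif x y = X /\ Psif x y = Y.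
Proof.
have nzs := s_neq0 C.
pose A := (X + Y) / 2; pose B := (Y - X) / (4 * s).
have [w ww] := nth_root 1 (A ^+ 2 - 4 * B ^+ 2).
have [x xE] := nth_root 3 ((A + w) / 2); have [y yE] := nth_root 3 ((A - w) / 2).
have A2 : x ^+ 4 + y ^+ 4 = A by rewrite xE yE; field.
have AE (e : C) : x ^+ 4 + e + y ^+ 4 = A + e by rewrite -A2; ring.
have /eqP : (x ^+ 2 * y ^+ 2 - B) * (x ^+ 2 * y ^+ 2 + B) = 0.
  have -> : (x ^+ 2 * y ^+ 2 - B) * (x ^+ 2 * y ^+ 2 + B) = x ^+ 4 * y ^+ 4 - B ^+ 2 by ring.
  have -> : x ^+ 4 * y ^+ 4 = (A ^+ 2 - w ^+ 2) / 4 by rewrite xE yE; field.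
  by rewrite ww; field.
rewrite mulf_eq0 subr_eq0 addr_eq0 => /orP[]/eqP B2.
  exists x, y; rewrite /Phif /Psif B2.
  rewrite !AE.
  by rewrite /A /B; split; field; rewrite ?nzs ?nz2.
exists x, ('i * y); rewrite /Phif /Psif.
have -> : ('i * y) ^+ 4 = y ^+ 4 by ring: ii.
have -> : x ^+ 2 * ('i * y) ^+ 2 = - (x ^+ 2 * y ^+ 2) by ring: ii.
rewrite B2 opprK.
rewrite !AE.
by rewrite /A /B; split; field; rewrite ?nzs ?nz2.
Qed.

Lemma phi_surj (X Y : C) : exists x y, Phif x y ^+ 3 = X /\ Psif x y ^+ 3 = Y.
Proof.
have [X' <-] := nth_root 2 X; have [Y' <-] := nth_root 2 Y.
by have [x [y [<- <-]]] := PhiPsi_surj X' Y'; exists x, y.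
Qed.

Lemma PhiPsi0 : Phif 0 0 = 0 :> C /\ Psif 0 0 = 0 :> C.
Proof. by rewrite /Phif /Psif; split; ring. Qed.

Lemma PhiPsi_eq0 (x y : C) : Phif x y = 0 -> Psif x y = 0 -> x = 0 /\ y = 0.
Proof.
move=> e1 e2; have nzs := s_neq0 C.
have B0 : x ^+ 2 * y ^+ 2 = 0.
  have nz4s : 4 * s != 0 by rewrite mulf_neq0 // pnatr_eq0.
  apply: (mulfI nz4s); rewrite mulr0 -[RHS](subrr (Phif x y)) {1}e1 -e2 /Phif /Psif; ring.
have A0 : x ^+ 4 + y ^+ 4 = 0 by rewrite -e1 /Phif B0; ring.
move/eqP: B0; rewrite mulf_eq0 !expf_eq0 /= => /orP[]/eqP z0; rewrite z0 in A0 *; split=> //.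
  by move/eqP: A0; rewrite expr0n add0r expf_eq0 => /eqP.
by move/eqP: A0; rewrite expr0n addr0 expf_eq0 => /eqP.
Qed.

Lemma CmIm : Cm C *m Im C = - (Jm C *m Cm C).
Proof.
by rewrite !mul_mx2 -scaleN1r scale_mx2; congr mx2; field: ii.
Qed.
Lemma CmJm : Cm C *m Jm C = Im C *m Jm C *m Cm C.
Proof. by rewrite !mul_mx2; congr mx2; field: ii. Qed.
Lemma ImJm : Im C *m Jm C = - (Jm C *m Im C).
Proof. by rewrite !mul_mx2 -scaleN1r scale_mx2; congr mx2; ring. Qed.
Lemma CmCmCm : Cm C *m Cm C *m Cm C = - 1%:M.
Proof. by rewrite !mul_mx2 mx2_1 -scaleN1r scale_mx2; congr mx2; field: ii. Qed.

(** Maps from the plane to matrices, homogeneous of degree n and covariant for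
    the action of some matrices: S acts on the source and rho S, an action on
    the right, on the target. *)
Section Characters.
Variables (p r n : nat) (G : 'cV[C]_2 -> 'M[C]_(p, r)) (rho : 'M[C]_2 -> 'M[C]_r).
Hypothesis rhoM : forall S T, rho (S *m T) = rho T *m rho S.
Hypothesis rho1 : rho 1%:M = 1%:M.
Hypothesis GZ : forall k q, G (k *: q) = k ^+ n *: G q.
Variables (chiI chiJ chiC : C) (q0 : 'cV[C]_2) (e : C).
Hypothesis Gq0 : G q0 != 0.
Hypothesis e2 : e * e = 1.
Hypothesis rhoN : forall S, rho (- S) = e *: rho S.
Hypothesis nzI : chiI != 0.
Hypothesis nzJ : chiJ != 0.
Hypothesis nzC : chiC != 0.
Hypothesis GI : forall q, G (Im C *m q) = chiI *: (G q *m rho (Im C)).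
Hypothesis GJ : forall q, G (Jm C *m q) = chiJ *: (G q *m rho (Jm C)).
Hypothesis GC : forall q, G (Cm C *m q) = chiC *: (G q *m rho (Cm C)).

Let GN q : G (- q) = (-1) ^+ n *: G q. Proof. by rewrite -scaleN1r GZ. Qed.

Let rho_unit S : S \in unitmx -> rho S \in unitmx.
Proof.
move=> uS; have : rho (invmx S) *m rho S = 1%:M.
  by rewrite -rhoM mulmxV // rho1.
by case/mulmx1_unit.
Qed.

Let cancel S (k l : C) : S \in unitmx ->
  k *: (G q0 *m rho S) = l *: (G q0 *m rho S) -> k = l.
Proof.
move=> uS E; apply/eqP; rewrite -subr_eq0.
have /eqP : (k - l) *: (G q0 *m rho S) = 0 by rewrite scalerBl E subrr.
rewrite scaler_eq0 => /orP[//|/eqP E0]; case/eqP: Gq0.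
by rewrite -[LHS](mulmxK (rho_unit uS)) E0 mul0mx.
Qed.

Let comp S T k l : (forall q, G (S *m q) = k *: (G q *m rho S)) ->
  (forall q, G (T *m q) = l *: (G q *m rho T)) ->
  forall q, G (S *m T *m q) = (k * l) *: (G q *m rho (S *m T)).
Proof.
by move=> GS GT q; rewrite -mulmxA GS GT -scalemxAl scalerA rhoM mulmxA.
Qed.

Lemma chi_sign : (-1) ^+ n = e.
Proof.
have E := comp GI GJ q0; have E' := comp GJ GI q0.
have uIJ : Jm C *m Im C \in unitmx by rewrite unitmx_mul unit_Im unit_Jm.
move: E; rewrite ImJm mulNmx GN E' rhoN -scalemxAr !scalerA => /(cancel uIJ) E.
by apply: (mulIf (mulf_neq0 nzJ nzI)); rewrite E; ring.
Qed.

Lemma chi_J : chiI = chiJ.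
Proof.
have E := comp GC GI q0; have E' := comp GJ GC q0.
have uJC : Jm C *m Cm C \in unitmx by rewrite unitmx_mul unit_Cm unit_Jm.
move: E; rewrite CmIm mulNmx GN E' rhoN -scalemxAr !scalerA chi_sign => /(cancel uJC) E.
have nze : e != 0.
  by apply/eqP=> e0; move/eqP: e2; rewrite e0 mul0r eq_sym oner_eq0.
apply: (mulIf nzC); apply: (mulIf nze).
transitivity (chiC * chiI * e); first by ring.
by rewrite -E; ring.
Qed.

Lemma chi_I1 : chiI = 1.
Proof.
have E := comp GC GJ q0; have E' := comp (comp GI GJ) GC q0.
have uIJC : Im C *m Jm C *m Cm C \in unitmx by rewrite !unitmx_mul unit_Im unit_Cm unit_Jm.
move: E; rewrite CmJm E' => /(cancel uIJC) E.
apply: (mulIf (mulf_neq0 nzJ nzC)); rewrite mulrA E; ring.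
Qed.

Lemma chi_J1 : chiJ = 1. Proof. by rewrite -chi_J chi_I1. Qed.

Lemma chi_C3 : chiC ^+ 3 = 1.
Proof.
have E := comp (comp GC GC) GC q0.
move: E; rewrite CmCmCm mulNmx GN mul1mx rhoN rho1 chi_sign -scalemxAr scalerA -[G q0 in LHS]mulmx1 -rho1.
move=> /(cancel (unitmx1 _ _)) E.
have -> : chiC ^+ 3 = chiC * chiC * chiC * (e * e) by rewrite e2; ring.
by rewrite mulrA -E e2.
Qed.

(** The abelian quotient of the binary tetrahedral group has order 3: the
    quaternion group consists of commutators, and Cm has order 3 modulo it. *)
Lemma characters : [/\ (-1) ^+ n = e, chiI = 1, chiJ = 1 & chiC ^+ 3 = 1].
Proof. by split; [apply: chi_sign|apply: chi_I1|apply: chi_J1|apply: chi_C3]. Qed.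

End Characters.

End Lifts.

(** * Values of a lift on the deck transformations *)

Section LiftValues.
Variable C : numClosedFieldType.

Lemma at_ptZ d m n (g : 'M[binform C]_(m, n)) k q :
  (forall i j, g i j \is d.-homog) -> at_pt g (k *: q) = k ^+ d *: at_pt g q.
Proof.
move=> hg; rewrite (colE q) scale_pt; apply/matrixP=> i j.
by rewrite [RHS]mxE !ev_at (form_scale _ _ _ (form_ev (hg i j))).
Qed.

Lemma form_entry d m n (g : 'M[binform C]_(m, n)) (S : 'M[C]_2) i j :
  g i j \is d.-homog -> form d (fun x y => at_pt g (S *m pt x y) i j).
Proof.
move=> hg; have [a [b [c [e ->]]]] := mx2_ex S.
apply: (form_ext (f := fun x y => ev (g i j) (a * x + b * y) (c * x + e * y))).
  move=> x y; rewrite mul_mx2_pt. by rewrite ev_at.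
by apply: (form_subst (form_ev hg)); apply: form_lin.
Qed.

Lemma form_entry1 d m n (g : 'M[binform C]_(m, n)) i j :
  g i j \is d.-homog -> form d (fun x y => at_pt g (pt x y) i j).
Proof. by move=> hg; apply: form_ext (fun x y => esym (ev_at g x y i j)) (form_ev hg). Qed.

Lemma form_det d (g : 'M[binform C]_2) (S : 'M[C]_2) : (forall i j, g i j \is d.-homog) ->
  form (d + d) (fun x y => \det (at_pt g (S *m pt x y))).
Proof.
move=> hg; apply: (form_ext (f := fun x y =>
  at_pt g (S *m pt x y) ord0 ord0 * at_pt g (S *m pt x y) ord_max ord_max -
  at_pt g (S *m pt x y) ord0 ord_max * at_pt g (S *m pt x y) ord_max ord0)).
  by move=> x y; rewrite -det_mx2 -mx2P.
by apply: formB; apply: formM; apply: form_entry.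
Qed.

Lemma pt_neq0 (x y : C) : (x, y) != (0, 0) -> pt x y != 0.
Proof. by rewrite pt_eq0 xpair_eqE. Qed.

Lemma curve_at_neq0 d m n (g : 'M[binform C]_(m, n)) q : is_curve d g -> q != 0 -> at_pt g q != 0.
Proof.
rewrite (colE q) pt_eq0 => cg nz.
have [k nzk] := curve_primitive cg (x := q ord0 0) (y := q ord_max 0) nz.
by apply: contraNneq nzk => g0; rewrite -ev_at g0 mxE.
Qed.

Lemma mx_neq0 m n (A : 'M[C]_(m, n)) : A != 0 -> exists i j, A i j != 0.
Proof.
move=> nzA; case: (pickP [pred k : 'I_m * 'I_n | A k.1 k.2 != 0]) => [k nz|A0].
  by exists k.1, k.2.
case/eqP: nzA; apply/matrixP=> i j; rewrite mxE; apply/eqP/negbNE.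
by have /= -> := A0 (i, j).
Qed.

(** The matrix K acts through its transpose, so that S and K multiply in the same
    order. *)
Definition lifts (g : 'M[binform C]_2) (S K : 'M[C]_2) :=
  exists chi, chi != 0 /\ forall q, at_pt g (S *m q) = chi *: (at_pt g q *m K^T).

Definition nondeg (g : 'M[binform C]_2) := exists q, at_pt g q \in unitmx.

Lemma nondeg_det (g : 'M[binform C]_2) (S : 'M[C]_2) : S \in unitmx -> nondeg g ->
  nonzero (fun x y => \det (at_pt g (S *m pt x y))).
Proof.
move=> uS [q uq]; exists ((invmx S *m q) ord0 0), ((invmx S *m q) ord_max 0).
by rewrite -colE mulKVmx // -unitfE -unitmxE.
Qed.

(** The value of a lift at S is constant, so that g (S q) and g q H^-1 are
    proportional; neither has a common factor, and the factor is constant. *)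
Lemma lift_value_lifts n g S H : is_curve n g -> nondeg g -> S \in unitmx -> H \in unitmx ->
  lift_value g S H -> lifts g S (invmx H)^T.
Proof.
move=> cg ndg uS uH lv; have [hg _] := cg.
pose A (k : 'I_2 * 'I_2) x y := at_pt g (S *m pt x y) k.1 k.2.
pose B (k : 'I_2 * 'I_2) x y := (at_pt g (pt x y) *m invmx H) k.1 k.2.
have fA k : form n (A k) by apply: form_entry.
have fB k : form n (B k).
  apply: (form_ext (f := fun x y => invmx H ord0 k.2 * at_pt g (pt x y) k.1 ord0 +
      invmx H ord_max k.2 * at_pt g (pt x y) k.1 ord_max)).
    by move=> x y; rewrite /B [RHS]mxE big_ord2 ![invmx H _ _ * _]mulrC.
  by apply: formD; apply: formZ; apply: form_entry1.
have ndS := nondeg_det uS ndg.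
have nd1 := nondeg_det (unitmx1 _ _) ndg.
have AB : proportional A B.
  move=> k l x y; apply/eqP; rewrite -subr_eq0; apply/eqP.
  pose D x y := A k x y * B l x y - A l x y * B k x y.
  apply: (form_mul0 (g := D) (formM (form_det S hg) (form_det 1%:M hg)) _ _).
  - by apply: formB; apply: formM.
  - move=> {}x {}y; rewrite mul1mx; apply/eqP; rewrite mulf_eq0.
    apply/orP; case: eqVneq => [_|]; first by left.
    rewrite mulf_eq0 => /norP[]; rewrite -!unitfE -!unitmxE => uqS uq; right.
    have [c [nzc E]] := lv _ uq uqS.
    have {}E : at_pt g (S *m pt x y) = c^-1 *: (at_pt g (pt x y) *m invmx H).
      have -> : at_pt g (pt x y) = c *: (at_pt g (S *m pt x y) *m H).
        by rewrite scalemxAr -E mulKVmx.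
      by rewrite -scalemxAl mulmxK // scalerK.
    rewrite /D subr_eq0 /A /B E; move: (at_pt g (pt x y) *m invmx H) => W.
    by rewrite !mxE; apply/eqP; ring.
  - exact: form_neqM (form_det S hg) (form_det 1%:M hg) ndS nd1.
have [||c nzc cE] := proportional_const fA fB _ AB.
- have [x [y nz]] := ndS.
  have : at_pt g (S *m pt x y) != 0 by apply: contraNneq nz => ->; rewrite det0.
  by case/mx_neq0 => i [j nzij]; exists (i, j), x, y.
- move=> x y nzq; have : at_pt g (pt x y) *m invmx H != 0.
    apply: contraTneq (curve_at_neq0 cg (pt_neq0 nzq)) => E0.
    by rewrite -[at_pt _ _](mulmxKV uH) E0 mul0mx eqxx.
  by case/mx_neq0 => i [j nzij]; exists (i, j).
- exists c; split=> // q; rewrite trmxK (colE q); apply/matrixP=> i j.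
  by have := cE (i, j) (q ord0 0) (q ord_max 0); rewrite /A /B /= => ->; rewrite [RHS]mxE.
Qed.

End LiftValues.

Section Normalization.
Variable C : numClosedFieldType.

(** Both sides have the same degree and the second one has no common zero, so the
    factor is a form of degree 0. *)
Lemma same_const d m n (G1 G2 : 'cV[C]_2 -> 'M[C]_(m, n)) :
  (forall i j, form d (fun x y => G1 (pt x y) i j)) ->
  (forall i j, form d (fun x y => G2 (pt x y) i j)) ->
  (forall q, q != 0 -> same_point (G1 q) (G2 q)) -> (forall q, q != 0 -> G2 q != 0) ->
  exists c, c != 0 /\ forall q, G1 q = c *: G2 q.
Proof.
move=> f1 f2 G12 G2nz.
pose A (k : 'I_m * 'I_n) x y := G1 (pt x y) k.1 k.2.
pose B (k : 'I_m * 'I_n) x y := G2 (pt x y) k.1 k.2.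
have fA k : form d (A k) := f1 k.1 k.2.
have fB k : form d (B k) := f2 k.1 k.2.
have nz1 (z : C) : pt 1 z != 0 by rewrite pt_eq0 oner_eq0.
have AB : proportional A B.
  move=> k l x y; apply/eqP; rewrite -subr_eq0; apply/eqP.
  apply: (form_inf0 (f := fun x y => A k x y * B l x y - A l x y * B k x y)).
    by apply: formB; apply: formM.
  move=> z; have [c [_ E]] := G12 _ (nz1 z).
  by rewrite /A /B E !mxE; ring.
have [||c nzc cE] := proportional_const fA fB _ AB.
- have [c [nzc E]] := G12 _ (nz1 0).
  have /mx_neq0[i [j nz]] := G2nz _ (nz1 0); exists (i, j), 1, 0.
  by rewrite /A E mxE mulf_neq0.
- move=> x y nz; have /mx_neq0[i [j nzij]] := G2nz _ (pt_neq0 nz).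
  by exists (i, j).
exists c; split=> // q; apply/matrixP=> i j.
by have := cE (i, j) (q ord0 0) (q ord_max 0); rewrite /A /B -colE => ->; rewrite [RHS]mxE.
Qed.

Section Lifts.
Variables (n : nat) (g : 'M[binform C]_2).
Hypothesis cg : is_curve n g.
Hypothesis ndg : nondeg g.

Lemma lifts_mul S T K L : lifts g S K -> lifts g T L -> lifts g (S *m T) (K *m L).
Proof.
move=> [c [nzc cE]] [e [nze eE]]; exists (c * e); split=> [|q]; first by rewrite mulf_neq0.
by rewrite -mulmxA cE eE trmx_mul -scalemxAl scalerA mulmxA.
Qed.

Lemma lifts1 : lifts g 1%:M 1%:M.
Proof.
by exists 1; split=> [|q]; rewrite ?oner_neq0 // mul1mx trmx1 mulmx1 scale1r.
Qed.

Lemma lifts_same S S' K K' : same_point S S' -> same_point K K' -> lifts g S K -> lifts g S' K'.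
Proof.
move=> [k [nzk ->]] [l [nzl ->]] [c [nzc cE]].
exists (k ^- n * c * l); split=> [|q].
  by rewrite !mulf_neq0 // invr_eq0 expf_neq0.
have := cE q; rewrite -scalemxAl (at_ptZ _ _ cg.1) linearZ /= -scalemxAr scalerA => E.
by rewrite -!scalerA [c *: _]scalerA -E scalerK // expf_neq0.
Qed.

Lemma lifts_uniq S K L : S \in unitmx -> lifts g S K -> lifts g S L -> same_point K L.
Proof.
move=> uS [c [nzc cE]] [e [nze eE]]; have [q uq] := ndg.
rewrite -[K]trmxK -[L]trmxK; apply: same_tr; apply: (same_mull uq).
exists (c^-1 * e); split; first by rewrite mulf_neq0 ?invr_eq0.
by rewrite -scalerA -eE cE scalerK.
Qed.

Lemma lifts_value S K : K \in unitmx -> lifts g S K -> lift_value g S (invmx K)^T.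
Proof.
move=> uK [c [nzc cE]] q uq uSq; exists c^-1; split; first by rewrite invr_eq0.
rewrite -[RHS](mulKmx uSq); congr (_ *m _).
by rewrite cE -scalemxAl -scalemxAr scalerA divff // scale1r -mulmxA -trmx_mul mulVmx // trmx1 mulmx1.
Qed.

End Lifts.

Lemma sameN m n (A : 'M[C]_(m, n)) : same_point (- A) A.
Proof. by exists (-1); rewrite oppr_eq0 oner_neq0 scaleN1r. Qed.

End Normalization.

(** * Normal form of the covering and of the lift *)

Section NormalForm.
Variable C : numClosedFieldType.

Lemma nondegP (g : 'M[binform C]_2) : nondeg g \/ forall q, at_pt g q \notin unitmx.
Proof.
have [ndg|dg] := pselect (nondeg g); [by left|right=> q].
by apply/negP => uq; apply: dg; exists q.
Qed.

(** Phi and Psi take all pairs of values. *)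
Lemma cubic_eq0 (a0 a1 a2 a3 : C) :
  (forall x y, a0 * Phif x y ^+ 3 + a1 * (Phif x y ^+ 2 * Psif x y)
        + a2 * (Phif x y * Psif x y ^+ 2) + a3 * Psif x y ^+ 3 = 0) ->
  [/\ a0 = 0, a1 = 0, a2 = 0 & a3 = 0].
Proof.
move=> E0.
have E X Y : \sum_(k < 4) [:: a0; a1; a2; a3]`_k * (X ^+ (3 - k) * Y ^+ k) =
             \sum_(k < 4) 0 * (X ^+ (3 - k) * Y ^+ k).
  have [x [y [<- <-]]] := PhiPsi_surj X Y.
  rewrite [RHS]big1 => [|k _]; last by rewrite mul0r.
  by rewrite -[RHS](E0 x y) !big_ord_recl big_ord0 /bump /=; ring.
have Ek := coef_inj (a := nth 0 [:: a0; a1; a2; a3]) (b := fun => 0) E.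
by split; [apply: (Ek 0%N)|apply: (Ek 1%N)|apply: (Ek 2%N)|apply: (Ek 3%N)].
Qed.

(** The components are invariants of the quaternion group, hence cubics in Phi and
    Psi. On the four cubic monomials Cm acts with three characters, only the
    trivial one occurring twice, on Phi^3 and Psi^3; components sharing another
    character would be proportional and have a common zero. *)
Lemma covering_of_cubics (beta0 : 'cV[C]_2 -> 'cV[C]_2) :
  (forall i, form 12 (fun x y => beta0 (pt x y) i 0)) ->
  (forall q, q != 0 -> beta0 q != 0) ->
  (exists chi, chi != 0 /\ forall q, beta0 (Im C *m q) = chi *: beta0 q) ->
  (exists chi, chi != 0 /\ forall q, beta0 (Jm C *m q) = chi *: beta0 q) ->
  (exists chi, chi != 0 /\ forall q, beta0 (Cm C *m q) = chi *: beta0 q) ->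
  exists beta : 'M[C]_2, beta \in unitmx /\
    forall q, beta0 q = beta *m at_pt (phi_A4 C) q.
Proof.
move=> fb nzb [chiI [nzI bI]] [chiJ [nzJ bJ]] [chi [nzC bC]].
have bZ k q : beta0 (k *: q) = k ^+ 12 *: beta0 q.
  apply/colP=> i; rewrite (colE q) scale_pt mxE.
  exact: (form_scale _ _ _ (fb i)).
pose rho := fun _ : 'M[C]_2 => (1%:M : 'M[C]_1).
have rhoM S T : rho (S *m T) = rho T *m rho S by rewrite mulmx1.
have rhoN S : rho (- S) = 1 *: rho S by rewrite scale1r.
have q0nz : pt 1 0 != 0 :> 'cV[C]_2 by rewrite pt_eq0 oner_eq0.
have bI' q : beta0 (Im C *m q) = chiI *: (beta0 q *m rho (Im C)) by rewrite mulmx1.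
have bJ' q : beta0 (Jm C *m q) = chiJ *: (beta0 q *m rho (Jm C)) by rewrite mulmx1.
have bC' q : beta0 (Cm C *m q) = chi *: (beta0 q *m rho (Cm C)) by rewrite mulmx1.
have [_ eI eJ _] := characters rhoM (erefl _) bZ (nzb _ q0nz) (mulr1 1) rhoN nzI nzJ nzC bI' bJ' bC'.
rewrite {}eI {}eJ in bI bJ; clear bI' bJ' bC'.
have inv i : Q8_inv (fun x y => beta0 (pt x y) i 0).
  by split=> x y; rewrite -?Im_pt -?Jm_pt ?bI ?bJ scale1r.
have co i := Q8_inv12 (fb i) (inv i).
have {co} [a aE] : exists a : 'I_2 -> C * C * C * C, forall i x y,
  beta0 (pt x y) i 0 = (a i).1.1.1 * Phif x y ^+ 3 + (a i).1.1.2 * (Phif x y ^+ 2 * Psif x y)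
     + (a i).1.2 * (Phif x y * Psif x y ^+ 2) + (a i).2 * Psif x y ^+ 3.
  suff /fin_all_exists[a aE] i : exists t : C * C * C * C, forall x y, beta0 (pt x y) i 0 =
      t.1.1.1 * Phif x y ^+ 3 + t.1.1.2 * (Phif x y ^+ 2 * Psif x y)
     + t.1.2 * (Phif x y * Psif x y ^+ 2) + t.2 * Psif x y ^+ 3 by exists a.
  by have [a0 [a1 [a2 [a3 E]]]] := co i; exists (a0, a1, a2, a3).
have w1 := om11 C; have w2 := om22 C; have w12 := om12 C.
have chiE i : [/\ (a i).1.1.1 * (chi - 1) = 0, (a i).1.1.2 * (chi - om2 C) = 0,
    (a i).1.2 * (chi - om1 C) = 0 & (a i).2 * (chi - 1) = 0].
  apply: cubic_eq0 => x y.
  have := congr1 (fun M : 'cV_2 => M i 0) (bC (pt x y)).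
  rewrite /= [in RHS]mxE Cm_pt !aE Phi_c Psi_c => /eqP; rewrite eq_sym -subr_eq0 => /eqP <-.
  move: (Phif x y) (Psif x y) w1 w2 w12 => X Y; move: (om1 C) (om2 C) => o1 o2 {}w1 {}w2 {}w12.
  by ring: w1 w2 w12.
have chi1 : chi = 1.
  apply/eqP; rewrite -subr_eq0; apply/negbNE/negP => nchi.
  have [u [v [nzq Phi0]]] := form_root (form_Phi C).
  have := nzb _ (pt_neq0 nzq); case/eqP; apply/colP=> i.
  have [/eqP e0 _ _ /eqP e3] := chiE i.
  move: e0 e3; rewrite !mulf_eq0 (negbTE nchi) !orbF => /eqP e0 /eqP e3.
  by rewrite aE e0 e3 Phi0 mxE; ring.
have {}aE i x y : beta0 (pt x y) i 0 = (a i).1.1.1 * Phif x y ^+ 3 + (a i).2 * Psif x y ^+ 3.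
  have [_ /eqP e1 /eqP e2 _] := chiE i; move: e1 e2; rewrite !mulf_eq0 chi1.
  rewrite -![_ == 0 :> C]eqr_opp !oppr0 !opprB.
  rewrite (negbTE (om1_neq1 C)) (negbTE (om2_neq1 C)) !orbF !oppr_eq0 => /eqP e1 /eqP e2.
  by rewrite aE e1 e2; ring.
pose beta := mx2 (a ord0).1.1.1 (a ord0).2 (a ord_max).1.1.1 (a ord_max).2.
have bE q : beta0 q = beta *m at_pt (phi_A4 C) q.
  rewrite (colE q) [at_pt _ _](_ : _ = pt (Phif (q ord0 0) (q ord_max 0) ^+ 3) (Psif (q ord0 0) (q ord_max 0) ^+ 3)).
    rewrite mul_mx2_pt; apply/colP=> i; rewrite [RHS]mxE aE.
    by case: (ord2P i) => ->.
  apply/colP=> i; rewrite ev_at !mxE; case: (ord2P i) => -> /=.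
    by rewrite evX ev_Phi.
  by rewrite evX ev_Psi.
exists beta; split=> //.
rewrite unit_mx2; apply/negP => /eqP det0.
have [X [Y [nzXY b0]]] : exists X Y, pt X Y != 0 /\ beta *m pt X Y = 0.
  have pt0 : pt 0 0 = 0 :> 'cV[C]_2 by apply/colP=> i; rewrite !mxE if_same.
  have [E|nz] := eqVneq (pt (a ord0).2 (- (a ord0).1.1.1)) 0; last first.
    exists (a ord0).2, (- (a ord0).1.1.1); split=> //.
    rewrite mul_mx2_pt -pt0; congr pt; first by ring.
    by rewrite -[RHS]oppr0 -det0; ring.
  have /pt_inj[a2 a1] : pt (a ord0).2 (- (a ord0).1.1.1) = pt 0 0 by rewrite E pt0.
  have {}a1 : (a ord0).1.1.1 = 0 by apply/eqP; rewrite -oppr_eq0 a1.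
  have [E'|nz] := eqVneq (pt (a ord_max).2 (- (a ord_max).1.1.1)) 0; last first.
    exists (a ord_max).2, (- (a ord_max).1.1.1); split=> //.
    by rewrite mul_mx2_pt -pt0 a1 a2; congr pt; ring.
  exists 1, 0; split=> //; rewrite mul_mx2_pt a1 a2 -pt0.
  have /pt_inj[a4 a3] : pt (a ord_max).2 (- (a ord_max).1.1.1) = pt 0 0 by rewrite E' pt0.
  have {}a3 : (a ord_max).1.1.1 = 0 by apply/eqP; rewrite -oppr_eq0 a3.
  by rewrite a3 a4; congr pt; ring.
have [x [y [Xx Yy]]] := phi_surj X Y.
have : pt x y != 0.
  apply: contraNneq nzXY => /eqP; rewrite pt_eq0 => /andP[/eqP x0 /eqP y0].
  by rewrite -Xx -Yy x0 y0 /Phif /Psif pt_eq0; apply/andP; split; apply/eqP; ring.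
move/nzb; rewrite bE [at_pt _ _](_ : _ = pt X Y) ?b0 ?eqxx //.
apply/colP=> i; rewrite ev_at !mxE; case: (ord2P i) => -> /=.
  by rewrite evX ev_Phi.
by rewrite evX ev_Psi.
Qed.

End NormalForm.

Section Normalize.
Variable C : numClosedFieldType.

(** A conjugator of two copies of the alternating group that both preserve Omf
    preserves it too: Omf in the new coordinates is a semi-invariant sextic of
    the standard copy, and Omf is the only one. *)
Lemma conjugator_octa (Q : 'M[C]_2) (KI KJ KC : 'M[C]_2) : Q \in unitmx ->
  octa KI -> octa KJ -> octa KC -> same_point (KI *m Q) (Q *m Im C) ->
  same_point (KJ *m Q) (Q *m Jm C) -> same_point (KC *m Q) (Q *m Cm C) -> octa Q.
Proof.
move=> uQ oI oJ oC sI sJ sC.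
pose G (q : 'cV[C]_2) : 'M[C]_1 := (Omv (Q *m q))%:M.
have GE q : G q = Omv (Q *m q) *: 1%:M by rewrite /G -scalemx1.
have GZ k q : G (k *: q) = k ^+ 6 *: G q by rewrite !GE -scalemxAr OmvZ scalerA.
pose rho := fun _ : 'M[C]_2 => (1%:M : 'M[C]_1).
have rhoM S T : rho (S *m T) = rho T *m rho S by rewrite mulmx1.
have rhoN S : rho (- S) = 1 *: rho S by rewrite scale1r.
have nz1 : (1%:M : 'M[C]_1) != 0.
  by apply/eqP=> /matrixP/(_ 0 0)/eqP; rewrite !mxE oner_eq0.
have step K S : octa K -> same_point (K *m Q) (Q *m S) ->
    exists chi, chi != 0 /\ forall q, G (S *m q) = chi *: (G q *m rho S).
  move=> [uK [c [nzc cE]]] /same_sym[k [nzk E]].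
  exists (k ^+ 6 * c); split=> [|q]; first by rewrite mulf_neq0 ?expf_neq0.
  by rewrite mulmx1 !GE !mulmxA E -scalemxAl OmvZ -mulmxA cE scalerA !mulrA.
have [chiI [nzI GI]] := step _ _ oI sI.
have [chiJ [nzJ GJ]] := step _ _ oJ sJ.
have [chi [nzC GC]] := step _ _ oC sC.
have [q0 nzq0] : exists q, G q != 0.
  exists (invmx Q *m pt 1 2); rewrite GE mulKVmx // scaler_eq0 negb_or nz1 andbT Omv_pt.
  exact: Om12_neq0.
have [_ eI eJ _] := characters rhoM (erefl _) GZ nzq0 (mulr1 1) rhoN nzI nzJ nzC GI GJ GC.
have fG : form 6 (fun x y => Omv (Q *m pt x y)).
  have [a [b [c [d ->]]]] := mx2_ex Q.
  apply: (form_ext (f := fun x y => Omf (a * x + b * y) (c * x + d * y))).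
    by move=> x y; rewrite mul_mx2_pt Omv_pt.
  by apply: (form_subst (form_Om C)); apply: form_lin.
have GE0 q : G q 0 0 = Omv (Q *m q) by rewrite mxE eqxx mulr1n.
have inv : Q8_inv (fun x y => Omv (Q *m pt x y)).
  split=> x y; rewrite -?Im_pt -?Jm_pt -!GE0 ?GI ?GJ mulmx1 ?eI ?eJ scale1r //.
have [c cE] := Q8_inv6 fG inv; split=> //; exists c; split=> [|q]; last first.
  by rewrite {1}(colE q) cE.
apply: contraNneq nzq0 => c0.
by rewrite GE (colE q0) cE c0 mul0r scale0r.
Qed.

Lemma at_pt_same m n (g : 'M[binform C]_(m, n)) d (S T : 'M[C]_2) :
  (forall i j, g i j \is d.-homog) -> same_point S T ->
  exists c, c != 0 /\ forall q, at_pt g (S *m q) = c *: at_pt g (T *m q).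
Proof.
move=> hg [c [nzc ->]]; exists (c ^+ d); split=> [|q]; first by rewrite expf_neq0.
by rewrite -scalemxAl (at_ptZ _ _ hg).
Qed.

(** A4_conj applies to the deck group and to its image under the lift;
    covering_of_cubics identifies the covering in the new coordinates, and
    conjugator_octa the second conjugator. *)
Lemma normalize phi F n (g : 'M[binform C]_2) :
  galois_covering 'Alt_('I_4)%G 12 phi -> is_curve n g -> galois_lift phi F g ->
  nondeg g /\
  exists alpha beta B chi, [/\ alpha \in unitmx, beta \in unitmx, bin_oct B,
    forall q, at_pt phi (alpha *m q) = beta *m at_pt (phi_A4 C) q &
    let G q := at_pt g (alpha *m q) *m B^T in
    [/\ odd n, chi ^+ 3 = 1, forall q, G (Im C *m q) = G q *m (Im C)^T,
        forall q, G (Jm C *m q) = G q *m (Jm C)^T &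
        forall q, G (Cm C *m q) = chi *: (G q *m (Cm C)^T)]].
Proof.
move=> [cphi _ [theta [deckT thM thI _]]] cg [_ _ liftH liftI].
have [hphi _] := cphi; have [hg _] := cg.
have [aS aT aK] := a4_in; have [SS TT ST KS KT] := a4_rel.
have [nS nT nST] := a4_neq.
have a1 : (1%g : 'S_4) \in ('Alt_('I_4))%G by apply: group1.
have uth s : s \in ('Alt_('I_4))%G -> theta s \in unitmx by move/deckT => [].
have th1 : same_point (theta 1%g) 1%:M.
  apply/same_sym/(same_mull (uth _ a1)); rewrite mulmx1.
  by have := thM _ _ a1 a1; rewrite mulg1.
pose S1 := theta a4s; pose T1 := theta a4t; pose K1 := theta a4k.
have [uS uT uK] : [/\ S1 \in unitmx, T1 \in unitmx & K1 \in unitmx].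
  by split; [exact: uth aS|exact: uth aT|exact: uth aK].
have deck1 : deck phi 1%:M.
  by split=> [|q _]; [apply: unitmx1|rewrite mul1mx; apply: same_refl].
have S11 : same_point (S1 *m S1) 1%:M.
  by apply: same_trans (same_sym (thM _ _ aS aS)) _; rewrite SS.
have T11 : same_point (T1 *m T1) 1%:M.
  by apply: same_trans (same_sym (thM _ _ aT aT)) _; rewrite TT.
have STc : same_point (S1 *m T1) (T1 *m S1).
  by apply: same_trans (same_sym (thM _ _ aS aT)) _; rewrite ST; apply: thM.
have KSc : same_point (K1 *m S1) (T1 *m K1).
  by apply: same_trans (same_sym (thM _ _ aK aS)) _; rewrite KS; apply: thM.
have KTc : same_point (K1 *m T1) (S1 *m T1 *m K1).
  apply: same_trans (same_sym (thM _ _ aK aT)) _; rewrite KT.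
  apply: same_trans (thM _ _ (groupM aS aT) aK) _.
  exact: same_mul (thM _ _ aS aT) (same_refl _).
have nS1 : ~ same_point S1 1%:M.
  move=> E; case/eqP: nS; apply: (thI _ _ aS a1).
  exact: same_trans E (same_sym th1).
have nT1 : ~ same_point T1 1%:M.
  move=> E; case/eqP: nT; apply: (thI _ _ aT a1).
  exact: same_trans E (same_sym th1).
have nST1 : ~ same_point S1 T1 by move=> E; case/eqP: nST; apply: (thI _ _ aS aT).
have ndg : nondeg g.
  have [//|dg] := nondegP g; case: nS1.
  by apply: (liftI _ _ 1%:M) (deckT _ aS) deck1 _ _ => q uq; move: (dg q); rewrite uq.
split=> //.
have lift s : s \in ('Alt_('I_4))%G -> exists K, [/\ octa K, K \in unitmx & lifts g (theta s) K].
  move=> As; have [H [oH lv]] := liftH _ (deckT _ As).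
  have {}oH : octa H by apply/stab_octP.
  have oK := octaT (octaV oH); exists (invmx H)^T; split=> //; first by case: oK.
  exact: (lift_value_lifts cg ndg (uth _ As) oH.1 lv).
have [KI [oI uI lI]] := lift _ aS; have [KJ [oJ uJ lJ]] := lift _ aT.
have [KC [oC uC lC]] := lift _ aK; rewrite -/S1 -/T1 -/K1 in lI lJ lC.
have lift_inj S T K : deck phi S -> deck phi T -> K \in unitmx -> lifts g S K -> lifts g T K ->
    same_point S T.
  by move=> dS dT uKK lS lT; apply: liftI dS dT (lifts_value uKK lS) (lifts_value uKK lT).
have lmul := lifts_mul; have luniq := lifts_uniq ndg; have lsame := lifts_same cg.
have l11 := lifts1 g.
have [alpha [uA sI sJ sC]] := A4_conj uS uT uK S11 nS1 T11 nT1 nST1 STc KSc KTc.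
have KII : same_point (KI *m KI) 1%:M.
  exact: luniq (unitmx1 _ _) (lsame _ _ _ _ S11 (same_refl _) (lmul _ _ _ _ _ _ lI lI)) l11.
have KJJ : same_point (KJ *m KJ) 1%:M.
  exact: luniq (unitmx1 _ _) (lsame _ _ _ _ T11 (same_refl _) (lmul _ _ _ _ _ _ lJ lJ)) l11.
have KIJ : same_point (KI *m KJ) (KJ *m KI).
  apply: luniq (lsame _ _ _ _ STc (same_refl _) (lmul _ _ _ _ _ _ lI lJ)) (lmul _ _ _ _ _ _ lJ lI).
  by rewrite unitmx_mul uS uT.
have KCI : same_point (KC *m KI) (KJ *m KC).
  apply: luniq (lsame _ _ _ _ KSc (same_refl _) (lmul _ _ _ _ _ _ lC lI)) (lmul _ _ _ _ _ _ lJ lC).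
  by rewrite unitmx_mul uK uT.
have KCJ : same_point (KC *m KJ) (KI *m KJ *m KC).
  apply: luniq (lsame _ _ _ _ KTc (same_refl _) (lmul _ _ _ _ _ _ lC lJ))
    (lmul _ _ _ _ _ _ (lmul _ _ _ _ _ _ lI lJ) lC).
  by rewrite !unitmx_mul uK uT uS.
have nKI : ~ same_point KI 1%:M.
  move=> E; apply: nS1; apply: (lift_inj _ _ 1%:M) (deckT _ aS) deck1 (unitmx1 _ _) _ l11.
  exact: lsame (same_refl _) E lI.
have nKJ : ~ same_point KJ 1%:M.
  move=> E; apply: nT1; apply: (lift_inj _ _ 1%:M) (deckT _ aT) deck1 (unitmx1 _ _) _ l11.
  exact: lsame (same_refl _) E lJ.
have nKIJ : ~ same_point KI KJ.
  move=> E; apply: nST1; apply: (lift_inj _ _ KJ) (deckT _ aS) (deckT _ aT) uJ _ lJ.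
  exact: lsame (same_refl _) E lI.
have [Q [uQ qI qJ qC]] := A4_conj uI uJ uC KII nKI KJJ nKJ nKIJ KIJ KCI KCJ.
have oQ := conjugator_octa uQ oI oJ oC qI qJ qC.
have [k [nzk bB]] := octa_bin_oct (octaV oQ).
set B := k *: invmx Q in bB.
pose G q := at_pt g (alpha *m q) *m B^T.
have step S0 S K : lifts g S K -> same_point (S *m alpha) (alpha *m S0) ->
    same_point (K *m Q) (Q *m S0) ->
    exists chi, chi != 0 /\ forall q, G (S0 *m q) = chi *: (G q *m S0^T).
  move=> [c [nzc cE]] sS [e [nze eE]].
  have [f [nzf fE]] := at_pt_same hg (same_sym sS).
  exists (f * c * e); split=> [|q]; first by rewrite !mulf_neq0.
  have BK : B *m K = e *: (S0 *m B).
    rewrite /B -scalemxAl -scalemxAr scalerA mulrC -scalerA; congr (_ *: _).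
    by rewrite -[LHS](mulmxK uQ) -(mulmxA _ K Q) eE -scalemxAr mulKmx // -scalemxAl.
  rewrite /G mulmxA fE -mulmxA cE -!scalemxAl scalerA -mulmxA -trmx_mul BK.
  by rewrite linearZ /= -scalemxAr scalerA trmx_mul mulmxA.
have [chiI [nzI GI]] := step _ _ _ lI sI qI.
have [chiJ [nzJ GJ]] := step _ _ _ lJ sJ qJ.
have [chi [nzC GC]] := step _ _ _ lC sC qC.
have GZ c q : G (c *: q) = c ^+ n *: G q.
  by rewrite /G -scalemxAr (at_ptZ _ _ hg) -scalemxAl.
have uB : B \in unitmx by rewrite unitmxZ ?unitfE // unitmx_inv.
have [q0 nzq0] : exists q, G q != 0.
  have [q uq] := ndg; exists (invmx alpha *m q).
  have uG : G (invmx alpha *m q) \in unitmx by rewrite /G mulKVmx // unitmx_mul uq unitmx_tr.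
  by apply: contraTneq uG => ->; rewrite unitmxE det0 unitr0.
have e2 : -1 * -1 = 1 :> C by rewrite mulrNN mulr1.
have rhoN (S : 'M[C]_2) : (- S)^T = -1 *: S^T by rewrite linearN scaleN1r.
have [signn eI eJ chi3] := characters (rho := trmx) (@trmx_mul _ _ _ _) (trmx1 _ _) GZ nzq0
  e2 rhoN nzI nzJ nzC GI GJ GC.
have phi_step S0 S : deck phi S -> same_point (S *m alpha) (alpha *m S0) ->
    exists chi, chi != 0 /\ forall q, at_pt phi (alpha *m (S0 *m q)) = chi *: at_pt phi (alpha *m q).
  move=> [uS' dS] sS; have [f [nzf fE]] := at_pt_same hphi (same_sym sS).
  have fo (M : 'M[C]_2) i j : form 12 (fun x y => at_pt phi (M *m pt x y) i j) by apply: form_entry.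
  have nzA (q : 'cV[C]_2) : q != 0 -> alpha *m q != 0.
    by apply: contraNneq => q0'; rewrite -[q](mulKmx uA) q0' mulmx0.
  have [|q nzq|c [nzc cE]] := @same_const _ 12 _ _ (fun q => at_pt phi (S *m (alpha *m q)))
      (fun q => at_pt phi (alpha *m q)) _ (fo _) (fun q nzq => dS _ (nzA q nzq)).
  - move=> i j; apply: (form_ext (f := fun x y => at_pt phi ((S *m alpha) *m pt x y) i j)) => //.
    by move=> x y; rewrite mulmxA.
  - by apply: curve_at_neq0 cphi _; apply: nzA.
  exists (f * c); split=> [|q]; first by rewrite mulf_neq0.
  by rewrite mulmxA fE -mulmxA cE scalerA.
have nzA (q : 'cV[C]_2) : q != 0 -> alpha *m q != 0.
  by apply: contraNneq => q0'; rewrite -[q](mulKmx uA) q0' mulmx0.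
have [beta [ub bE]] := covering_of_cubics (beta0 := fun q => at_pt phi (alpha *m q))
  (fun i => form_entry alpha (hphi i 0)) (fun q nzq => curve_at_neq0 cphi (nzA q nzq))
  (phi_step _ _ (deckT _ aS) sI) (phi_step _ _ (deckT _ aT) sJ) (phi_step _ _ (deckT _ aK) sC).
exists alpha, beta, B, chi; split=> //=; split=> //.
- apply/negPn/negP => evn; move: signn; rewrite -signr_odd (negbTE evn) expr0 => /eqP.
  by rewrite -subr_eq0 opprK (pnatr_eq0 _ 2).
- by move=> q; have := GI q; rewrite eI scale1r.
- by move=> q; have := GJ q; rewrite eJ scale1r.
Qed.

End Normalize.

(** * The bound on the degree of a lift *)

Section PolyBound.
Variable C : numClosedFieldType.
Implicit Types (p q : {poly C}).

Lemma coprime_roots p q : (forall z, root p z -> q.[z] != 0) -> coprimep p q.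
Proof.
move=> pq; apply/negPn/negP; rewrite /coprimep => /closed_rootP[z].
by rewrite root_gcd => /andP[/pq nzq]; rewrite /root (negbTE nzq).
Qed.

Lemma prod_coprime_dvd (ps : seq {poly C}) D : pairwise (@coprimep _) ps ->
  all (fun p => p %| D) ps -> \prod_(p <- ps) p %| D.
Proof.
elim: ps => [|p ps IHps] /=; first by rewrite big_nil dvd1p.
case/andP=> cop /IHps dvd /andP[pD /dvd psD]; rewrite big_cons Gauss_dvdp ?pD //.
elim: ps cop {IHps dvd psD} => [|r ps IHps] /=; first by rewrite big_nil coprimep1.
by case/andP=> pr /IHps; rewrite big_cons coprimepMr pr.
Qed.

Lemma separable_dvd p q : coprimep p p^`() -> (forall z, root p z -> root q z) -> p %| q.
Proof.
move=> sep pq; have [r pE] := closed_field_poly_normal p.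
have [p0|nzp] := eqVneq p 0.
  move: sep; rewrite p0 deriv0 coprimep0 => /eqp_size.
  by rewrite size_poly0 size_poly1.
have nzl : lead_coef p != 0 by rewrite lead_coef_eq0.
rewrite pE dvdpZl //; apply: uniq_roots_dvdp; last first.
  rewrite uniq_rootsE -separable_prod_XsubC separable_poly.unlock.
  move: sep; rewrite pE derivZ coprimepZl // coprimepZr //.
apply/allP=> z zr; apply: pq; rewrite pE rootZ //.
by rewrite root_prod_XsubC.
Qed.

(** If E divides every combination of two rows evaluated on the product of the
    linear forms w, then it divides the product of the contents e w, because a
    general combination of the primitive parts avoids the zeros of E. The
    contents are pairwise coprime and divide the determinant. *)
Lemma content_bound (a b c d E N : {poly C}) (W : seq (C * C)) :
  let f w := w.1 *: a + w.2 *: b in let h w := w.1 *: c + w.2 *: d in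
  let D := a * d - b * c in
  D != 0 -> E != 0 -> N != 0 ->
  (forall z, ~ [/\ root a z, root b z, root c z & root d z]) ->
  pairwise (fun w w' : C * C => w.1 * w'.2 - w.2 * w'.1 != 0) W ->
  all (fun w => w != (0, 0)) W ->
  (forall u, E %| \prod_(w <- W) (f w - u *: h w)) ->
  N %| D -> (forall z w, root N z -> w \in W -> ~~ (root (f w) z && root (h w) z)) ->
  (size E + size N <= (size D).+1)%N.
Proof.
move=> f h D nzD nzE nzN prim Wind Wnz EW ND NW.
pose e w := gcdp (f w) (h w).
have fE w : f w = w.1 *: a + w.2 *: b by [].
have hE w : h w = w.1 *: c + w.2 *: d by [].
have eD w : w \in W -> e w %| D.
  move=> Ww; have [ef eh] : e w %| f w /\ e w %| h w by rewrite dvdp_gcdl dvdp_gcdr.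
  have : (w.1 != 0) || (w.2 != 0).
    by move: (allP Wnz _ Ww); case: (w) => w1 w2; rewrite xpair_eqE negb_and.
  case/orP=> nz.
    rewrite -(dvdpZr _ _ nz).
    have -> : w.1 *: D = f w * d - b * h w by rewrite fE hE /D -!mul_polyC; ring.
    by apply: dvdp_sub; [apply: dvdp_mulr|apply: dvdp_mull].
  rewrite -(dvdpZr _ _ nz).
  have -> : w.2 *: D = a * h w - f w * c by rewrite fE hE /D -!mul_polyC; ring.
  by apply: dvdp_sub; [apply: dvdp_mull|apply: dvdp_mulr].
have nze w : w \in W -> e w != 0.
  by move=> /eD; apply: contraTneq => ->; rewrite dvd0p.
have root_e w z : root (e w) z = root (f w) z && root (h w) z by rewrite root_gcd.
have cop w w' : w.1 * w'.2 - w.2 * w'.1 != 0 -> coprimep (e w) (e w').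
  move=> nzdet; apply: coprime_roots => z; rewrite root_e => /andP[fz hz].
  apply/negP => ez'; have: root (e w') z by [].
  rewrite root_e => /andP[fz' hz']; apply: (prim z).
  move: fz hz fz' hz'; rewrite /root !fE !hE !hornerD !hornerZ.
  move=> /eqP e1 /eqP e2 /eqP e3 /eqP e4.
  have kill (x y : C) : w.1 * x + w.2 * y = 0 -> w'.1 * x + w'.2 * y = 0 -> x = 0 /\ y = 0.
    move=> E1 E2; split; apply: (mulfI nzdet); rewrite mulr0.
      by transitivity (w'.2 * (w.1 * x + w.2 * y) - w.2 * (w'.1 * x + w'.2 * y));
         [ring | rewrite E1 E2 !mulr0 subrr].
    by transitivity (w.1 * (w'.1 * x + w'.2 * y) - w'.1 * (w.1 * x + w.2 * y));
       [ring | rewrite E1 E2 !mulr0 subrr].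
  have [-> ->] := kill _ _ e1 e3; have [-> ->] := kill _ _ e2 e4.
  by rewrite eqxx.
have [r rE] := closed_field_poly_normal E.
have rootE z : root E z -> z \in r.
  by rewrite rE rootZ ?lead_coef_eq0 // root_prod_XsubC.
pose f' w := f w %/ e w; pose h' w := h w %/ e w.
have f'E w : f w = f' w * e w by rewrite divpK ?dvdp_gcdl.
have h'E w : h w = h' w * e w by rewrite divpK ?dvdp_gcdr.
pose B := \prod_(z <- r) \prod_(w <- W) ((f' w).[z]%:P - (h' w).[z] *: 'X).
have nzB : B != 0.
  rewrite /B prodf_seq_neq0; apply/allP=> z _ /=; rewrite prodf_seq_neq0.
  apply/allP=> w Ww /=; apply/negP => /eqP /polyP P0.
  have := P0 0%N; have := P0 1%N; rewrite !coefB !coefZ !coefX !coefC ?coef0 /=.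
  rewrite mulr1 mulr0 sub0r subr0 => /eqP; rewrite oppr_eq0 => /eqP h0 f0.
  have : coprimep (f' w) (h' w).
    apply: (coprimep_div_gcd _ : coprimep (f w %/ gcdp (f w) (h w)) (h w %/ gcdp (f w) (h w))).
    by move: (nze _ Ww); rewrite gcdp_eq0 negb_and.
  by move/coprimep_root/(_ (_ : root _ z)); rewrite /root f0 h0 eqxx => /(_ isT).
have /closed_nonrootP[u] := nzB.
rewrite /root horner_prod prodf_seq_neq0 => /allP Bu.
have : coprimep E (\prod_(w <- W) (f' w - u *: h' w)).
  apply: coprime_roots => z /rootE zr; rewrite horner_prod.
  have := Bu _ zr; rewrite /= horner_prod.
  by under eq_bigr do rewrite hornerD hornerN hornerC hornerZ hornerX mulrC -hornerZ -hornerN -hornerD.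
have := EW u; have -> : \prod_(w <- W) (f w - u *: h w) =
    \prod_(w <- W) e w * \prod_(w <- W) (f' w - u *: h' w).
  rewrite -big_split /=; apply: eq_bigr => w _.
  by rewrite {1}f'E {1}h'E -!mul_polyC; ring.
move=> dvd copE; move: dvd; rewrite Gauss_dvdpl // => Edvd.
have : \prod_(p <- N :: [seq e w | w <- W]) p %| D.
  apply: prod_coprime_dvd => /=; last first.
    by rewrite ND all_map; apply/allP => w /eD.
  rewrite pairwise_map; apply/andP; split; last by apply: sub_pairwise Wind => w w'; apply: cop.
  rewrite all_map; apply/allP=> w Ww; apply: coprime_roots => z /NW/(_ Ww).
  by rewrite -root_e.
rewrite big_cons big_map => dvd.
have /(dvdp_leq nzD) : E * N %| D.
  by apply: dvdp_trans dvd; rewrite mulrC dvdp_mul.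
by rewrite size_mul // -ltnS prednK // addn_gt0 size_poly_gt0 nzE.
Qed.

End PolyBound.

Section Bound.
Variable C : numClosedFieldType.
Let ii := ii C.
Let ss := ss C.
Let nz2 : (2 : C) != 0. Proof. by rewrite pnatr_eq0. Qed.

(** What is kept of a Galois lift after normalization. Parity of the degree and
    the triviality of the character on the quaternion group are forced. *)
Record equivariant_lift n (chi : C) (G : 'cV[C]_2 -> 'M[C]_2) : Prop := EquivariantLift {
  el_form : forall i j, form n (fun x y => G (pt x y) i j);
  el_prim : forall q, q != 0 -> G q != 0;
  el_unit : exists q, G q \in unitmx;
  el_I : forall q, G (Im C *m q) = G q *m (Im C)^T;
  el_J : forall q, G (Jm C *m q) = G q *m (Jm C)^T;
  el_C : forall q, G (Cm C *m q) = chi *: (G q *m (Cm C)^T);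
  el_chi : chi ^+ 3 = 1;
  el_odd : odd n }.

Lemma at_phi (x y : C) : at_pt (phi_A4 C) (pt x y) = pt (Phif x y ^+ 3) (Psif x y ^+ 3).
Proof.
apply/colP=> i; rewrite ev_at !mxE; case: (ord2P i) => -> /=.
  by rewrite evX ev_Phi.
by rewrite evX ev_Psi.
Qed.

Lemma phi_neq0 (q : 'cV[C]_2) : q != 0 -> at_pt (phi_A4 C) q != 0.
Proof.
rewrite (colE q) at_phi; apply: contraNneq => /eqP.
rewrite !pt_eq0 !expf_eq0 /= => /andP[/eqP e1 /eqP e2].
by have [-> ->] := PhiPsi_eq0 e1 e2; rewrite eqxx.
Qed.

Lemma val6_f1T (M : 'M[C]_2) u v : val6 (f1 M) u v = Omv (M^T *m pt v (- u)).
Proof.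
have [a [b [c [d ->]]]] := mx2_ex M.
by rewrite val6_f1 tr_mx2 mul_mx2_pt Omv_pt /Omf; ring.
Qed.

Lemma octa_val6_f1 (M B : 'M[C]_2) : octa B -> exists c, c != 0 /\
  forall M u v, val6 (f1 (M *m B^T)) u v = c * val6 (f1 M) u v.
Proof.
move=> [_ [c [nzc cE]]]; exists c; split=> // M' u v.
by rewrite !val6_f1T trmx_mul trmxK -mulmxA cE.
Qed.

Lemma val6_neq0 (w : 'cV[C]_7) : w != 0 -> exists u v, val6 w u v != 0.
Proof.
move=> nzw; apply: contrapT => H; case/eqP: nzw; apply: val6_eq0 => u v.
by apply/eqP/negPn/negP => nz; apply: H; exists u, v.
Qed.

Lemma form_val6_comp d (w : C -> C -> 'cV[C]_7) u v :
  (forall k, form d (fun x y => w x y k 0)) -> form d (fun x y => val6 (w x y) u v).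
Proof.
move=> fw; apply: form_sum => k.
by apply: form_ext (formZ (u ^+ (6 - k) * v ^+ k) (fw k)) => x y; rewrite mulrC.
Qed.

Lemma form_Omv_rows n (G : 'cV[C]_2 -> 'M[C]_2) (u v : C) :
  (forall i j, form n (fun x y => G (pt x y) i j)) ->
  form (6 * n) (fun x y => Omv ((G (pt x y))^T *m pt v (- u))).
Proof.
move=> fG; apply: (form_ext (f := fun x y =>
  Omf (v * G (pt x y) ord0 ord0 - u * G (pt x y) ord_max ord0)
      (v * G (pt x y) ord0 ord_max - u * G (pt x y) ord_max ord_max))).
  move=> x y; rewrite [in RHS](mx2P (G _)) tr_mx2 mul_mx2_pt Omv_pt.
  by congr Omf; ring.
by apply: (form_comp (form_Om C)); apply: formB; apply: formZ.
Qed.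

Lemma form_F_phi d (F : 'M[binform C]_(7, 1)) (beta : 'M[C]_2) k :
  F k 0 \is d.-homog -> form (d * 12) (fun x y => at_pt F (beta *m at_pt (phi_A4 C) (pt x y)) k 0).
Proof.
move=> hF; have ff := form_entry beta hF.
have := form_comp ff (form_exp 3 (form_Phi C)) (form_exp 3 (form_Psi C)).
by apply: form_ext => x y; rewrite at_phi.
Qed.

Lemma mul_unit_neq0 (A : 'M[C]_2) (q : 'cV[C]_2) : A \in unitmx -> q != 0 -> A *m q != 0.
Proof.
by move=> uA; apply: contraNneq => q0'; rewrite -[q](mulKmx uA) q0' mulmx0.
Qed.

(** The common factor E of the six-fold composite accounts for the excess of its
    degree 6 n over 72. *)
Lemma f1_factor phi F n (g : 'M[binform C]_2) alpha beta B :
  is_curve n g -> is_curve 6 F -> galois_lift phi F g -> nondeg g ->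
  alpha \in unitmx -> beta \in unitmx -> octa B ->
  (forall q, at_pt phi (alpha *m q) = beta *m at_pt (phi_A4 C) q) ->
  (72 <= 6 * n)%N /\ exists2 E, form (6 * n - 72) E & forall x y u v,
    Omv ((at_pt g (alpha *m pt x y) *m B^T)^T *m pt v (- u)) =
    E x y * val6 (at_pt F (beta *m at_pt (phi_A4 C) (pt x y))) u v.
Proof.
move=> cg cF [_ gF _ _] ndg uA ub oB phiE; have [hg _] := cg; have [hF _] := cF.
have [cB [nzcB cBE]] := octa_val6_f1 1%:M oB.
pose A (k : C * C) x y := Omv ((at_pt g (alpha *m pt x y) *m B^T)^T *m pt k.2 (- k.1)).
pose Bf (k : C * C) x y := val6 (at_pt F (beta *m at_pt (phi_A4 C) (pt x y))) k.1 k.2.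
have AE k x y : A k x y = cB * val6 (f1 (at_pt g (alpha *m pt x y))) k.1 k.2.
  by rewrite -cBE val6_f1T.
have fA k : form (6 * n) (A k).
  apply: form_Omv_rows (fun q => at_pt g (alpha *m q) *m B^T) _ _ _ => i j.
  apply: (form_ext (f := fun x y => B j ord0 * at_pt g (alpha *m pt x y) i ord0 +
     B j ord_max * at_pt g (alpha *m pt x y) i ord_max)).
    by move=> x y; rewrite [RHS]mxE big_ord2 2![B^T _ _]mxE; ring.
  by apply: formD; apply: formZ; apply: form_entry.
have fB k : form 72 (Bf k) by apply: form_val6_comp => l; apply: (form_F_phi _ (d := 6)).
have AB : proportional A Bf.
  move=> k l x y; rewrite !AE /Bf.
  have [->|nz] := eqVneq (f1 (at_pt g (alpha *m pt x y))) 0.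
    by rewrite !val6_0; ring.
  by have [c [_ ->]] := gF _ nz; rewrite phiE !val6Z; ring.
have primB : primitive Bf.
  move=> x y nzq; have := curve_at_neq0 cF (mul_unit_neq0 ub (phi_neq0 (pt_neq0 nzq))).
  by case/val6_neq0 => u [v nz]; exists (u, v).
have [|le72 [E fE EA]] := proportional_primitive fA fB _ AB primB.
  have [q uq] := ndg; have [uB _] := oB.
  pose M := at_pt g q *m B^T.
  have uM : M \in unitmx by rewrite unitmx_mul uq unitmx_tr.
  pose w := invmx M^T *m pt 1 2.
  exists (- (w ord_max 0), w ord0 0), ((invmx alpha *m q) ord0 0), ((invmx alpha *m q) ord_max 0).
  rewrite /A -colE mulKVmx //= opprK -colE mulKVmx ?unitmx_tr // Omv_pt.
  exact: Om12_neq0.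
by split=> //; exists E => // x y u v; rewrite -(EA (u, v)).
Qed.

Section Tetrahedral.
Variables (n : nat) (chi : C) (G : 'cV[C]_2 -> 'M[C]_2).
Hypothesis eG : equivariant_lift n chi G.

Lemma el_scale k q : G (k *: q) = k ^+ n *: G q.
Proof.
rewrite (colE q) scale_pt; apply/matrixP=> i j; rewrite mxE.
exact: (form_scale _ _ _ (el_form eG i j)).
Qed.

Lemma form_el_det : form (n + n) (fun x y => \det (G (pt x y))).
Proof.
apply: (form_ext (f := fun x y =>
  G (pt x y) ord0 ord0 * G (pt x y) ord_max ord_max -
  G (pt x y) ord0 ord_max * G (pt x y) ord_max ord0)).
  by move=> x y; rewrite -det_mx2 -mx2P.
by apply: formB; apply: formM; apply: (el_form eG).
Qed.

Lemma el_chi_neq0 : chi != 0.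
Proof.
by apply/eqP => c0; have /eqP := el_chi eG; rewrite c0 expr0n eq_sym oner_eq0.
Qed.

Lemma cross_eq0 (x y z t : C) : pt x y != 0 -> x * t - y * z = 0 ->
  exists l, pt z t = l *: pt x y.
Proof.
rewrite pt_eq0 negb_and => /orP[] nz /eqP; rewrite subr_eq0 => /eqP E.
  exists (z / x); rewrite scale_pt divfK //; congr pt.
  by apply: (mulfI nz); rewrite E; field.
exists (t / y); rewrite scale_pt divfK //; congr pt.
by apply: (mulfI nz); rewrite -E; field.
Qed.

Lemma kernel_span (M : 'M[C]_2) (x y z t : C) : x * t - y * z != 0 ->
  M *m pt x y = 0 -> M *m pt z t = 0 -> M = 0.
Proof.
have pt0 : 0 = pt 0 0 :> 'cV[C]_2 by apply/colP=> i; rewrite !mxE if_same.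
have [a [b [c [d ->]]]] := mx2_ex M => nz.
rewrite !mul_mx2_pt pt0 => /pt_inj[e1 e2] /pt_inj[e3 e4].
have kill (p q : C) : p * x + q * y = 0 -> p * z + q * t = 0 -> p = 0 /\ q = 0.
  move=> E1 E2; split; apply: (mulfI nz); rewrite mulr0.
    by transitivity (t * (p * x + q * y) - y * (p * z + q * t));
       [ring | rewrite E1 E2 !mulr0 subrr].
  by transitivity (x * (p * z + q * t) - z * (p * x + q * y));
     [ring | rewrite E1 E2 !mulr0 subrr].
have [-> ->] := kill _ _ e1 e3; have [-> ->] := kill _ _ e2 e4.
by apply/matrixP=> i j; rewrite !mxE !if_same.
Qed.

Lemma Om_factor (x y : C) :
  Omf x y = x * y * (x - y) * (x + y) * (x - 'i * y) * (x + 'i * y).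
Proof. by rewrite /Omf; ring: ii. Qed.

(** The quadratic form vanishes at the fixed points of the transpose of Cm, which
    moves all six zeros of Omf. *)
Lemma no_fixed_zero (x y : C) : Omf x y = 0 ->
  (1 + 'i) * x ^+ 2 - 2 * 'i * x * y + (1 - 'i) * y ^+ 2 = 0 -> x = 0 /\ y = 0.
Proof.
have n2 : 2 - 2 * 'i != 0 :> C.
  have n8 : (8 : C) != 0 by rewrite pnatr_eq0.
  apply: contraNneq n8 => E; have <- : (2 - 2 * 'i) * (2 + 2 * 'i) = 8 :> C by ring: ii.
  by rewrite E mul0r.
have n2' : 2 + 2 * 'i != 0 :> C.
  have n8 : (8 : C) != 0 by rewrite pnatr_eq0.
  apply: contraNneq n8 => E; have <- : (2 - 2 * 'i) * (2 + 2 * 'i) = 8 :> C by ring: ii.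
  by rewrite E mulr0.
have n1 : 1 - 'i != 0 :> C by apply: contraNneq n2 => E; have -> : 2 - 2 * 'i = 2 * (1 - 'i) :> C by [ring]; rewrite E mulr0.
have n1' : 1 + 'i != 0 :> C by apply: contraNneq n2' => E; have -> : 2 + 2 * 'i = 2 * (1 + 'i) :> C by [ring]; rewrite E mulr0.
have kill (k z : C) : k != 0 -> k * z ^+ 2 = 0 -> z = 0.
  by move=> nz /eqP; rewrite mulf_eq0 (negbTE nz) expf_eq0 => /eqP.
rewrite Om_factor => /eqP; rewrite !mulf_eq0 -!orbA => /or4P[/eqP->|/eqP->|/eqP E|/or3P[]/eqP E] Q.
- split=> //; apply: (kill _ _ n1); rewrite -Q; ring.
- split=> //; apply: (kill _ _ n1'); rewrite -Q; ring.
- have xE : x = y by apply/eqP; rewrite -subr_eq0 E.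
  have y0 : y = 0 by apply: (kill _ _ n2); rewrite -Q xE; ring.
  by rewrite xE y0.
- have xE : x = - y by apply/eqP; rewrite -addr_eq0 E.
  have y0 : y = 0 by apply: (kill _ _ n2'); rewrite -Q xE; ring.
  by rewrite xE y0 oppr0.
- have xE : x = 'i * y by apply/eqP; rewrite -subr_eq0 E.
  have y0 : y = 0 by apply: (kill _ _ n2); rewrite -Q xE; ring: ii.
  by rewrite xE y0 mulr0.
- have xE : x = - ('i * y) by apply/eqP; rewrite -addr_eq0 E.
  have y0 : y = 0.
    have n2m : - 2 - 2 * 'i != 0 :> C by rewrite -opprD oppr_eq0.
    by apply: (kill _ _ n2m); rewrite -Q xE; ring: ii.
  by rewrite xE y0 mulr0 oppr0.
Qed.

(** Points at which the determinant of the lift vanishes while the contents of the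
    six combinations of its rows do not; they sharpen the bound on the degree. *)
Definition clean q := \det (G q) = 0 /\
  forall w : 'cV[C]_2, w != 0 -> Omv w = 0 -> G q *m w != 0.

(** An invertible value at a fixed point of Cm would make Cm scalar. The kernel of
    the value is stable under the transpose of Cm, hence is none of the six
    zeros of Omf. *)
Lemma clean_fixed q : q != 0 -> (exists l, Cm C *m q = l *: q) -> clean q.
Proof.
move=> nzq [l lE].
have E : chi *: (G q *m (Cm C)^T) = l ^+ n *: G q by rewrite -(el_C eG) lE el_scale.
split.
  apply/eqP/negPn/negP => nzdet.
  have uq : G q \in unitmx by rewrite unitmxE unitfE.
  have : chi *: (Cm C)^T = l ^+ n *: 1%:M.
    by rewrite -[LHS](mulKmx uq) -scalemxAr E -scalemxAr mulVmx.
  rewrite tr_mx2 mx2_1 !scale_mx2 => /mx2_inj[_ /eqP + _ _].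
  have n1 : 2^-1 * (1 - 'i) != 0 :> C.
    rewrite mulf_neq0 ?invr_eq0 //; apply: contraNneq nz2 => E1.
    have <- : (1 - 'i) * (1 + 'i) = 2 :> C by ring: ii.
    by rewrite E1 mul0r.
  by rewrite mulr0 mulrN oppr_eq0 mulf_eq0 (negbTE el_chi_neq0) (negbTE n1).
move=> w nzw Ow; apply/eqP => Gw.
have Gw' : G q *m ((Cm C)^T *m w) = 0.
  apply: (scalerI el_chi_neq0); rewrite mulmxA scalemxAl E -scalemxAl Gw !scaler0 //.
move: nzw Ow Gw Gw'; rewrite (colE w); move: (w _ _) (w _ _) => y x.
rewrite Omv_pt tr_mx2 mul_mx2_pt => nzw Ow Gw Gw'.
set z := _ + _ in Gw'; set t := _ + _ in Gw'.
have [Q|nz] := eqVneq (x * t - y * z) 0; last first.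
  by have := el_prim eG nzq; rewrite (kernel_span nz Gw Gw') eqxx.
have [] := no_fixed_zero Ow (_ : _ = 0).
  have -> : (1 + 'i) * x ^+ 2 - 2 * 'i * x * y + (1 - 'i) * y ^+ 2 = 2 * (x * t - y * z).
    by rewrite /z /t; field.
  by rewrite Q mulr0.
by move=> x0 y0; move: nzw; rewrite x0 y0 pt_eq0 eqxx.
Qed.

Lemma clean_move T q : T \in unitmx -> octa T -> (forall q, G (T *m q) = G q *m T^T) ->
  clean (T *m q) -> clean q.
Proof.
move=> uT oT GT [d0 cl]; move: d0 cl; rewrite GT det_mulmx det_tr => /eqP.
move: (uT); rewrite unitmxE unitfE mulf_eq0 => /negbTE -> /=; rewrite orbF => /eqP d0 cl.
split=> // w nzw Ow; have uTT : T^T \in unitmx by rewrite unitmx_tr.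
have := cl (invmx T^T *m w); rewrite -mulmxA mulKVmx //; apply.
  by apply: contraNneq nzw => w0; rewrite -[w](mulKVmx uTT) w0 mulmx0.
have [_ [c [nzc cE]]] := octaV (octaT oT).
by rewrite cE Ow mulr0.
Qed.

(** The zeros of Phi Psi are the fixed points of the elements of order 3. There
    the lift is singular, but its kernel is not one of the six zeros of Omf. *)
Lemma clean_PhiPsi x y : pt x y != 0 -> Phif x y * Psif x y = 0 -> clean (pt x y).
Proof.
move=> nzq PP.
pose cr (x y : C) := x * cy x y - y * cx x y.
have crP (z t : C) : pt z t != 0 -> cr z t = 0 -> clean (pt z t).
  by move=> nz /(cross_eq0 nz)[l lE]; apply: clean_fixed => //; exists l; rewrite Cm_pt.
have : cr x y * cr ('i * x) (- ('i * y)) * cr (- y) x * cr ('i * - y) (- ('i * x)) = 0.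
  rewrite -[RHS](mulr0 (4^-1)) -PP /cr /cx /cy /Phif /Psif.
  by field: ii ss; rewrite ?nz2 ?pnatr_eq0.
have IM := clean_move (unit_Im C) (octa_Im C) (el_I eG).
have JM := clean_move (unit_Jm C) (octa_Jm C) (el_J eG).
have nzM (T : 'M[C]_2) (q : 'cV[C]_2) : T \in unitmx -> q != 0 -> T *m q != 0.
  exact: mul_unit_neq0.
move/eqP; rewrite !mulf_eq0 -!orbA => /or4P[]/eqP E.
- exact: crP nzq E.
- apply: IM; rewrite Im_pt; apply: crP E; rewrite -Im_pt; exact: nzM (unit_Im C) nzq.
- apply: JM; rewrite Jm_pt; apply: crP E; rewrite -Jm_pt; exact: nzM (unit_Jm C) nzq.
- apply: JM; apply: IM; rewrite Jm_pt Im_pt; apply: crP E; rewrite -Im_pt -Jm_pt.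
  exact: nzM (unit_Im C) (nzM _ _ (unit_Jm C) nzq).
Qed.

Lemma el_Omv_neq0 q : G q \in unitmx -> exists u v, Omv ((G q)^T *m pt v (- u)) != 0.
Proof.
move=> uq; pose w := invmx (G q)^T *m pt 1 2.
exists (- w ord_max 0), (w ord0 0); rewrite opprK -colE mulKVmx ?unitmx_tr // Omv_pt.
exact: Om12_neq0.
Qed.

Definition oct_points : seq (C * C) :=
  [:: (1, 0); (0, 1); (1, -1); (1, 1); (1, - 'i); (1, 'i)].

Lemma oct_pointsP (a b : C) : Omf a b = \prod_(w <- oct_points) (w.1 * a + w.2 * b).
Proof. by rewrite /oct_points !big_cons big_nil Om_factor /=; ring. Qed.

Lemma oct_points_zero w : w \in oct_points -> pt w.1 w.2 != 0 /\ Omf w.1 w.2 = 0.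
Proof.
rewrite !inE => /or4P[/eqP->|/eqP->|/eqP->|/or3P[]/eqP->] /=;
  by rewrite pt_eq0 oner_eq0 ?andbF; split=> //; rewrite /Omf; ring: ii.
Qed.

Lemma oct_points_pairwise :
  pairwise (fun w w' : C * C => w.1 * w'.2 - w.2 * w'.1 != 0) oct_points.
Proof.
have n1 : 1 - 'i != 0 :> C.
  apply: contraNneq nz2 => E; have <- : (1 - 'i) * (1 + 'i) = 2 :> C by ring: ii.
  by rewrite E mul0r.
have n2 : 1 + 'i != 0 :> C.
  apply: contraNneq nz2 => E; have <- : (1 - 'i) * (1 + 'i) = 2 :> C by ring: ii.
  by rewrite E mulr0.
have n3 := neq0Ci C; have n4 := oner_neq0 C.
have neq (a b : C) : b != 0 -> (a = b) \/ (a = - b) -> a != 0.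
  by move=> nz [->|->]; rewrite ?oppr_eq0.
rewrite /oct_points /= !andbT; do ?[apply/andP; split];
  first [ by apply: (neq _ _ n4); first [by left; ring | by right; ring]
        | by apply: (neq _ _ n3); first [by left; ring | by right; ring]
        | by apply: (neq _ _ nz2); first [by left; ring | by right; ring]
        | by apply: (neq _ _ n1); first [by left; ring | by right; ring]
        | by apply: (neq _ _ n2); first [by left; ring | by right; ring]
        | by apply: (neq _ _ (mulf_neq0 nz2 n3)); first [by left; ring | by right; ring] ].
Qed.

(** Degrees: on a general line E times Phi Psi divides the determinant, so that
    (6 n - 72) + 8 is at most 2 n. *)
Lemma degree_bound E m : form m E -> (72 + m = 6 * n)%N ->
  (forall u v, exists2 h, form 72 h &
     forall x y, Omv ((G (pt x y))^T *m pt v (- u)) = E x y * h x y) ->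
  (n <= 16)%N.
Proof.
move=> fE mE Eh; have [q1 uq1] := el_unit eG.
set x1 := q1 ord0 0; set y1 := q1 ord_max 0.
have q1E : q1 = pt x1 y1 by apply: colE.
have nzq1 : pt x1 y1 != 0.
  apply/eqP=> q10; have : G q1 = 0.
    have n_gt0 : (0 < n)%N by case: (n) (el_odd eG).
    by rewrite q1E q10 -(scale0r q1) el_scale expr0n eqn0Ngt n_gt0 scale0r.
  by move=> G0; move: uq1; rewrite G0 unitmxE det0 unitr0.
have [x0 [y0 nz01]] : exists x0 y0, x0 * y1 - y0 * x1 != 0.
  move: nzq1; rewrite pt_eq0 negb_and => /orP[nz|nz].
    by exists 0, (-1); rewrite mul0r mulN1r sub0r opprK.
  by exists 1, 0; rewrite mul1r mul0r subr0.
have nzl (z : C) : pt (x0 + z * x1) (y0 + z * y1) != 0.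
  rewrite pt_eq0; apply: contraNN nz01 => /andP[/eqP e1 /eqP e2].
  have -> : x0 * y1 - y0 * x1 = (x0 + z * x1) * y1 - (y0 + z * y1) * x1 by ring.
  by rewrite e1 e2 !mul0r subrr.
have line f d := @form_line C d f x0 y0 x1 y1.
have [a [aE _ _]] := line _ _ (el_form eG ord0 ord0).
have [b [bE _ _]] := line _ _ (el_form eG ord0 ord_max).
have [c [cE _ _]] := line _ _ (el_form eG ord_max ord0).
have [d [dE _ _]] := line _ _ (el_form eG ord_max ord_max).
have [D [DE szD lcD]] := line _ _ form_el_det.
have [Eh' [EE _ lcE]] := line _ _ fE.
have fPP : form 8 (fun x y => Phif x y * Psif x y) := formM (form_Phi C) (form_Psi C).
have [N [NE _ lcN]] := line _ _ fPP.
have Dabcd : a * d - b * c = D.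
  apply/eqP; rewrite -subr_eq0; apply/eqP/poly_inf0 => z.
  rewrite hornerD hornerN hornerD hornerN !hornerM aE bE cE dE DE.
  by rewrite [in \det _](mx2P (G _)) det_mx2 subrr.
have nzlcD : D`_(n + n) != 0 by rewrite lcD -q1E -unitfE -unitmxE.
have nzD : D != 0 by apply: contraNneq nzlcD => ->; rewrite coef0.
have szD' : (size D <= (n + n).+1)%N by [].
have big p k : p`_k != 0 -> (k < size p)%N.
  by apply: contraR; rewrite -leqNgt => /(nth_default 0) ->.
have szE : (m < size Eh')%N.
  apply: big; rewrite lcE; have [u [v]] := el_Omv_neq0 uq1.
  by have [h _ hE] := Eh u v; rewrite q1E hE mulf_eq0 => /norP[].
have szN : (8 < size N)%N.
  apply: big; rewrite lcN; apply/eqP => PP; have [d0 _] := clean_PhiPsi nzq1 PP.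
  by move: uq1; rewrite unitmxE q1E d0 unitr0.
have nzE : Eh' != 0 by rewrite -size_poly_gt0; apply: leq_ltn_trans szE.
have nzN : N != 0 by rewrite -size_poly_gt0; apply: leq_ltn_trans szN.
have GE z : G (pt (x0 + z * x1) (y0 + z * y1)) = mx2 a.[z] b.[z] c.[z] d.[z].
  by rewrite aE bE cE dE -mx2P.
have := @content_bound C a b c d Eh' N oct_points.
rewrite Dabcd => /(_ nzD nzE nzN) bound.
suff : (size Eh' + size N <= (size D).+1)%N.
  move: szE szN szD' mE; move: (size Eh') (size N) (size D); clear.
  by move=> e k l; lia.
apply: bound.
- move=> z [/eqP az /eqP bz /eqP cz /eqP dz].
  have := el_prim eG (nzl z); rewrite GE az bz cz dz => /eqP; apply.
  by apply/matrixP=> i j; rewrite !mxE !if_same.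
- exact: oct_points_pairwise.
- apply/allP=> w /oct_points_zero[]; case: w => w1 w2 /=.
  by rewrite pt_eq0 xpair_eqE.
- move=> u; have [h fh hE] := Eh u 1.
  have [H [HE _ _]] := line _ _ fh.
  apply/dvdpP; exists H; apply/eqP; rewrite -subr_eq0; apply/eqP/poly_inf0 => z.
  rewrite hornerD hornerN hornerM HE EE mulrC -hE GE tr_mx2 mul_mx2_pt Omv_pt oct_pointsP.
  rewrite horner_prod; apply/eqP; rewrite subr_eq0; apply/eqP; apply: eq_bigr => w _.
  by rewrite !(hornerD, hornerN, hornerZ); ring.
- apply: separable_dvd; last first.
    move=> z; rewrite /root NE => /eqP PP; rewrite DE.
    by have [-> _] := clean_PhiPsi (nzl z) PP.
  pose Xh : {poly C} := x0%:P + x1 *: 'X; pose Yh : {poly C} := y0%:P + y1 *: 'X.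
  have NX : N = Xh ^+ 8 + 14 * (Xh ^+ 4 * Yh ^+ 4) + Yh ^+ 8.
    apply/eqP; rewrite -subr_eq0; apply/eqP/poly_inf0 => z.
    rewrite hornerD hornerN NE; have -> : (14 : {poly C}) = 14%:P by rewrite -polyC_natr.
    rewrite /Xh /Yh !(hornerD, hornerM, hornerZ, horner_exp, hornerC, hornerX).
    by rewrite /Phif /Psif; ring: ss.
  have dX : Xh^`() = x1%:P by rewrite derivD derivC derivZ derivX add0r alg_polyC.
  have dY : Yh^`() = y1%:P by rewrite derivD derivC derivZ derivX add0r alg_polyC.
  have dN : N^`() = x1%:P * (8 * Xh ^+ 3 * (Xh ^+ 4 + 7 * Yh ^+ 4))
     + y1%:P * (8 * Yh ^+ 3 * (Yh ^+ 4 + 7 * Xh ^+ 4)).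
    have dpow (V : {poly C}) v k : V^`() = v%:P -> (V ^+ k.+1)^`() = k.+1%:R * v%:P * V ^+ k.
      by move=> dV; rewrite deriv_exp dV /= -mulr_natl mulrA.
    have dsum (U8 U4 V4 V8 u8 u4 v4 v8 : {poly C}) : U8^`() = u8 -> U4^`() = u4 -> V4^`() = v4 ->
        V8^`() = v8 -> (U8 + 14 * (U4 * V4) + V8)^`() = u8 + 14 * (u4 * V4 + U4 * v4) + v8.
      move=> <- <- <- <-; have -> : (14 : {poly C}) = 14%:P by rewrite -polyC_natr.
      by rewrite 2!derivD derivM derivC mul0r add0r derivM.
    rewrite NX (dsum _ _ _ _ _ _ _ _ (dpow _ _ 7%N dX) (dpow _ _ 3%N dX) (dpow _ _ 3%N dY) (dpow _ _ 7%N dY)).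
    by move: (Xh) (Yh) (x1%:P) (y1%:P) => U V u v; ring.
  have XE z : Xh.[z] = x0 + z * x1.
    by rewrite hornerD hornerC hornerZ hornerX mulrC.
  have YE z : Yh.[z] = y0 + z * y1.
    by rewrite hornerD hornerC hornerZ hornerX mulrC.
  have hn k z : ((k%:R : {poly C})).[z] = k%:R by rewrite -polyC_natr hornerC.
  have N'E z : N^`().[z] = x1 * (8 * (x0 + z * x1) ^+ 3 * ((x0 + z * x1) ^+ 4 + 7 * (y0 + z * y1) ^+ 4))
     + y1 * (8 * (y0 + z * y1) ^+ 3 * ((y0 + z * y1) ^+ 4 + 7 * (x0 + z * x1) ^+ 4)).
    rewrite dN; move: (Xh) (Yh) (XE z) (YE z) => U V <- <-.
    by do ?[rewrite hornerD | rewrite hornerM | rewrite horner_exp | rewrite hornerC | rewrite hn].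
  apply: coprime_roots => z; rewrite /root NE N'E => /eqP PP; apply/negP => /eqP Q.
  have nzXY := nzl z; have nzdet := nz01.
  have detE : x0 * y1 - y0 * x1 = (x0 + z * x1) * y1 - (y0 + z * y1) * x1 by ring.
  rewrite {}detE in nzdet; move: nzXY nzdet PP Q.
  move: (x0 + z * x1) (y0 + z * y1) => X Y nzXY nzdet PP Q.
  set Gx := 8 * X ^+ 3 * _ in Q; set Gy := 8 * Y ^+ 3 * _ in Q.
  have euler : X * Gx + Y * Gy = 0.
    by rewrite -[RHS](mulr0 8) -PP /Gx /Gy /Phif /Psif; ring: ss.
  have Gx0 : Gx = 0.
    apply: (mulfI nzdet); rewrite mulr0.
    transitivity (y1 * (X * Gx + Y * Gy) - Y * (x1 * Gx + y1 * Gy)); first by ring.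
    by rewrite euler Q !mulr0 subrr.
  have Gy0 : Gy = 0.
    apply: (mulfI nzdet); rewrite mulr0.
    transitivity (X * (x1 * Gx + y1 * Gy) - x1 * (X * Gx + Y * Gy)); first by ring.
    by rewrite euler Q !mulr0 subrr.
  have n8 : (8 : C) != 0 by rewrite pnatr_eq0.
  have n7 : (7 : C) != 0 by rewrite pnatr_eq0.
  have n48 : (48 : C) != 0 by rewrite pnatr_eq0.
  have kill (U V : C) : 8 * U ^+ 3 * (U ^+ 4 + 7 * V ^+ 4) = 0 ->
      8 * V ^+ 3 * (V ^+ 4 + 7 * U ^+ 4) = 0 -> U = 0.
    move=> /eqP; rewrite mulf_eq0 mulf_eq0 expf_eq0 (negbTE n8) /= => /orP[/eqP-> //|/eqP e1].
    have U4 : U ^+ 4 = - (7 * V ^+ 4) by apply/eqP; rewrite -addr_eq0 e1.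
    rewrite U4 => /eqP; rewrite mulf_eq0 mulf_eq0 expf_eq0 (negbTE n8) /= => /orP[|] /eqP V0.
      by apply/eqP; rewrite -[U == 0]/((0 < 4)%N && (U == 0)) -expf_eq0 U4 V0 expr0n mulr0 oppr0.
    have V4 : V ^+ 4 = 0 by apply: (mulfI n48); rewrite mulr0 -[RHS]oppr0 -V0; ring.
    by apply/eqP; rewrite -[U == 0]/((0 < 4)%N && (U == 0)) -expf_eq0 U4 V4 mulr0 oppr0.
  by move: nzXY; rewrite (kill _ _ Gx0 Gy0) (kill _ _ Gy0 Gx0) pt_eq0 eqxx.
- move=> z w; rewrite /root NE => /eqP PP Ww.
  have [_ cl] := clean_PhiPsi (nzl z) PP; have [nzw Ow] := oct_points_zero Ww.
  have := cl _ nzw; rewrite Omv_pt Ow GE mul_mx2_pt => /(_ erefl).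
  rewrite pt_eq0 !hornerD !hornerZ; apply: contraNN.
  by rewrite ![_ * w.1]mulrC ![_ * w.2]mulrC.
Qed.

End Tetrahedral.
End Bound.

(** * Classification of the equivariant lifts *)

Section Rows.
Variable C : numClosedFieldType.
Let ii := ii C.
Let ss := ss C.
Let nz2 : (2 : C) != 0. Proof. by rewrite pnatr_eq0. Qed.
Local Notation s := (sqrtm3 C).

(** The laws under which a row of an equivariant lift transforms. *)
Record row_equivariant (chi : C) (a b : C -> C -> C) : Prop := RowEquivariant {
  row_aI : forall x y, a ('i * x) (- ('i * y)) = 'i * a x y;
  row_bI : forall x y, b ('i * x) (- ('i * y)) = - ('i * b x y);
  row_aJ : forall x y, a (- y) x = - b x y;
  row_bJ : forall x y, b (- y) x = a x y;
  row_aC : forall x y, a (cx x y) (cy x y) = chi * cx (a x y) (b x y);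
  row_bC : forall x y, b (cx x y) (cy x y) = chi * cy (a x y) (b x y) }.

(** As (a, b) transforms like (x, y), their determinant is a semi-invariant. *)
Lemma row_det chi a b : row_equivariant chi a b ->
  Q8_inv (fun x y => x * b x y - y * a x y) /\
  forall x y, cx x y * b (cx x y) (cy x y) - cy x y * a (cx x y) (cy x y) =
              chi * (x * b x y - y * a x y).
Proof.
move=> [aI bI aJ bJ aC bC]; split; first split=> x y.
- by rewrite aI bI; ring: ii.
- by rewrite aJ bJ; ring.
- by move=> x y; rewrite aC bC; move: (a x y) (b x y) => A B; rewrite /cx /cy; field: ii.
Qed.

(** The turned gradient of the semi-invariant Psi transforms like (x, y). *)
Lemma row_psi kappa f : Q8_inv f -> (forall x y, f (cx x y) (cy x y) = kappa * f x y) ->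
  row_equivariant (kappa * om1 C) (fun x y => - (f x y * dPy x y)) (fun x y => f x y * dPx x y).
Proof.
move=> [fI fJ] fC; split=> x y; rewrite ?fI ?fJ ?fC; move: (f x y) => z.
- by rewrite /dPy; ring: ii.
- by rewrite /dPx; ring: ii.
- by rewrite /dPx /dPy; ring.
- by rewrite /dPx /dPy; ring.
- by rewrite /dPx /dPy /cx /cy /om1; field: ii ss.
- by rewrite /dPx /dPy /cx /cy /om1; field: ii ss.
Qed.

Lemma row_sub chi k a b a' b' : row_equivariant chi a b -> row_equivariant chi a' b' ->
  row_equivariant chi (fun x y => a x y - k * a' x y) (fun x y => b x y - k * b' x y).
Proof.
move=> [aI bI aJ bJ aC bC] [aI' bI' aJ' bJ' aC' bC']; split=> x y.
- by rewrite aI aI'; ring.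
- by rewrite bI bI'; ring.
- by rewrite aJ aJ'; ring.
- by rewrite bJ bJ'.
- by rewrite aC aC' /cx; ring.
- by rewrite bC bC' /cy; ring.
Qed.

(** As x and y have no common factor, x divides a; cancelling x, y and cx shows
    that the quotient is a semi-invariant. *)
Lemma row_radial d chi a b : form d.+1 a -> form d.+1 b -> row_equivariant chi a b ->
  (forall x y, x * b x y = y * a x y) ->
  exists D, [/\ form d D, Q8_inv D, forall x y, D (cx x y) (cy x y) = chi * D x y &
    forall x y, a x y = x * D x y /\ b x y = y * D x y].
Proof.
move=> fa fb [aI bI aJ bJ aC bC] E.
have a01 : a 0 1 = 0 by have := E 0 1; rewrite mul0r mul1r.
have nz01 : (0, 1) != (0, 0) :> C * C by rewrite xpair_eqE oner_eq0 andbF.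
have [D fD aE] := form_div fa nz01 a01.
have {}aE x y : a x y = x * D x y by rewrite aE; ring.
have fx : form 1 (fun x _ : C => x) := formx C.
have nzx : nonzero (fun x _ : C => x) by exists 1, 1; apply: oner_neq0.
have fyD : form d.+1 (fun x y => y * D x y) by rewrite -add1n; apply: formM fD; apply: formy.
have bE := form_cancel fx nzx fb fyD (fun x y => _ : x * b x y = x * (y * D x y)).
have {}bE x y : b x y = y * D x y by apply: bE => u v; rewrite E aE; ring.
have sub g h : form 1 g -> form 1 h -> form d (fun x y => D (g x y) (h x y)).
  exact: form_subst fD.
exists D; split=> //; first split.
- apply: (form_cancel (d := d) fx nzx) => //.
    by apply: sub; form_tac.
  move=> x y; apply: (mulfI (neq0Ci C)).
  by rewrite -aE -aI aE; ring.
- apply: (form_cancel (d := d) (formy C) _) => //.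
  + by exists 1, 1; apply: oner_neq0.
  + by apply: sub; form_tac.
  by move=> x y; apply/eqP; rewrite -eqr_opp -mulNr -aE aJ bE.
- have := (form_cancel (d := d) (f := fun x y => D (cx x y) (cy x y)) (g := fun x y => chi * D x y) (b := cx (C := C))).
  apply.
  + rewrite /cx; form_tac.
  + exists 1, 0; rewrite /cx addr0 mulr1 mulf_neq0 ?invr_eq0 //.
    apply: contraNneq nz2 => E1; have <- : (1 - 'i) * (1 + 'i) = 2 :> C by ring: ii.
    by rewrite E1 mulr0.
  + by apply: sub; rewrite /cx /cy; form_tac.
  + exact: formZ.
  by move=> x y; rewrite -aE aC aE bE /cx; ring.
Qed.

Lemma dP_euler (x y : C) : x * dPx x y + y * dPy x y = Psif x y.
Proof. by rewrite /dPx /dPy /Psif; ring. Qed.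

Lemma Q8_Phi : Q8_inv (@Phif C).
Proof. by split=> x y; rewrite /Phif; ring: ii. Qed.
Lemma Q8_Psi : Q8_inv (@Psif C).
Proof. by split=> x y; rewrite /Psif; ring: ii. Qed.
Lemma Q8_Om : Q8_inv (@Omf C).
Proof. by split=> x y; rewrite /Omf; ring: ii. Qed.

Lemma om_sub : om1 C - om2 C != 0.
Proof.
have nz3 : (3 : C) != 0 by rewrite pnatr_eq0.
have -> : om1 C - om2 C = s by rewrite /om1 /om2; field.
by apply/eqP=> s0; have /eqP := ss; rewrite s0 mul0r eq_sym oppr_eq0 (negbTE nz3).
Qed.

Let kill (k z : C) : k != 0 -> z * k = 0 -> z = 0.
Proof. by move=> nz /eqP; rewrite mulf_eq0 (negbTE nz) orbF => /eqP. Qed.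

Lemma quad_eq0 (a0 a1 a2 : C) :
  (forall x y, Omf x y * (a0 * Phif x y ^+ 2 + a1 * (Phif x y * Psif x y) + a2 * Psif x y ^+ 2) = 0) ->
  [/\ a0 = 0, a1 = 0 & a2 = 0].
Proof.
move=> E.
pose q x y := a0 * Phif x y ^+ 2 + a1 * (Phif x y * Psif x y) + a2 * Psif x y ^+ 2.
have fq : form 8 q by have f1 := form_Phi C; have f2 := form_Psi C; rewrite /q; form_tac.
have q0 := form_mul0 (form_Om C) fq E (nonzero_Om C).
have Q X Y : a0 * X ^+ 2 + a1 * (X * Y) + a2 * Y ^+ 2 = 0.
  by have [x [y [<- <-]]] := PhiPsi_surj X Y; apply: q0.
have e0 : a0 = 0 by rewrite -(Q 1 0); ring.
have e2 : a2 = 0 by rewrite -(Q 0 1); ring.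
by split=> //; rewrite -(Q 1 1) e0 e2; ring.
Qed.

(** The determinant against (x, y) is Omega times a quadratic form in Phi and Psi,
    and the trivial character leaves Omega Phi Psi. By the identity of Euler this
    is the determinant of Omega Phi times the turned gradient of Psi. The
    difference is radial, the factor being an invariant of degree 12. *)
Lemma row_classify13 a b : form 13 a -> form 13 b -> row_equivariant 1 a b ->
  exists m0 m1 m2, forall x y,
   a x y = m0 * (x * Omf x y ^+ 2) + m1 * (x * Phif x y ^+ 3) - m2 * (Omf x y * Phif x y * (4 * dPy x y)) /\
   b x y = m0 * (y * Omf x y ^+ 2) + m1 * (y * Phif x y ^+ 3) + m2 * (Omf x y * Phif x y * (4 * dPx x y)).
Proof.
move=> fa fb eab; have [Pinv PC] := row_det eab.
have fP : form 14 (fun x y => x * b x y - y * a x y) by form_tac.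
have [a0 [a1 [a2 PE]]] := Q8_inv14 fP Pinv.
have w1 := om11 C; have w2 := om22 C; have w12 := om12 C.
have [e0 _ e2] : [/\ a0 * (om1 C - 1) = 0, 0 * 0 = 0 :> C & a2 * (om2 C - 1) = 0].
  rewrite mulr0; have [] := @quad_eq0 (a0 * (om1 C - 1)) 0 (a2 * (om2 C - 1)) => // x y.
  have := PC x y; rewrite (PE x y) (PE (cx x y) (cy x y)) Phi_c Psi_c Om_c => /eqP.
  rewrite -subr_eq0 => /eqP E0; rewrite -[RHS]E0 {E0}; move: (Omf x y) (Phif x y) (Psif x y) => O X Y.
  by move: (om1 C) (om2 C) w1 w2 w12 => o1 o2 {}w1 {}w2 {}w12; ring: w1 w2 w12.
have {}e0 := kill (om1_neq1 C) e0; have {}e2 := kill (om2_neq1 C) e2.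
have {}PE x y : x * b x y - y * a x y = a1 * (Omf x y * Phif x y * Psif x y).
  by rewrite PE e0 e2; ring.
have [OI OJ] := Q8_Om; have [FI FJ] := Q8_Phi.
have inv3 : Q8_inv (fun x y : C => Omf x y * Phif x y).
  by split=> x y /=; rewrite ?OI ?OJ ?FI ?FJ.
have /(row_sub a1 eab) r' : row_equivariant 1 (fun x y => - (Omf x y * Phif x y * dPy x y))
     (fun x y => Omf x y * Phif x y * dPx x y).
  have -> : 1 = om2 C * om1 C by rewrite mulrC om12.
  by apply: row_psi => // x y; rewrite Om_c Phi_c; ring.
have fO := form_Om C; have fF := form_Phi C; have fx := form_dPx C; have fy := form_dPy C.
have fa' : form 13 (fun x y => a x y - a1 * - ((Omf x y * Phif x y) * dPy x y)) by form_tac.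
have fb' : form 13 (fun x y => b x y - a1 * ((Omf x y * Phif x y) * dPx x y)) by form_tac.
have /(row_radial fa' fb' r')[D [fD Dinv DC DE]] : forall x y,
    x * (b x y - a1 * ((Omf x y * Phif x y) * dPx x y)) = y * (a x y - a1 * - ((Omf x y * Phif x y) * dPy x y)).
  move=> x y; apply/eqP; rewrite -subr_eq0; apply/eqP.
  transitivity ((x * b x y - y * a x y) - a1 * (Omf x y * Phif x y) * (x * dPx x y + y * dPy x y)); first by ring.
  by rewrite PE dP_euler; ring.
have [d0 [d1 [d2 [d3 D12]]]] := Q8_inv12 fD Dinv.
have [_ e1' e2' _] : [/\ 0 = 0 :> C, d1 * (om2 C - 1) = 0, d2 * (om1 C - 1) = 0 & 0 = 0 :> C].
  apply: cubic_eq0 => x y.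
  have := DC x y; rewrite !D12 Phi_c Psi_c => /eqP; rewrite -subr_eq0 => /eqP E0; rewrite -[RHS]E0 {E0}.
  move: (Phif x y) (Psif x y) => X Y.
  by move: (om1 C) (om2 C) w1 w2 w12 => o1 o2 {}w1 {}w2 {}w12; ring: w1 w2 w12.
have {}e1' := kill (om2_neq1 C) e1'; have {}e2' := kill (om1_neq1 C) e2'.
have nz4 : (4 : C) != 0 by rewrite pnatr_eq0.
exists (d3 * 12 * s), (d0 + d3), (a1 / 4) => x y.
have {}DE := DE x y; have DE' : D x y = (d0 + d3) * Phif x y ^+ 3 + d3 * 12 * s * Omf x y ^+ 2.
  by rewrite D12 e1' e2' XZ_rel; ring.
rewrite DE' in DE; case: DE => Ea Eb; split.
  by rewrite -[a x y](subrK (a1 * - (Omf x y * Phif x y * dPy x y))) Ea; field; rewrite ?nz4.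
by rewrite -[b x y](subrK (a1 * (Omf x y * Phif x y * dPx x y))) Eb; field; rewrite ?nz4.
Qed.

(** The same argument as in row_classify13, with a quartic in Phi and Psi as
    determinant, divisible by Psi because of the character, and with a radial
    factor of degree 14. *)
Lemma row_classify15 a b : form 15 a -> form 15 b -> row_equivariant (om1 C) a b ->
  exists m0 m1 m2, forall x y,
   a x y = m0 * (x * Omf x y * Phif x y ^+ 2) - m1 * (Omf x y ^+ 2 * (4 * dPy x y))
          - m2 * (Phif x y ^+ 3 * (4 * dPy x y)) /\
   b x y = m0 * (y * Omf x y * Phif x y ^+ 2) + m1 * (Omf x y ^+ 2 * (4 * dPx x y))
          + m2 * (Phif x y ^+ 3 * (4 * dPx x y)).
Proof.
move=> fa fb eab; have [Pinv PC] := row_det eab.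
have fP : form 16 (fun x y => x * b x y - y * a x y) by form_tac.
have [a0 [a1 [a2 [a3 [a4 PE]]]]] := Q8_inv16 fP Pinv.
have w1 := om11 C; have w2 := om22 C; have w12 := om12 C.
have E X Y : a0 * (om2 C - om1 C) * X ^+ 4 + a2 * (1 - om1 C) * (X ^+ 2 * Y ^+ 2)
     + a3 * (om2 C - om1 C) * (X * Y ^+ 3) = 0.
  have [x [y [<- <-]]] := PhiPsi_surj X Y.
  have := PC x y; rewrite (PE x y) (PE (cx x y) (cy x y)) Phi_c Psi_c => /eqP.
  rewrite -subr_eq0 => /eqP E0; rewrite -[RHS]E0 {E0}; move: (Phif x y) (Psif x y) => {}X {}Y.
  by move: (om1 C) (om2 C) w1 w2 w12 => o1 o2 {}w1 {}w2 {}w12; ring: w1 w2 w12.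
have n12 : om2 C - om1 C != 0 by rewrite -opprB oppr_eq0 om_sub.
have n1 : 1 - om1 C != 0 by rewrite -opprB oppr_eq0 om1_neq1.
have e0 : a0 = 0 by apply: (kill n12); rewrite -(E 1 0); ring.
have e23 : a2 * (1 - om1 C) + a3 * (om2 C - om1 C) = 0 by rewrite -(E 1 1) e0; ring.
have e23' : a2 * (1 - om1 C) - a3 * (om2 C - om1 C) = 0 by rewrite -(E 1 (-1)) e0; ring.
have e2 : a2 = 0.
  apply: (kill n1); apply: (kill nz2).
  transitivity ((a2 * (1 - om1 C) + a3 * (om2 C - om1 C)) + (a2 * (1 - om1 C) - a3 * (om2 C - om1 C))); first by ring.
  by rewrite e23 e23' addr0.
have e3 : a3 = 0 by apply: (kill n12); rewrite -e23 e2; ring.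
pose f x y := a1 * Phif x y ^+ 3 + a4 * Psif x y ^+ 3.
have {}PE x y : x * b x y - y * a x y = f x y * Psif x y.
  by rewrite PE e0 e2 e3 /f; ring.
have [OI OJ] := Q8_Om; have [FI FJ] := Q8_Phi; have [GI GJ] := Q8_Psi.
have finv : Q8_inv f by split=> x y /=; rewrite /f ?GI ?GJ ?FI ?FJ.
have /(row_sub 1 eab) r' : row_equivariant (om1 C) (fun x y => - (f x y * dPy x y))
     (fun x y => f x y * dPx x y).
  have {1}-> : om1 C = 1 * om1 C by rewrite mul1r.
  apply: row_psi => // x y; rewrite /f Phi_c Psi_c; move: (Phif x y) (Psif x y) => X Y.
  by move: (om1 C) (om2 C) w1 w2 w12 => o1 o2 {}w1 {}w2 {}w12; ring: w1 w2 w12.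
have fF := form_Phi C; have fG := form_Psi C; have fx := form_dPx C; have fy := form_dPy C.
have ff : form 12 f by rewrite /f; form_tac.
have fa' : form 15 (fun x y => a x y - 1 * - (f x y * dPy x y)) by form_tac.
have fb' : form 15 (fun x y => b x y - 1 * (f x y * dPx x y)) by form_tac.
have /(row_radial fa' fb' r')[D [fD Dinv DC DE]] : forall x y,
    x * (b x y - 1 * (f x y * dPx x y)) = y * (a x y - 1 * - (f x y * dPy x y)).
  move=> x y; apply/eqP; rewrite -subr_eq0; apply/eqP.
  transitivity ((x * b x y - y * a x y) - 1 * f x y * (x * dPx x y + y * dPy x y)); first by ring.
  by rewrite PE dP_euler; ring.
have [d0 [d1 [d2 D14]]] := Q8_inv14 fD Dinv.
have [_ e1' e2'] : [/\ 0 = 0 :> C, d1 * (1 - om1 C) = 0 & d2 * (om2 C - om1 C) = 0].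
  apply: quad_eq0 => x y.
  have := DC x y; rewrite !D14 Phi_c Psi_c Om_c => /eqP; rewrite -subr_eq0 => /eqP E0; rewrite -[RHS]E0 {E0}.
  move: (Omf x y) (Phif x y) (Psif x y) => O X Y.
  by move: (om1 C) (om2 C) w1 w2 w12 => o1 o2 {}w1 {}w2 {}w12; ring: w1 w2 w12.
have {}e1' := kill n1 e1'; have {}e2' := kill n12 e2'.
have nz4 : (4 : C) != 0 by rewrite pnatr_eq0.
exists d0, (a4 * 12 * s / 4), ((a1 + a4) / 4) => x y.
have {}DE := DE x y; have DE' : D x y = d0 * (Omf x y * Phif x y ^+ 2).
  by rewrite D14 e1' e2'; ring.
have fE : f x y = (a1 + a4) * Phif x y ^+ 3 + a4 * 12 * s * Omf x y ^+ 2.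
  by rewrite /f XZ_rel; ring.
rewrite DE' in DE; case: DE => Ea Eb; split.
  by rewrite -[a x y](subrK (1 * - (f x y * dPy x y))) Ea fE; field; rewrite ?nz4.
by rewrite -[b x y](subrK (1 * (f x y * dPx x y))) Eb fE; field; rewrite ?nz4.
Qed.

End Rows.

Section Planes.
Variable C : numClosedFieldType.
Let ii := ii C.
Let ss := ss C.
Let nz2 : (2 : C) != 0. Proof. by rewrite pnatr_eq0. Qed.

Definition o30 : 'I_3 := @Ordinal 3 0 isT.
Definition o31 : 'I_3 := @Ordinal 3 1 isT.
Definition o32 : 'I_3 := @Ordinal 3 2 isT.

Lemma big_ord3 (R : nmodType) (F : 'I_3 -> R) : \sum_i F i = F o30 + F o31 + F o32.
Proof.
rewrite !big_ord_recl big_ord0 addr0 addrA.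
by congr (F _ + F _ + F _); apply: val_inj.
Qed.

Lemma at_plane (N : 'M[binform C]_(2, 3)) (M : 'M[C]_(2, 3)) q :
  at_pt (curve_of_plane N M) q = M *m (at_pt N q)^T.
Proof.
rewrite /at_pt /curve_of_plane map_mxM map_trmx; congr (_ *m _).
by apply/matrixP=> i j; rewrite 2!mxE; apply: mevalC.
Qed.

Definition row2 (u v : C * C * C) : 'M[C]_(2, 3) :=
  mx_of_rows 2 3 [:: [:: u.1.1; u.1.2; u.2]; [:: v.1.1; v.1.2; v.2]].

Lemma row2E u v i : row2 u v i o30 = (if i == ord0 then u else v).1.1 /\
  row2 u v i o31 = (if i == ord0 then u else v).1.2 /\
  row2 u v i o32 = (if i == ord0 then u else v).2.
Proof. by rewrite !mxE; case: (ord2P i) => ->. Qed.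

Lemma at_N13 x y :
  [/\ at_pt (N13 C) (pt x y) ord0 o30 = x * Omf x y ^+ 2,
      at_pt (N13 C) (pt x y) ord0 o31 = x * Phif x y ^+ 3,
      at_pt (N13 C) (pt x y) ord0 o32 = - (Omf x y * Phif x y * (4 * dPy x y)) &
  [/\ at_pt (N13 C) (pt x y) ord_max o30 = y * Omf x y ^+ 2,
      at_pt (N13 C) (pt x y) ord_max o31 = y * Phif x y ^+ 3 &
      at_pt (N13 C) (pt x y) ord_max o32 = Omf x y * Phif x y * (4 * dPx x y)]].
Proof.
by do !split; rewrite ev_at mxE /= !evE ?ev_Omega ?ev_Phi ?ev_d0Psi ?ev_d1Psi.
Qed.

Lemma at_N15 x y :
  [/\ at_pt (N15 C) (pt x y) ord0 o30 = x * Omf x y * Phif x y ^+ 2,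
      at_pt (N15 C) (pt x y) ord0 o31 = - (Omf x y ^+ 2 * (4 * dPy x y)),
      at_pt (N15 C) (pt x y) ord0 o32 = - (Phif x y ^+ 3 * (4 * dPy x y)) &
  [/\ at_pt (N15 C) (pt x y) ord_max o30 = y * Omf x y * Phif x y ^+ 2,
      at_pt (N15 C) (pt x y) ord_max o31 = Omf x y ^+ 2 * (4 * dPx x y) &
      at_pt (N15 C) (pt x y) ord_max o32 = Phif x y ^+ 3 * (4 * dPx x y)]].
Proof.
by do !split; rewrite ev_at mxE /= !evE ?ev_Omega ?ev_Phi ?ev_d0Psi ?ev_d1Psi.
Qed.

Lemma plane_rank (M : 'M[C]_(2, 3)) (N : 'M[C]_(3, 2)) : M *m N \in unitmx -> \rank M = 2%N.
Proof.
rewrite -row_free_unit /row_free => /eqP E; apply/eqP; rewrite eqn_leq rank_leq_row /=.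
by rewrite -{1}E mxrankM_maxl.
Qed.

Section Lift.
Variables (n : nat) (chi : C) (G : 'cV[C]_2 -> 'M[C]_2).
Hypothesis eG : equivariant_lift n chi G.

Lemma el_row i : row_equivariant chi (fun x y => G (pt x y) i ord0) (fun x y => G (pt x y) i ord_max).
Proof.
have E (M A : 'M[C]_2) : (M *m A^T) i ord0 = M i ord0 * A ord0 ord0 + M i ord_max * A ord0 ord_max.
  by rewrite mxE big_ord2 !mxE.
have E' (M A : 'M[C]_2) : (M *m A^T) i ord_max = M i ord0 * A ord_max ord0 + M i ord_max * A ord_max ord_max.
  by rewrite mxE big_ord2 !mxE.
split=> x y.
- by rewrite -Im_pt (el_I eG) E !mxE /=; ring.
- by rewrite -Im_pt (el_I eG) E' !mxE /=; ring.
- by rewrite -Jm_pt (el_J eG) E !mxE /=; ring.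
- by rewrite -Jm_pt (el_J eG) E' !mxE /=; ring.
- by rewrite -Cm_pt (el_C eG) mxE E !mxE /= /cx; ring.
- by rewrite -Cm_pt (el_C eG) mxE E' !mxE /= /cy; ring.
Qed.

(** At a fixed point of the generator of order 3, for the eigenvalue l, the lift
    does not vanish, which makes l ^ n / chi an eigenvalue of that generator. *)
Lemma chi_fixed l : l ^+ 2 - l + 1 = 0 -> l ^+ n * l ^+ n - l ^+ n * chi + chi * chi = 0.
Proof.
move=> El.
have [q nzq lE] : exists2 q : 'cV[C]_2, q != 0 & Cm C *m q = l *: q.
  have n1 : 1 + 'i != 0 :> C.
    apply: contraNneq nz2 => E; have <- : (1 - 'i) * (1 + 'i) = 2 :> C by ring: ii.
    by rewrite E mulr0.
  exists (pt (2^-1 * (1 + 'i)) (l - 2^-1 * (1 + 'i))).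
    by rewrite pt_eq0 negb_and mulf_neq0 ?invr_eq0.
  rewrite Cm_pt scale_pt /cx /cy; congr pt; first by field: ii.
  by apply/eqP; rewrite -subr_eq0 -oppr_eq0 -El; apply/eqP; field: ii.
have E : chi *: (G q *m (Cm C)^T) = l ^+ n *: G q by rewrite -(el_C eG) lE (el_scale eG).
have E2 : chi * chi *: (G q *m (Cm C)^T *m (Cm C)^T) = l ^+ n * l ^+ n *: G q.
  have := congr1 (fun M => chi *: (M *m (Cm C)^T)) E; rewrite /= -!scalemxAl !scalerA => ->.
  by rewrite [chi * _]mulrC -[LHS]scalerA E scalerA.
have CH : (Cm C)^T *m (Cm C)^T = (Cm C)^T - 1%:M.
  rewrite tr_mx2 mul_mx2 mx2_1; apply/matrixP=> i j; rewrite !mxE.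
  by case: (ord2P i) (ord2P j) => [] -> [] -> /=; field: ii.
have : (l ^+ n * l ^+ n - l ^+ n * chi + chi * chi) *: G q = 0.
  rewrite scalerDl scalerBl -E2 -mulmxA CH mulmxBr mulmx1 scalerBr.
  have -> : (chi * chi) *: (G q *m (Cm C)^T) = (l ^+ n * chi) *: G q.
    by rewrite -[LHS]scalerA E scalerA mulrC.
  by rewrite addrAC subrK subrr.
by move/eqP; rewrite scaler_eq0 (negbTE (el_prim eG nzq)) orbF => /eqP.
Qed.

Lemma om_root : [/\ (- om1 C) ^+ 2 - - om1 C + 1 = 0, (- om2 C) ^+ 2 - - om2 C + 1 = 0,
  om1 C ^+ 3 = 1 & om2 C ^+ 3 = 1].
Proof. by split; rewrite /om1 /om2; field: ss. Qed.

Lemma chi_cases : [\/ chi = 1, chi = om1 C | chi = om2 C].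
Proof.
have : (chi - 1) * (chi - om1 C) * (chi - om2 C) = 0.
  transitivity (chi ^+ 3 - 1); last by rewrite (el_chi eG) subrr.
  by rewrite /om1 /om2; field: ss.
by move/eqP; rewrite !mulf_eq0 !subr_eq0 -orbA => /or3P[]/eqP; constructor.
Qed.

(** Tests chi_fixed on both eigenvalues of Cm, which are primitive sixth roots of
    unity. *)
Lemma chi13 : n = 13%N -> chi = 1.
Proof.
move=> n13; have nz3 : (3 : C) != 0 by rewrite pnatr_eq0.
have w1 := om11 C; have w2 := om22 C; have w12 := om12 C.
have [r1 r2 c1 c2] := om_root; have := chi_fixed r1; have := chi_fixed r2; rewrite n13.
have -> : (- om1 C) ^+ 13 = - om1 C.
  by transitivity (- (om1 C ^+ 3) ^+ 4 * om1 C); [ring | rewrite c1; ring].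
have -> : (- om2 C) ^+ 13 = - om2 C.
  by transitivity (- (om2 C ^+ 3) ^+ 4 * om2 C); [ring | rewrite c2; ring].
case: chi_cases => -> // E2 E1; case/negP: nz3; apply/eqP.
  transitivity (om1 C * (- om1 C * - om1 C - - om1 C * om1 C + om1 C * om1 C)); last by rewrite E1 mulr0.
  by move: (om1 C) (om2 C) w1 w2 w12 => o1 o2 {}w1 {}w2 {}w12; ring: w1 w2 w12.
transitivity (om2 C * (- om2 C * - om2 C - - om2 C * om2 C + om2 C * om2 C)); last by rewrite E2 mulr0.
by move: (om1 C) (om2 C) w1 w2 w12 => o1 o2 {}w1 {}w2 {}w12; ring: w1 w2 w12.
Qed.

Lemma chi15 : n = 15%N -> chi = om1 C \/ chi = om2 C.
Proof.
move=> n15; have nz3 : (3 : C) != 0 by rewrite pnatr_eq0.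
have [r1 r2 c1 c2] := om_root; have := chi_fixed r1; rewrite n15.
have -> : (- om1 C) ^+ 15 = - 1.
  by transitivity (- (om1 C ^+ 3) ^+ 5); [ring | rewrite c1; ring].
case: chi_cases => ->; [|by left|by right] => E.
by case/negP: nz3; apply/eqP; rewrite -E; ring.
Qed.

Lemma el_plane (N : 'M[binform C]_(2, 3)) (u : 'I_2 -> C * C * C) :
  (forall i x y, G (pt x y) i ord0 = (u i).1.1 * at_pt N (pt x y) ord0 o30 +
     (u i).1.2 * at_pt N (pt x y) ord0 o31 + (u i).2 * at_pt N (pt x y) ord0 o32) ->
  (forall i x y, G (pt x y) i ord_max = (u i).1.1 * at_pt N (pt x y) ord_max o30 +
     (u i).1.2 * at_pt N (pt x y) ord_max o31 + (u i).2 * at_pt N (pt x y) ord_max o32) ->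
  exists M, \rank M = 2%N /\ forall q, G q = at_pt (curve_of_plane N M) q.
Proof.
move=> E0 E1; pose M := row2 (u ord0) (u ord_max).
have GM q : G q = at_pt (curve_of_plane N M) q.
  rewrite (colE q) at_plane; apply/matrixP=> i j; rewrite [RHS]mxE big_ord3.
  have [-> [-> ->]] := row2E (u ord0) (u ord_max) i.
  have -> : (if i == ord0 then u ord0 else u ord_max) = u i by case: (ord2P i) => ->.
  by case: (ord2P j) => ->; rewrite ?E0 ?E1 ![(_^T) _ _]mxE.
exists M; split=> //; have [q uq] := el_unit eG.
by move: uq; rewrite GM at_plane => /plane_rank.
Qed.

Lemma el_classify13 : n = 13%N ->
  exists M, \rank M = 2%N /\ forall q, G q = at_pt (curve_of_plane (N13 C) M) q.
Proof.
move=> n13; have c1 := chi13 n13.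
have fG i j : form 13 (fun x y => G (pt x y) i j) by rewrite -n13; apply: el_form eG _ _.
have [u uE] : exists u : 'I_2 -> C * C * C, forall i x y,
   G (pt x y) i ord0 = (u i).1.1 * (x * Omf x y ^+ 2) + (u i).1.2 * (x * Phif x y ^+ 3)
      - (u i).2 * (Omf x y * Phif x y * (4 * dPy x y)) /\
   G (pt x y) i ord_max = (u i).1.1 * (y * Omf x y ^+ 2) + (u i).1.2 * (y * Phif x y ^+ 3)
      + (u i).2 * (Omf x y * Phif x y * (4 * dPx x y)).
  suff /fin_all_exists[u uE] i : exists t : C * C * C, forall x y,
     G (pt x y) i ord0 = t.1.1 * (x * Omf x y ^+ 2) + t.1.2 * (x * Phif x y ^+ 3)
        - t.2 * (Omf x y * Phif x y * (4 * dPy x y)) /\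
     G (pt x y) i ord_max = t.1.1 * (y * Omf x y ^+ 2) + t.1.2 * (y * Phif x y ^+ 3)
        + t.2 * (Omf x y * Phif x y * (4 * dPx x y)) by exists u.
  have er := el_row i; rewrite c1 in er.
  by have [m0 [m1 [m2 E]]] := row_classify13 (fG i _) (fG i _) er; exists (m0, m1, m2).
apply: (el_plane (u := u)) => i x y; have [E0 E1] := uE i x y;
  have [e0 e1 e2 [e3 e4 e5]] := at_N13 x y;
  rewrite ?E0 ?E1 ?e0 ?e1 ?e2 ?e3 ?e4 ?e5; ring.
Qed.

Lemma el_classify15 : n = 15%N -> chi = om1 C ->
  exists M, \rank M = 2%N /\ forall q, G q = at_pt (curve_of_plane (N15 C) M) q.
Proof.
move=> n15 c1.
have fG i j : form 15 (fun x y => G (pt x y) i j) by rewrite -n15; apply: el_form eG _ _.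
have [u uE] : exists u : 'I_2 -> C * C * C, forall i x y,
   G (pt x y) i ord0 = (u i).1.1 * (x * Omf x y * Phif x y ^+ 2) - (u i).1.2 * (Omf x y ^+ 2 * (4 * dPy x y))
      - (u i).2 * (Phif x y ^+ 3 * (4 * dPy x y)) /\
   G (pt x y) i ord_max = (u i).1.1 * (y * Omf x y * Phif x y ^+ 2) + (u i).1.2 * (Omf x y ^+ 2 * (4 * dPx x y))
      + (u i).2 * (Phif x y ^+ 3 * (4 * dPx x y)).
  suff /fin_all_exists[u uE] i : exists t : C * C * C, forall x y,
     G (pt x y) i ord0 = t.1.1 * (x * Omf x y * Phif x y ^+ 2) - t.1.2 * (Omf x y ^+ 2 * (4 * dPy x y))
      - t.2 * (Phif x y ^+ 3 * (4 * dPy x y)) /\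
     G (pt x y) i ord_max = t.1.1 * (y * Omf x y * Phif x y ^+ 2) + t.1.2 * (Omf x y ^+ 2 * (4 * dPx x y))
      + t.2 * (Phif x y ^+ 3 * (4 * dPx x y)) by exists u.
  have er := el_row i; rewrite c1 in er.
  by have [m0 [m1 [m2 E]]] := row_classify15 (fG i _) (fG i _) er; exists (m0, m1, m2).
apply: (el_plane (u := u)) => i x y; have [E0 E1] := uE i x y;
  have [e0 e1 e2 [e3 e4 e5]] := at_N15 x y;
  rewrite ?E0 ?E1 ?e0 ?e1 ?e2 ?e3 ?e4 ?e5; ring.
Qed.

(** The octahedral group normalizes the tetrahedral one and exchanges its two
    nontrivial characters. *)
Definition D8 : 'M[C]_2 := mx2 (z8 C) 0 0 (z8' C).

Lemma unit_D8 : D8 \in unitmx.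
Proof. by rewrite unit_mx2 z8z8' mulr0 subr0 oner_neq0. Qed.

Lemma D8_Im : D8 *m Im C = Im C *m D8.
Proof. by rewrite !mul_mx2; congr mx2; ring. Qed.

Lemma D8_Jm : D8 *m Jm C = Im C *m Jm C *m D8.
Proof.
have E := z8z8 C; have E' := z8'E C.
rewrite !mul_mx2; congr mx2; rewrite ?E'; try by ring.
by ring: ii.
Qed.

Lemma D8_Cm : D8 *m Cm C = Jm C *m Cm C *m Cm C *m Jm C *m D8.
Proof.
have E := z8z8 C; have E' := z8'E C.
by rewrite !mul_mx2; congr mx2; rewrite ?E'; field: ii.
Qed.

Lemma el_twist : equivariant_lift n (chi ^+ 2) (fun q => G (D8 *m q) *m (invmx D8)^T).
Proof.
have uD := unit_D8; have uDT : (invmx D8)^T \in unitmx by rewrite unitmx_tr unitmx_inv.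
have conj (S T : 'M[C]_2) (k : C) : D8 *m S = T *m D8 -> (forall q, G (T *m q) = k *: (G q *m T^T)) ->
    forall q, G (D8 *m (S *m q)) *m (invmx D8)^T = k *: (G (D8 *m q) *m (invmx D8)^T *m S^T).
  move=> DS GT q; rewrite mulmxA DS -mulmxA GT -scalemxAl -!mulmxA -!trmx_mul.
  by congr (_ *: (_ *m _^T)); rewrite -[LHS](mulmxK uD) -(mulmxA _ T D8) -DS mulKmx.
have GI q : G (Im C *m q) = 1 *: (G q *m (Im C)^T) by rewrite scale1r (el_I eG).
have GIJ q : G (Im C *m Jm C *m q) = 1 *: (G q *m (Im C *m Jm C)^T).
  by rewrite -mulmxA (el_I eG) (el_J eG) scale1r trmx_mul mulmxA.
have GC' q : G (Jm C *m Cm C *m Cm C *m Jm C *m q) =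
    chi ^+ 2 *: (G q *m (Jm C *m Cm C *m Cm C *m Jm C)^T).
  rewrite -!mulmxA (el_J eG) !(el_C eG) (el_J eG) -!scalemxAl scalerA -expr2 !trmx_mul.
  by rewrite -!mulmxA.
split.
- move=> i j; apply: (form_ext (f := fun x y =>
     (invmx D8)^T ord0 j * G (pt (z8 C * x) (z8' C * y)) i ord0 +
     (invmx D8)^T ord_max j * G (pt (z8 C * x) (z8' C * y)) i ord_max)).
    move=> x y; rewrite mul_mx2_pt !mul0r addr0 add0r [RHS]mxE big_ord2.
    by rewrite ![G _ _ _ * _]mulrC.
  have sub k : form n (fun x y => G (pt (z8 C * x) (z8' C * y)) i k).
    by apply: (form_subst (el_form eG i k)); form_tac.
  by apply: formD; apply: formZ.
- move=> q nzq; have := el_prim eG (mul_unit_neq0 uD nzq); apply: contraNneq => E0.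
  by rewrite -[G _](mulmxK uDT) E0 mul0mx.
- have [q uq] := el_unit eG; exists (invmx D8 *m q).
  by rewrite mulKVmx // unitmx_mul uq.
- by move=> q; rewrite (conj _ _ _ D8_Im GI) scale1r.
- by move=> q; rewrite (conj _ _ _ D8_Jm GIJ) scale1r.
- exact: conj D8_Cm GC'.
- by rewrite -exprM mulnC exprM (el_chi eG) expr1n.
- exact: el_odd eG.
Qed.

End Lift.

End Planes.

(** * Tangency to the orbit of the sixth powers *)

Section Ramified.
Variable C : numClosedFieldType.
Let nz2 : (2 : C) != 0. Proof. by rewrite pnatr_eq0. Qed.

Definition linearly_full (F : 'M[binform C]_(7, 1)) :=
  forall w : 'rV[C]_7, (forall q, w *m at_pt F q = 0) -> w = 0.

Definition coef_mx (F : 'M[binform C]_(7, 1)) : 'M[C]_7 :=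
  \matrix_(k, l) (F k 0)@_(bimon 6 l).

Lemma at_coef (F : 'M[binform C]_(7, 1)) x y : (forall k, F k 0 \is 6.-homog) ->
  at_pt F (pt x y) = coef_mx F *m \col_(l < 7) (x ^+ (6 - l) * y ^+ l).
Proof.
move=> hF; apply/colP=> k; rewrite ev_at {1}(homog_sum (hF k)) ev_sum mxE.
by apply: eq_bigr => l _; rewrite !mxE !evE.
Qed.

Lemma full_unit (F : 'M[binform C]_(7, 1)) : (forall k, F k 0 \is 6.-homog) ->
  linearly_full F -> coef_mx F \in unitmx.
Proof.
move=> hF full; rewrite -row_free_unit; apply/row_freeP.
apply/row_freeP/inj_row_free => w wK; apply: full => q.
by rewrite (colE q) at_coef // mulmxA wK mul0mx.
Qed.

Lemma full_span (F : 'M[binform C]_(7, 1)) p : (forall k, F k 0 \is 6.-homog) ->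
  linearly_full F -> p \is 6.-homog ->
  exists w : 'rV[C]_7, p = \sum_k w 0 k *: F k 0.
Proof.
move=> hF full hp; pose c : 'rV[C]_7 := \row_l p@_(bimon 6 l).
exists (c *m invmx (coef_mx F)); apply: ev_inj => x y.
set w := c *m _; have -> : ev p x y = (c *m \col_(l < 7) (x ^+ (6 - l) * y ^+ l)) 0 0.
  by rewrite mxE {1}(homog_sum hp) ev_sum; apply: eq_bigr => l _; rewrite !mxE !evE.
have -> : c = w *m coef_mx F by rewrite mulmxKV // full_unit.
rewrite -mulmxA -at_coef // mxE ev_sum; apply: eq_bigr => k _.
by rewrite ev_at evZ.
Qed.

Lemma full_primitive (F : 'M[binform C]_(7, 1)) : (forall k, F k 0 \is 6.-homog) ->
  linearly_full F -> is_curve 6 F.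
Proof.
move=> hF full; apply: primitive_curve => [i j|x y nz]; first by rewrite ord1.
have : at_pt F (pt x y) != 0.
  rewrite at_coef //; apply/eqP => /(congr1 (mulmx (invmx (coef_mx F)))).
  rewrite mulmx0 mulKmx ?full_unit // => /colP E.
  have := E ord0; have := E ord_max; rewrite !mxE /= subnn expr0 subn0 expr0 mulr1 mul1r.
  move=> /eqP; rewrite expf_eq0 => /eqP y0 /eqP; rewrite expf_eq0 => /eqP x0.
  by move: nz; rewrite x0 y0 eqxx.
by case/mx_neq0 => i [j]; rewrite (ord1 j) ev_at => nzi; exists (i, 0).
Qed.

Lemma mderivX_exp (p : binform C) k i : (p ^+ k.+1)^`M(i) = k.+1%:R *: (p ^+ k * p^`M(i)).
Proof.
elim: k => [|k IHk]; first by rewrite expr0 expr1 mul1r scale1r.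
rewrite exprS mderivM IHk -scalerAr [in RHS]mulrS scalerDl scale1r.
by rewrite [p^`M(i) * _]mulrC mulrA -exprS.
Qed.

Lemma meval_ev (p : binform C) (q : 'cV[C]_2) :
  p.@[fun i => q i 0] = ev p (q ord0 0) (q ord_max 0).
Proof. by apply: meval_eq => j; rewrite {1}(colE q). Qed.

Lemma mderiv_sum I (r : seq I) (P : pred I) (p : I -> binform C) i :
  (\sum_(k <- r | P k) p k)^`M(i) = \sum_(k <- r | P k) (p k)^`M(i).
Proof. exact: (linear_sum (mderiv i)). Qed.

Definition lin (l m : C) : binform C := l *: X0 C + m *: X1 C.

Lemma ev_lin l m x y : ev (lin l m) x y = l * x + m * y.
Proof. by rewrite !evE. Qed.

Lemma d_lin l m i : (lin l m)^`M(i) = (if i == ord0 then l else m)%:MP.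
Proof.
rewrite mderivD !mderivZ !mderivXU; case: (ord2P i) => -> /=.
  by rewrite mpolyC1 mpolyC0 scaler0 addr0 -mul_mpolyC mulr1.
by rewrite mpolyC1 mpolyC0 scaler0 add0r -mul_mpolyC mulr1.
Qed.

(** All binary sextics are combinations of the coordinates, among them the sixth
    powers, whose differentials separate the tangent vectors. *)
Lemma jacobian_inj (F : 'M[binform C]_(7, 1)) (q a : 'cV[C]_2) :
  (forall k, F k 0 \is 6.-homog) -> linearly_full F -> q != 0 ->
  jacobian F q *m a = 0 -> a = 0.
Proof.
move=> hF full nzq Ja0; apply/eqP/negPn/negP => nza.
have [l [m [lq la]]] : exists l m, l * q ord0 0 + m * q ord_max 0 != 0 /\
    l * a ord0 0 + m * a ord_max 0 != 0.
  have f1 : form 1 (fun l m : C => l * q ord0 0 + m * q ord_max 0).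
    by apply: form_ext (form_lin (q ord0 0) (q ord_max 0)) => x y; ring.
  have f2 : form 1 (fun l m : C => l * a ord0 0 + m * a ord_max 0).
    by apply: form_ext (form_lin (a ord0 0) (a ord_max 0)) => x y; ring.
  have nz (r : 'cV[C]_2) : r != 0 -> nonzero (fun l m : C => l * r ord0 0 + m * r ord_max 0).
    rewrite (colE r) pt_eq0 negb_and => /orP[]; rewrite !mxE /= => n.
      by exists 1, 0; rewrite mul1r mul0r addr0.
    by exists 0, 1; rewrite mul1r mul0r add0r.
  have [l [m]] := form_neqM f1 f2 (nz _ nzq) (nz _ nza).
  by rewrite mulf_eq0 => /norP[]; exists l, m.
have hl : lin l m ^+ 6 \is 6.-homog.
  apply: homog_of_form; apply: (form_ext (f := fun x y => (l * x + m * y) ^+ 6)).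
    by move=> x y; rewrite evX ev_lin.
  exact: (form_exp 6 (form_lin l m)).
have [w wE] := full_span hF full hl.
have : (w *m (jacobian F q *m a)) 0 0 = 0 by rewrite Ja0 mulmx0 mxE.
have -> : (w *m (jacobian F q *m a)) 0 0 =
   \sum_i a i 0 * ((lin l m ^+ 6)^`M(i)).@[fun j => q j 0].
  rewrite mulmxA mxE; apply: eq_bigr => i _; rewrite mulrC; congr (_ * _).
  rewrite mxE wE mderiv_sum meval_ev ev_sum; apply: eq_bigr => k _.
  by rewrite mderivZ evZ !mxE meval_ev.
rewrite big_ord2 !(mderivX_exp _ 5) !d_lin /= !meval_ev !evZ !evM !ev_lin !evC => /eqP.
set L := l * q ord0 0 + m * q ord_max 0; rewrite (_ : _ + _ = 6 * L ^+ 5 * (l * a ord0 0 + m * a ord_max 0)); last by ring.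
by apply/negP; rewrite !mulf_neq0 ?pnatr_eq0 ?expf_neq0.
Qed.

Lemma val6_jac (F : 'M[binform C]_(7, 1)) q i u v :
  val6 (col i (jacobian F q)) u v =
  ((\sum_(k < 7) (u ^+ (6 - k) * v ^+ k) *: F k 0)^`M(i)).@[fun l => q l 0].
Proof.
rewrite mderiv_sum meval_ev ev_sum; apply: eq_bigr => k _.
by rewrite mderivZ evZ !mxE meval_ev mulrC.
Qed.

Lemma val6_at (F : 'M[binform C]_(7, 1)) x y u v :
  val6 (at_pt F (pt x y)) u v = ev (\sum_(k < 7) (u ^+ (6 - k) * v ^+ k) *: F k 0) x y.
Proof. by rewrite ev_sum; apply: eq_bigr => k _; rewrite ev_at evZ mulrC. Qed.

(** To first order at q0 the curve stays in the space of the sextics divisible by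
    l ^ 5, which is the tangent space of the cone over the orbit of the sixth
    powers; both having dimension 2, the image of the Jacobian matrix is all of
    it. *)
Lemma ramified_at (F : 'M[binform C]_(7, 1)) (q0 : 'cV[C]_2) (l1 l2 : C) d
    (e f0 f1 T : C -> C -> C) (m : C -> C -> C) (R : C -> C -> C -> C -> C) :
  is_curve 6 F -> linearly_full F -> q0 != 0 -> (l1, l2) != (0, 0) ->
  form d e -> form (d + 6) f0 -> form (d + 6) f1 -> form 1 T -> form 1 m ->
  (forall u v, form (d + 4) (R u v)) ->
  e (q0 ord0 0) (q0 ord_max 0) != 0 -> T (q0 ord0 0) (q0 ord_max 0) = 0 ->
  f1 (q0 ord0 0) (q0 ord_max 0) = 0 ->
  (forall X Y u v, e X Y * val6 (at_pt F (pt X Y)) u v =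
     (l1 * u + l2 * v) ^+ 5 * (f0 X Y * (l1 * u + l2 * v) + f1 X Y * m u v) +
     T X Y ^+ 2 * R u v X Y) ->
  generally_ramified F.
Proof.
move=> cF full nzq0 nzl fe ff0 ff1 fT fm fR.
set X0' := q0 ord0 0; set Y0' := q0 ord_max 0 => nze T0 f10 E.
have [hF0 _] := cF; have hF k : F k 0 \is 6.-homog by apply: hF0.
have q0E : q0 = pt X0' Y0' by apply: colE.
have [pe he eE] := fe; have [p0 h0 f0E] := ff0; have [p1 h1 f1E] := ff1.
have [pT hT TE] := fT.
(* a coordinate system of which l is the first coordinate *)
have [m1 [m2 lm]] : exists m1 m2, l1 * m2 - l2 * m1 = 1.
  move: nzl; rewrite xpair_eqE negb_and => /orP[] nz.
    by exists 0, l1^-1; rewrite mulr0 subr0 divff.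
  by exists (- l2^-1), 0; rewrite mulr0 sub0r mulrN opprK divff.
pose L u v := l1 * u + l2 * v.
have [mu1 [mu2 mE]] : exists mu1 mu2, forall u v, m u v = mu1 * L u v + mu2 * (m1 * u + m2 * v).
  have [k kE] := form_coef fm.
  exists (k 0%N * m2 - k 1%N * m1), (l1 * k 1%N - l2 * k 0%N) => u v.
  rewrite kE !big_ord_recl big_ord0 /= /L /bump /= subn0 subnn !expr0 !expr1.
  transitivity ((l1 * m2 - l2 * m1) * (k 0%N * u + k 1%N * v)); last by ring.
  by rewrite lm; ring.
pose A := invmx (mx2 l1 l2 m1 m2).
have uB : mx2 l1 l2 m1 m2 \in unitmx by rewrite unit_mx2 lm oner_neq0.
have detA : \det A = 1 by rewrite det_inv det_mx2 lm invr1.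
pose f := sl2_act A (X0 C ^+ 6).
have fE : f = lin l1 l2 ^+ 6.
  apply: ev_inj => u v; rewrite ev_act /A invmxK !evX ev_lin evX0 !mxE //.
have hf : f \is 6.-homog.
  rewrite fE; apply: homog_of_form; apply: (form_ext (f := fun x y => (l1 * x + l2 * y) ^+ 6)).
    by move=> x y; rewrite evX ev_lin.
  exact: (form_exp 6 (form_lin l1 l2)).
have vf u v : val6 (coords f) u v = L u v ^+ 6.
  by rewrite val6_coords // fE evX ev_lin.
set e0 := e X0' Y0' in nze; pose f00 := f0 X0' Y0'.
have F0 u v : val6 (at_pt F q0) u v = e0^-1 * f00 * L u v ^+ 6.
  apply: (mulfI nze); rewrite {1}q0E E T0 f10 -/(L u v) -/f00; field; exact: nze.
have nzf0 : f00 != 0.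
  apply: contraNneq (curve_at_neq0 cF nzq0) => z; apply/eqP.
  by apply: val6_eq0 => u v; rewrite F0 z mulr0 mul0r.
pose D p i := (p^`M(i)).@[fun l : 'I_2 => q0 l 0].
(* the derivative of the hypothesis at q0, to which T ^ 2 does not contribute *)
have jac i : exists c d, forall u v, val6 (col i (jacobian F q0)) u v =
    L u v ^+ 5 * (c * L u v + d * (m1 * u + m2 * v)).
  pose c1 := D p1 i.
  exists (e0^-1 * (D p0 i + c1 * mu1 - D pe i * (e0^-1 * f00))), (e0^-1 * (c1 * mu2)) => u v.
  pose P := \sum_(k < 7) (u ^+ (6 - k) * v ^+ k) *: F k 0.
  have [pR hR RE] := fR u v.
  have PE : pe * P = L u v ^+ 6 *: p0 + (L u v ^+ 5 * m u v) *: p1 + pT ^+ 2 * pR.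
    apply: ev_inj => X Y; rewrite evM -val6_at -eE E !evD !evZ evM evX -f0E -f1E -TE -RE /L.
    by ring.
  have at0 p : p.@[fun l : 'I_2 => q0 l 0] = ev p X0' Y0'.
    by apply: meval_eq => j; rewrite {1}q0E.
  have := congr1 (fun p => D p i) PE.
  rewrite /D mderivM !mderivD !mderivZ mderivM (mderivX_exp pT 1) expr1.
  rewrite !mevalD !mevalM !mevalZ !mevalM -/(D p0 i) -/(D p1 i) -/(D pe i).
  rewrite (at0 pT) -TE T0 (at0 P) -val6_at -q0E F0 (at0 pe) -eE -/e0 -val6_jac mE => H.
  apply: (mulfI nze); apply: (addrI (D pe i * (e0^-1 * f00 * L u v ^+ 6))); rewrite H /c1; field.
  exact: nze.
have [c0 [d0 j0]] := jac ord0; have [c1 [d1 j1]] := jac ord_max.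
have mulJ (a : 'cV[C]_2) : jacobian F q0 *m a =
    a ord0 0 *: col ord0 (jacobian F q0) + a ord_max 0 *: col ord_max (jacobian F q0).
  by apply/colP=> k; rewrite !mxE big_ord2 !mxE; ring.
have vJ (a : 'cV[C]_2) u v : val6 (jacobian F q0 *m a) u v =
    L u v ^+ 5 * ((c0 * a ord0 0 + c1 * a ord_max 0) * L u v +
                  (d0 * a ord0 0 + d1 * a ord_max 0) * (m1 * u + m2 * v)).
  by rewrite mulJ val6D !val6Z j0 j1; ring.
have vI (X : 'M[C]_2) u v : val6 (coords (inf_act X f)) u v = 6 * L u v ^+ 5 *
    ((X ord0 ord0 * l1 + X ord_max ord0 * l2) * u + (X ord0 ord_max * l1 + X ord_max ord_max * l2) * v).
  pose p := X ord0 ord0 * l1 + X ord_max ord0 * l2.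
  pose q := X ord0 ord_max * l1 + X ord_max ord_max * l2.
  have evI u' v' : ev (inf_act X f) u' v' = (6 * (p * u' + q * v')) * (l1 * u' + l2 * v') ^+ 5.
    rewrite /inf_act big_ord2 !big_ord2 fE !(mderivX_exp _ 5) !d_lin /=.
    by rewrite !evD !evZ !evM -/(X0 C) -/(X1 C) evX0 evX1 !evZ !evM !ev_lin !evC /p /q; ring.
  rewrite val6_coords; first by rewrite evI /L -/p -/q; ring.
  apply: homog_of_form.
  apply: (form_ext (f := fun x y => (6 * (p * x + q * y)) * (l1 * x + l2 * y) ^+ 5)).
    by move=> x y; rewrite evI.
  apply: (@formM _ 1 5); last exact: (form_exp 5 (form_lin l1 l2)).
  exact: (formZ 6 (form_lin p q)).
exists q0, A; split=> //.
  by apply/same_val6; exists (e0^-1 * f00); split; [rewrite mulf_neq0 ?invr_eq0|move=> u v; rewrite F0 vf].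
move=> w; split=> [[a ->]|[X ->]].
  pose al := c0 * a ord0 0 + c1 * a ord_max 0; pose be := d0 * a ord0 0 + d1 * a ord_max 0.
  exists (mx2 ((al * l1 + be * m1) / 6 * m2) ((al * l2 + be * m2) / 6 * m2)
              (- ((al * l1 + be * m1) / 6 * m1)) (- ((al * l2 + be * m2) / 6 * m1))).
  apply: val6_inj => u v; rewrite vJ vI !mxE /= -/al -/be.
  have lmE p : p / 6 * m2 * l1 + - (p / 6 * m1) * l2 = p / 6.
    by transitivity (p / 6 * (l1 * m2 - l2 * m1)); [ring|rewrite lm mulr1].
  by rewrite !lmE /L; field; rewrite ?pnatr_eq0.
pose p := X ord0 ord0 * l1 + X ord_max ord0 * l2.
pose q := X ord0 ord_max * l1 + X ord_max ord_max * l2.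
have inj (a : 'cV[C]_2) : c0 * a ord0 0 + c1 * a ord_max 0 = 0 ->
    d0 * a ord0 0 + d1 * a ord_max 0 = 0 -> a = 0.
  move=> k1 k2; apply: (jacobian_inj hF full nzq0).
  by apply: val6_eq0 => u v; rewrite vJ k1 k2 !mul0r addr0 mulr0.
have nzD : c0 * d1 - c1 * d0 != 0.
  apply/eqP=> /subr0_eq D0.
  have /eqP : pt c1 (- c0) = 0 :> 'cV[C]_2 by apply: inj; rewrite !mxE /=; ring: D0.
  rewrite pt_eq0 oppr_eq0 => /andP[/eqP c10 /eqP c00].
  have /eqP : pt d1 (- d0) = 0 :> 'cV[C]_2 by apply: inj; rewrite !mxE /=; ring: D0.
  rewrite pt_eq0 oppr_eq0 => /andP[/eqP d10 /eqP d00].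
  have /eqP : pt 1 0 = 0 :> 'cV[C]_2.
    by apply: inj; rewrite ?c10 ?c00 ?d10 ?d00 !mul0r addr0.
  by rewrite pt_eq0 oner_eq0.
pose al := 6 * (p * m2 - q * m1); pose be := 6 * (l1 * q - l2 * p).
exists (pt ((al * d1 - c1 * be) / (c0 * d1 - c1 * d0)) ((c0 * be - al * d0) / (c0 * d1 - c1 * d0))).
apply: val6_inj => u v; rewrite vJ vI !mxE /= -/p -/q.
have -> : c0 * ((al * d1 - c1 * be) / (c0 * d1 - c1 * d0)) +
          c1 * ((c0 * be - al * d0) / (c0 * d1 - c1 * d0)) = al by field.
have -> : d0 * ((al * d1 - c1 * be) / (c0 * d1 - c1 * d0)) +
          d1 * ((c0 * be - al * d0) / (c0 * d1 - c1 * d0)) = be by field.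
have lm' : l1 * m2 = 1 + l2 * m1 by rewrite -lm subrK.
by rewrite /L /al /be; ring: lm'.
Qed.

End Ramified.

(** * The sextics of a lift as functions on the target *)

Section Expansion.
Variable C : numClosedFieldType.
Let ss := ss C.
Let nz2 : (2 : C) != 0. Proof. by rewrite pnatr_eq0. Qed.
Local Notation s := (sqrtm3 C).

Lemma Omf_expand (p r x y : C) : Omf (p * x - r * dPy x y) (p * y + r * dPx x y) =
  p ^+ 6 * Omf x y + p ^+ 5 * r * Phif x y ^+ 2
  - 5 * s * p ^+ 4 * r ^+ 2 * Omf x y * Phif x y - 40 * p ^+ 3 * r ^+ 3 * Omf x y ^+ 2
  - 5 * p ^+ 2 * r ^+ 4 * Omf x y * Phif x y ^+ 2
  - p * r ^+ 5 * Phif x y * (Phif x y ^+ 3 + 8 * s * Omf x y ^+ 2)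
  + r ^+ 6 * Omf x y * (s * Phif x y ^+ 3 - 32 * Omf x y ^+ 2).
Proof. by rewrite /Omf /Phif /dPx /dPy; ring: ss. Qed.

(** Omega ^ 2 in terms of X = Phi ^ 3 and Y = Psi ^ 3, by XZ_rel. *)
Definition Zf (X Y : C) := (Y - X) / (12 * s).

Lemma Zf_phi x y : Zf (Phif x y ^+ 3) (Psif x y ^+ 3) = Omf x y ^+ 2.
Proof. by rewrite /Zf XZ_rel; field; rewrite (s_neq0 C) ?pnatr_eq0. Qed.

Lemma form_Zf : form 1 Zf.
Proof.
apply: (form_ext (f := fun X Y => (12 * s)^-1 * (Y - X))).
  by move=> x y; rewrite mulrC.
by apply: formZ; apply: formB; [exact: formy|exact: formx].
Qed.

(** For a row with coefficient p at (x, y) and r at Omega Phi, respectively at the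
    turned gradient of Psi, divided by 4, these are the quotients by Omega of the
    value of Omega at the row, as polynomials in X = Phi ^ 3 and Z = Omega ^ 2; in
    degree 15 the coefficient at (x, y) is p Omega Phi ^ 2. *)
Definition S13 p r X Z : C :=
  p ^+ 6 + p ^+ 5 * r * X - 5 * s * p ^+ 4 * r ^+ 2 * (Z * X)
  - 40 * p ^+ 3 * r ^+ 3 * (Z ^+ 2 * X) - 5 * p ^+ 2 * r ^+ 4 * (Z ^+ 2 * X ^+ 2)
  - p * r ^+ 5 * (Z ^+ 2 * X ^+ 2 * (X + 8 * s * Z))
  + r ^+ 6 * (Z ^+ 3 * X ^+ 2 * (s * X - 32 * Z)).

Definition S15 p r X Z : C :=
  p ^+ 6 * (Z ^+ 3 * X ^+ 4) + p ^+ 5 * r * (Z ^+ 2 * X ^+ 4)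
  - 5 * s * p ^+ 4 * r ^+ 2 * (Z ^+ 2 * X ^+ 3) - 40 * p ^+ 3 * r ^+ 3 * (Z ^+ 2 * X ^+ 2)
  - 5 * p ^+ 2 * r ^+ 4 * (Z * X ^+ 2) - p * r ^+ 5 * (X * (X + 8 * s * Z))
  + r ^+ 6 * (s * X - 32 * Z).

(** The coefficients of the row v g_0 - u g_1, at which the value of Omega is the
    sextic f_1 (g) in u and v. *)
Definition cmb (M : 'M[C]_(2, 3)) u v k := v * M ord0 k - u * M ord_max k.

Definition H13 M u v X Y :=
  S13 (cmb M u v o30 * Zf X Y + cmb M u v o31 * X) (4 * cmb M u v o32) X (Zf X Y).

Definition H15 M u v X Y :=
  S15 (cmb M u v o30) (4 * (cmb M u v o31 * Zf X Y + cmb M u v o32 * X)) X (Zf X Y).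

Lemma plane_cmb (N : 'M[binform C]_(2, 3)) M q u v :
  (at_pt (curve_of_plane N M) q)^T *m pt v (- u) =
  at_pt N q *m \col_k cmb M u v k.
Proof.
rewrite at_plane trmx_mul trmxK -mulmxA; congr (_ *m _); apply/colP=> k.
by rewrite mxE big_ord2 !mxE /cmb /=; ring.
Qed.

Lemma plane_entry (N : 'M[binform C]_(2, 3)) M q i j : at_pt (curve_of_plane N M) q i j =
  M i o30 * at_pt N q j o30 + M i o31 * at_pt N q j o31 + M i o32 * at_pt N q j o32.
Proof. by rewrite at_plane mxE big_ord3 ![_^T _ _]mxE. Qed.

Lemma Om_plane13 M u v x y :
  Omv ((at_pt (curve_of_plane (N13 C) M) (pt x y))^T *m pt v (- u)) =
  Omf x y * H13 M u v (Phif x y ^+ 3) (Psif x y ^+ 3).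
Proof.
have [a0 a1 a2 [b0 b1 b2]] := at_N13 x y.
rewrite plane_cmb /Omv !mxE !big_ord3 a0 a1 a2 b0 b1 b2 !mxE /H13 Zf_phi.
set p := cmb M u v _; set q := cmb M u v _; set r := cmb M u v _.
pose r' := 4 * r * Omf x y * Phif x y.
pose p' := p * Omf x y ^+ 2 + q * Phif x y ^+ 3.
transitivity (Omf (p' * x - r' * dPy x y) (p' * y + r' * dPx x y)).
  by rewrite /p' /r'; congr Omf; ring.
by rewrite Omf_expand /S13 -/p' /r'; ring.
Qed.

Lemma Om_plane15 M u v x y :
  Omv ((at_pt (curve_of_plane (N15 C) M) (pt x y))^T *m pt v (- u)) =
  Omf x y * H15 M u v (Phif x y ^+ 3) (Psif x y ^+ 3).
Proof.
have [a0 a1 a2 [b0 b1 b2]] := at_N15 x y.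
rewrite plane_cmb /Omv !mxE !big_ord3 a0 a1 a2 b0 b1 b2 !mxE /H15 Zf_phi.
set p := cmb M u v _; set q := cmb M u v _; set r := cmb M u v _.
pose r' := 4 * (q * Omf x y ^+ 2 + r * Phif x y ^+ 3).
pose p' := p * Omf x y * Phif x y ^+ 2.
transitivity (Omf (p' * x - r' * dPy x y) (p' * y + r' * dPx x y)).
  by rewrite /p' /r'; congr Omf; ring.
by rewrite Omf_expand /S15 -/r' /p'; ring.
Qed.

Lemma form_H13 M u v : form 6 (H13 M u v).
Proof. by have fZ := form_Zf; rewrite /H13 /S13; form_tac. Qed.

Lemma form_H15 M u v : form 7 (H15 M u v).
Proof. by have fZ := form_Zf; rewrite /H15 /S15; form_tac. Qed.

End Expansion.

Section Tangency.
Variable C : numClosedFieldType.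
Let nz2 : (2 : C) != 0. Proof. by rewrite pnatr_eq0. Qed.
Local Notation s := (sqrtm3 C).

(** The criterion ramified_at after a linear change of the coordinates of the
    target. *)
Lemma ramified_comp (F : 'M[binform C]_(7, 1)) (beta : 'M[C]_2) (x0 y0 l1 l2 : C) d
    (e f0 f1 T m : C -> C -> C) (R : C -> C -> C -> C -> C) :
  is_curve 6 F -> linearly_full F -> beta \in unitmx ->
  (x0, y0) != (0, 0) -> (l1, l2) != (0, 0) ->
  form d e -> form (d + 6) f0 -> form (d + 6) f1 -> form 1 T -> form 1 m ->
  (forall u v, form (d + 4) (R u v)) ->
  e x0 y0 != 0 -> T x0 y0 = 0 -> f1 x0 y0 = 0 ->
  (forall X Y u v, e X Y * val6 (at_pt F (beta *m pt X Y)) u v =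
     (l1 * u + l2 * v) ^+ 5 * (f0 X Y * (l1 * u + l2 * v) + f1 X Y * m u v) +
     T X Y ^+ 2 * R u v X Y) ->
  generally_ramified F.
Proof.
move=> cF full ub nz0 nzl fe ff0 ff1 fT fm fR nze T0 f10 E.
pose b := invmx beta; pose gx x y := b ord0 ord0 * x + b ord0 ord_max * y.
pose gy x y := b ord_max ord0 * x + b ord_max ord_max * y.
have fgx : form 1 gx by apply: form_lin.
have fgy : form 1 gy by apply: form_lin.
have gE x y : b *m pt x y = pt (gx x y) (gy x y).
  by apply/colP=> i; rewrite mxE big_ord2 !mxE /=; case: (ord2P i) => ->.
pose q0 := beta *m pt x0 y0.
have [g1 g2] : gx (q0 ord0 0) (q0 ord_max 0) = x0 /\ gy (q0 ord0 0) (q0 ord_max 0) = y0.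
  by apply: pt_inj; rewrite -gE -colE /b /q0 mulKmx.
apply: (ramified_at (q0 := q0) cF full _ nzl (form_subst fe fgx fgy) (form_subst ff0 fgx fgy)
  (form_subst ff1 fgx fgy) (form_subst fT fgx fgy) fm (R := fun u v x y => R u v (gx x y) (gy x y))).
- exact: mul_unit_neq0 (pt_neq0 nz0).
- by move=> u v; apply: form_subst.
- by rewrite g1 g2.
- by rewrite g1 g2.
- by rewrite g1 g2.
by move=> X Y u v; rewrite -E -gE mulKVmx.
Qed.

Section Descent.
Variables (n d m : nat) (N : 'M[binform C]_(2, 3)) (M : 'M[C]_(2, 3)).
Variables (F : 'M[binform C]_(7, 1)) (beta : 'M[C]_2) (E : C -> C -> C).
Variable H : C -> C -> C -> C -> C.
Hypothesis cF : is_curve 6 F.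
Hypothesis ub : beta \in unitmx.
Hypothesis uG : exists q, at_pt (curve_of_plane N M) q \in unitmx.
Hypothesis GE : forall x y u v, Omv ((at_pt (curve_of_plane N M) (pt x y))^T *m pt v (- u)) =
  E x y * val6 (at_pt F (beta *m at_pt (phi_A4 C) (pt x y))) u v.
Hypothesis fH : forall u v, form d (H u v).
Hypothesis GH : forall x y u v, Omv ((at_pt (curve_of_plane N M) (pt x y))^T *m pt v (- u)) =
  Omf x y * H u v (Phif x y ^+ 3) (Psif x y ^+ 3).

(** Up to factors that do not depend on u and v, both H and F give the sextic of
    the lift over each point of the target. As the covering is surjective they are
    proportional, and F has no common zeros. *)
Lemma descend : exists2 e, form (d - 6) e /\ nonzero e &
  forall u v X Y, H u v X Y = e X Y * val6 (at_pt F (beta *m pt X Y)) u v.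
Proof.
have [hF _] := cF.
pose A (k : C * C) X Y := H k.1 k.2 X Y.
pose B (k : C * C) X Y := val6 (at_pt F (beta *m pt X Y)) k.1 k.2.
have fA k : form d (A k) by apply: fH.
have fB k : form 6 (B k).
  by apply: form_val6_comp => l; apply: form_entry.
have AB : proportional A B.
  move=> k l X Y; apply/eqP; rewrite -subr_eq0; apply/eqP.
  have [x [y [<- <-]]] := phi_surj X Y.
  apply: (form_mul0 (form_Om C) (g := fun x y =>
     A k (Phif x y ^+ 3) (Psif x y ^+ 3) * B l (Phif x y ^+ 3) (Psif x y ^+ 3) -
     A l (Phif x y ^+ 3) (Psif x y ^+ 3) * B k (Phif x y ^+ 3) (Psif x y ^+ 3))).
  - apply: (form_comp (d := d + 6) (f := fun X Y => A k X Y * B l X Y - A l X Y * B k X Y)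
      _ (form_exp 3 (form_Phi C)) (form_exp 3 (form_Psi C))).
    by apply: formB; apply: formM.
  - move=> {}x {}y; rewrite mulrBr !mulrA /A -!GH !GE /B at_phi; ring.
  exact: nonzero_Om.
have primB : primitive B.
  move=> x y nzq; have := curve_at_neq0 cF (mul_unit_neq0 ub (pt_neq0 nzq)).
  by case/val6_neq0 => u [v nz]; exists (u, v).
suff nzA : exists k, nonzero (A k).
  have [_ [e fe eE]] := proportional_primitive fA fB nzA AB primB.
  exists e => [|u v X Y]; last exact: (eE (u, v)).
  split=> //; have [k [X [Y]]] := nzA; rewrite eE mulf_eq0 => /norP[nze _].
  by exists X, Y.
have [q uq] := uG; pose K := at_pt (curve_of_plane N M) q.
pose w := invmx K^T *m pt 1 2.
exists (- (w ord_max 0), w ord0 0), (Phif (q ord0 0) (q ord_max 0) ^+ 3), (Psif (q ord0 0) (q ord_max 0) ^+ 3).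
have : Omv (K^T *m w) != 0.
  rewrite /w mulKVmx ?unitmx_tr // Omv_pt.
  exact: Om12_neq0.
have -> : w = pt (w ord0 0) (- - w ord_max 0) by rewrite opprK -colE.
by rewrite /K {1}(colE q) GH mulf_eq0 !mxE /= opprK => /norP[_].
Qed.

End Descent.

(** Let l be the last coefficient of the combined row and write p = P l + T m with
    a second linear form m. As S13 is homogeneous in p and r = 4 l, it is divisible
    by l ^ 5 modulo T ^ 2, and F is a sixth power at the zero of T. *)
Lemma ramified13 M (F : 'M[binform C]_(7, 1)) beta E : is_curve 6 F -> linearly_full F ->
  beta \in unitmx ->
  (exists q, at_pt (curve_of_plane (N13 C) M) q \in unitmx) ->
  (forall x y u v, Omv ((at_pt (curve_of_plane (N13 C) M) (pt x y))^T *m pt v (- u)) =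
    E x y * val6 (at_pt F (beta *m at_pt (phi_A4 C) (pt x y))) u v) ->
  generally_ramified F.
Proof.
move=> cF full ub uG GE.
have [e [fe nze] HE] := descend cF ub uG GE (form_H13 M) (fun x y u v => Om_plane13 M u v x y).
have [c cE] := form_degree0 fe.
have [q uq] := uG; move: q uq => q uq.
set l1 := - M ord_max o32; set l2 := M ord0 o32.
have nzl : (l1, l2) != (0, 0).
  apply: contraTneq uq => -[/eqP]; rewrite oppr_eq0 => /eqP m1 m0.
  have [a0 a1 a2 [b0 b1 b2]] := at_N13 (q ord0 0) (q ord_max 0).
  rewrite unitmxE unitfE (colE q) [at_pt _ _]mx2P det_mx2 negbK !plane_entry.
  by rewrite a0 a1 a2 b0 b1 b2 -/l2 m0 m1; apply/eqP; ring.
have [m1 [m2 lm]] : exists m1 m2, l1 * m2 = 1 + l2 * m1.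
  move: nzl; rewrite xpair_eqE negb_and => /orP[] nz.
    by exists 0, l1^-1; rewrite mulr0 addr0 divff.
  by exists (- l2^-1), 0; rewrite mulr0 mulrN divff // subrr.
pose al k := - M ord_max k * m2 - M ord0 k * m1.
pose be k := l1 * M ord0 k + l2 * M ord_max k.
pose L u v : C := l1 * u + l2 * v; pose m u v : C := m1 * u + m2 * v.
have cE' k u v : cmb M u v k = al k * L u v + be k * m u v.
  by rewrite /cmb /al /be /L /m; ring: lm.
have c2 u v : cmb M u v o32 = L u v by rewrite /cmb /L /l1 /l2; ring.
(* modulo T the first argument of S13 is a multiple of l *)
pose T X Y : C := be o30 * Zf X Y + be o31 * X.
pose P X Y : C := al o30 * Zf X Y + al o31 * X.
have fZ := form_Zf C.
have fT : form 1 T by rewrite /T; form_tac.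
have fP : form 1 P by rewrite /P; form_tac.
have [x0 [y0 [nz0 T0]]] := form_root fT.
pose f0 X Y := S13 (P X Y) 4 X (Zf X Y).
pose f1 X Y : C := T X Y * (6 * P X Y ^+ 5 + 5 * P X Y ^+ 4 * 4 * X
  - 20 * s * P X Y ^+ 3 * 4 ^+ 2 * (Zf X Y * X) - 120 * P X Y ^+ 2 * 4 ^+ 3 * (Zf X Y ^+ 2 * X)
  - 10 * P X Y * 4 ^+ 4 * (Zf X Y ^+ 2 * X ^+ 2)
  - 4 ^+ 5 * (Zf X Y ^+ 2 * X ^+ 2 * (X + 8 * s * Zf X Y))).
pose R u v X Y : C := let l := L u v in let A := P X Y * l in let t := T X Y * m u v in
  let r := 4 * l in let Z := Zf X Y in
  m u v ^+ 2 * ((15 * A ^+ 4 + 20 * A ^+ 3 * t + 15 * A ^+ 2 * t ^+ 2 + 6 * A * t ^+ 3 + t ^+ 4)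
  + (10 * A ^+ 3 + 10 * A ^+ 2 * t + 5 * A * t ^+ 2 + t ^+ 3) * r * X
  - 5 * s * (6 * A ^+ 2 + 4 * A * t + t ^+ 2) * r ^+ 2 * (Z * X)
  - 40 * (3 * A + t) * r ^+ 3 * (Z ^+ 2 * X) - 5 * r ^+ 4 * (Z ^+ 2 * X ^+ 2)).
have ff0 : form 6 f0 by rewrite /f0 /S13; form_tac.
have ff1 : form 6 f1 by rewrite /f1; form_tac.
have fR u v : form 4 (R u v) by rewrite /R /=; form_tac.
have fm : form 1 m by apply: form_lin.
apply: (ramified_comp cF full ub nz0 nzl fe ff0 ff1 fT fm fR _ T0 _ _).
- by rewrite cE; have [X [Y]] := nze; rewrite cE.
- by rewrite /f1 T0 mul0r.
move=> X Y u v; rewrite -HE /H13 c2 !cE' /S13 /f0 /S13 /f1 /R /= -/(L u v) /T /P.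
by ring.
Qed.

(** Modulo X ^ 2 the polynomial S15 is divisible by the fifth power of the middle
    coefficient of the combined row; F is a sixth power at X = 0. *)
Lemma ramified15 M (F : 'M[binform C]_(7, 1)) beta E : is_curve 6 F -> linearly_full F ->
  beta \in unitmx ->
  (exists q, at_pt (curve_of_plane (N15 C) M) q \in unitmx) ->
  (forall q, q != 0 -> at_pt (curve_of_plane (N15 C) M) q != 0) ->
  (forall x y u v, Omv ((at_pt (curve_of_plane (N15 C) M) (pt x y))^T *m pt v (- u)) =
    E x y * val6 (at_pt F (beta *m at_pt (phi_A4 C) (pt x y))) u v) ->
  generally_ramified F.
Proof.
move=> cF full ub uG primG GE.
have [e [fe nze] HE] := descend cF ub uG GE (form_H15 M) (fun x y u v => Om_plane15 M u v x y).
set l1 := - M ord_max o31; set l2 := M ord0 o31.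
have nzs := s_neq0 C.
have nzl : (l1, l2) != (0, 0).
  apply/eqP => -[/eqP]; rewrite oppr_eq0 => /eqP m1 m0.
  have [x [y [X0 Y1]]] := phi_surj (0 : C) 1.
  have F0 : Phif x y = 0 by apply/eqP; move/eqP: X0; rewrite expf_eq0.
  have nzq : pt x y != 0 :> 'cV[C]_2.
    rewrite pt_eq0; apply: contra_eqN Y1 => /andP[/eqP -> /eqP ->].
    by rewrite (PhiPsi0 C).2 expr0n eq_sym oner_eq0.
  case/eqP: (primG _ nzq); apply/matrixP=> i j; rewrite plane_entry [RHS]mxE.
  have [a0 a1 a2 [b0 b1 b2]] := at_N15 x y.
  case: (ord2P i) (ord2P j) => [] -> [] ->;
    by rewrite ?a0 ?a1 ?a2 ?b0 ?b1 ?b2 -/l2 ?m0 ?m1 F0; ring.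
pose L u v : C := l1 * u + l2 * v.
have c1 u v : cmb M u v o31 = L u v by rewrite /cmb /L /l1 /l2; ring.
pose m u v : C := - 8 * s * cmb M u v o30 - 768 * cmb M u v o32.
have fm : form 1 m.
  apply: (form_ext (f := fun u v => (8 * s * M ord_max o30 + 768 * M ord_max o32) * u +
    (- 8 * s * M ord0 o30 - 768 * M ord0 o32) * v)).
    by move=> u v; rewrite /m /cmb; ring.
  exact: form_lin.
have fZ := form_Zf C.
have fT : form 1 (fun X Y : C => X) by apply: formx.
pose f0 X Y := (4 * Zf X Y) ^+ 6 * (s * X - 32 * Zf X Y).
pose f1 X Y : C := X * ((4 * Zf X Y) ^+ 5 * Zf X Y).
pose R u v X Y : C := let p := cmb M u v o30 in let q := 4 * cmb M u v o32 in
  let Z := Zf X Y in let A := 4 * Z * L u v in let t := X * q in let r := A + t in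
  p ^+ 6 * (Z ^+ 3 * X ^+ 2) + p ^+ 5 * r * (Z ^+ 2 * X ^+ 2)
  - 5 * s * p ^+ 4 * r ^+ 2 * (Z ^+ 2 * X) - 40 * p ^+ 3 * r ^+ 3 * Z ^+ 2
  - 5 * p ^+ 2 * r ^+ 4 * Z - p * r ^+ 5
  - 8 * s * p * q * Z * (5 * A ^+ 4 + 10 * A ^+ 3 * t + 10 * A ^+ 2 * t ^+ 2 + 5 * A * t ^+ 3 + t ^+ 4)
  + q ^+ 2 * (15 * A ^+ 4 + 20 * A ^+ 3 * t + 15 * A ^+ 2 * t ^+ 2 + 6 * A * t ^+ 3 + t ^+ 4)
      * (s * X - 32 * Z) + 6 * s * q * A ^+ 5.
have ff0 : form 7 f0 by rewrite /f0; form_tac.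
have ff1 : form 7 f1 by rewrite /f1; form_tac.
have fR u v : form 5 (R u v) by rewrite /R /=; form_tac.
have HR X Y u v : H15 M u v X Y = (l1 * u + l2 * v) ^+ 5 *
    (f0 X Y * (l1 * u + l2 * v) + f1 X Y * m u v) + X ^+ 2 * R u v X Y.
  by rewrite /H15 c1 -/(L u v) /f0 /f1 /R /m /S15 /=; ring.
have nz01 : (0, 1) != (0, 0) :> C * C by rewrite xpair_eqE oner_eq0 andbF.
apply: (ramified_comp cF full ub nz01 nzl fe ff0 ff1 fT fm fR) => //.
- have [u [v nzL]] : exists u v, L u v != 0.
    move: nzl; rewrite xpair_eqE negb_and => /orP[] nz.
      by exists 1, 0; rewrite /L mulr1 mulr0 addr0.
    by exists 0, 1; rewrite /L mulr1 mulr0 add0r.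
  have : H15 M u v 0 1 != 0.
    rewrite HR -/(L u v) /f1 /f0 mul0r expr0n mul0r addr0 mul0r addr0 mulr0 sub0r /Zf subr0.
    have nzZ : 1 / (12 * s) != 0 by rewrite mul1r invr_eq0 mulf_neq0 ?pnatr_eq0.

    apply: mulf_neq0 (expf_neq0 5 nzL) (mulf_neq0 (mulf_neq0 (expf_neq0 6 _) _) nzL).
      by apply: mulf_neq0 nzZ; rewrite pnatr_eq0.
    by rewrite oppr_eq0; apply: mulf_neq0 nzZ; rewrite pnatr_eq0.
  by rewrite HE mulf_eq0 => /norP[].
- by rewrite /f1 mul0r.
by move=> X Y u v; rewrite -HE HR.
Qed.

End Tangency.

(** * Equivariance of the two frames and the parameter t *)

Section Equivariance.
Variable C : numClosedFieldType.
Let ii := ii C.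
Let ss := ss C.
Let nz2 : (2 : C) != 0. Proof. by rewrite pnatr_eq0. Qed.

Lemma Phi_i (x y : C) : Phif ('i * x) (- ('i * y)) = Phif x y.
Proof. by rewrite /Phif; ring: ii. Qed.
Lemma Psi_i (x y : C) : Psif ('i * x) (- ('i * y)) = Psif x y.
Proof. by rewrite /Psif; ring: ii. Qed.
Lemma Om_i (x y : C) : Omf ('i * x) (- ('i * y)) = Omf x y.
Proof. by rewrite /Omf; ring: ii. Qed.
Lemma Phi_j (x y : C) : Phif (- y) x = Phif x y. Proof. by rewrite /Phif; ring. Qed.
Lemma Om_j (x y : C) : Omf (- y) x = Omf x y. Proof. by rewrite /Omf; ring. Qed.

(** The turned gradient (- dPy, dPx) of Psi transforms like (x, y). *)
Lemma dP_i (x y : C) : - dPy ('i * x) (- ('i * y)) = 'i * - dPy x y /\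
  dPx ('i * x) (- ('i * y)) = - ('i * dPx x y).
Proof. by split; rewrite /dPx /dPy; ring: ii. Qed.
Lemma dP_j (x y : C) : - dPy (- y) x = - dPx x y /\ dPx (- y) x = - dPy x y.
Proof. by split; rewrite /dPx /dPy; ring. Qed.
Lemma dP_c (x y : C) : - dPy (cx x y) (cy x y) = om1 C * cx (- dPy x y) (dPx x y) /\
  dPx (cx x y) (cy x y) = om1 C * cy (- dPy x y) (dPx x y).
Proof. by split; rewrite /dPx /dPy /cx /cy /om1; field: ss ii. Qed.

(** The columns transform like (x, y), up to the character chi of Cm. *)
Definition equivariant_frame (chi : C) (N : 'M[binform C]_(2, 3)) :=
  [/\ forall q, at_pt N (Im C *m q) = Im C *m at_pt N q,
      forall q, at_pt N (Jm C *m q) = Jm C *m at_pt N q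
    & forall q, at_pt N (Cm C *m q) = chi *: (Cm C *m at_pt N q)].

Lemma ord3P (i : 'I_3) : [\/ i = o30, i = o31 | i = o32].
Proof.
case: i => [[|[|[|//]]] lt]; [apply: Or31|apply: Or32|apply: Or33]; exact: val_inj.
Qed.

Lemma frame_entry (N : 'M[binform C]_(2, 3)) chi (a b : 'I_3 -> C -> C -> C) :
  (forall k x y, at_pt N (pt x y) ord0 k = a k x y /\ at_pt N (pt x y) ord_max k = b k x y) ->
  (forall k x y, [/\ a k ('i * x) (- ('i * y)) = 'i * a k x y,
    b k ('i * x) (- ('i * y)) = - ('i * b k x y), a k (- y) x = - b k x y & b k (- y) x = a k x y]) ->
  (forall k x y, a k (cx x y) (cy x y) = chi * cx (a k x y) (b k x y) /\
     b k (cx x y) (cy x y) = chi * cy (a k x y) (b k x y)) ->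
  equivariant_frame chi N.
Proof.
move=> NE ij c; split=> q; rewrite (colE q) ?Im_pt ?Jm_pt ?Cm_pt; apply/matrixP=> i k;
  rewrite ?[in RHS]mxE ?[in RHS]mxE big_ord2;
  have [n0 n1] := NE k (q ord0 0) (q ord_max 0); rewrite n0 n1.
- have [n0' n1'] := NE k ('i * q ord0 0) (- ('i * q ord_max 0)).
  have [e0 e1 _ _] := ij k (q ord0 0) (q ord_max 0).
  by case: (ord2P i) => ->; rewrite ?n0' ?n1' ?e0 ?e1 !mxE /=; ring.
- have [n0' n1'] := NE k (- q ord_max 0) (q ord0 0).
  have [_ _ e0 e1] := ij k (q ord0 0) (q ord_max 0).
  by case: (ord2P i) => ->; rewrite ?n0' ?n1' ?e0 ?e1 !mxE /=; ring.
have [n0' n1'] := NE k (cx (q ord0 0) (q ord_max 0)) (cy (q ord0 0) (q ord_max 0)).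
have [e0 e1] := c k (q ord0 0) (q ord_max 0).
by case: (ord2P i) => ->; rewrite ?n0' ?n1' ?e0 ?e1 /cx /cy !mxE /=; ring.
Qed.

Definition a13 (k : 'I_3) x y : C := if k == o30 then x * Omf x y ^+ 2 else
  if k == o31 then x * Phif x y ^+ 3 else Omf x y * Phif x y * (4 * - dPy x y).
Definition b13 (k : 'I_3) x y : C := if k == o30 then y * Omf x y ^+ 2 else
  if k == o31 then y * Phif x y ^+ 3 else Omf x y * Phif x y * (4 * dPx x y).
Definition a15 (k : 'I_3) x y : C := if k == o30 then x * Omf x y * Phif x y ^+ 2 else
  if k == o31 then Omf x y ^+ 2 * (4 * - dPy x y) else Phif x y ^+ 3 * (4 * - dPy x y).
Definition b15 (k : 'I_3) x y : C := if k == o30 then y * Omf x y * Phif x y ^+ 2 else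
  if k == o31 then Omf x y ^+ 2 * (4 * dPx x y) else Phif x y ^+ 3 * (4 * dPx x y).

Lemma N13_ab k x y : at_pt (N13 C) (pt x y) ord0 k = a13 k x y /\
  at_pt (N13 C) (pt x y) ord_max k = b13 k x y.
Proof.
have [? ? a2 [? ? ?]] := at_N13 x y.
by case: (ord3P k) => ->; split=> //; rewrite a2 /a13 /=; ring.
Qed.

Lemma N15_ab k x y : at_pt (N15 C) (pt x y) ord0 k = a15 k x y /\
  at_pt (N15 C) (pt x y) ord_max k = b15 k x y.
Proof.
have [? a1 a2 [? ? ?]] := at_N15 x y.
by case: (ord3P k) => ->; split=> //; rewrite ?a1 ?a2 /a15 /=; ring.
Qed.

Lemma N13_equivariant : equivariant_frame 1 (N13 C).
Proof.
apply: (frame_entry N13_ab) => k x y.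
  have [d1 d2] := dP_i x y; have [d3 d4] := dP_j x y.
  by case: (ord3P k) => ->; split; rewrite /a13 /b13 /= ?Phi_i ?Om_i ?Phi_j ?Om_j ?d1 ?d2 ?d3 ?d4; ring: ii.
have [d1 d2] := dP_c x y.
case: (ord3P k) => ->; rewrite /a13 /b13 /= ?Om_c ?Phi_c ?d1 ?d2 /cx /cy /om1 /om2.
all: by split; field: ss ii.
Qed.

Lemma ab15_c k x y : a15 k (cx x y) (cy x y) = om1 C * cx (a15 k x y) (b15 k x y) /\
  b15 k (cx x y) (cy x y) = om1 C * cy (a15 k x y) (b15 k x y).
Proof.
have [d1 d2] := dP_c x y.
case: (ord3P k) => ->; rewrite /a15 /b15 /= ?Om_c ?Phi_c ?d1 ?d2 /cx /cy /om1 /om2.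
all: by split; field: ss ii.
Qed.

Lemma N15_equivariant : equivariant_frame (om1 C) (N15 C).
Proof.
apply: (frame_entry N15_ab) => k x y; last exact: ab15_c.
have [d1 d2] := dP_i x y; have [d3 d4] := dP_j x y.
by case: (ord3P k) => ->; split; rewrite /a15 /b15 /= ?Phi_i ?Om_i ?Phi_j ?Om_j ?d1 ?d2 ?d3 ?d4; ring: ii.
Qed.

Lemma plane_equivariant chi N M (G := fun q => at_pt (curve_of_plane N M) q) :
  equivariant_frame chi N ->
  [/\ forall q, G (Im C *m q) = G q *m (Im C)^T, forall q, G (Jm C *m q) = G q *m (Jm C)^T
    & forall q, G (Cm C *m q) = chi *: (G q *m (Cm C)^T)].
Proof.
move=> [NI NJ NC]; split=> q; rewrite /G !at_plane ?NI ?NJ ?NC ?linearZ /= ?trmx_mul ?mulmxA //.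
Qed.

End Equivariance.

Section Normal.
Variable C : numClosedFieldType.
Let ii := ii C.
Let ss := ss C.
Let nz2 : (2 : C) != 0. Proof. by rewrite pnatr_eq0. Qed.
Local Notation s := (sqrtm3 C).

(** The second row of N15 is x times this form of degree 14, which extends the
    normal vector of the parameter t = x / y to the projective line. *)
Definition nf (c : 'I_3 -> C) x y := c o30 * (y ^+ 2 * (x ^+ 4 - y ^+ 4) * Phif x y ^+ 2)
  + (c o31 * Omf x y ^+ 2 + c o32 * Phif x y ^+ 3) * (4 * (x ^+ 2 + s * y ^+ 2)).

Definition rowa (c : 'I_3 -> C) x y := \sum_k c k * a15 k x y.
Definition rowb (c : 'I_3 -> C) x y := \sum_k c k * b15 k x y.

Lemma rowb_nf c x y : rowb c x y = x * nf c x y.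
Proof. by rewrite /rowb big_ord3 /b15 /= /nf /dPx /Omf; ring. Qed.

Lemma rowa_nf c x y : rowa c x y = - (y * nf c (- y) x).
Proof. by rewrite /rowa big_ord3 /a15 /= /nf Phi_j Om_j /dPy {1}/Omf; ring. Qed.

Lemma row_c c x y : rowa c (cx x y) (cy x y) = om1 C * cx (rowa c x y) (rowb c x y) /\
  rowb c (cx x y) (cy x y) = om1 C * cy (rowa c x y) (rowb c x y).
Proof.
rewrite /rowa /rowb !big_ord3 !(ab15_c _ x y).1 !(ab15_c _ x y).2 /cx /cy.
by split; ring.
Qed.

Definition dn c x y := nf c x y * nf c (- y) x.

(** By equivariance the six linear factors of Omf at a row are, up to constants,
    the two coordinates of the row at (x, y) and at its images under Cm and
    Cm ^ 2. Each coordinate is x or y times a value of nf, and the factors x and y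
    multiply to Omega. *)
Lemma Omf_dn c x y : Omf (rowa c x y) (rowb c x y) =
  - (Omf x y * (dn c x y * dn c (cx x y) (cy x y) * dn c (cx (cx x y) (cy x y)) (cy (cx x y) (cy x y)))).
Proof.
have E x' y' : rowa c x' y' * rowb c x' y' = - (x' * y' * dn c x' y').
  by rewrite rowa_nf rowb_nf /dn; ring.
have [c1a c1b] := row_c c x y; have [c2a c2b] := row_c c (cx x y) (cy x y).
have e0 := E x y; have := E (cx x y) (cy x y); have := E (cx (cx x y) (cy x y)) (cy (cx x y) (cy x y)).
rewrite c2a c2b c1a c1b.
set D0 := dn c x y in e0 *; set D1 := dn c _ _; set D2 := dn c _ _.
set a := rowa c x y in e0 *; set b := rowb c x y in e0 *.
have e1 (u v : C) : cx u v * cy u v = (v ^+ 2 - u ^+ 2) / 2 by rewrite /cx /cy; field: ii.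
have e2 (u v : C) : cx (cx u v) (cy u v) * cy (cx u v) (cy u v) = - ('i / 2 * (u ^+ 2 + v ^+ 2)).
  by rewrite /cx /cy; field: ii.
have om3 := om_root C; have {om3} [_ _ om3 _] := om3.
have -> : cx (om1 C * cx a b) (om1 C * cy a b) = om1 C * cx (cx a b) (cy a b).
  by rewrite /cx /cy; ring.
have -> : cy (om1 C * cx a b) (om1 C * cy a b) = om1 C * cy (cx a b) (cy a b).
  by rewrite /cx /cy; ring.
have mm (o p q : C) : o * p * (o * q) = o ^+ 2 * (p * q) by ring.
rewrite !mm !e2 !e1 => h2 h1.
have w3 : om1 C ^+ 2 * (om1 C ^+ 2 * om1 C ^+ 2) = 1 by rewrite -!exprD (exprM _ 3 2) om3 expr1n.
have nzi : 'i / 4 != 0 :> C.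
  by rewrite mulf_neq0 ?invr_eq0 ?pnatr_eq0 // neq0Ci.
apply: (mulfI nzi); transitivity ((a * b) * (om1 C ^+ 2 * ((b ^+ 2 - a ^+ 2) / 2)) *
  (om1 C ^+ 2 * (om1 C ^+ 2 * (- ('i / 2 * (a ^+ 2 + b ^+ 2)))))).
  transitivity (om1 C ^+ 2 * (om1 C ^+ 2 * om1 C ^+ 2) * ('i / 4 * Omf a b)).
    by rewrite w3 mul1r.
  by rewrite /Omf; field.
by rewrite e0 h1 h2 /Omf; field.
Qed.

Lemma form_nf c : form 14 (nf c).
Proof. by rewrite /nf /Omf /Phif; form_tac. Qed.

Lemma H15_dn M u v x y (c := cmb M u v) :
  H15 M u v (Phif x y ^+ 3) (Psif x y ^+ 3) =
  - (dn c x y * dn c (cx x y) (cy x y) * dn c (cx (cx x y) (cy x y)) (cy (cx x y) (cy x y))).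
Proof.
have fnx : form 1 (@cx C) by rewrite /cx; form_tac.
have fny : form 1 (@cy C) by rewrite /cy; form_tac.
have fdn : form 28 (dn c).
  apply: (@formM _ 14 14 _ _ (form_nf c)); apply: (form_subst (form_nf c)).
    by apply: formN; exact: formy.
  exact: formx.
apply: (form_cancel (form_Om C) (d := 84) _ (f := fun x y => H15 M u v (Phif x y ^+ 3) (Psif x y ^+ 3))
  (g := fun x y => - (dn c x y * dn c (cx x y) (cy x y) *
     dn c (cx (cx x y) (cy x y)) (cy (cx x y) (cy x y))))).
- exact: nonzero_Om.
- exact: form_comp (form_H15 M u v) (form_exp 3 (form_Phi C)) (form_exp 3 (form_Psi C)).
- apply: formN; apply: (@formM _ 56 28).
    by apply: (@formM _ 28 28) => //; apply: form_subst.
  by apply: (form_subst fdn); [apply: (form_subst fnx)|apply: (form_subst fny)].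
move=> {}x {}y; rewrite -Om_plane15 mulrN -Omf_dn.
rewrite plane_cmb /Omv 2![(_ *m _) _ _]mxE /rowa /rowb; congr Omf.
  by apply: eq_bigr => k _; rewrite [(\col__ _) _ _]mxE -(N15_ab k x y).1 mulrC.
by apply: eq_bigr => k _; rewrite [(\col__ _) _ _]mxE -(N15_ab k x y).2 mulrC.
Qed.

(** By H15_dn a product of six linear forms in u and v vanishes identically, so
    one of them does: the two rows of M have a common zero. *)
Lemma normal_exists M X Y : (X, Y) != (0, 0) -> (forall u v, H15 M u v X Y = 0) ->
  exists x y, (x, y) != (0, 0) /\ forall i, nf (fun k => M i k) x y = 0.
Proof.
have [x [y [<- <-]]] := phi_surj X Y => nz H0.
have nzq : (x, y) != (0, 0).
  apply: contraNneq nz => -[-> ->].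
  by rewrite (PhiPsi0 C).1 (PhiPsi0 C).2 expr0n.
have nzj (x' y' : C) : (x', y') != (0, 0) -> (- y', x') != (0, 0).
  by rewrite !xpair_eqE oppr_eq0 andbC.
have nzc (x' y' : C) : (x', y') != (0, 0) -> (cx x' y', cy x' y') != (0, 0).
  move=> nz'; have := mul_unit_neq0 (unit_Cm C) (pt_neq0 nz').
  by rewrite Cm_pt pt_eq0 xpair_eqE.
have nzc1 := nzc _ _ nzq; have nzc2 := nzc _ _ nzc1.
apply: contrapT => none.
have nzf x' y' : (x', y') != (0, 0) -> nonzero (fun u v => nf (cmb M u v) x' y').
  move=> nz'; apply: contrapT => all0; apply: none; exists x', y'; split=> // i.
  have nfE u v : nf (cmb M u v) x' y' = v * nf (fun k => M ord0 k) x' y' - u * nf (fun k => M ord_max k) x' y'.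
    by rewrite /nf /cmb; ring.
  have H u v : nf (cmb M u v) x' y' = 0.
    by apply/eqP/negPn/negP => n; apply: all0; exists u, v.
  case: (ord2P i) => ->.
    by rewrite -[RHS](H 0 1) nfE; ring.
  by apply: oppr_inj; rewrite oppr0 -[RHS](H 1 0) nfE; ring.
have fnf x' y' : form 1 (fun u v => nf (cmb M u v) x' y').
  apply: (form_ext (f := fun u v => (- nf (fun k => M ord_max k) x' y') * u + nf (fun k => M ord0 k) x' y' * v)).
    by move=> u v; rewrite /nf /cmb; ring.
  exact: form_lin.
have fdn x' y' : form 2 (fun u v => dn (cmb M u v) x' y').
  exact: (formM (fnf x' y') (fnf (- y') x')).
have nzd x' y' : (x', y') != (0, 0) -> nonzero (fun u v => dn (cmb M u v) x' y').
  move=> nz'; exact: (form_neqM (fnf x' y') (fnf (- y') x') (nzf _ _ nz') (nzf _ _ (nzj _ _ nz'))).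
have nz01 := form_neqM (fdn _ _) (fdn _ _) (nzd _ _ nzq) (nzd _ _ nzc1).
have [u [v]] := form_neqM (formM (fdn _ _) (fdn _ _)) (fdn _ _) nz01 (nzd _ _ nzc2).
by rewrite -[_ * _]opprK -H15_dn H0 oppr0 eqxx.
Qed.

Lemma nf_normal t c : nf c t 1 = \sum_k c k * normal15 t k 0.
Proof.
by rewrite big_ord3 !mxE /= /nf /Omf /Phif; ring.
Qed.

(** The vector of coefficients of nf at (x, y) is normal15 (x / y) up to scalars;
    at y = 0 it is the last basis vector, as is normal15 1. *)
Lemma plane15_exists (M : 'M[C]_(2, 3)) X Y : \rank M = 2%N -> (X, Y) != (0, 0) ->
  (forall u v, H15 M u v X Y = 0) -> exists t : C, plane15 t M.
Proof.
move=> rM nz H0; have [x [y [nzq M0]]] := normal_exists nz H0.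
have tE (t : C) : (forall i, nf (fun k => M i k) t 1 = 0) -> plane15 t M.
  move=> h; split=> //; apply/colP=> i; rewrite mxE [RHS]mxE.
  by rewrite -[RHS](h i) nf_normal.
have [y0|nzy] := eqVneq y 0.
  exists 1; apply: tE => i; have := M0 i; rewrite /nf y0 /Omf /Phif => E.
  have nzx : x != 0 by apply: contraNneq nzq => ->; rewrite y0.
  have {E} : 4 * x ^+ 14 * M i o32 = 0 by rewrite -[RHS]E; ring.
  have nz4 : 4 * x ^+ 14 != 0 by rewrite mulf_neq0 ?pnatr_eq0 ?expf_neq0.
  by move/eqP; rewrite mulf_eq0 (negbTE nz4) => /eqP ->; ring: ss.
exists (x / y); apply: tE => i.
have E := form_scale y (x / y) 1 (form_nf (fun k => M i k)).
rewrite mulr1 mulrCA divff // mulr1 M0 in E.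
by move/esym/eqP: E; rewrite mulf_eq0 expf_eq0 /= (negbTE nzy) => /eqP.
Qed.

End Normal.

(** * Every Galois lift has a normal form *)

Section Classification.
Variable C : numClosedFieldType.
Let ii := ii C.
Let nz2 : (2 : C) != 0. Proof. by rewrite pnatr_eq0. Qed.

Lemma bin_oct_D8 : bin_oct (D8 C).
Proof. exact: oct_diag. Qed.

Definition swap : 'M[C]_2 := mx2 0 (-1) (-1) 0.

Lemma unit_swap : swap \in unitmx.
Proof. by rewrite unit_mx2 mulr0 mulrNN mulr1 sub0r oppr_eq0 oner_eq0. Qed.

Lemma phi_D8 q : at_pt (phi_A4 C) (D8 C *m q) = swap *m at_pt (phi_A4 C) q.
Proof.
rewrite (colE q) mul_mx2_pt !at_phi mul_mx2_pt; have E := z8z8 C; rewrite z8'E /Phif /Psif.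
by congr pt; ring: E ii.
Qed.

Definition normal_form n (alpha B : 'M[C]_2) (g : 'M[binform C]_2) :=
  (n = 13%N /\ exists M : 'M[C]_(2, 3), \rank M = 2%N /\
     carries alpha 1%:M B g (curve_of_plane (N13 C) M)) \/
  (n = 15%N /\ exists (t : C) (M : 'M[C]_(2, 3)), plane15 t M /\
     carries alpha 1%:M B g (curve_of_plane (N15 C) M)).

(** In degree 15 the sextic H15 has degree 7 on the target, one more than F, and
    it vanishes at the zero of the quotient; this produces the parameter t. *)
Lemma equivariant_normal_form phi F n (g : 'M[binform C]_2) alpha beta B chi :
  sextic_curve F -> is_curve n g -> galois_lift phi F g -> nondeg g ->
  alpha \in unitmx -> beta \in unitmx -> bin_oct B ->
  (forall q, at_pt phi (alpha *m q) = beta *m at_pt (phi_A4 C) q) ->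
  equivariant_lift n chi (fun q => at_pt g (alpha *m q) *m B^T) ->
  n = 13%N \/ (n = 15%N /\ chi = om1 C) ->
  generally_ramified F /\ normal_form n alpha B g.
Proof.
move=> [cF _ full _] cg gl ndg uA ub oB phiE eG.
have [_ [E fE EE]] := f1_factor cg cF gl ndg uA ub (bin_oct_octa oB) phiE.
have [hF _] := cF.
have car h : (forall q, at_pt g (alpha *m q) *m B^T = at_pt h q) -> carries alpha 1%:M B g h.
  by move=> gh; split; rewrite ?det1 // => q _; rewrite mul1mx gh; apply: same_refl.
case=> [n13|[n15 chi1]].
  have [M [rM GM]] := el_classify13 eG n13; split; last by left; split=> //; exists M; split=> //; apply: car.
  apply: (ramified13 cF full ub (M := M) (E := E)) => [|x y u v].
    by have [q uq] := el_unit eG; exists q; rewrite -GM.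
  by rewrite -GM EE.
have [M [rM GM]] := el_classify15 eG n15 chi1.
have uG : exists q, at_pt (curve_of_plane (N15 C) M) q \in unitmx.
  by have [q uq] := el_unit eG; exists q; rewrite -GM.
have GE x y u v : Omv ((at_pt (curve_of_plane (N15 C) M) (pt x y))^T *m pt v (- u)) =
    E x y * val6 (at_pt F (beta *m at_pt (phi_A4 C) (pt x y))) u v by rewrite -GM EE.
split.
  apply: (ramified15 cF full ub uG _ GE) => q nzq; rewrite -GM; exact: (el_prim eG nzq).
right; split=> //.
have [e [fe nze] HE] := descend cF ub uG GE (form_H15 M) (fun x y u v => Om_plane15 M u v x y).
have [X [Y [nzXY e0]]] := form_root fe.
have [|t tM] := plane15_exists rM nzXY; first by move=> u v; rewrite HE e0 mul0r.
by exists t, M; split=> //; apply: car.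
Qed.

(** The octahedral matrix D8 exchanges the two characters that are possible in
    degree 15; on the target it exchanges 0 and infinity. *)
Lemma normal_form_exists (phi : 'M[binform C]_(2, 1)) (F : 'M[binform C]_(7, 1)) n
    (g : 'M[binform C]_(2, 2)) :
  galois_covering 'Alt_('I_4)%G 12 phi -> sextic_curve F -> is_curve n g -> galois_lift phi F g ->
  generally_ramified F /\ exists alpha beta B, [/\ beta \in unitmx,
    forall q, at_pt phi (alpha *m q) = beta *m at_pt (phi_A4 C) q & normal_form n alpha B g].
Proof.
move=> cphi sF cg gl; have [ndg [alpha [beta [B [chi [uA ub oB phiE]]]]]] := normalize cphi cg gl.
move=> /= [odd_n chi3 GI GJ GC]; have [cF _ _ _] := sF; have [hF _] := cF; have [hg _] := cg.
have [uB _] := bin_oct_octa oB.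
have uBT : B^T \in unitmx by rewrite unitmx_tr.
have eG : equivariant_lift n chi (fun q => at_pt g (alpha *m q) *m B^T).
  split=> //.
  - move=> i j; apply: (form_ext (f := fun x y => B j ord0 * at_pt g (alpha *m pt x y) i ord0 +
       B j ord_max * at_pt g (alpha *m pt x y) i ord_max)).
      by move=> x y; rewrite [RHS]mxE big_ord2 2![B^T _ _]mxE; ring.
    by apply: formD; apply: formZ; apply: form_entry.
  - move=> q nzq; apply: contraNneq (curve_at_neq0 cg (mul_unit_neq0 uA nzq)) => z.
    by rewrite -[at_pt _ _](mulmxK uBT) z mul0mx.
  have [q uq] := ndg; exists (invmx alpha *m q).
  by rewrite mulKVmx // unitmx_mul uq.
have [le72 [E fE EE]] := f1_factor cg cF gl ndg uA ub (bin_oct_octa oB) phiE.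
have n16 : (n <= 16)%N.
  apply: (degree_bound eG fE); first by rewrite subnKC.
  move=> u v; exists (fun x y => val6 (at_pt F (beta *m at_pt (phi_A4 C) (pt x y))) u v) => //.
  by apply: form_val6_comp => l; apply: (form_F_phi _ (d := 6)).
have : n = 13%N \/ n = 15%N by lia.
move=> n1315; have done1 := equivariant_normal_form sF cg gl ndg uA ub oB phiE eG.
case: (n1315) => n_eq; first by have [//|? ?] := done1; [left|split=> //; exists alpha, beta, B].
case: (chi15 eG n_eq) => chiE; first by have [//|? ?] := done1; [right|split=> //; exists alpha, beta, B].
have eG2 := el_twist eG.
have uA2 : alpha *m D8 C \in unitmx by rewrite unitmx_mul uA unit_D8.
have ub2 : beta *m swap \in unitmx by rewrite unitmx_mul ub unit_swap.
have oB2 : bin_oct (invmx (D8 C) *m B) by apply: bin_oct_mul oB; apply: bin_oct_inv; apply: bin_oct_D8.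
have phiE2 q : at_pt phi (alpha *m D8 C *m q) = beta *m swap *m at_pt (phi_A4 C) q.
  by rewrite -!mulmxA phiE phi_D8.
have eG3 : equivariant_lift n (om1 C) (fun q => at_pt g (alpha *m D8 C *m q) *m (invmx (D8 C) *m B)^T).
  move: eG2; rewrite chiE expr2 om22; congr equivariant_lift; apply: funext => q.
  by rewrite trmx_mul !mulmxA.
have [|ram nf] := equivariant_normal_form sF cg gl ndg uA2 ub2 oB2 phiE2 eG3; first by right.
by split=> //; exists (alpha *m D8 C), (beta *m swap), (invmx (D8 C) *m B).
Qed.

End Classification.

(** * The plane perpendicular to the normal vector *)

Section NormalPlane.
Variable C : numClosedFieldType.
Let ss := ss C.
Local Notation s := (sqrtm3 C).

Lemma normal15_neq0 (t : C) : normal15 t != 0.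
Proof.
apply/eqP=> /colP n0; have e0 := n0 o30; have e1 := n0 o31; have e2 := n0 o32.
move: e0 e1 e2; rewrite !mxE /=.
set P := 2 * s * t ^+ 2 - t ^+ 4 - 1; set w := t ^+ 4 - 1; set r := s + t ^+ 2 => e0 e1 e2.
have nat_neq0 k : k.+1%:R != 0 :> C by rewrite pnatr_eq0.
have [P0|nzP] := eqVneq P 0.
  have t4 : t ^+ 4 = 2 * s * t ^+ 2 - 1.
    by transitivity (2 * s * t ^+ 2 - 1 - P); [rewrite /P; ring|rewrite P0 subr0].
  have [z|nzt] := eqVneq t 0; last have [z|nzw] := eqVneq w 0; last have [z|nzr] := eqVneq r 0.
  - have : P = -1 by rewrite /P z; ring.
    by move/eqP; rewrite P0 eq_sym oppr_eq0 oner_eq0.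
  - have t1 : t ^+ 4 = 1 by apply/eqP; rewrite -subr_eq0 -/w z.
    have E : s * t ^+ 2 = 1.
      apply: (mulfI (nat_neq0 1%N)); transitivity (t ^+ 4 + 1); first by rewrite t4; ring.
      by rewrite t1; ring.
    have : -3 * t ^+ 4 = (s * t ^+ 2) ^+ 2 by ring: ss.
    rewrite E t1 => /eqP; rewrite -subr_eq0.
    have -> : -3 * 1 - 1 ^+ 2 = - (4%:R) :> C by ring.
    by rewrite oppr_eq0 (negbTE (nat_neq0 3%N)).
  - have E : t ^+ 2 = - s by apply/eqP; rewrite -addr_eq0 addrC -/r z.
    have : P = 8 by rewrite /P -[4%N]/(2 * 2)%N exprM E; ring: ss.
    by move/eqP; rewrite P0 eq_sym (negbTE (nat_neq0 7%N)).
  - case/eqP: (mulf_neq0 (mulf_neq0 (mulf_neq0 (nat_neq0 3%N) (expf_neq0 2 nzt)) (expf_neq0 2 nzw)) nzr).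
    exact: e1.
have w0 : t ^+ 4 = 1.
  by apply/eqP; rewrite -subr_eq0 -/w; move/eqP: e0; rewrite mulf_eq0 (negbTE (expf_neq0 2 nzP)) orbF.
have r0 : t ^+ 2 = - s.
  apply/eqP; rewrite -addr_eq0 addrC -/r; move/eqP: e2.
  rewrite mulf_eq0 mulf_eq0 (negbTE (expf_neq0 3 nzP)) orbF oppr_eq0.
  by rewrite (negbTE (nat_neq0 3%N)).
have t4 : t ^+ 4 = -3 by rewrite -[4%N]/(2 * 2)%N exprM r0; ring: ss.
have /eqP : 4%:R = 0 :> C by transitivity (1 - t ^+ 4); [rewrite t4; ring|rewrite w0 subrr].
by rewrite (negbTE (nat_neq0 3%N)).
Qed.

Lemma rank_ker_normal (n : 'cV[C]_3) : n != 0 -> \rank (kermx n) = 2%N.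
Proof.
move=> nzn; have -> : \rank (kermx n) = (3 - \rank n)%N by apply: mxrank_ker.
suff -> : \rank n = 1%N by [].
apply/eqP; rewrite eqn_leq rank_leq_col /= lt0n mxrank_eq0 //.
Qed.

Lemma plane15_ker (t : C) M : plane15 t M -> (M == kermx (normal15 t))%MS.
Proof.
move=> [rM /sub_kermxP M0]; have [_ <-] := mxrank_leqif_eq M0.
by rewrite rM rank_ker_normal // normal15_neq0.
Qed.

Lemma plane15_unique (t : C) : exists2 M : 'M[C]_(2, 3), plane15 t M &
  forall M', plane15 t M' -> (M' == M)%MS.
Proof.
have rk := rank_ker_normal (normal15_neq0 t).
pose K := kermx (normal15 t); pose M : 'M[C]_(2, 3) := castmx (rk, erefl) (row_base K).
have MK : (M :=: K)%MS by apply: eqmx_trans (eqmx_cast _ _) (eq_row_base K).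
have tM : plane15 t M by split; [rewrite MK|apply/sub_kermxP; rewrite MK].
exists M => // M' tM'; have /eqmxP e1 := plane15_ker tM'.
by apply/eqmxP; apply: eqmx_trans e1 (eqmx_sym MK).
Qed.

End NormalPlane.

(** * Deck transformations of the tetrahedral covering *)

Section Deck.
Variable C : numClosedFieldType.
Let ii := ii C.
Let ss := ss C.
Let nz2 : (2 : C) != 0. Proof. by rewrite pnatr_eq0. Qed.
Local Notation s := (sqrtm3 C).

Inductive tetra : 'M[C]_2 -> Prop :=
| tetra_one : tetra 1%:M
| tetra_I : tetra (Im C)
| tetra_J : tetra (Jm C)
| tetra_C : tetra (Cm C)
| tetra_mul S T : tetra S -> tetra T -> tetra (S *m T).

Lemma octa_Cm : octa (Cm C).
Proof.
split; first exact: unit_Cm.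
exists 1; split=> [|q]; first exact: oner_neq0.
by rewrite (colE q) Cm_pt !Omv_pt Om_c mul1r.
Qed.

Lemma tetra_octa S : tetra S -> octa S.
Proof.
by elim=> {S} *; [exact: octa1|exact: octa_Im|exact: octa_Jm|exact: octa_Cm|exact: octaM].
Qed.

Lemma cube_root_form d (A B : C -> C -> C) c : form d A -> form d B -> c != 0 ->
  (forall x y, A x y ^+ 3 = c * B x y ^+ 3) ->
  exists a, a ^+ 3 = c /\ forall x y, A x y = a * B x y.
Proof.
move=> fA fB nzc AB; have [a aE] := nth_root 2 c.
have [_ _ o1 o2] := om_root C.
have fa k : form d (fun x y => A x y - k * B x y) by apply: formB fA (formZ _ fB).
have prod0 x y : (A x y - a * B x y) * ((A x y - a * om1 C * B x y) * (A x y - a * om2 C * B x y)) = 0.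
  transitivity (A x y ^+ 3 - a ^+ 3 * B x y ^+ 3); last by rewrite aE AB subrr.
  by rewrite /om1 /om2; field: ss.
have sub0 k : (forall x y, A x y - k * B x y = 0) -> forall x y, A x y = k * B x y.
  by move=> h x y; apply/eqP; rewrite -subr_eq0 h.
have cases d' (k : C) (g : C -> C -> C) : form d' g -> (forall x y, (A x y - k * B x y) * g x y = 0) ->
    (forall x y, A x y = k * B x y) \/ forall x y, g x y = 0.
  move=> fg z; have [nz|nz] := pselect (nonzero (fun x y => A x y - k * B x y)).
    by right; apply: (form_mul0 (fa k) fg z nz).
  left; apply: sub0 => x y; apply/eqP/negPn/negP => n; apply: nz; by exists x, y.
have [E|E] := cases _ _ _ (formM (fa _) (fa _)) prod0; first by exists a.
have [E'|E'] := cases _ _ _ (fa _) E.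
  by exists (a * om1 C); rewrite exprMn o1 mulr1.
by exists (a * om2 C); rewrite exprMn o2 mulr1; split=> //; apply: sub0.
Qed.

(** A substitution that multiplies Phi and Psi by the same constant permutes the
    zeros of x y and of x ^ 4 + y ^ 4. *)
Lemma PhiPsi_fixed (S : 'M[C]_2) c : S \in unitmx ->
  (forall x y, let q := S *m pt x y in Phif (q ord0 0) (q ord_max 0) = c * Phif x y /\
     Psif (q ord0 0) (q ord_max 0) = c * Psif x y) ->
  exists2 V, tetra V & same_point S V.
Proof.
have [p [q [r [t ->]]]] := mx2_ex S; rewrite unit_mx2 => u H.
have nzs := s_neq0 C.
have h4 x y : (p * x + q * y) ^+ 4 + (r * x + t * y) ^+ 4 = c * (x ^+ 4 + y ^+ 4).
  have [] := H x y; rewrite mul_mx2_pt !mxE /= => h1 h2.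
  have E (a b : C) : a ^+ 4 + b ^+ 4 = (Phif a b + Psif a b) / 2 by rewrite /Phif /Psif; field.
  by rewrite !E h1 h2; field.
have h2 x y : (p * x + q * y) ^+ 2 * (r * x + t * y) ^+ 2 = c * (x ^+ 2 * y ^+ 2).
  have [] := H x y; rewrite mul_mx2_pt !mxE /= => h1 h2.
  have E (a b : C) : a ^+ 2 * b ^+ 2 = (Psif a b - Phif a b) / (4 * s).
    by rewrite /Phif /Psif; field; rewrite nzs ?pnatr_eq0.
  by rewrite !E h1 h2; field; rewrite nzs ?pnatr_eq0.
have sq0 (a b : C) : a ^+ 2 * b ^+ 2 = 0 -> a = 0 \/ b = 0.
  move=> /eqP; rewrite -exprMn expf_eq0 /= mulf_eq0.
  by case/orP => /eqP ->; [left|right].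
have pr : p = 0 \/ r = 0.
  by apply: sq0; have := h2 1 0; rewrite !mulr1 !mulr0 !addr0 => ->; ring.
have qt : q = 0 \/ t = 0.
  by apply: sq0; have := h2 0 1; rewrite !mulr1 !mulr0 !add0r => ->; ring.
have eq_sq (a b : C) : b != 0 -> a ^+ 4 = c -> b ^+ 4 = c -> a ^+ 2 * b ^+ 2 = c -> a = b \/ a = - b.
  move=> nzb h4a h4b h2ab; have /eqP : a ^+ 2 = b ^+ 2.
    by apply: (mulIf (expf_neq0 2 nzb)); rewrite h2ab -h4b; ring.
  by rewrite eqf_sqr => /orP[]/eqP; [left|right].
have nzi : 'i != 0 :> C := neq0Ci C.
have a10 := h4 1 0; have a01 := h4 0 1; have a11 := h2 1 1.
case: pr qt => [p0|r0] [q0|t0]; first by move: u; rewrite p0 q0 !mul0r subrr eqxx.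
- have hr : r ^+ 4 = c.
    by transitivity ((p * 1 + q * 0) ^+ 4 + (r * 1 + t * 0) ^+ 4); [rewrite p0; ring|rewrite a10; ring].
  have hq : q ^+ 4 = c.
    by transitivity ((p * 0 + q * 1) ^+ 4 + (r * 0 + t * 1) ^+ 4); [rewrite t0; ring|rewrite a01; ring].
  have hqr : q ^+ 2 * r ^+ 2 = c.
    by transitivity ((p * 1 + q * 1) ^+ 2 * (r * 1 + t * 1) ^+ 2); [rewrite p0 t0; ring|rewrite a11; ring].
  move: u; rewrite p0 t0 mul0r sub0r oppr_eq0 mulf_eq0 => /norP[nzq nzr].
  have [->|->] := eq_sq _ _ nzr hq hr hqr.
    exists (Im C *m Jm C); first by apply: tetra_mul; [apply: tetra_I|apply: tetra_J].
    by rewrite mul_mx2; apply: (same_mx2 (k := 'i * r)); rewrite ?mulf_neq0 //; ring: ii.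
  by exists (Jm C); [apply: tetra_J|apply: (same_mx2 (k := r)) => //; ring].
- have hp : p ^+ 4 = c.
    by transitivity ((p * 1 + q * 0) ^+ 4 + (r * 1 + t * 0) ^+ 4); [rewrite r0; ring|rewrite a10; ring].
  have ht : t ^+ 4 = c.
    by transitivity ((p * 0 + q * 1) ^+ 4 + (r * 0 + t * 1) ^+ 4); [rewrite q0; ring|rewrite a01; ring].
  have hpt : p ^+ 2 * t ^+ 2 = c.
    by transitivity ((p * 1 + q * 1) ^+ 2 * (r * 1 + t * 1) ^+ 2); [rewrite r0 q0; ring|rewrite a11; ring].
  move: u; rewrite r0 q0 mul0r subr0 mulf_eq0 => /norP[nzp nzt].
  have [->|->] := eq_sq _ _ nzt hp ht hpt.
    exists 1%:M; first exact: tetra_one.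
    by rewrite mx2_1; apply: (same_mx2 (k := t)) => //; ring.
  exists (Im C); first exact: tetra_I.
  by apply: (same_mx2 (k := 'i * t)); rewrite ?mulf_neq0 //; ring: ii.
by move: u; rewrite r0 t0 !mulr0 subrr eqxx.
Qed.

(** A deck transformation multiplies Phi ^ 3 and Psi ^ 3 by the same constant, hence
    Phi and Psi by constants whose ratio is a cube root of unity; a power of Cm
    makes this ratio 1. *)
Lemma deck_tetra (S : 'M[C]_2) : deck (phi_A4 C) S -> exists2 V, tetra V & same_point S V.
Proof.
move=> [uS dS].
have hphi i j : phi_A4 C i j \is 12.-homog.
  apply: homog_of_form; rewrite mxE (ord1 j); case: (ord2P i) => -> /=.
    by apply: form_ext (form_exp 3 (form_Phi C)) => x y; rewrite evX ev_Phi.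
  by apply: form_ext (form_exp 3 (form_Psi C)) => x y; rewrite evX ev_Psi.
have [c [nzc cE]] : exists c, c != 0 /\ forall q, at_pt (phi_A4 C) (S *m q) = c *: at_pt (phi_A4 C) q.
  apply: (same_const (d := 12)) => [i j|i j|q nz|q nz].
  - exact: form_entry.
  - exact: form_entry1.
  - exact: dS.
  exact: phi_neq0.
pose f x y := (S *m pt x y) ord0 0; pose h x y := (S *m pt x y) ord_max 0.
have SE x y : S *m pt x y = pt (f x y) (h x y) by apply: colE.
have fE x y : f x y = S ord0 ord0 * x + S ord0 ord_max * y by rewrite /f mxE big_ord2 !mxE.
have hE x y : h x y = S ord_max ord0 * x + S ord_max ord_max * y by rewrite /h mxE big_ord2 !mxE.
have ff : form 1 f by apply: form_ext (form_lin _ _) => x y; rewrite fE.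
have fh : form 1 h by apply: form_ext (form_lin _ _) => x y; rewrite hE.
have cub x y : Phif (f x y) (h x y) ^+ 3 = c * Phif x y ^+ 3 /\ Psif (f x y) (h x y) ^+ 3 = c * Psif x y ^+ 3.
  by have := cE (pt x y); rewrite SE !at_phi scale_pt => /pt_inj[].
have [a1 [a1E A1]] := cube_root_form (form_subst (form_Phi C) ff fh) (form_Phi C) nzc (fun x y => (cub x y).1).
have [a2 [a2E A2]] := cube_root_form (form_subst (form_Psi C) ff fh) (form_Psi C) nzc (fun x y => (cub x y).2).
have nza1 : a1 != 0 by apply: contraNneq nzc => z; rewrite -a1E z expr0n.
have o11 := om11 C; have o22 := om22 C; have o12 := om12 C.
have S1 k x y : Phif (f x y) (h x y) = k * Phif x y -> Psif (f x y) (h x y) = k * Psif x y ->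
  let q := S *m pt x y in Phif (q ord0 0) (q ord_max 0) = k * Phif x y /\
     Psif (q ord0 0) (q ord_max 0) = k * Psif x y by [].
have [w [w3 a2w]] : exists w, w ^+ 3 = 1 /\ a2 = w * a1.
  by exists (a2 / a1); rewrite expr_div_n a1E a2E divff ?divfK.
have : [\/ w = 1, w = om1 C | w = om2 C].
  have /eqP : (w - 1) * ((w - om1 C) * (w - om2 C)) = 0.
    by transitivity (w ^+ 3 - 1); [rewrite /om1 /om2; field: ss|rewrite w3 subrr].
  by rewrite !mulf_eq0 !subr_eq0 => /or3P[]/eqP; [apply: Or31|apply: Or32|apply: Or33].
case=> wE; rewrite {w w3}wE in a2w.
- apply: (PhiPsi_fixed (c := a1) uS) => x y; apply: S1; first exact: A1.
  by rewrite A2 a2w mul1r.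
- have [||V tV SV] := PhiPsi_fixed (S := S *m Cm C) (c := om2 C * a1).
  + by rewrite unitmx_mul uS unit_Cm.
  + move=> x y /=; rewrite -mulmxA Cm_pt SE !mxE /= A1 A2 a2w Phi_c Psi_c -o11.
    by split; ring.
  exists (V *m (Cm C *m Cm C)); first by do 2?apply: tetra_mul; do ?apply: tetra_C.
  apply: same_trans (same_mul SV (same_refl _)).
  by rewrite -!mulmxA [Cm C *m (_ *m _)]mulmxA CmCmCm mulmxN mulmx1; apply/same_sym/sameN.
have [||V tV SV] := PhiPsi_fixed (S := S *m Cm C *m Cm C) (c := om1 C * a1).
- by rewrite !unitmx_mul uS unit_Cm.
- move=> x y /=; rewrite -!mulmxA !Cm_pt SE !mxE /= A1 A2 a2w !Phi_c !Psi_c.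
  by split; [rewrite -o22; ring|ring: o12].
exists (V *m Cm C); first by apply: tetra_mul => //; apply: tetra_C.
apply: same_trans (same_mul SV (same_refl _)).
by rewrite -!mulmxA [Cm C *m (_ *m _)]mulmxA CmCmCm mulmxN mulmx1; apply/same_sym/sameN.
Qed.

End Deck.

(** * The threefold V5 and its boundary *)

Section Threefold.
Variable C : numClosedFieldType.

Lemma meval_homogZ n d (P : {mpoly C[n]}) (c : C) (v w : 'I_n -> C) : P \is d.-homog ->
  (forall i, w i = c * v i) -> P.@[w] = c ^+ d * P.@[v].
Proof.
move=> hP wE; rewrite !mevalE mulr_sumr; apply: eq_big_seq => m /(dhomog_mf hP) /= md.
rewrite mulrCA; congr (_ * _); rewrite -md mdegE -prodrXr -big_split /=.
by apply: eq_bigr => i _; rewrite wE exprMn.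
Qed.

Lemma orbit_f1 (M : 'M[C]_2) : M \in unitmx -> orbit6 (f_oct C) (f1 M).
Proof.
move=> uM; have [r r2] := nth_root 1 (\det M).
have nzr : r != 0.
  by apply: contraTneq uM => r0; rewrite unitmxE -r2 r0 expr0n unitr0.
exists (r^-1 *: M); split; first by rewrite detZ -r2 exprVn mulVf ?expf_neq0.
apply/same_val6; exists (r ^+ 6); split=> [|u v]; first exact: expf_neq0.
rewrite val6_coords ?ev_act ?ev_f_oct; last exact: act_homog (f_oct_homog C).
have [a [b [c [d ME]]]] := mx2_ex M; rewrite ME in r2 uM *; rewrite det_mx2 in r2.
have nzD : a * d - b * c != 0 by rewrite -r2 expf_neq0.
have e1 : r^-1 * a * (r^-1 * d) - r^-1 * b * (r^-1 * c) = 1.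
  transitivity (r^-1 ^+ 2 * (a * d - b * c)); first by ring.
  by rewrite -r2 exprVn mulVf ?expf_neq0.
rewrite val6_f1 scale_mx2 inv_mx2 e1 ?oner_neq0 // invr1 scale1r !mxE /= /Omf.
by field.
Qed.

(** The quadratic invariant of binary sextics, up to a constant. *)
Definition I2 : {mpoly C[7]} := let X k (lt : (k < 7)%N) := 'X_(Ordinal lt) in
  120 *: (X 0%N isT * X 6%N isT) - 20 *: (X 1%N isT * X 5%N isT) +
  8 *: (X 2%N isT * X 4%N isT) - 3 *: (X 3%N isT * X 3%N isT).

Lemma I2_homog : I2 \is 2.-homog.
Proof.
have h (i j : 'I_7) : ('X_i * 'X_j : {mpoly C[7]}) \is 2.-homog.
  by apply: (@dhomogM _ _ _ 1 _ 1); rewrite dhomogX /= mdeg1.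
by rewrite /I2; do 3?[apply: rpredB|apply: rpredD]; apply: dhomogZ.
Qed.

Definition vec7 (s : seq C) : 'cV[C]_7 := \col_k s`_k.

Lemma I2_vec7 c0 c1 c2 c3 c4 c5 c6 :
  I2.@[fun i => vec7 [:: c0; c1; c2; c3; c4; c5; c6] i 0] =
  120 * (c0 * c6) - 20 * (c1 * c5) + 8 * (c2 * c4) - 3 * (c3 * c3).
Proof.
by rewrite /I2 /= !(mevalD, mevalB, mevalN) !mevalZ !mevalM !mevalXU !mxE.
Qed.

Lemma val6_vec7 c0 c1 c2 c3 c4 c5 c6 u v :
  val6 (vec7 [:: c0; c1; c2; c3; c4; c5; c6]) u v = c0 * u ^+ 6 + c1 * (u ^+ 5 * v) +
  c2 * (u ^+ 4 * v ^+ 2) + c3 * (u ^+ 3 * v ^+ 3) + c4 * (u ^+ 2 * v ^+ 4) + c5 * (u * v ^+ 5)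
  + c6 * v ^+ 6.
Proof.
by rewrite /val6 !big_ord_recl big_ord0 !mxE /=; ring.
Qed.

(** By I2_f1 the invariant does not vanish on the open orbit, so that this separates
    the open orbit from its boundary. *)
Lemma I2_boundary w : orbit6 (X0 C ^+ 5 * X1 C) w -> I2.@[fun i => w i 0] = 0.
Proof.
move=> [A [dA /same_val6[c [nzc wE]]]].
pose B := invmx A; pose p := B ord0 ord0; pose q := B ord0 ord_max.
pose p' := B ord_max ord0; pose q' := B ord_max ord_max.
have -> : w = vec7 [:: c * (p ^+ 5 * p'); c * (5 * p ^+ 4 * q * p' + p ^+ 5 * q');
  c * (10 * p ^+ 3 * q ^+ 2 * p' + 5 * p ^+ 4 * q * q');
  c * (10 * p ^+ 2 * q ^+ 3 * p' + 10 * p ^+ 3 * q ^+ 2 * q');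
  c * (5 * p * q ^+ 4 * p' + 10 * p ^+ 2 * q ^+ 3 * q');
  c * (q ^+ 5 * p' + 5 * p * q ^+ 4 * q'); c * (q ^+ 5 * q')].
  apply: val6_inj => u v; rewrite wE val6_coords; last first.
    apply: act_homog; rewrite /X0 /X1; apply: (@dhomogM _ _ _ 5 _ 1); last by rewrite dhomogX /= mdeg1.
    by apply: (@dhomogMn _ _ _ 1); rewrite dhomogX /= mdeg1.
  by rewrite val6_vec7 ev_act !evE /p /q /p' /q' /B; ring.
by rewrite I2_vec7; ring.
Qed.

Lemma I2_f1 (M : 'M[C]_2) : I2.@[fun i => f1 M i 0] = 20 * \det M ^+ 6.
Proof.
have [a [b [c [d ->]]]] := mx2_ex M; rewrite det_mx2.
pose t (p q p' q' : C) := [:: p ^+ 5 * p'; 5 * p ^+ 4 * q * p' + p ^+ 5 * q';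
  10 * p ^+ 3 * q ^+ 2 * p' + 5 * p ^+ 4 * q * q';
  10 * p ^+ 2 * q ^+ 3 * p' + 10 * p ^+ 3 * q ^+ 2 * q';
  5 * p * q ^+ 4 * p' + 10 * p ^+ 2 * q ^+ 3 * q'; q ^+ 5 * p' + 5 * p * q ^+ 4 * q'; q ^+ 5 * q'].
pose t1 := t d (- b) (- c) a; pose t2 := t (- c) a d (- b).
have -> : f1 (mx2 a b c d) = vec7 [:: t1`_0 - t2`_0; t1`_1 - t2`_1; t1`_2 - t2`_2;
   t1`_3 - t2`_3; t1`_4 - t2`_4; t1`_5 - t2`_5; t1`_6 - t2`_6].
  by apply: val6_inj => u v; rewrite val6_f1 val6_vec7 /t1 /t2 /t /= /Omf; ring.
by rewrite I2_vec7 /t1 /t2 /t /=; ring.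
Qed.

Lemma f1_neq0 (M : 'M[C]_2) : M \in unitmx -> f1 M != 0.
Proof.
rewrite unitmxE unitfE => nzD; apply/eqP=> f10.
have /eqP : 20 * \det M ^+ 6 = 0.
  rewrite -I2_f1 (meval_homogZ (c := 0) (v := fun=> 0) I2_homog) ?expr0n ?mul0r // => i.
  by rewrite f10 mxE.
by rewrite mulf_eq0 expf_eq0 /= (negbTE nzD) pnatr_eq0.
Qed.

(** A polynomial that vanishes on the open orbit vanishes at f_1 (g) wherever g is
    invertible, hence everywhere, and f_1 (g) is a nonzero multiple of F over
    the covering. *)
Lemma V5_curve n (g : 'M[binform C]_2) (F : 'M[binform C]_(7, 1)) d E :
  (forall i j, g i j \is n.-homog) -> (forall k, F k 0 \is 6.-homog) -> form d E ->
  nondeg g ->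
  (forall x y, f1 (at_pt g (pt x y)) = E x y *: at_pt F (at_pt (phi_A4 C) (pt x y))) ->
  forall q, V5 (at_pt F q).
Proof.
move=> hg hF [pE _ EE] ndg gF q e P hP P0.
have [x [y [Xq Yq]]] := phi_surj (q ord0 0) (q ord_max 0).
have -> : at_pt F q = at_pt F (at_pt (phi_A4 C) (pt x y)) by rewrite at_phi Xq Yq -colE.
have /fin_all_exists[p pP] (k : 'I_7) : exists p : binform C, forall x y,
    ev p x y = at_pt F (at_pt (phi_A4 C) (pt x y)) k 0.
  have [p _ E'] := form_F_phi 1%:M (hF k); exists p => x' y'.
  by rewrite -E' mul1mx.
pose Q := P \mPo [tuple p i | i < 7].
have QE x' y' : ev Q x' y' = P.@[fun i => at_pt F (at_pt (phi_A4 C) (pt x' y')) i 0].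
  rewrite /ev comp_mpoly_meval; apply: meval_eq => i; rewrite tnth_mktuple; exact: pP.
have [pD hD DE] := form_det 1%:M hg.
have [x0 [y0]] := nondeg_det (unitmx1 _ _) ndg.
have pDE x' y' : ev pD x' y' = \det (at_pt g (pt x' y')) by rewrite -DE mul1mx.
rewrite mul1mx -pDE => nzD.
have nzpD : pD != 0 by apply: contraNneq nzD => ->; rewrite ev0.
have nzpE : pE != 0.
  apply: contraNneq (f1_neq0 (M := at_pt g (pt x0 y0)) _) => [z|]; first by rewrite gF EE z ev0 scale0r.
  by rewrite unitmxE unitfE -pDE.
have : pD * (pE ^+ e * Q) = 0.
  apply: ev_inj => x' y'; rewrite ev0 evM evM evX QE -EE -(meval_homogZ hP (w := fun i => f1 (at_pt g (pt x' y')) i 0)).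
    rewrite pDE; have [z|nz] := eqVneq (\det (at_pt g (pt x' y'))) 0; first by rewrite z mul0r.
    rewrite P0 ?mulr0 //; apply: orbit_f1; by rewrite unitmxE unitfE.
  by move=> i; rewrite gF mxE.
move/eqP; rewrite mulf_eq0 (negbTE nzpD) /= mulf_eq0 expf_eq0 (negbTE nzpE) andbF /= => /eqP Q0.
by rewrite -QE Q0 ev0.
Qed.

End Threefold.

(** * Planes that give sextic curves *)

Section Realization.
Variable C : numClosedFieldType.
Variables (n : nat) (N : 'M[binform C]_(2, 3)) (M : 'M[C]_(2, 3)) (chi : C).
Variables (F : 'M[binform C]_(7, 1)) (d : nat) (E : C -> C -> C).
Let g := curve_of_plane N M.
Hypothesis n_gt0 : (0 < n)%N.
Hypothesis hN : forall i j, N i j \is n.-homog.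
Hypothesis primg : forall q, q != 0 -> at_pt g q != 0.
Hypothesis ndg : nondeg g.
Hypothesis nz_chi : chi != 0.
Hypothesis eN : equivariant_frame chi N.
Hypothesis hF : forall k, F k 0 \is 6.-homog.
Hypothesis full : linearly_full F.
Hypothesis fE : form d E.
Hypothesis gF : forall x y,
  f1 (at_pt g (pt x y)) = E x y *: at_pt F (at_pt (phi_A4 C) (pt x y)).

Lemma plane_homog i j : g i j \is n.-homog.
Proof.
rewrite mxE; apply: rpred_sum => k _; rewrite !mxE.
by rewrite mul_mpolyC; apply: dhomogZ.
Qed.

Lemma curve_g : is_curve n g.
Proof.
apply: primitive_curve => [i j|x y nz]; first exact: plane_homog.
have /mx_neq0[i [j nzij]] := primg (pt_neq0 nz).
by exists (i, j); rewrite -ev_at.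
Qed.

Lemma tetra_lifts S : tetra S -> lifts g S S.
Proof.
have [GI GJ GC] := plane_equivariant M eN.
elim=> {S} [|||| S T _ lS _ lT].
- exact: lifts1.
- by exists 1; split=> [|q]; rewrite ?oner_neq0 // scale1r GI.
- by exists 1; split=> [|q]; rewrite ?oner_neq0 // scale1r GJ.
- by exists chi.
exact: (lifts_mul lS lT).
Qed.

(** The frame being equivariant, a deck transformation S is lifted by S itself, up
    to a scalar. *)
Lemma realizes : lifts_sextic n g.
Proof.
split; first exact: curve_g.
have V5F := V5_curve plane_homog hF fE ndg gF.
have deckS S : deck (phi_A4 C) S -> [/\ S \in unitmx, octa S & lifts g S S].
  move=> dS; have [uS _] := dS; have [V tV SV] := deck_tetra dS; split=> //.
    exact: octa_same SV (tetra_octa tV).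
  exact: (lifts_same curve_g (same_sym SV) (same_sym SV) (tetra_lifts tV)).
have [q0 uq0] := ndg.
exists F; split.
  split=> //; first exact: full_primitive.
  move=> /(_ (at_pt (phi_A4 C) q0)) H.
  have f0 := I2_f1 (at_pt g q0).
  have nzE : f1 (at_pt g q0) = E (q0 ord0 0) (q0 ord_max 0) *: at_pt F (at_pt (phi_A4 C) q0).
    by rewrite {1 4}(colE q0) gF.
  have I0 : (I2 C).@[fun i => at_pt F (at_pt (phi_A4 C) q0) i 0] = 0.
    apply: H _ _ (I2_homog C) (@I2_boundary C).
    apply: phi_neq0; apply: contraTneq uq0 => ->.
    rewrite -(scale0r 0) (at_ptZ _ _ plane_homog) expr0n eqn0Ngt n_gt0 scale0r.
    by rewrite unitmxE det0 unitr0.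
  have /eqP : 20 * \det (at_pt g q0) ^+ 6 = 0.
    rewrite -f0 nzE (meval_homogZ (c := E (q0 ord0 0) (q0 ord_max 0)) (I2_homog C) (v := fun i => at_pt F (at_pt (phi_A4 C) q0) i 0)) ?I0 ?mulr0 // => i.
    by rewrite mxE.
  move: uq0; rewrite unitmxE unitfE => nzD.
  by rewrite mulf_eq0 expf_eq0 /= (negbTE nzD) pnatr_eq0.
split.
- by exists q0; apply: f1_neq0.
- move=> q; rewrite (colE q) gF => nz; exists (E (q ord0 0) (q ord_max 0)); split=> //.
  by apply: contraNneq nz => ->; rewrite scale0r.
- move=> S dS; have [uS oS lS] := deckS _ dS; exists (invmx S)^T; split.
    by apply/stab_octP/octaT/octaV.
  exact: lifts_value uS lS.
move=> S T H dS dT lvS lvT; have [uS oS lS] := deckS _ dS; have [uT oT lT] := deckS _ dT.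
have uH : H \in unitmx.
  have [x [y nz]] := form_neqM (form_det 1%:M plane_homog) (form_det S plane_homog) (nondeg_det (unitmx1 _ _) ndg)
     (nondeg_det uS ndg).
  move: nz; rewrite mul1mx -unitfE unitrM -!unitmxE => /andP[u1 u2].
  by apply: same_unit (same_sym (lvS _ u1 u2)) _; rewrite unitmx_mul unitmx_inv u2.
apply: same_trans (lifts_uniq ndg uS lS (lift_value_lifts curve_g ndg uS uH lvS)) _.
exact: same_sym (lifts_uniq ndg uT lT (lift_value_lifts curve_g ndg uT uH lvT)).
Qed.

End Realization.

Section Bases.
Variable C : numClosedFieldType.

Lemma form_lin2 d (l1 l2 m1 m2 : C) k : (k <= d)%N ->
  form d (fun u v => (l1 * u + l2 * v) ^+ (d - k) * (m1 * u + m2 * v) ^+ k).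
Proof.
move=> lek; have := formM (form_exp (d - k) (form_lin l1 l2)) (form_exp k (form_lin m1 m2)).
by rewrite !mul1n subnK.
Qed.

(** The monomials of degree 6 in two independent linear forms are a basis of the
    sextics, so a linear relation between the coordinates of the curve is one
    between the given forms. *)
Lemma curve_of_basis (l1 l2 m1 m2 : C) (G : 'I_7 -> C -> C -> C) :
  l1 * m2 - l2 * m1 != 0 -> (forall k, form 6 (G k)) ->
  (forall a : 'I_7 -> C, (forall X Y, \sum_k a k * G k X Y = 0) -> forall k, a k = 0) ->
  exists F : 'M[binform C]_(7, 1), [/\ forall k, F k 0 \is 6.-homog, linearly_full F &
    forall X Y u v, val6 (at_pt F (pt X Y)) u v =
      \sum_(k < 7) G k X Y * ((l1 * u + l2 * v) ^+ (6 - k) * (m1 * u + m2 * v) ^+ k)].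
Proof.
move=> nzD fG indep.
pose D := l1 * m2 - l2 * m1; pose b (k : 'I_7) u v := (l1 * u + l2 * v) ^+ (6 - k) * (m1 * u + m2 * v) ^+ k.
have /fin_all_exists[w wE] (k : 'I_7) : exists w : 'cV[C]_7, forall u v, val6 w u v = b k u v.
  have lek : (k <= 6)%N by rewrite -ltnS.
  have [a aE] := form_coef (form_lin2 l1 l2 m1 m2 lek).
  by exists (\col_j a j) => u v; rewrite /b aE; apply: eq_bigr => j _; rewrite mxE.
pose V : 'M[C]_7 := \matrix_(j, k) w k j 0.
have VE (a : 'cV[C]_7) u v : val6 (V *m a) u v = \sum_k a k 0 * b k u v.
  transitivity (\sum_k a k 0 * val6 (w k) u v); last by apply: eq_bigr => k _; rewrite wE.
  rewrite /val6; under eq_bigr do rewrite mxE mulr_suml.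
  rewrite exchange_big; apply: eq_bigr => k _; rewrite mulr_sumr; apply: eq_bigr => j _.
  by rewrite mxE; ring.
have uV : V \in unitmx.
  rewrite -unitmx_tr -row_free_unit; apply: inj_row_free => a aV0.
  have Va0 : V *m a^T = 0 by rewrite -[V]trmxK -trmx_mul aV0 trmx0.
  have H x y : \sum_(k < 7) a 0 k * (x ^+ (6 - k) * y ^+ k) = \sum_(k < 7) 0 * (x ^+ (6 - k) * y ^+ k).
    rewrite [RHS]big1 => [|k _]; last by rewrite mul0r.
    have := VE a^T ((m2 * x - l2 * y) / D) ((l1 * y - m1 * x) / D).
    rewrite Va0 val6_0 => E; rewrite [RHS]E; apply: eq_bigr => k _; rewrite mxE /b.
    by congr (_ * (_ ^+ _ * _ ^+ _)); rewrite /D; field.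
  have := @coef_inj C 6 (fun k => a 0 (inord k)) (fun=> 0).
  move=> ci; apply/rowP=> k; rewrite mxE -[k in LHS]inord_val ci ?leq_ord // => x y.
  rewrite -H; apply: eq_bigr => j _; by rewrite inord_val.
have /fin_all_exists[p pE] (k : 'I_7) : exists p, p \is 6.-homog /\
    forall X Y, ev p X Y = \sum_j V k j * G j X Y.
  have [p hp E] : form 6 (fun X Y => \sum_j V k j * G j X Y) by apply: form_sum => j; apply: formZ.
  by exists p; split=> // X Y; rewrite E.
pose F : 'M[binform C]_(7, 1) := \matrix_(k, i) p k.
have atF X Y : at_pt F (pt X Y) = V *m \col_j G j X Y.
  apply/colP=> k; rewrite ev_at mxE (pE k).2 mxE.
  by apply: eq_bigr => j _; rewrite [(\col__ _) _ _]mxE.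
exists F; split=> [k|c cF|X Y u v]; first by rewrite mxE; case: (pE k).
  suff cV : c *m V = 0 by rewrite -[c](mulmxK uV) cV mul0mx.
  apply/rowP=> k; rewrite [RHS]mxE; apply: (indep (fun k => (c *m V) 0 k)) => X Y.
  have /rowP/(_ 0) := cF (pt X Y); rewrite atF mulmxA mxE [RHS]mxE => H; rewrite -[RHS]H.
  by apply: eq_bigr => j _; rewrite [(\col__ _) _ _]mxE.
by rewrite atF VE; apply: eq_bigr => k _; rewrite mxE.
Qed.

(** The summands have different orders of vanishing at the zero of T. *)
Lemma adic_indep (T : C -> C -> C) x0 y0 n : form 1 T -> nonzero T -> T x0 y0 = 0 ->
  forall (D : nat -> C -> C -> C) (a : nat -> C),
  (forall k, (k <= n)%N -> form (n - k) (D k) /\ D k x0 y0 != 0) ->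
  (forall x y, \sum_(k < n.+1) a k * (T x y ^+ k * D k x y) = 0) ->
  forall k, (k <= n)%N -> a k = 0.
Proof.
move=> fT nzT T0; elim: n => [|n IHn] D a hD H.
  case=> // _; have := H x0 y0; rewrite big_ord1 expr0 mul1r => /eqP.
  by have [_ nz] := hD 0%N isT; rewrite mulf_eq0 (negbTE nz) orbF => /eqP.
have a0 : a 0%N = 0.
  have := H x0 y0; rewrite big_ord_recl expr0 mul1r big1 => [|k _].
    rewrite addr0 => /eqP; have [_ nz] := hD 0%N isT.
    by rewrite mulf_eq0 (negbTE nz) orbF => /eqP.
  by rewrite T0 expr0n mul0r mulr0.
have hD' k : (k <= n)%N -> form (n - k) (D k.+1) /\ D k.+1 x0 y0 != 0.
  by move=> lek; have := hD k.+1 lek; rewrite subSS.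
have H' x y : \sum_(k < n.+1) a k.+1 * (T x y ^+ k * D k.+1 x y) = 0.
  have fS : form n (fun x y => \sum_(k < n.+1) a k.+1 * (T x y ^+ k * D k.+1 x y)).
    apply: form_sum => k; apply: formZ.
    have lek : (k <= n)%N by rewrite -ltnS.
    have := formM (form_exp k fT) (hD' k lek).1.
    by rewrite mul1n addnC subnK.
  apply: (form_mul0 fT fS _ nzT) => {}x {}y.
  rewrite -[RHS](H x y) [in RHS]big_ord_recl a0 mul0r add0r mulr_sumr.
  by apply: eq_bigr => k _; rewrite /= exprS; ring.
case=> [|k] // lek; exact: (IHn (fun k => D k.+1) (fun k => a k.+1)).
Qed.

Lemma generic_point U : form 1 U -> nonzero U -> exists x y : C,
  [/\ Omf x y != 0, Phif x y != 0, Psif x y != 0 & U (Phif x y ^+ 3) (Psif x y ^+ 3) != 0].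
Proof.
move=> fU nzU; have fZ := form_Zf C.
have fx : form 1 (fun X Y : C => X) := formx C.
have fy : form 1 (fun X Y : C => Y) := formy C.
have nzx : nonzero (fun X Y : C => X) by exists 1, 0; apply: oner_neq0.
have nzy : nonzero (fun X Y : C => Y) by exists 0, 1; apply: oner_neq0.
have nzZ : nonzero (@Zf C).
  by exists 0, 1; rewrite /Zf subr0 mul1r invr_eq0 mulf_neq0 ?pnatr_eq0 // s_neq0.
have [X [Y]] := form_neqM (formM fU fZ) (formM fx fy) (form_neqM fU fZ nzU nzZ)
  (form_neqM fx fy nzx nzy).
have [x [y [<- <-]]] := phi_surj X Y.
case/split_neq0 => /split_neq0[nU nO] /split_neq0[nX nY]; rewrite Zf_phi in nO.
by exists x, y; split=> //; [apply: base_neq0 nO|apply: base_neq0 nX|apply: base_neq0 nY].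
Qed.

Lemma Om0_Phi_neq0 (x y : C) : pt x y != 0 -> Omf x y = 0 -> Phif x y != 0.
Proof.
move=> nzq Om0; apply: contraNneq nzq => P0.
have := XZ_rel x y; rewrite P0 Om0 !expr0n /= mulr0 addr0 => /eqP.
by rewrite expf_eq0 /= => /eqP /(PhiPsi_eq0 P0) [-> ->]; rewrite pt_eq0 eqxx.
Qed.

End Bases.

(** * The family of degree 13 *)

Section Degree13.
Variable C : numClosedFieldType.
Let nz2 : (2 : C) != 0. Proof. by rewrite pnatr_eq0. Qed.
Local Notation s := (sqrtm3 C).

Lemma minorsE (M : 'M[C]_(2, 3)) :
  [/\ minors M o30 = M ord0 o31 * M ord_max o32 - M ord0 o32 * M ord_max o31,
      minors M o31 = M ord0 o30 * M ord_max o32 - M ord0 o32 * M ord_max o30 &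
      minors M o32 = M ord0 o30 * M ord_max o31 - M ord0 o31 * M ord_max o30].
Proof.
by split; rewrite /minors [col' _ _]mx2P det_mx2 !mxE;
  congr (M _ _ * M _ _ - M _ _ * M _ _); apply: val_inj.
Qed.

(** The coefficients of the expansion of S13 (p + t) 4 X Z in powers of t. *)
Definition D13 k (p X Z : C) : C := match k with
| 0 => p ^+ 6 + 4 * p ^+ 5 * X - 80 * s * p ^+ 4 * Z * X - 2560 * p ^+ 3 * Z ^+ 2 * X
   - 1280 * p ^+ 2 * Z ^+ 2 * X ^+ 2 - 1024 * p * Z ^+ 2 * X ^+ 2 * (X + 8 * s * Z)
   + 4096 * Z ^+ 3 * X ^+ 2 * (s * X - 32 * Z)
| 1 => 6 * p ^+ 5 + 20 * p ^+ 4 * X - 320 * s * p ^+ 3 * Z * X - 2560 * 3 * p ^+ 2 * Z ^+ 2 * X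
   - 2560 * p * Z ^+ 2 * X ^+ 2 - 1024 * Z ^+ 2 * X ^+ 2 * (X + 8 * s * Z)
| 2 => 15 * p ^+ 4 + 40 * p ^+ 3 * X - 480 * s * p ^+ 2 * Z * X - 2560 * 3 * p * Z ^+ 2 * X
   - 1280 * Z ^+ 2 * X ^+ 2
| 3 => 20 * p ^+ 3 + 40 * p ^+ 2 * X - 320 * s * p * Z * X - 2560 * Z ^+ 2 * X
| 4 => 15 * p ^+ 2 + 20 * p * X - 80 * s * Z * X
| 5 => 6 * p + 4 * X
| _ => 1 end.

Lemma S13_taylor p t l X Z :
  S13 (p * l + t) (4 * l) X Z = \sum_(k < 7) D13 k p X Z * (l ^+ (6 - k) * t ^+ k).
Proof. by rewrite !big_ord_recl big_ord0 /= /S13; ring. Qed.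

Lemma form_D13 k (p X Z : C -> C -> C) : (k <= 6)%N -> form 1 p -> form 1 X -> form 1 Z ->
  form (6 - k) (fun x y => D13 k (p x y) (X x y) (Z x y)).
Proof.
by move=> lek fp fX fZ; case: k lek => [|[|[|[|[|[|[|]]]]]]] // _; rewrite /D13; form_tac.
Qed.

(** Monomials in the arguments p, X and Z of D13 at the zero of T, where they are
    minors up to signs. *)
Definition mono a b c : {mpoly C[3]} := (- 'X_o32) ^+ a * (- 'X_o31) ^+ b * 'X_o30 ^+ c.

Lemma mono_homog a b c d : (a + b + c = d)%N -> mono a b c \is d.-homog.
Proof.
move=> <-; have h (i : 'I_3) : ('X_i : {mpoly C[3]}) \is 1.-homog by rewrite dhomogX /= mdeg1.
have hN (i : 'I_3) : (- 'X_i : {mpoly C[3]}) \is 1.-homog by rewrite dhomogN.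
apply: dhomogM; [apply: dhomogM|]; rewrite -[X in X.-homog]mul1n; exact: dhomogMn.
Qed.

Definition D13_poly k : {mpoly C[3]} := match k with
| 0 => mono 6 0 0 + 4 *: mono 5 1 0 - (80 * s) *: mono 4 1 1 - 2560 *: mono 3 1 2
   - 1280 *: mono 2 2 2 - 1024 *: mono 1 3 2 - (1024 * 8 * s) *: mono 1 2 3
   + (4096 * s) *: mono 0 3 3 - (4096 * 32) *: mono 0 2 4
| 1 => 6 *: mono 5 0 0 + 20 *: mono 4 1 0 - (320 * s) *: mono 3 1 1 - (2560 * 3) *: mono 2 1 2
   - 2560 *: mono 1 2 2 - 1024 *: mono 0 3 2 - (1024 * 8 * s) *: mono 0 2 3
| 2 => 15 *: mono 4 0 0 + 40 *: mono 3 1 0 - (480 * s) *: mono 2 1 1 - (2560 * 3) *: mono 1 1 2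
   - 1280 *: mono 0 2 2
| 3 => 20 *: mono 3 0 0 + 40 *: mono 2 1 0 - (320 * s) *: mono 1 1 1 - 2560 *: mono 0 1 2
| 4 => 15 *: mono 2 0 0 + 20 *: mono 1 1 0 - (80 * s) *: mono 0 1 1
| 5 => 6 *: mono 1 0 0 + 4 *: mono 0 1 0
| _ => 1 end.

Lemma D13_poly_homog k : (k <= 6)%N -> D13_poly k \is (6 - k).-homog.
Proof.
case: k => [|[|[|[|[|[|[|]]]]]]] // _; rewrite /D13_poly ?subn0 /=;
  try by do ![apply: rpredB|apply: rpredD]; try apply: rpredZ; apply: mono_homog.
by rewrite subnn; apply: dhomog1.
Qed.

Lemma D13_polyE k (v : 'I_3 -> C) : (D13_poly k).@[v] = D13 k (- v o32) (- v o31) (v o30).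
Proof.
have mE a b c : (mono a b c).@[v] = (- v o32) ^+ a * (- v o31) ^+ b * v o30 ^+ c.
  by rewrite !mevalM !rmorphXn /= !mevalN !mevalXU.
case: k => [|[|[|[|[|[|[|]]]]]]] *; rewrite /D13_poly /D13 ?meval1 //.
all: rewrite !(mevalD, mevalN, mevalZ, mE); ring.
Qed.

Lemma N_homog n (N : 'M[binform C]_(2, 3)) (a b : 'I_3 -> C -> C -> C) :
  (forall k x y, at_pt N (pt x y) ord0 k = a k x y /\ at_pt N (pt x y) ord_max k = b k x y) ->
  (forall k, form n (a k)) -> (forall k, form n (b k)) -> forall i j, N i j \is n.-homog.
Proof.
move=> NE fa fb i j; apply: homog_of_form.
case: (ord2P i) => ->.
  by apply: form_ext (fa j) => x y; rewrite -(NE j x y).1 ev_at.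
by apply: form_ext (fb j) => x y; rewrite -(NE j x y).2 ev_at.
Qed.

Lemma N13_homog i j : N13 C i j \is 13.-homog.
Proof.
apply: (N_homog (@N13_ab C)) => {i j} k; case: (ord3P k) => -> /=;
  rewrite /a13 /b13 /= /Omf /Phif /dPx /dPy; form_tac.
Qed.

Lemma N15_homog i j : N15 C i j \is 15.-homog.
Proof.
apply: (N_homog (@N15_ab C)) => {i j} k; case: (ord3P k) => -> /=;
  rewrite /a15 /b15 /= /Omf /Phif /dPx /dPy; form_tac.
Qed.

Section Plane.
Variable M : 'M[C]_(2, 3).
Let m0 := minors M o30.
Let m1 := minors M o31.
Let m2 := minors M o32.
Let G x y := at_pt (curve_of_plane (N13 C) M) (pt x y).

Lemma det_plane13 x y : \det (G x y) =
  4 * Omf x y * Phif x y * Psif x y * (m1 * Omf x y ^+ 2 + m0 * Phif x y ^+ 3).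
Proof.
have [-> -> _] : [/\ m0 = _, m1 = _ & m2 = _] := minorsE M.
have [a0 a1 a2 [b0 b1 b2]] := at_N13 x y.
rewrite /G [at_pt _ _]mx2P det_mx2 !plane_entry a0 a1 a2 b0 b1 b2 -dP_euler.
by ring.
Qed.

Hypothesis nz0 : m0 != 0.
Hypothesis nzD : forall k, (k < 6)%N -> D13 k (- m2) (- m1) m0 != 0.

Let T X Y := (m1 * Zf X Y + m0 * X) / m0.
Let D k X Y := D13 k (- (m2 / m0) * Zf X Y) X (Zf X Y).

(** The relation m0 p0 - m1 p1 + m2 p2 = 0 between the combined coefficients
    removes p0, and T is what multiplies p1. *)
Lemma H13_basis u v X Y : H13 M u v X Y =
  \sum_(k < 7) (T X Y ^+ k * D k X Y) * (cmb M u v o32 ^+ (6 - k) * cmb M u v o31 ^+ k).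
Proof.
have E : cmb M u v o30 * Zf X Y + cmb M u v o31 * X =
   - (m2 / m0) * Zf X Y * cmb M u v o32 + T X Y * cmb M u v o31.
  rewrite /T; apply: (mulfI nz0).
  have [e0 e1 e2] : [/\ m0 = _, m1 = _ & m2 = _] := minorsE M.
  transitivity (- m2 * Zf X Y * cmb M u v o32 + (m1 * Zf X Y + m0 * X) * cmb M u v o31).
    by rewrite e0 e1 e2 /cmb; ring.
  by field; exact: nz0.
rewrite /H13 E S13_taylor; apply: eq_bigr => k _.
by rewrite exprMn /D; ring.
Qed.

(** By adic_indep the coefficients of the powers of p1 are independent as soon as
    none of the D13 vanishes at the zero of T. *)
Lemma lifts_sextic13 : lifts_sextic 13 (curve_of_plane (N13 C) M).
Proof.
have fZ := form_Zf C; have nzs := s_neq0 C.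
have fT : form 1 T.
  by apply: (form_ext (f := fun X Y => (m0^-1) * (m1 * Zf X Y + m0 * X))) => [x y|]; [rewrite mulrC|form_tac].
have fD k : (k <= 6)%N -> form (6 - k) (D k).
  by move=> lek; apply: form_D13 => //; [apply: formZ|exact: formx].
(* the zero of T at which Zf takes the value m0 *)
pose Y0 := 12 * s * m0 - m1.
have Z0 : Zf (- m1) Y0 = m0 by rewrite /Zf /Y0; field; rewrite nzs ?pnatr_eq0.
have T0 : T (- m1) Y0 = 0 by rewrite /T Z0; ring.
have nzT : nonzero T.
  exists 1, 1; rewrite /T /Zf subrr mul0r mulr0 add0r mulr1 divff ?oner_neq0 //.
have [F [hF full FE]] : exists F : 'M[binform C]_(7, 1), [/\ forall k, F k 0 \is 6.-homog,
    linearly_full F & forall X Y u v, val6 (at_pt F (pt X Y)) u v = H13 M u v X Y].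
  have [||a H|F [hF full FE]] := curve_of_basis (l1 := - M ord_max o32) (l2 := M ord0 o32)
      (m1 := - M ord_max o31) (m2 := M ord0 o31) (G := fun k : 'I_7 => fun X Y => T X Y ^+ k * D k X Y).
  - have [e0 _ _] : [/\ m0 = _, m1 = _ & m2 = _] := minorsE M.
    by apply: contraNneq nz0 => z; rewrite e0; apply/eqP/oppr_inj; rewrite oppr0 -[RHS]z; ring.
  - move=> k; have lek : (k <= 6)%N by rewrite -ltnS.
    by have := formM (form_exp k fT) (fD k lek); rewrite mul1n addnC subnK.
  - move=> k; have := adic_indep (n := 6) fT nzT T0 (D := D) (a := fun k => a (inord k)).
    move=> ind; rewrite -[k]inord_val; apply: ind; last by rewrite -ltnS.
      move=> j lej; split; first exact: fD.
      rewrite /D Z0 mulNr divfK //; move: lej; rewrite leq_eqVlt => /orP[/eqP ->|].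
        by rewrite /D13 oner_neq0.
      exact: nzD.
    by move=> x y; rewrite -[RHS](H x y); apply: eq_bigr => j _; rewrite inord_val.
  exists F; split=> // X Y u v; rewrite FE H13_basis; apply: eq_bigr => k _.
  by congr (_ * (_ ^+ _ * _ ^+ _)); rewrite /cmb; ring.
have cF := full_primitive hF full.
have prim q : q != 0 -> at_pt (curve_of_plane (N13 C) M) q != 0.
  rewrite (colE q); move: (q ord0 0) (q ord_max 0) => x y nzq; apply/eqP=> G0.
  have [Om0|nzOm] := eqVneq (Omf x y) 0.
    have nzP := Om0_Phi_neq0 nzq Om0.
    have [a0 a1 a2 [b0 b1 b2]] := at_N13 x y.
    have M1 i : M i o31 = 0.
      have e0 : x * M i o31 = 0.
        apply: (mulIf (expf_neq0 3 nzP)); rewrite mul0r.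
        have := congr1 (fun A : 'M[C]_2 => A i ord0) G0; rewrite plane_entry a0 a1 a2 Om0 [in RHS]mxE => <-; ring.
      have e1 : y * M i o31 = 0.
        apply: (mulIf (expf_neq0 3 nzP)); rewrite mul0r.
        have := congr1 (fun A : 'M[C]_2 => A i ord_max) G0; rewrite plane_entry b0 b1 b2 Om0 [in RHS]mxE => <-; ring.
      move: nzq; rewrite pt_eq0 negb_and => /orP[] nz; apply: (mulfI nz); by rewrite mulr0.
    have [e0 _ _] : [/\ m0 = _, m1 = _ & m2 = _] := minorsE M.
    by case/eqP: nz0; rewrite e0 !M1; ring.
  have := curve_at_neq0 cF (phi_neq0 nzq); rewrite at_phi => /val6_neq0[u [v]].
  rewrite FE; case/eqP; apply: (mulfI nzOm).
  by rewrite -Om_plane13 G0 trmx0 mul0mx mulr0 /Omv !mxE /Omf; ring.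
have nd : nondeg (curve_of_plane (N13 C) M).
  have [x [y [nO nX nY nT]]] := generic_point fT nzT.
  exists (pt x y); rewrite unitmxE unitfE det_plane13.
  have -> : m1 * Omf x y ^+ 2 + m0 * Phif x y ^+ 3 = m0 * T (Phif x y ^+ 3) (Psif x y ^+ 3).
    by rewrite /T Zf_phi; field; exact: nz0.
  apply: mulf_neq0 (mulf_neq0 nz0 nT); apply: mulf_neq0 nY; apply: mulf_neq0 nX.
  by apply: mulf_neq0 nO; rewrite pnatr_eq0.
apply: (realizes (n := 13) (chi := 1) (d := 6) (F := F) (E := @Omf C)) => //.
- exact: N13_homog.
- exact: oner_neq0.
- exact: N13_equivariant.
- exact: form_Om.
by move=> x y; apply: val6_inj => u v; rewrite val6_f1T val6Z Om_plane13 at_phi FE.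
Qed.

End Plane.

(** The polynomial is not zero: where the minors are 1, 0, 1 the D13 are binomial
    coefficients up to signs. *)
Lemma open_family13 : exists d (P : {mpoly C[3]}), [/\ P \is d.-homog, P != 0 &
  forall M : 'M[C]_(2, 3), \rank M = 2%N -> P.@[minors M] != 0 ->
    lifts_sextic 13 (curve_of_plane (N13 C) M)].
Proof.
have hX : ('X_o30 : {mpoly C[3]}) \is 1.-homog by rewrite dhomogX /= mdeg1.
have hprod n : (n <= 6)%N -> exists d, \prod_(k < n) D13_poly k \is d.-homog.
  elim: n => [|n IHn] len; first by exists 0%N; rewrite big_ord0; apply: dhomog1.
  have [d hd] := IHn (ltnW len); exists (d + (6 - n))%N; rewrite big_ord_recr /=.
  exact: dhomogM hd (D13_poly_homog (ltnW len)).
have [d hd] := hprod 6%N (leqnn _).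
have PE v : ('X_o30 * \prod_(k < 6) D13_poly k).@[v] =
    v o30 * \prod_(k < 6) D13 k (- v o32) (- v o31) (v o30).
  rewrite mevalM mevalXU rmorph_prod /=; congr (_ * _); apply: eq_bigr => k _.
  exact: D13_polyE.
exists (1 + d)%N, ('X_o30 * \prod_(k < 6) D13_poly k); split.
- exact: dhomogM.
- pose v (i : 'I_3) : C := if i == o31 then 0 else 1.
  suff : ('X_o30 * \prod_(k < 6) D13_poly k).@[v] != 0 by apply: contraNneq => ->; rewrite meval0.
  rewrite PE /v /= mul1r oppr0; apply/prodf_neq0 => k _.
  have D0 j : (j < 6)%N -> exists n, D13 j (-1) 0 1 = n.+1%:R \/ D13 j (-1) 0 1 = - n.+1%:R.
    case: j => [|[|[|[|[|[|]]]]]] // _; rewrite /D13.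
    - by exists 0%N; left; ring.
    - by exists 5%N; right; ring.
    - by exists 14%N; left; ring.
    - by exists 19%N; right; ring.
    - by exists 14%N; left; ring.
    by exists 5%N; right; ring.
  by have [n [->|->]] := D0 _ (ltn_ord k); rewrite ?oppr_eq0 pnatr_eq0.
move=> M _; rewrite PE mulf_eq0 => /norP[nz0 /prodf_neq0 nz].
apply: lifts_sextic13 => // k ltk; exact: (nz (Ordinal ltk) isT).
Qed.

End Degree13.

(** * The family of degree 15 *)

Section Degree15.
Variable C : numClosedFieldType.
Let ss := ss C.
Let nz2 : (2 : C) != 0. Proof. by rewrite pnatr_eq0. Qed.
Local Notation s := (sqrtm3 C).

(** The coefficients of the expansion of S15 n (A + t) X Z in powers of t. *)
Definition E15 j (n A X Z : C) : C := match j with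
| 0 => S15 n A X Z
| 1 => n ^+ 5 * (Z ^+ 2 * X ^+ 4) - 10 * s * n ^+ 4 * A * (Z ^+ 2 * X ^+ 3)
  - 120 * n ^+ 3 * A ^+ 2 * (Z ^+ 2 * X ^+ 2) - 20 * n ^+ 2 * A ^+ 3 * (Z * X ^+ 2)
  - 5 * n * A ^+ 4 * (X * (X + 8 * s * Z)) + 6 * A ^+ 5 * (s * X - 32 * Z)
| 2 => - 5 * s * n ^+ 4 * (Z ^+ 2 * X ^+ 3) - 120 * n ^+ 3 * A * (Z ^+ 2 * X ^+ 2)
  - 30 * n ^+ 2 * A ^+ 2 * (Z * X ^+ 2) - 10 * n * A ^+ 3 * (X * (X + 8 * s * Z))
  + 15 * A ^+ 4 * (s * X - 32 * Z)
| 3 => - 40 * n ^+ 3 * (Z ^+ 2 * X ^+ 2) - 20 * n ^+ 2 * A * (Z * X ^+ 2)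
  - 10 * n * A ^+ 2 * (X * (X + 8 * s * Z)) + 20 * A ^+ 3 * (s * X - 32 * Z)
| 4 => - 5 * n ^+ 2 * (Z * X ^+ 2) - 5 * n * A * (X * (X + 8 * s * Z))
  + 15 * A ^+ 2 * (s * X - 32 * Z)
| 5 => - n * (X * (X + 8 * s * Z)) + 6 * A * (s * X - 32 * Z)
| _ => s * X - 32 * Z end.

Lemma S15_taylor n A B p0 p1 X Z : S15 (n * p0) (A * p0 + B * p1) X Z =
  \sum_(j < 7) B ^+ j * E15 j n A X Z * (p0 ^+ (6 - j) * p1 ^+ j).
Proof. by rewrite !big_ord_recl big_ord0 /= /S15; ring. Qed.

(** The coefficients of H15, multiplied by n3 ^ 6, in the combined coefficients p0
    and p1, the third one being eliminated by orthogonality to (n1, n2, n3). *)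
Definition G15 (n1 n2 n3 : C) j X Z :=
  (4 * (n3 * Z - n2 * X)) ^+ j * E15 j n3 (- 4 * n1 * X) X Z.

Lemma form_G15 n1 n2 n3 j : (j <= 6)%N -> form 7 (fun X Y => G15 n1 n2 n3 j X (Zf X Y)).
Proof.
have fZ := form_Zf C; case: j => [|[|[|[|[|[|[|]]]]]]] // _; rewrite /G15 /E15 /S15; form_tac.
Qed.

Definition polyfun (f : C -> C) := exists p : {poly C}, forall t, f t = p.[t].

Lemma polyfunC c : polyfun (fun=> c).
Proof. by exists c%:P => t; rewrite hornerC. Qed.
Lemma polyfun_id : polyfun id.
Proof. by exists 'X => t; rewrite hornerX. Qed.
Lemma polyfunD f g : polyfun f -> polyfun g -> polyfun (fun t => f t + g t).
Proof. by move=> [p pE] [q qE]; exists (p + q) => t; rewrite hornerD pE qE. Qed.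
Lemma polyfunN f : polyfun f -> polyfun (fun t => - f t).
Proof. by move=> [p pE]; exists (- p) => t; rewrite hornerN pE. Qed.
Lemma polyfunM f g : polyfun f -> polyfun g -> polyfun (fun t => f t * g t).
Proof. by move=> [p pE] [q qE]; exists (p * q) => t; rewrite hornerM pE qE. Qed.
Lemma polyfunX f k : polyfun f -> polyfun (fun t => f t ^+ k).
Proof. by move=> [p pE]; exists (p ^+ k) => t; rewrite horner_exp pE. Qed.

Lemma polyfun_det n (A : C -> 'M[C]_n) : (forall i j, polyfun (fun t => A t i j)) ->
  polyfun (fun t => \det (A t)).
Proof.
move=> hA; have /fin_all_exists[p pE] (k : 'I_n * 'I_n) : exists p : {poly C}, forall t, A t k.1 k.2 = p.[t].
  exact: hA.
exists (\det (\matrix_(i, j) p (i, j))) => t.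
rewrite -horner_evalE -det_map_mx; congr (\det _); apply/matrixP=> i j.
by rewrite !mxE (pE (i, j)).
Qed.

Ltac polyfun_tac := repeat first
  [ apply: polyfunC | apply: polyfun_id | apply: polyfunX | apply: polyfunD | apply: polyfunN
  | apply: polyfunM ].

Definition nt1 (t : C) := (t ^+ 4 - 1) * (2 * s * t ^+ 2 - t ^+ 4 - 1) ^+ 2.
Definition nt2 (t : C) := 4 * t ^+ 2 * (t ^+ 4 - 1) ^+ 2 * (s + t ^+ 2).
Definition nt3 (t : C) := - 4 * (2 * s * t ^+ 2 - t ^+ 4 - 1) ^+ 3 * (s + t ^+ 2).

Lemma normal15E t : [/\ normal15 t o30 0 = nt1 t, normal15 t o31 0 = nt2 t & normal15 t o32 0 = nt3 t].
Proof. by split; rewrite mxE. Qed.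

Lemma polyfun_nt : [/\ polyfun nt1, polyfun nt2 & polyfun nt3].
Proof. by split; rewrite /nt1 /nt2 /nt3; polyfun_tac. Qed.

(** Seven values of each of the seven forms: an invertible matrix makes the forms
    independent, and its determinant is a polynomial in t. *)
Definition K15 (t : C) : 'M[C]_7 :=
  \matrix_(j, i) G15 (nt1 t) (nt2 t) (nt3 t) j 1 (s * i.+1%:R).

Lemma polyfun_K15 : polyfun (fun t => \det (K15 t)).
Proof.
have [p1 p2 p3] := polyfun_nt; apply: polyfun_det => j i.
suff : polyfun (fun t => G15 (nt1 t) (nt2 t) (nt3 t) j 1 (s * i.+1%:R)).
  by case=> p pE; exists p => t; rewrite mxE pE.
rewrite /G15; apply: polyfunM; first by polyfun_tac.
have := ltn_ord j; move: (nat_of_ord j); case=> [|[|[|[|[|[|[|]]]]]]] // _; rewrite /E15 /S15; polyfun_tac.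
Qed.

Lemma sum7 (F : nat -> C) : \sum_(j < 7) F j = F 0%N + F 1%N + F 2%N + F 3%N + F 4%N + F 5%N + F 6%N.
Proof. by rewrite !big_ord_recr big_ord0 /= add0r. Qed.

(** At t = 0 the seven forms have increasing orders in Z, except for the first
    one, and the linear system for the coefficients of a relation is solved by
    elimination. *)
Lemma K15_0 : \det (K15 0) != 0.
Proof.
rewrite -unitfE -unitmxE -row_free_unit; apply: inj_row_free => a aK.
pose z k := a 0 (inord k).
have nzs := s_neq0 C.
have [n10 n20 n30] : [/\ nt1 0 = -1, nt2 0 = 0 & nt3 0 = 4 * s].
  by split; rewrite /nt1 /nt2 /nt3; ring.
pose c0 := 4096 * s * z 0%N; pose c1 := -48 * (1024 * s) * z 1%N.
pose c2 := (-48) ^+ 2 * (1280 * s) * z 2%N; pose c3 := (-48) ^+ 3 * (640 * s) * z 3%N.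
pose c4 := (-48) ^+ 4 * (80 * s) * z 4%N; pose c5 := (-48) ^+ 5 * (4 * s) * z 5%N.
pose c6 := (-48) ^+ 6 * s * z 6%N.
pose Q := Poly [:: 7 * c0 + c1; - 252 * c0 - 12 * c1 + c2; 81 * c0 - 837 * c1 - 30 * c2 + c3;
  - 189 * c2 - 34 * c3 + 2 * c4; - 36 * c3 - 69 * c4 + 5 * c5; - 168 * c5 + c6; - 32 * c6].
have GQ v : \sum_(j < 7) a 0 j * G15 (-1) 0 (4 * s) j 1 (s * v) = v * Q.[v].
  have -> : \sum_(j < 7) a 0 j * G15 (-1) 0 (4 * s) j 1 (s * v) =
     \sum_(j < 7) z j * G15 (-1) 0 (4 * s) j 1 (s * v).
    by apply: eq_bigr => j _; rewrite /z inord_val.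
  rewrite (sum7 (fun j => z j * G15 (-1) 0 (4 * s) j 1 (s * v))) horner_Poly /= /G15 /E15 /S15.
  rewrite /c0 /c1 /c2 /c3 /c4 /c5 /c6; move: (z 0%N) (z 1%N) (z 2%N) (z 3%N) (z 4%N) (z 5%N) (z 6%N).
  by move=> *; ring: ss.
have Q0 : Q = 0.
  apply: (@roots_geq_poly_eq0 _ _ [seq i.+1%:R | i <- iota 0 7]).
  - rewrite all_map; apply/allP=> i; rewrite mem_iota => /andP[_ lti]; apply/eqP.
    have nzi : i.+1%:R != 0 :> C by rewrite pnatr_eq0.
    apply: (mulfI nzi); rewrite mulr0 -GQ.
    have /rowP/(_ (Ordinal lti)) := aK; rewrite mxE [RHS]mxE => E; rewrite -[RHS]E.
    by apply: eq_bigr => j _; rewrite mxE n10 n20 n30.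
  - rewrite map_inj_uniq ?iota_uniq // => i j /eqP; rewrite eqr_nat => /eqP[]//.
  by rewrite size_map size_iota; apply: size_Poly.
have q k := congr1 (fun p : {poly C} => p`_k) Q0.
have e0 := q 0%N; have e1 := q 1%N; have e2 := q 2%N; have e3 := q 3%N; have e4 := q 4%N.
have e5 := q 5%N; have e6 := q 6%N; move: e0 e1 e2 e3 e4 e5 e6; rewrite /Q !coef_Poly !coef0 /=.
move=> e0 e1 e2 e3 e4 e5 e6.
have nat_neq0 k : k.+1%:R != 0 :> C by rewrite pnatr_eq0.
have c60 : c6 = 0.
  by apply: (mulfI (nat_neq0 31%N)); apply: oppr_inj; rewrite mulr0 oppr0 -[RHS]e6; ring.
have c50 : c5 = 0.
  by apply: (mulfI (nat_neq0 167%N)); apply: oppr_inj; rewrite mulr0 oppr0 -[RHS]e5 c60; ring.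
have c1E : c1 = - 7 * c0 by rewrite -[LHS](addKr (7 * c0)) e0; ring.
have c2E : c2 = 168 * c0 by rewrite -[LHS](addKr (- 252 * c0 - 12 * c1)) e1 c1E; ring.
have c3E : c3 = - 900 * c0.
  by rewrite -[LHS](addKr (81 * c0 - 837 * c1 - 30 * c2)) e2 c1E c2E; ring.
have c4E : c4 = 576 * c0.
  apply: (mulfI nz2); rewrite -[LHS](addKr (- 189 * c2 - 34 * c3)) e3 c2E c3E; ring.
have c00 : c0 = 0.
  apply: (mulfI (mulf_neq0 (nat_neq0 1835%N) (nat_neq0 3%N))).
  by apply: oppr_inj; rewrite mulr0 oppr0 -[RHS]e4 c3E c4E c50; ring.
have zE k e : e != 0 -> e * z k = 0 -> z k = 0 by move=> nz /eqP; rewrite mulf_eq0 (negbTE nz) => /eqP.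
have n48 : -48 != 0 :> C by rewrite oppr_eq0 pnatr_eq0.
have zk k : (k < 7)%N -> z k = 0.
  case: k => [|[|[|[|[|[|[|]]]]]]] // _.
  - exact: (zE _ _ (mulf_neq0 (nat_neq0 _) nzs) c00).
  - apply: (zE _ _ _ (etrans c1E _)); rewrite ?c00 ?mulr0 //.
    exact: mulf_neq0 n48 (mulf_neq0 (nat_neq0 _) nzs).
  - apply: (zE _ _ _ (etrans c2E _)); rewrite ?c00 ?mulr0 //.
    exact: mulf_neq0 (expf_neq0 2 n48) (mulf_neq0 (nat_neq0 _) nzs).
  - apply: (zE _ _ _ (etrans c3E _)); rewrite ?c00 ?mulr0 //.
    exact: mulf_neq0 (expf_neq0 3 n48) (mulf_neq0 (nat_neq0 _) nzs).
  - apply: (zE _ _ _ (etrans c4E _)); rewrite ?c00 ?mulr0 //.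
    exact: mulf_neq0 (expf_neq0 4 n48) (mulf_neq0 (nat_neq0 _) nzs).
  - apply: (zE _ _ _ c50).
    exact: mulf_neq0 (expf_neq0 5 n48) (mulf_neq0 (nat_neq0 _) nzs).
  apply: (zE _ _ _ c60); exact: mulf_neq0 (expf_neq0 6 n48) nzs.
by apply/rowP=> k; rewrite mxE -(zk k (ltn_ord k)) /z inord_val.
Qed.

End Degree15.

Section Family15.
Variable C : numClosedFieldType.
Let nz2 : (2 : C) != 0. Proof. by rewrite pnatr_eq0. Qed.
Local Notation s := (sqrtm3 C).

Lemma plane15_kernel (t : C) (M : 'M[C]_(2, 3)) v : plane15 t M -> M *m v = 0 ->
  exists k, v = k *: normal15 t.
Proof.
move=> [rM Mn] Mv.
have sub (w : 'cV[C]_3) : M *m w = 0 -> (w^T <= kermx M^T)%MS.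
  by move=> Mw; apply/sub_kermxP; rewrite -trmx_mul Mw trmx0.
have rK : \rank (kermx M^T) = 1%N by rewrite mxrank_ker mxrank_tr rM.
have rn : \rank (normal15 t)^T = 1%N.
  apply/eqP; rewrite eqn_leq rank_leq_row lt0n mxrank_eq0.
  by rewrite -(inj_eq (can_inj (@trmxK _ _ _))) trmxK trmx0 normal15_neq0.
have [_ E] := mxrank_leqif_eq (sub _ Mn).
have /eqmxP eqn : (((normal15 t)^T) == kermx M^T)%MS by rewrite -E rn rK.
have : (v^T <= (normal15 t)^T)%MS by rewrite eqn; apply: sub.
by case/sub_rVP => k vE; exists k; rewrite -[v]trmxK vE linearZ /= trmxK.
Qed.

Section Plane.
Variables (t : C) (M : 'M[C]_(2, 3)).
Hypothesis tM : plane15 t M.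
Hypothesis nz1 : nt1 t != 0.
Hypothesis nz3 : nt3 t != 0.
Hypothesis nzPsi : Psif t 1 != 0.
Hypothesis nzK : \det (K15 t) != 0.
Let n1 := nt1 t.
Let n2 := nt2 t.
Let n3 := nt3 t.

Lemma kernel_col (v : 'cV[C]_3) : M *m v = 0 ->
  exists k, [/\ v o30 0 = k * n1, v o31 0 = k * n2 & v o32 0 = k * n3].
Proof.
move=> /(plane15_kernel tM)[k ->]; have [e1 e2 e3] := normal15E t.
by exists k; split; rewrite mxE ?e1 ?e2 ?e3.
Qed.

Lemma minor2_neq0 : M ord0 o30 * M ord_max o31 - M ord0 o31 * M ord_max o30 != 0.
Proof.
apply/eqP=> m2.
pose v (a b : C) : 'cV[C]_3 := \col_k (if k == o30 then a else if k == o31 then b else 0).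
have Mv a b : (forall i, M i o30 * a + M i o31 * b = 0) -> a = 0 /\ b = 0.
  move=> h; have [|k [e0 e1 e2]] := kernel_col (v := v a b).
    by apply/colP=> i; rewrite mxE big_ord3 !mxE /= -[RHS](h i); ring.
  move/eqP: e2; rewrite mxE /= eq_sym mulf_eq0 (negbTE nz3) orbF => /eqP k0.
  by move: e0 e1; rewrite !mxE /= k0 !mul0r.
have row0 i : M i o30 = 0 /\ M i o31 = 0.
  have [|e0 e1] := Mv (M i o31) (- M i o30); last first.
    by split=> //; apply: oppr_inj; rewrite oppr0.
  move=> j; case: (ord2P i) (ord2P j) => [] -> [] ->; try ring.
    by apply: oppr_inj; rewrite oppr0 -[RHS]m2; ring.
  by rewrite -[RHS]m2; ring.
have [|/eqP] := Mv 1 0; last by rewrite oner_eq0.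
by move=> i; rewrite (row0 i).1 (row0 i).2; ring.
Qed.

Lemma cmb_normal u v : cmb M u v o30 * n1 + cmb M u v o31 * n2 + cmb M u v o32 * n3 = 0.
Proof.
have [_ Mn] := tM; have [e1 e2 e3] := normal15E t.
have E i : M i o30 * n1 + M i o31 * n2 + M i o32 * n3 = 0.
  by have /colP/(_ i) := Mn; rewrite mxE big_ord3 e1 e2 e3 mxE.
transitivity (v * (M ord0 o30 * n1 + M ord0 o31 * n2 + M ord0 o32 * n3) -
  u * (M ord_max o30 * n1 + M ord_max o31 * n2 + M ord_max o32 * n3)); first by rewrite /cmb; ring.
by rewrite !E; ring.
Qed.

Lemma H15_basis u v X Y : n3 ^+ 6 * H15 M u v X Y =
  \sum_(j < 7) G15 n1 n2 n3 j X (Zf X Y) * (cmb M u v o30 ^+ (6 - j) * cmb M u v o31 ^+ j).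
Proof.
have E := cmb_normal u v; rewrite /H15; set p0 := cmb M u v o30 in E *.
set p1 := cmb M u v o31 in E *; set p2 := cmb M u v o32 in E *; set Z := Zf X Y.
transitivity (S15 (n3 * p0) (- 4 * n1 * X * p0 + 4 * (n3 * Z - n2 * X) * p1) X Z).
  have -> : - 4 * n1 * X * p0 + 4 * (n3 * Z - n2 * X) * p1 = n3 * (4 * (p1 * Z + p2 * X)).
    by apply/eqP; rewrite -subr_eq0 -(mulr0 (- 4 * X)) -E; apply/eqP; ring.
  by rewrite /S15; ring.
by rewrite S15_taylor.
Qed.

Lemma G15_indep (a : 'I_7 -> C) :
  (forall X Y, \sum_(j < 7) a j * G15 n1 n2 n3 j X (Zf X Y) = 0) -> forall j, a j = 0.
Proof.
move=> H; have nzs := s_neq0 C.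
have aK : (\row_j a j) *m K15 t = 0.
  apply/rowP=> i; rewrite mxE [RHS]mxE -[RHS](H 1 (1 + 12 * s * (s * i.+1%:R))).
  apply: eq_bigr => j _; rewrite !mxE; congr (_ * G15 _ _ _ _ _ _).
  by rewrite /Zf; field; rewrite nzs ?pnatr_eq0.
have uK : K15 t \in unitmx by rewrite unitmxE unitfE.
move=> j; have /rowP/(_ j) : \row_j a j = 0 by rewrite -[LHS](mulmxK uK) aK mul0mx.
by rewrite !mxE.
Qed.

Lemma det_plane15 x y : \det (at_pt (curve_of_plane (N15 C) M) (pt x y)) =
  4 * Omf x y * Phif x y ^+ 2 * Psif x y * (minors M o32 * Omf x y ^+ 2 + minors M o31 * Phif x y ^+ 3).
Proof.
have [_ -> ->] := minorsE M.
have [a0 a1 a2 [b0 b1 b2]] := at_N15 x y.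
rewrite [at_pt _ _]mx2P det_mx2 !plane_entry a0 a1 a2 b0 b1 b2 -dP_euler.
by ring.
Qed.

(** At a zero of the lift the frame drops rank, which happens only over the zeros
    of Omega, Phi and Psi; in each case the kernel of M contains a vector that is
    not a multiple of the normal vector. *)
Lemma prim15 q : q != 0 -> at_pt (curve_of_plane (N15 C) M) q != 0.
Proof.
rewrite (colE q); move: (q ord0 0) (q ord_max 0) => x y nzq; apply/eqP=> G0.
have [a0 a1 a2 [b0 b1 b2]] := at_N15 x y.
have eA i : M i o30 * (x * Omf x y * Phif x y ^+ 2) -
   (M i o31 * Omf x y ^+ 2 + M i o32 * Phif x y ^+ 3) * (4 * dPy x y) = 0.
  have := congr1 (fun A : 'M[C]_2 => A i ord0) G0; rewrite plane_entry a0 a1 a2 [in RHS]mxE => <-; ring.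
have eB i : M i o30 * (y * Omf x y * Phif x y ^+ 2) +
   (M i o31 * Omf x y ^+ 2 + M i o32 * Phif x y ^+ 3) * (4 * dPx x y) = 0.
  have := congr1 (fun A : 'M[C]_2 => A i ord_max) G0; rewrite plane_entry b0 b1 b2 [in RHS]mxE => <-; ring.
have nz4 : (4 : C) != 0 by rewrite pnatr_eq0.
have nz_xy : x != 0 \/ y != 0.
  by move: nzq; rewrite pt_eq0 negb_and => /orP.
have nzdP : dPx x y != 0 \/ dPy x y != 0.
  have [dx|] := eqVneq (dPx x y) 0; last by left.
  right; apply: contraNneq nzq => dy; have [-> ->] := dP_eq0 dx dy.
  by rewrite pt_eq0 eqxx.
(* with its first term gone, a row is a multiple of the nonzero vector (-dPy, dPx) *)
have mid i : M i o30 * Omf x y * Phif x y ^+ 2 = 0 ->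
    M i o31 * Omf x y ^+ 2 + M i o32 * Phif x y ^+ 3 = 0.
  move=> z; have z1 : (M i o31 * Omf x y ^+ 2 + M i o32 * Phif x y ^+ 3) * (4 * dPx x y) = 0.
    transitivity ((M i o30 * (y * Omf x y * Phif x y ^+ 2) +
      (M i o31 * Omf x y ^+ 2 + M i o32 * Phif x y ^+ 3) * (4 * dPx x y)) -
      y * (M i o30 * Omf x y * Phif x y ^+ 2)); [ring|by rewrite eB z; ring].
  have z2 : (M i o31 * Omf x y ^+ 2 + M i o32 * Phif x y ^+ 3) * (4 * dPy x y) = 0.
    transitivity (x * (M i o30 * Omf x y * Phif x y ^+ 2) - (M i o30 * (x * Omf x y * Phif x y ^+ 2) -
      (M i o31 * Omf x y ^+ 2 + M i o32 * Phif x y ^+ 3) * (4 * dPy x y))); [ring|by rewrite eA z; ring].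
  case: nzdP => nz; apply: (mulIf (mulf_neq0 nz4 nz)); by rewrite mul0r.
pose v (a b c : C) : 'cV[C]_3 := \col_k (if k == o30 then a else if k == o31 then b else c).
have Mv a b c : (forall i, M i o30 * a + M i o31 * b + M i o32 * c = 0) ->
    exists k, [/\ a = k * n1, b = k * n2 & c = k * n3].
  move=> h; have [|k [e0 e1 e2]] := kernel_col (v := v a b c).
    by apply/colP=> i; rewrite mxE big_ord3 !mxE /= -[RHS](h i); ring.
  by exists k; move: e0 e1 e2; rewrite !mxE.
have n30 k : 0 = k * n3 -> k = 0.
  by move/esym/eqP; rewrite mulf_eq0 (negbTE nz3) orbF => /eqP.
have n10 k : 0 = k * n1 -> k = 0.
  by move/esym/eqP; rewrite mulf_eq0 (negbTE nz1) orbF => /eqP.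
have one0 (k n : C) : 1 = k * n -> k = 0 -> False.
  by move=> e k0; move/eqP: e; rewrite k0 mul0r oner_eq0.
have [Om0|nzOm] := eqVneq (Omf x y) 0.
  have nzP := Om0_Phi_neq0 nzq Om0.
  have [|k [/n10 k0 _ e]] := Mv 0 0 1; last exact: one0 e k0.
  move=> i; have := mid i; rewrite Om0 mulr0 mul0r expr0n mulr0 add0r => /(_ erefl) z.
  by apply: (mulIf (expf_neq0 3 nzP)); rewrite mul0r -[RHS]z; ring.
have [P0|nzP] := eqVneq (Phif x y) 0.
  have [|k [_ e /n30 k0]] := Mv 0 1 0; last exact: one0 e k0.
  move=> i; have := mid i; rewrite P0 !expr0n /= !mulr0 addr0 => /(_ erefl) z.
  by apply: (mulIf (expf_neq0 2 nzOm)); rewrite mul0r -[RHS]z; ring.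
have nzOP : Omf x y * Phif x y ^+ 2 != 0 by rewrite mulf_neq0 ?expf_neq0.
have [Psi0|nzS] := eqVneq (Psif x y) 0; last first.
  have mid0 i : M i o31 * Omf x y ^+ 2 + M i o32 * Phif x y ^+ 3 = 0.
    apply: (mulIf (mulf_neq0 nz4 nzS)); rewrite mul0r -dP_euler.
    transitivity (x * (M i o30 * (y * Omf x y * Phif x y ^+ 2) +
      (M i o31 * Omf x y ^+ 2 + M i o32 * Phif x y ^+ 3) * (4 * dPx x y)) - y * (M i o30 * (x * Omf x y * Phif x y ^+ 2) -
      (M i o31 * Omf x y ^+ 2 + M i o32 * Phif x y ^+ 3) * (4 * dPy x y))); [ring|by rewrite eA eB; ring].
  have [|k [e _ /n30 k0]] := Mv 1 0 0; last exact: one0 e k0.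
  move=> i; rewrite mulr1 !mulr0 !addr0; apply: (mulIf nzOP); rewrite mul0r.
  have h z : z * (M i o30 * (Omf x y * Phif x y ^+ 2)) = 0 -> z != 0 -> M i o30 * (Omf x y * Phif x y ^+ 2) = 0.
    by move=> /eqP; rewrite mulf_eq0 => /orP[/eqP -> /eqP|/eqP].
  case: nz_xy => nz; apply: h nz.
    by rewrite -[RHS](eA i) mid0; ring.
  by rewrite -[RHS](eB i) mid0; ring.
(* over a zero of Psi the rank of the frame is one *)
have ratio : n2 * Phif x y ^+ 3 = n3 * Omf x y ^+ 2.
  have cases (a d : C) : a != 0 -> (forall i, M i o30 * (a * Omf x y * Phif x y ^+ 2) -
     (M i o31 * Omf x y ^+ 2 + M i o32 * Phif x y ^+ 3) * d = 0) -> n2 * Phif x y ^+ 3 = n3 * Omf x y ^+ 2.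
    move=> nza h.
    have [|k [e0 e1 e2]] := Mv (a * Omf x y * Phif x y ^+ 2) (- d * Omf x y ^+ 2) (- d * Phif x y ^+ 3).
      by move=> i; rewrite -[RHS](h i); ring.
    have nzk : k != 0.
      apply: contraNneq nza => k0; move/eqP: e0; rewrite k0 mul0r -mulrA mulf_eq0 (negbTE nzOP) orbF.
      by move=> /eqP ->.
    apply: (mulfI nzk); transitivity (k * n2 * Phif x y ^+ 3); first by ring.
    transitivity (k * n3 * Omf x y ^+ 2); last by ring.
    by rewrite -e1 -e2; ring.
  case: nz_xy => nz; first exact: (cases x (4 * dPy x y) nz eA).
  apply: (cases y (- (4 * dPx x y)) nz) => i; rewrite -[RHS](eB i); ring.
have X_Z : Phif x y ^+ 3 = - (12 * s) * Omf x y ^+ 2.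
  by have := XZ_rel x y; rewrite Psi0 expr0n /= => e; rewrite -[LHS](addrK (12 * s * Omf x y ^+ 2)) -e; ring.
have : Psif t 1 ^+ 3 * (- 4 * (2 * s * t ^+ 2 - t ^+ 4 - 1) ^+ 3 * (s + t ^+ 2)) = 0.
  have -> : Psif t 1 ^+ 3 * (- 4 * (2 * s * t ^+ 2 - t ^+ 4 - 1) ^+ 3 * (s + t ^+ 2)) =
     - (2 * s * t ^+ 2 - t ^+ 4 - 1) ^+ 3 * (n3 + 12 * s * n2).
    by rewrite XZ_rel /n3 /n2 /nt3 /nt2 /Phif /Omf; ring.
  apply/eqP; rewrite mulf_eq0; apply/orP; right; apply/eqP.
  apply: (mulIf (expf_neq0 2 nzOm)); rewrite mul0r mulrDl -ratio X_Z; ring.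
by move/eqP; rewrite mulf_eq0 expf_eq0 /= (negbTE nzPsi) /=; apply/negP: nz3.
Qed.

(** Above the image of (t, 1) under the covering one of the factors in H15_dn is
    zero, so that the seven forms are divisible by the linear form T of this
    image. *)
Lemma lifts_sextic15 : lifts_sextic 15 (curve_of_plane (N15 C) M).
Proof.
have nzs := s_neq0 C; have fZ := form_Zf C; have m2 := minor2_neq0.
pose X0' := Phif t 1 ^+ 3; pose Y0' := Psif t 1 ^+ 3.
have nz0 : (X0', Y0') != (0, 0) by rewrite xpair_eqE negb_and (expf_neq0 3 nzPsi) orbT.
pose T X Y : C := Y0' * X - X0' * Y.
have fT : form 1 T.
  by apply: form_ext (form_lin Y0' (- X0')) => X Y; rewrite /T; ring.
have H0 u v : H15 M u v X0' Y0' = 0.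
  rewrite H15_dn /dn nf_normal big_ord3.
  have [-> -> ->] := normal15E t; rewrite cmb_normal; ring.
have G0 (j : 'I_7) : G15 n1 n2 n3 j X0' (Zf X0' Y0') = 0.
  pose D := M ord0 o30 * M ord_max o31 - M ord0 o31 * M ord_max o30.
  have H x y : \sum_(k < 7) G15 n1 n2 n3 k X0' (Zf X0' Y0') * (x ^+ (6 - k) * y ^+ k) =
      \sum_(k < 7) 0 * (x ^+ (6 - k) * y ^+ k).
    rewrite [RHS]big1 => [|k _]; last by rewrite mul0r.
    pose u := (M ord0 o31 * x - M ord0 o30 * y) / D.
    pose v := (M ord_max o31 * x - M ord_max o30 * y) / D.
    transitivity (n3 ^+ 6 * H15 M u v X0' Y0'); last by rewrite H0 mulr0.
    rewrite H15_basis /u /v.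
    by apply: eq_bigr => k _; congr (_ * (_ ^+ _ * _ ^+ _)); rewrite /cmb /D; field; exact: m2.
  have := @coef_inj C 6 (fun k => G15 n1 n2 n3 k X0' (Zf X0' Y0')) (fun=> 0) H j.
  by apply; rewrite -ltnS.
have /fin_all_exists[Fj FjE] (j : 'I_7) : exists f : C -> C -> C, form 6 f /\
    forall X Y, G15 n1 n2 n3 j X (Zf X Y) = T X Y * f X Y.
  have lej : (j <= 6)%N by rewrite -ltnS.
  have [f ff fE] := form_div (form_G15 n1 n2 n3 lej) nz0 (G0 j).
  by exists f.
have [||a Ha|F [hF full FE]] := curve_of_basis (l1 := - M ord_max o30) (l2 := M ord0 o30)
    (m1 := - M ord_max o31) (m2 := M ord0 o31) (G := Fj).
- by apply: contraNneq m2 => z; apply/eqP; rewrite -[RHS]z; ring.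
- by move=> j; case: (FjE j).
- apply: G15_indep => X Y; transitivity (T X Y * \sum_j a j * Fj j X Y); last by rewrite Ha mulr0.
  rewrite mulr_sumr.
  by apply: eq_bigr => j _; rewrite (FjE j).2; ring.
have HF u v X Y : n3 ^+ 6 * H15 M u v X Y = T X Y * val6 (at_pt F (pt X Y)) u v.
  rewrite H15_basis FE mulr_sumr; apply: eq_bigr => j _; rewrite (FjE j).2 -mulrA.
  by congr (_ * (_ * (_ ^+ _ * _ ^+ _))); rewrite /cmb; ring.
have nd : nondeg (curve_of_plane (N15 C) M).
  pose U X Y := minors M o32 * Zf X Y + minors M o31 * X.
  have fU : form 1 U by rewrite /U; have fx := formx C; form_tac.
  have nzU : nonzero U.
    exists 0, 1; rewrite /U mulr0 addr0 /Zf subr0 mul1r; apply: mulf_neq0.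
      by have [_ _ ->] := minorsE M.
    by rewrite invr_eq0 mulf_neq0 ?pnatr_eq0.
  have [x [y [nO nX nY nU]]] := generic_point fU nzU.
  rewrite /U Zf_phi in nU; exists (pt x y); rewrite unitmxE unitfE det_plane15.
  apply: mulf_neq0 nU; apply: mulf_neq0 nY; apply: mulf_neq0 (expf_neq0 2 nX).
  by apply: mulf_neq0 nO; rewrite pnatr_eq0.
apply: (realizes (n := 15) (chi := om1 C) (d := 18) (F := F)
  (E := fun x y => (n3 ^+ 6)^-1 * (Omf x y * T (Phif x y ^+ 3) (Psif x y ^+ 3)))) => //.
- exact: N15_homog.
- exact: prim15.
- by apply: contraNneq (oner_neq0 C) => z; rewrite -(om12 C) z mul0r.
- exact: N15_equivariant.
- apply: formZ; apply: (@formM _ 6 12 _ _ (form_Om C)).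
  exact: (form_comp fT (form_exp 3 (form_Phi C)) (form_exp 3 (form_Psi C))).
move=> x y; apply: val6_inj => u v; rewrite val6_f1T val6Z Om_plane15 at_phi.
have nz36 : n3 ^+ 6 != 0 := expf_neq0 6 nz3.
by apply: (mulfI nz36); rewrite mulrCA HF; field; exact: nz3.
Qed.

End Plane.

(** All conditions of lifts_sextic15 hold at t = 0. *)
Lemma cofinite_family15 : exists s : seq C, forall (t : C) M, t \notin s -> plane15 t M ->
  lifts_sextic 15 (curve_of_plane (N15 C) M).
Proof.
have [p1 _ p3] := polyfun_nt C; have pK := polyfun_K15 C.
have pPsi : polyfun (fun t : C => Psif t 1).
  exists ('X ^+ 4 + (2 * s)%:P * 'X ^+ 2 + 1) => t.
  by rewrite /Psif !(hornerD, hornerM, hornerC, horner_exp, hornerX, hornerXn); ring.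
have [p pE] := polyfunM (polyfunM p1 p3) (polyfunM pPsi pK).
have nzp : p != 0.
  have : nt1 0 * nt3 0 * (Psif 0 1 * \det (K15 0)) != 0 :> C.
    have e1 : nt1 0 = -1 :> C by rewrite /nt1; ring.
    have e3 : nt3 0 = 4 * s :> C by rewrite /nt3; ring.
    have e4 : Psif 0 1 = 1 :> C by rewrite /Psif; ring.
    have nzs := s_neq0 C; have nK := K15_0 C.
    rewrite e1 e3 e4 mul1r; apply: mulf_neq0 nK; apply: mulf_neq0 (mulf_neq0 _ nzs).
      by rewrite oppr_eq0 oner_neq0.
    by rewrite pnatr_eq0.
  by rewrite pE; apply: contraNneq => ->; rewrite horner0.
have [r rE] := closed_field_poly_normal p.
exists r => t M nr tM.
have : p.[t] != 0.
  rewrite rE hornerZ horner_prod mulf_neq0 ?lead_coef_eq0 //.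
  rewrite prodf_seq_neq0; apply/allP=> z zr; apply/implyP=> _.
  by rewrite hornerXsubC subr_eq0; apply: contraNneq nr => ->.
rewrite -pE => /split_neq0[/split_neq0[nz1 nz3] /split_neq0[nzP nzK]].
exact: (lifts_sextic15 tM nz1 nz3 nzP nzK).
Qed.

End Family15.

(** * Finiteness of the equivalence classes *)

Section Finiteness.
Variable C : numClosedFieldType.
Let nz2 : (2 : C) != 0. Proof. by rewrite pnatr_eq0. Qed.

(** The representative of a code is chosen by excluded middle. *)
Lemma finite_pick (T U : eqType) (codes : seq T) (R : T -> U -> Prop) :
  exists L : seq U, forall c u, c \in codes -> R c u -> exists2 u0, u0 \in L & R c u0.
Proof.
elim: codes => [|c codes [L LE]]; first by exists [::].
have [[u0 Ru0]|none] := pselect (exists u, R c u).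
  exists (u0 :: L) => c' u; rewrite inE => /orP[/eqP -> _|c'in Ru].
    by exists u0; rewrite ?mem_head.
  by have [u1 u1L Ru1] := LE _ _ c'in Ru; exists u1 => //; rewrite inE u1L orbT.
exists L => c' u; rewrite inE => /orP[/eqP -> Ru|]; last exact: LE.
by case: none; exists u.
Qed.

Lemma finite_zeros d (f : C -> C -> C) : form d f -> nonzero f ->
  exists Z : seq 'cV[C]_2, forall x y, (x, y) != (0, 0) -> f x y = 0 ->
    exists2 p, p \in Z & same_point (pt x y) p.
Proof.
move=> ff nzf; have [P [PE _ _]] := form_line 0 1 1 0 ff.
have PE' z : P.[z] = f z 1 by rewrite PE; congr f; ring.
have nzP : P != 0.
  apply/eqP=> P0; have [x [y]] := nzf; case/eqP.
  have f1 z : f z 1 = 0 by rewrite -PE' P0 horner0.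
  have ff' : form d (fun x y => f y x) by apply: (form_subst ff); [exact: formy|exact: formx].
  exact: (form_inf0 ff' f1 y x).
have [r rE] := closed_field_poly_normal P.
exists (pt 1 0 :: [seq pt z 1 | z <- r]) => x y nzxy fxy.
have [y0|nzy] := eqVneq y 0.
  exists (pt 1 0); first exact: mem_head.
  exists x; split; last by rewrite scale_pt y0; congr pt; ring.
  by apply: contraNneq nzxy => ->; rewrite y0.
exists (pt (x / y) 1); last first.
  by exists y; split=> //; rewrite scale_pt mulrC divfK // mulr1.
rewrite inE; apply/orP; right; apply: map_f.
have : root P (x / y).
  apply/rootP; rewrite PE'; have := form_scale y (x / y) 1 ff.
  rewrite mulr1 mulrC divfK // fxy => /esym/eqP.
  by rewrite mulf_eq0 expf_eq0 (negbTE nzy) andbF => /eqP.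
by rewrite rE rootZ ?lead_coef_eq0 // root_prod_XsubC.
Qed.

Definition base_points : seq 'cV[C]_2 := [:: pt 1 0; pt 0 1; pt 1 1].

Lemma proj_three (S T : 'M[C]_2) : S \in unitmx -> T \in unitmx ->
  (forall e, e \in base_points -> same_point (S *m e) (T *m e)) -> same_point S T.
Proof.
move=> uS uT H.
have [k0 [nz0 e0]] : same_point (S *m pt 1 0) (T *m pt 1 0) by apply: H; rewrite !inE eqxx.
have [k1 [nz1 e1]] : same_point (S *m pt 0 1) (T *m pt 0 1) by apply: H; rewrite !inE eqxx orbT.
have [k2 [nz2' e2]] : same_point (S *m pt 1 1) (T *m pt 1 1) by apply: H; rewrite !inE eqxx !orbT.
have Tinj (x y : C) : T *m pt x y = 0 -> x = 0 /\ y = 0.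
  move=> z; apply: pt_inj; rewrite -[LHS](mulKmx uT) z mulmx0; apply/colP=> i.
  by rewrite !mxE; case: ifP.
have [k02 k12] : k0 - k2 = 0 /\ k1 - k2 = 0.
  apply: Tinj.
  have -> : pt (k0 - k2) (k1 - k2) = k0 *: pt 1 0 + k1 *: pt 0 1 - k2 *: pt 1 1 :> 'cV[C]_2.
    by apply/colP=> i; rewrite !mxE; case: ifP => _; ring.
  rewrite mulmxBr mulmxDr -!scalemxAr -e0 -e1 -e2 -mulmxDr -mulmxBr.
  have -> : pt 1 0 + pt 0 1 - pt 1 1 = 0 :> 'cV[C]_2.
    by apply/colP=> i; rewrite !mxE; case: ifP => _; ring.
  by rewrite mulmx0.
move/subr0_eq: k02 => k02; move/subr0_eq: k12 => k12.
exists k2; split=> //; apply/matrixP=> i j.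
have col0 (A : 'M[C]_2) : (A *m pt 1 0) i 0 = A i ord0.
  by rewrite mxE big_ord2 !mxE /=; ring.
have col1 (A : 'M[C]_2) : (A *m pt 0 1) i 0 = A i ord_max.
  by rewrite mxE big_ord2 !mxE /=; ring.
by case: (ord2P j) => ->; rewrite [RHS]mxE -?col0 -?col1 ?e0 ?e1 [LHS]mxE ?k02 ?k12.
Qed.

(** By proj_three a projective transformation of the line is determined by the
    images of three points. *)
Lemma finite_matrices (P : 'M[C]_2 -> Prop) (Z : seq 'cV[C]_2) :
  (forall S, P S -> S \in unitmx) ->
  (forall S e, P S -> e \in base_points -> exists2 p, p \in Z & same_point (S *m e) p) ->
  exists L : seq 'M[C]_2, forall S, P S -> exists2 S0, S0 \in L & same_point S S0.
Proof.
move=> uP PZ; pose codes := [seq (a, bc) | a <- Z, bc <- [seq (b, c) | b <- Z, c <- Z]].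
pose R (c : 'cV[C]_2 * ('cV[C]_2 * 'cV[C]_2)) S := [/\ P S, same_point (S *m pt 1 0) c.1,
  same_point (S *m pt 0 1) c.2.1 & same_point (S *m pt 1 1) c.2.2].
have [L LE] := finite_pick codes R; exists L => S PS.
have [a aZ ha] : exists2 p, p \in Z & same_point (S *m pt 1 0) p by apply: PZ; rewrite ?inE ?eqxx.
have [b bZ hb] : exists2 p, p \in Z & same_point (S *m pt 0 1) p by apply: PZ; rewrite ?inE ?eqxx ?orbT.
have [c cZ hc] : exists2 p, p \in Z & same_point (S *m pt 1 1) p by apply: PZ; rewrite ?inE ?eqxx ?orbT.
have [|//|S0 S0L [P0 h0a h0b h0c]] := LE (a, (b, c)) S.
  by apply: allpairs_f => //; apply: allpairs_f.
exists S0 => //; apply: proj_three; [exact: uP|exact: uP|].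
move=> e; rewrite !inE => /or3P[] /eqP ->; apply: same_trans (same_sym _); eassumption.
Qed.

Section Planes.
Variables (n : nat) (N : 'M[binform C]_(2, 3)).
Hypothesis hN : forall i j, N i j \is n.-homog.
Hypothesis injN : forall W : 'M[C]_(2, 3),
  (forall x y, at_pt (curve_of_plane N W) (pt x y) = 0) -> W = 0.
Hypothesis detN : forall M x y, Omf x y = 0 -> \det (at_pt (curve_of_plane N M) (pt x y)) = 0.

(** With a determinant that vanishes identically every lift value would be vacuous,
    and different deck transformations could not be told apart. *)
Lemma lift_nondeg F (g : 'M[binform C]_2) : galois_lift (phi_A4 C) F g -> nondeg g.
Proof.
move=> [_ _ _ inj]; have [//|dg] := nondegP g.
have dI : deck (phi_A4 C) (Im C).
  split=> [|q _]; first exact: unit_Im.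
  by rewrite (colE q) Im_pt !at_phi Phi_i Psi_i; apply: same_refl.
have d1 : deck (phi_A4 C) 1%:M.
  by split=> [|q _]; [exact: unitmx1|rewrite mul1mx; apply: same_refl].
have vac S H : lift_value g S H by move=> q; rewrite (negbTE (dg q)).
have [k [nzk]] := inj _ _ 1%:M d1 dI (vac _ _) (vac _ _).
rewrite mx2_1 scale_mx2 => /mx2_inj[e1 _ _ e2].
have /eqP : 2 * 'i * k = 0 :> C by transitivity (k * 'i - k * - 'i); [ring|rewrite -e1 -e2 subrr].
by rewrite !mulf_eq0 (negbTE nz2) (negbTE (neq0Ci C)) (negbTE nzk).
Qed.

(** Over the zeros of Omega all curves of planes are degenerate, so alpha maps
    three given points into the finite set of zeros of the determinant of g, and
    the octahedral matrix B permutes the six zeros. Both are therefore finitely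
    many up to scalars, and once they are fixed the planes differ by the left
    action of A, which does not change the row space. *)
Lemma finite_planes (M : 'M[C]_(2, 3)) : lifts_sextic n (curve_of_plane N M) ->
  exists L : seq 'M[C]_(2, 3), forall M' : 'M[C]_(2, 3), \rank M' = 2%N ->
    equivalent (curve_of_plane N M) (curve_of_plane N M') ->
    exists2 M0, M0 \in L & (M' == M0)%MS.
Proof.
move=> [cg [F [_ gl]]]; have ndg := lift_nondeg gl.
set g := curve_of_plane N M in cg gl ndg *.
have [hg _] := cg.
have [Z1 Z1E] := finite_zeros (form_det 1%:M hg) (nondeg_det (unitmx1 _ _) ndg).
have [Z2 Z2E] := finite_zeros (form_Om C) (nonzero_Om C).
have base0 e : e \in base_points -> e != 0 /\ Omv e = 0.
  rewrite !inE => /or3P[] /eqP ->; split; rewrite ?pt_eq0 ?oner_eq0 ?andbF // Omv_pt /Omf; ring.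
have [L1 L1E] : exists L : seq 'M[C]_2, forall alpha, (exists M' A B, carries alpha A B g (curve_of_plane N M')) ->
    exists2 a0, a0 \in L & same_point alpha a0.
  apply: (finite_matrices (Z := Z1)) => [S [M' [A [B []]]] //|S e [M' [A [B [uS dA oB car]]]] /base0[nze Oe]].
  have [uB _] := bin_oct_octa oB; have nzSe := mul_unit_neq0 uS nze.
  rewrite (colE (S *m e)); apply: Z1E; first by move: nzSe; rewrite {1}(colE (S *m e)) pt_eq0 xpair_eqE.
  rewrite mul1mx -colE; have [k [nzk kE]] := car _ nze.
  have : \det (A *m at_pt g (S *m e) *m B^T) = 0.
    rewrite kE detZ (colE e) detN ?mulr0 //; exact: Oe.
  move/eqP; rewrite !det_mulmx dA mul1r mulf_eq0 det_tr.
  by move: uB; rewrite unitmxE unitfE => /negbTE ->; rewrite orbF => /eqP.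
have [L2 L2E] : exists L : seq 'M[C]_2, forall B, bin_oct B -> exists2 B0, B0 \in L & same_point B B0.
  apply: (finite_matrices (Z := Z2)) => [B /bin_oct_octa[] //|B e oB /base0[nze Oe]].
  have [uB [c [_ cE]]] := bin_oct_octa oB; have nzBe := mul_unit_neq0 uB nze.
  rewrite (colE (B *m e)); apply: Z2E; first by move: nzBe; rewrite {1}(colE (B *m e)) pt_eq0 xpair_eqE.
  by have := cE e; rewrite Oe mulr0.
pose R (c : 'M[C]_2 * 'M[C]_2) (M' : 'M[C]_(2, 3)) := exists alpha A B,
  [/\ same_point alpha c.1, same_point B c.2 & carries alpha A B g (curve_of_plane N M')].
have [L LE] := finite_pick [seq (a, b) | a <- L1, b <- L2] R.
exists L => M' rM' [alpha [A [B car]]].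
have [a0 a0L sa] := L1E alpha (ex_intro _ M' (ex_intro _ A (ex_intro _ B car))).
have [uA dA oB carE] := car; have [b0 b0L sb] := L2E _ oB.
have [||M0 M0L [alpha2 [A2 [B2 [sa2 sb2 [uA2 dA2 oB2 carE2]]]]]] := LE (a0, b0) M'.
- exact: allpairs_f.
- by exists alpha, A, B.
exists M0 => //.
have uAA (D : 'M[C]_2) : \det D = 1 -> D \in unitmx by move=> d; rewrite unitmxE d unitr1.
have [uB2 _] := bin_oct_octa oB2.
pose U := A *m invmx A2.
have hM M1 i j : curve_of_plane N M1 i j \is n.-homog by apply: plane_homog.
have form_p (V : 'M[C]_2) M1 i j : form n (fun x y => (V *m at_pt (curve_of_plane N M1) (pt x y)) i j).
  apply: (form_ext (f := fun x y => V i ord0 * at_pt (curve_of_plane N M1) (pt x y) ord0 j +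
     V i ord_max * at_pt (curve_of_plane N M1) (pt x y) ord_max j)).
    by move=> x y; rewrite [RHS]mxE big_ord2.
  by apply: formD; apply: formZ; apply: form_entry1.
have uU : U \in unitmx by rewrite unitmx_mul unitmx_inv !uAA.
have [c [nzc cE]] : exists c, c != 0 /\ forall q, at_pt (curve_of_plane N M') q =
    c *: (U *m at_pt (curve_of_plane N M0) q).
  apply: (same_const (d := n)) => [i j|i j|q nzq|q nzq].
  - exact: form_entry1.
  - exact: form_p.
  - have [k [nzk kE]] := same_trans sa (same_sym sa2).
    apply: same_trans (same_sym (carE _ nzq)) _.
    have sG : same_point (at_pt g (alpha *m q)) (at_pt g (alpha2 *m q)).
      by exists (k ^+ n); rewrite expf_neq0 // kE -scalemxAl (at_ptZ _ _ hg).
    apply: same_trans (same_mul (same_mul (same_refl A) sG) (same_tr (same_trans sb (same_sym sb2)))) _.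
    apply: same_trans (same_mul (same_refl U) (carE2 _ nzq)).
    by rewrite /U !mulmxA mulmxKV ?uAA //; apply: same_refl.
  apply: contraNneq (curve_at_neq0 cg (mul_unit_neq0 uA2 nzq)) => z.
  have [k [nzk kE]] := carE2 _ nzq.
  have G0 : at_pt (curve_of_plane N M0) q = 0 by rewrite -[LHS](mulKmx uU) z mulmx0.
  rewrite -[at_pt g _](mulKmx (uAA _ dA2)) -[A2 *m _](@mulmxK _ _ _ B2^T) ?unitmx_tr //.
  by rewrite kE G0 scaler0 mul0mx mulmx0.
have ME : M' = (c *: U) *m M0.
  apply/eqP; rewrite -subr_eq0; apply/eqP/injN => x y.
  have := cE (pt x y); rewrite !at_plane mulmxBl => ->.
  by rewrite -!scalemxAl mulmxA subrr.
have ucU : c *: U \in unitmx by rewrite unitmxZ ?unitfE.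
apply/andP; split; first by rewrite ME submxMl.
by rewrite -[M0](mulKmx ucU) -ME submxMl.
Qed.

End Planes.
End Finiteness.

Section Families.
Variable C : numClosedFieldType.
Let nz2 : (2 : C) != 0. Proof. by rewrite pnatr_eq0. Qed.
Local Notation s := (sqrtm3 C).

Lemma phi_point (X Y : C) : exists x y, Phif x y ^+ 3 = X /\ Psif x y ^+ 3 = Y /\
  12 * s * Omf x y ^+ 2 = Y - X.
Proof.
have [x [y [eX eY]]] := phi_surj X Y; exists x, y; do !split=> //.
by rewrite -eX -eY XZ_rel; ring.
Qed.

Lemma om_sum_inj (a b : C) :
  (forall x y, (a * Omf x y ^+ 2 + b * Phif x y ^+ 3) * Psif x y = 0) -> a = 0 /\ b = 0.
Proof.
move=> H; have b0 : b = 0.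
  have [x [y [eX [eY eZ]]]] := phi_point 1 1.
  have nzY : Psif x y != 0 by apply: (@base_neq0 _ _ 2); rewrite eY oner_neq0.
  have /eqP : 12 * s * Omf x y ^+ 2 = 0 by rewrite eZ subrr.
  have nz12 : (12 : C) != 0 by rewrite pnatr_eq0.
  rewrite mulf_eq0 (negbTE (mulf_neq0 nz12 (s_neq0 C))) /= => /eqP O0.
  by have /eqP := H x y; rewrite mulf_eq0 (negbTE nzY) orbF O0 eX mulr0 add0r mulr1 => /eqP.
split=> //; have [x [y [eX [eY eZ]]]] := phi_point 0 1.
have nzY : Psif x y != 0 by apply: (@base_neq0 _ _ 2); rewrite eY oner_neq0.
have nzZ : Omf x y ^+ 2 != 0.
  by apply: contra_eq_neq eZ => ->; rewrite mulr0 subr0 eq_sym oner_neq0.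
by have /eqP := H x y; rewrite mulf_eq0 (negbTE nzY) orbF eX mulr0 addr0 mulf_eq0 (negbTE nzZ) orbF => /eqP.
Qed.

Lemma om_prod_inj (c : C) : (forall x y, c * (Omf x y * Phif x y ^+ 2 * Psif x y) = 0) -> c = 0.
Proof.
move=> H; have [x [y [eX [eY eZ]]]] := phi_point 1 2.
have nzX : Phif x y != 0 by apply: (@base_neq0 _ _ 2); rewrite eX oner_neq0.
have nzY : Psif x y != 0 by apply: (@base_neq0 _ _ 2); rewrite eY.
have nzZ : Omf x y != 0.
  apply: contra_eq_neq eZ => ->; rewrite expr0n mulr0 eq_sym.
  by have -> : 2 - 1 = 1 :> C by [ring]; rewrite oner_neq0.
have /eqP := H x y; rewrite mulf_eq0 (negbTE (mulf_neq0 (mulf_neq0 nzZ (expf_neq0 2 nzX)) nzY)) orbF.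
by move/eqP.
Qed.

Lemma inj_plane13 (W : 'M[C]_(2, 3)) :
  (forall x y, at_pt (curve_of_plane (N13 C) W) (pt x y) = 0) -> W = 0.
Proof.
move=> W0; have nz4 : (4 : C) != 0 by rewrite pnatr_eq0.
have eq1 i x y : (W i o30 * Omf x y ^+ 2 + W i o31 * Phif x y ^+ 3) * Psif x y = 0.
  have [a0 a1 a2 [b0 b1 b2]] := at_N13 x y.
  have := congr1 (fun A : 'M[C]_2 => A i ord_max) (W0 x y); rewrite plane_entry b0 b1 b2 [in RHS]mxE => eB.
  have := congr1 (fun A : 'M[C]_2 => A i ord0) (W0 x y); rewrite plane_entry a0 a1 a2 [in RHS]mxE => eA.
  transitivity (dPx x y * (W i o30 * (x * Omf x y ^+ 2) + W i o31 * (x * Phif x y ^+ 3) + W i o32 * - (Omf x y * Phif x y * (4 * dPy x y)))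
    + dPy x y * (W i o30 * (y * Omf x y ^+ 2) + W i o31 * (y * Phif x y ^+ 3) + W i o32 * (Omf x y * Phif x y * (4 * dPx x y)))).
    by rewrite -dP_euler; ring.
  by rewrite eA eB; ring.
have eq2 i x y : W i o32 * (4 * Omf x y * Phif x y * Psif x y) = 0.
  have [a0 a1 a2 [b0 b1 b2]] := at_N13 x y.
  have := congr1 (fun A : 'M[C]_2 => A i ord_max) (W0 x y); rewrite plane_entry b0 b1 b2 [in RHS]mxE => eB.
  have := congr1 (fun A : 'M[C]_2 => A i ord0) (W0 x y); rewrite plane_entry a0 a1 a2 [in RHS]mxE => eA.
  transitivity (x * (W i o30 * (y * Omf x y ^+ 2) + W i o31 * (y * Phif x y ^+ 3) + W i o32 * (Omf x y * Phif x y * (4 * dPx x y)))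
    - y * (W i o30 * (x * Omf x y ^+ 2) + W i o31 * (x * Phif x y ^+ 3) + W i o32 * - (Omf x y * Phif x y * (4 * dPy x y)))).
    by rewrite -dP_euler; ring.
  by rewrite eA eB; ring.
apply/matrixP=> i k; rewrite [RHS]mxE; have [e0 e1] := om_sum_inj (eq1 i).
have e2 : W i o32 = 0.
  apply: om_prod_inj => x y; apply: (mulfI nz4); rewrite mulr0.
  by transitivity (Phif x y * (W i o32 * (4 * Omf x y * Phif x y * Psif x y))); [ring|rewrite eq2 mulr0].
by case: (ord3P k) => ->.
Qed.

Lemma inj_plane15 (W : 'M[C]_(2, 3)) :
  (forall x y, at_pt (curve_of_plane (N15 C) W) (pt x y) = 0) -> W = 0.
Proof.
move=> W0; have nz4 : (4 : C) != 0 by rewrite pnatr_eq0.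
have eqs i x y : W i o30 * (Omf x y * Phif x y ^+ 2 * Psif x y) = 0 /\
    (W i o31 * Omf x y ^+ 2 + W i o32 * Phif x y ^+ 3) * Psif x y = 0.
  have [a0 a1 a2 [b0 b1 b2]] := at_N15 x y.
  have := congr1 (fun A : 'M[C]_2 => A i ord_max) (W0 x y); rewrite plane_entry b0 b1 b2 [in RHS]mxE => eB.
  have := congr1 (fun A : 'M[C]_2 => A i ord0) (W0 x y); rewrite plane_entry a0 a1 a2 [in RHS]mxE => eA.
  split.
    transitivity (dPx x y * (W i o30 * (x * Omf x y * Phif x y ^+ 2) + W i o31 * - (Omf x y ^+ 2 * (4 * dPy x y))
        + W i o32 * - (Phif x y ^+ 3 * (4 * dPy x y)))
      + dPy x y * (W i o30 * (y * Omf x y * Phif x y ^+ 2) + W i o31 * (Omf x y ^+ 2 * (4 * dPx x y))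
        + W i o32 * (Phif x y ^+ 3 * (4 * dPx x y)))).
      by rewrite -dP_euler; ring.
    by rewrite eA eB; ring.
  apply: (mulfI nz4); rewrite mulr0.
  transitivity (x * (W i o30 * (y * Omf x y * Phif x y ^+ 2) + W i o31 * (Omf x y ^+ 2 * (4 * dPx x y))
        + W i o32 * (Phif x y ^+ 3 * (4 * dPx x y)))
    - y * (W i o30 * (x * Omf x y * Phif x y ^+ 2) + W i o31 * - (Omf x y ^+ 2 * (4 * dPy x y))
        + W i o32 * - (Phif x y ^+ 3 * (4 * dPy x y)))).
    by rewrite -dP_euler; ring.
  by rewrite eA eB; ring.
apply/matrixP=> i k; rewrite [RHS]mxE; have [e1 e2] := om_sum_inj (fun x y => (eqs i x y).2).
have e0 : W i o30 = 0 by apply: om_prod_inj => x y; case: (eqs i x y).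
by case: (ord3P k) => ->.
Qed.

Lemma two_parameters13 : two_free_parameters C.
Proof.
split; first exact: open_family13.
move=> M _; apply: (finite_planes (n := 13)) => [|W|M' x y O0]; first exact: N13_homog.
  exact: inj_plane13.
by rewrite det_plane13 O0; ring.
Qed.

(** The normal vectors for t = 0 and t = 1 are not proportional, so perpendicularity
    to M is a nontrivial polynomial condition on t. *)
Lemma finite_parameters (M : 'M[C]_(2, 3)) : \rank M = 2%N ->
  exists s : seq C, forall t, plane15 t M -> t \in s.
Proof.
move=> rM; have [p1 p2 p3] := polyfun_nt C.
have [P PE] : exists P : 'I_2 -> {poly C}, forall i t, (M *m normal15 t) i 0 = (P i).[t].
  suff /fin_all_exists[P PE] (i : 'I_2) : exists p : {poly C}, forall t, (M *m normal15 t) i 0 = p.[t] by exists P.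
  have [p pE] := polyfunD (polyfunD (polyfunM (polyfunC (M i o30)) p1) (polyfunM (polyfunC (M i o31)) p2))
    (polyfunM (polyfunC (M i o32)) p3).
  exists p => t; rewrite -pE mxE big_ord3.
  by have [-> -> ->] := normal15E t.
have [i nzP] : exists i, P i != 0.
  apply: contrapT => none; have P0 i : P i = 0 by apply/eqP/negPn/negP => nz; apply: none; exists i.
  have tM t : plane15 t M.
    by split=> //; apply/colP=> i; rewrite PE P0 horner0 mxE.
  have [_ M1] := tM 1; have [k kE] := plane15_kernel (tM 0) M1.
  have k0 : k = 0.
    have := congr1 (fun A : 'cV[C]_3 => A o30 0) kE; rewrite [RHS]mxE.
    have [-> _ _] := normal15E (1 : C); have [-> _ _] := normal15E (0 : C).
    have -> : nt1 1 = 0 :> C by rewrite /nt1; ring.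
    have -> : nt1 0 = -1 :> C by rewrite /nt1; ring.
    by rewrite mulrN1 => /esym/eqP; rewrite oppr_eq0 => /eqP.
  by have /eqP := normal15_neq0 (1 : C); rewrite kE k0 scale0r.
have [r rE] := closed_field_poly_normal (P i).
exists r => t [_ /colP/(_ i)]; rewrite PE [RHS]mxE => /rootP.
by rewrite rE rootZ ?lead_coef_eq0 // root_prod_XsubC.
Qed.

Lemma one_parameter15 : one_free_parameter C.
Proof.
split; first exact: cofinite_family15.
move=> t M [rM _] lift; have [|W|M1 x y O0|//|L LE] := finite_planes (n := 15) (N := N15 C) _ _ _ (M := M).
- exact: N15_homog.
- exact: inj_plane15.
- by rewrite det_plane15 O0; ring.
have [s sE] : exists s : seq C, forall M0 t', M0 \in L -> plane15 t' M0 -> t' \in s.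
  elim: L {LE} => [|M0 L [s0 s0E]]; first by exists [::].
  have [r0|nr0] := eqVneq (\rank M0) 2%N; last first.
    exists s0 => M1 t'; rewrite inE => /orP[/eqP -> [rM1 _]|]; last exact: s0E.
    by rewrite rM1 eqxx in nr0.
  have [s1 s1E] := finite_parameters r0.
  exists (s1 ++ s0) => M1 t'; rewrite inE mem_cat => /orP[/eqP -> /s1E -> //|M1L /(s0E _ _ M1L) ->].
  by rewrite orbT.
exists s => t' M' [rM' Mn'] eqv; have [M0 M0L /andP[le1 le2]] := LE _ rM' eqv.
apply: sE M0L _; split.
  have h1 := mxrankS le1; have h2 := mxrankS le2; rewrite rM' in h1 h2.
  by apply/eqP; rewrite eqn_leq h1 h2.
by have /submxP[D ->] := le2; rewrite -mulmxA Mn' mulmx0.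
Qed.

End Families.

Theorem theorem11p1 (R : realType) (C : numClosedFieldType := R[i]) :
  [/\ (forall (phi : 'M[binform C]_(2, 1)) (F : 'M[binform C]_(7, 1))
              (n : nat) (g : 'M[binform C]_(2, 2)),
         galois_covering 'Alt_('I_4)%G 12 phi ->
         sextic_curve F -> is_curve n g -> galois_lift phi F g ->
         generally_ramified F /\
         exists alpha beta A B : 'M[C]_2,
           [/\ beta \in unitmx,
               (forall q, q != 0 ->
                  same_point (at_pt phi (alpha *m q))
                             (beta *m at_pt (phi_A4 C) q))
             & (n = 13%N /\
                exists M : 'M[C]_(2, 3), \rank M = 2%N /\
                  carries alpha A B g (curve_of_plane (N13 C) M)) \/
               (n = 15%N /\
                exists (t : C) (M : 'M[C]_(2, 3)), plane15 t M /\
                  carries alpha A B g (curve_of_plane (N15 C) M))]),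
      two_free_parameters C,
      (forall t : C, exists2 M : 'M[C]_(2, 3), plane15 t M &
         forall M', plane15 t M' -> (M' == M)%MS)
    & one_free_parameter C].
Proof.
split.
- move=> phi F n g cphi sF cg gl.
  have [ram [alpha [beta [B [ub phiE nf]]]]] := normal_form_exists cphi sF cg gl.
  split=> //; exists alpha, beta, 1%:M, B; split=> // q _.
  by rewrite phiE; apply: same_refl.
- exact: two_parameters13.
- exact: plane15_unique.
exact: one_parameter15.
Qed.
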